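(* Let $n,d,q\ge1$ be integers with $q\le d$, let $\mathbf H\in\mathbb R^{q\times d}$ have full rank $q$, and let $$\mathbf T=\mathbf H'(\mathbf H\mathbf H')^+\mathbf H,$$ the orthogonal projection of rank $q$ onto the row space of $\mathbf H$. Let $\boldsymbol X_1,\dots,\boldsymbol X_n$ be independent with $\boldsymbol X_i\sim N_d(\boldsymbol\mu,\Sigma)$, where $\Sigma$ is such that $\Sigma^{1/2}\mathbf T\Sigma^{1/2}$ has exactly $q$ non-zero eigenvalues $\lambda_1,\dots,\lambda_q$ (counted with multiplicity), and suppose that the null hypothesis $H_0:\mathbf H\boldsymbol\mu=0$ holds. With $\overline{\boldsymbol X}=\frac1n\sum_{i=1}^n\boldsymbol X_i$, let $$W_n=\frac n{\mathrm{tr}(\mathbf T\Sigma)}\,\overline{\boldsymbol X}'\mathbf T\overline{\boldsymbol X},\qquad \nu=\frac{\mathrm{tr}(\mathbf T\Sigma)^2}{\mathrm{tr}((\mathbf T\Sigma)^2)},$$ and let $U_q\sim\mathcal G_{\nu/2,\,2/\nu}$. For $r=1,2$, set $$\Delta_q^{(r)}:=\max_{1\le j\le q}\left\{\left|\frac{\lambda_j\,\mathrm{tr}(\mathbf T\Sigma)}{\mathrm{tr}((\mathbf T\Sigma)^2)}-1\right|\left(\frac{\lambda_j}{\mathrm{tr}(\mathbf T\Sigma)}\right)^r\right\}.$$ Then $$d_1(W_n,U_q)\le4\Delta_q^{(1)},\qquad d_2(W_n,U_q)\le8\Delta_q^{(2)}+2e_{\nu/2}\Delta_q^{(1)}.$$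 If $\nu>2$, then $$d_{\mathrm{Kol}}(W_n,U_q)\le2\left(\frac{\nu\Delta_q^{(1)}}{\sqrt{2\pi(\nu/2-1)}\,r_{\nu/2}}\right)^{1/2}.$$
   Context: $(\cdot)^+$ denotes the Moore--Penrose inverse and $'$ the transpose. For $a,b>0$, $\mathcal G_{a,b}$ denotes the Gamma distribution with shape $a$ and scale $b$, with density $p_{a,b}(x)=\frac{1}{\Gamma(a)b^a}x^{a-1}e^{-x/b}\mathbf 1_{\{x>0\}}$. For $\alpha>1$, $r_\alpha:=\exp\left(\frac1{12\alpha-11}\right)$. Distances. $\mathcal Z_1$ is the class of continuously differentiable $h:(0,\infty)\to\mathbb R$ with $\|h'\|_\infty\le1$; $\mathcal Z_2$ is the class of twice continuously differentiable $h:(0,\infty)\to\mathbb R$ with $\|h''\|_\infty\le1$. For (almost surely) positive random variables $X,Y$ with finite moments of order $j\in\{1,2\}$, $d_j(X,Y):=\sup_{h\in\mathcal Z_j}|\mathbb E[h(X)]-\mathbb E[h(Y)]|$. Also $d_{\mathrm{Kol}}(X,Y):=\sup_{z\in\mathbb R}|\mathbb P[X\le z]-\mathbb P[Y\le z]|$. The constant $e_a$, $a>0$. Write $P_{a,1}(x)=\int_0^xp_{a,1}(u)\,du$, $\overline P_{a,1}(x)=\int_x^\infty p_{a,1}(u)\,du$, $\underline{\mathrm P}^1_{a,1}(x)=\int_0^xP_{a,1}(u)\,du$, $\overline{\mathrm P}^1_{a,1}(x)=\int_x^\infty\overline P_{a,1}(u)\,du$, $\underline M_{a,1}(y)=\frac{P_{a,1}(y)}{y\,p_{a,1}(y)}$,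 $\overline M_{a,1}(y)=\frac{\overline P_{a,1}(y)}{y\,p_{a,1}(y)}$ for $x,y>0$, and $$C_{a,1}^2(z)=\overline M_{a,1}''(z)\int_0^z\underline{\mathrm P}^1_{a,1}(x)\,dx+\underline M_{a,1}''(z)\int_z^\infty\overline{\mathrm P}^1_{a,1}(x)\,dx,\qquad z>0.$$ Then $e_a:=\sup_{z>0}C_{a,1}^2(z)$, which is finite. *)

(* Defs.v *)
From HB Require Import structures.
From mathcomp Require Import all_boot all_order all_algebra.
From mathcomp Require Import all_classical all_reals all_analysis.

Set Implicit Arguments.
Unset Strict Implicit.
Unset Printing Implicit Defensive.

Import Order.TTheory GRing.Theory Num.Theory.
Import numFieldTopology.Exports numFieldNormedType.Exports.

Local Open Scope classical_set_scope.
Local Open Scope ring_scope.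

Section Matrices.
Context {R : realType}.

Definition is_mp_inverse m n (A : 'M[R]_(m, n)) (B : 'M[R]_(n, m)) : Prop :=
  [/\ A *m B *m A = A, B *m A *m B = B,
      (A *m B)^T = A *m B & (B *m A)^T = B *m A].

(* The four Penrose equations have exactly one solution; the default value 0
   is never used. *)
Definition mp_inverse m n (A : 'M[R]_(m, n)) : 'M[R]_(n, m) :=
  xget 0 [set B | is_mp_inverse A B].

Definition quad_form d (A : 'M[R]_d) (v : 'cV[R]_d) : R :=
  (v^T *m A *m v) 0 0.

Definition psdmx d (A : 'M[R]_d) : Prop :=
  A^T = A /\ forall v : 'cV[R]_d, 0 <= quad_form A v.

(* A positive semidefinite matrix has exactly one positive semidefinite square
   root; the default value 0 matters only when A is not one. *)
Definition sqrtmx d (A : 'M[R]_d) : 'M[R]_d :=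
  xget 0 [set B | psdmx B /\ B *m B = A].

(* "A has exactly q nonzero eigenvalues, lam 0, ..., lam (q - 1), counted with
   multiplicity" *)
Definition nonzero_eigenvalues d q (A : 'M[R]_d) (lam : 'I_q -> R) : Prop :=
  (forall j, lam j != 0) /\
  char_poly A = ('X^(d - q) * \prod_(j < q) ('X - (lam j)%:P))%R.

End Matrices.

Section RandomVectors.
Context {R : realType} {dT : measure_display} {T : measurableType dT}.
Variable P : probability T R.

Definition vec_events d (X : T -> 'cV[R]_d) : set (set T) :=
  <<s [set A | exists (j : 'I_d) (B : set R),
         measurable B /\ A = (fun w => X w j 0) @^-1` B] >>.

Definition independent_vecs n d (X : 'I_n -> T -> 'cV[R]_d) : Prop :=
  forall (J : {set 'I_n}) (A : 'I_n -> set T),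
    (forall i, i \in J -> vec_events (X i) (A i)) ->
    P (\bigcap_(i in [set` J]) A i) = (\prod_(i in J) fine (P (A i)))%:E.

(* normal_prob m s has standard deviation s, and normal_prob m 0 is not the
   point mass at m. *)
Definition normal_law (m v : R) : set R -> \bar R :=
  if v == 0 then \d_m else normal_prob m (Num.sqrt v).

(* N_d(mu, Sigma) for a possibly singular covariance matrix Sigma: all linear
   combinations of the coordinates are normal. *)
Definition normal_vec d (X : T -> 'cV[R]_d) (mu : 'cV[R]_d) (Sigma : 'M[R]_d)
    : Prop :=
  [/\ psdmx Sigma,
      forall j, measurable_fun setT (fun w => X w j 0) &
      forall (a : 'cV[R]_d) (B : set R), measurable B ->
        P ((fun w => (a^T *m X w) 0 0) @^-1` B) =
        normal_law ((a^T *m mu) 0 0) (quad_form Sigma a) B].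

Definition sample_mean n d (X : 'I_n -> T -> 'cV[R]_d) (w : T) : 'cV[R]_d :=
  n%:R^-1 *: \sum_(i < n) X i w.

End RandomVectors.

Section Gamma.
Context {R : realType}.
Local Notation leb := (@lebesgue_measure R).

Definition Gamma_fun (a : R) : R :=
  \int[leb]_(x in `]0, +oo[) (x `^ (a - 1) * expR (- x)).

Definition gamma_pdf (a b x : R) : R :=
  if 0 < x then (Gamma_fun a * b `^ a)^-1 * x `^ (a - 1) * expR (- x / b)
  else 0.

Definition gamma_law (a b : R) (B : set R) : \bar R :=
  (\int[leb]_(x in B) (gamma_pdf a b x)%:E)%E.

Definition gamma_lower (a x : R) : R :=
  \int[leb]_(u in `]0, x[) gamma_pdf a 1 u.

Definition gamma_upper (a x : R) : R :=
  \int[leb]_(u in `]x, +oo[) gamma_pdf a 1 u.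

Definition gamma_lower1 (a x : R) : R :=
  \int[leb]_(u in `]0, x[) gamma_lower a u.

Definition gamma_upper1 (a x : R) : R :=
  \int[leb]_(u in `]x, +oo[) gamma_upper a u.

Definition mills_lower (a y : R) : R := gamma_lower a y / (y * gamma_pdf a 1 y).

Definition mills_upper (a y : R) : R := gamma_upper a y / (y * gamma_pdf a 1 y).

Definition stein_C2 (a z : R) : R :=
  derive1n 2 (mills_upper a) z * \int[leb]_(x in `]0, z[) gamma_lower1 a x +
  derive1n 2 (mills_lower a) z * \int[leb]_(x in `]z, +oo[) gamma_upper1 a x.

(* The supremum is finite for every a > 0; it is taken in the extended reals so
   that it is the supremum by definition. *)
Definition stein_e (a : R) : \bar R :=
  ereal_sup [set (stein_C2 a z)%:E | z in `]0, +oo[].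

Definition stirling_r (alpha : R) : R := expR (12 * alpha - 11)^-1.

End Gamma.

Section Distances.
Context {R : realType}.

(* Functions on (0, +oo) are represented by functions on R whose values
   outside (0, +oo) are irrelevant. *)
Definition Z1 (h : R -> R) : Prop :=
  forall x : R, 0 < x ->
    [/\ derivable h x 1, {for x, continuous (derive1 h)} & `|derive1 h x| <= 1].

Definition Z2 (h : R -> R) : Prop :=
  forall x : R, 0 < x ->
    [/\ derivable h x 1, derivable (derive1 h) x 1,
        {for x, continuous (derive1n 2 h)} & `|derive1n 2 h x| <= 1].

(* E[h(X)] for h defined on (0, +oo) and almost surely positive X. *)
Definition expect_pos (d0 : measure_display) (T0 : measurableType d0)
    (P : probability T0 R) (X : T0 -> R) (h : R -> R) : \bar R :=
  expectation P ((h \_ `]0, +oo[) \o X).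

Context {d1 d2 : measure_display}.
Context {T1 : measurableType d1} {T2 : measurableType d2}.

Definition dist_class (Z : set (R -> R))
    (P : probability T1 R) (X : T1 -> R) (Q : probability T2 R) (Y : T2 -> R)
    : \bar R :=
  ereal_sup [set `| expect_pos P X h - expect_pos Q Y h |%E | h in Z].

Definition dist_kol
    (P : probability T1 R) (X : T1 -> R) (Q : probability T2 R) (Y : T2 -> R)
    : \bar R :=
  ereal_sup [set `| P (X @^-1` `]-oo, z]) - Q (Y @^-1` `]-oo, z]) |%E
            | z in [set: R]].

End Distances.

Section WaldType.
Context {R : realType}.

Definition row_space_proj q d (H : 'M[R]_(q, d)) : 'M[R]_d :=
  H^T *m mp_inverse (H *m H^T) *m H.

Definition wald_stat (dT : measure_display) (T : measurableType dT) n d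
    (M Sigma : 'M[R]_d) (X : 'I_n -> T -> 'cV[R]_d) (w : T) : R :=
  n%:R / \tr (M *m Sigma) * quad_form M (sample_mean X w).

Definition wald_nu d (M Sigma : 'M[R]_d) : R :=
  \tr (M *m Sigma) ^+ 2 / \tr (M *m Sigma *m (M *m Sigma)).

(* All terms are nonnegative, so the neutral element 0 does not affect the
   maximum when q > 0. *)
Definition wald_Delta d q (M Sigma : 'M[R]_d) (lam : 'I_q -> R) (r : nat) : R :=
  \big[Num.max/0]_(j < q)
    (`|lam j * \tr (M *m Sigma) / \tr (M *m Sigma *m (M *m Sigma)) - 1| *
     (lam j / \tr (M *m Sigma)) ^+ r).

End WaldType.

(* Main.v *)
(* In an orthonormal basis diagonalizing TH Sigma TH, the statistic W satisfies
   a W = V := kappa sum_i Z_i with a = nu/2, kappa = a / tr(TH Sigma), and Z_i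
   the squares of independent centered normal variables of variances l_i, the
   nonzero l_i being the lam_j.  With c_i = 2 kappa l_i, the Laplace transform of
   (Z_i) gives (1 + c_i s) E[Z_i exp(-sV)] = l_i E[exp(-sV)] for s > 0; by
   polynomial approximation in exp(-V) this extends to
     E[Z_i F(V)] = l_i E[F(V)] + c_i E[Z_i F'(V)].
   The choice of a and kappa makes sum_i (1 - c_i) l_i vanish, so that using the
   identity twice yields
     E[V F'(V) + (a - V) F(V)] = kappa sum_i c_i (1 - c_i) E[Z_i F''(V)],
   where |c_i (1 - c_i)| <= nu Delta_1.  For a Gamma variable in place of V the
   right-hand side is 0.  Taking for F the solution of the Stein equation
   y F' + (a - y) F = H, which satisfies y |F''(y)| <= 2 sup |H'| and
   |F''(y)| <= C2(y) sup |H''|, gives the bounds on d_1 and d_2.  The Kolmogorov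
   bound follows from the former by smoothing indicators at the optimal scale,
   the density of U being bounded through Stirling's inequality. *)
Require Import Defs.
From HB Require Import structures.
From mathcomp Require Import all_boot all_order all_algebra.
From mathcomp Require Import all_classical all_reals all_analysis measurable_realfun.
From mathcomp Require Import ring lra.
Set Implicit Arguments.
Unset Strict Implicit.
Unset Printing Implicit Defensive.
Import Order.TTheory GRing.Theory Num.Theory.
Import numFieldTopology.Exports numFieldNormedType.Exports.
Local Open Scope classical_set_scope.
Local Open Scope ring_scope.

(** * Calculus on the half-line *)

Section Calculus.
Context {R : realType}.
Implicit Types (f g F : R -> R) (a b x y : R).

(** The hypotheses describe only one-dimensional projections of the [X i]. The proof therefore works
    with a single real transform, the mean of [cos (sum_i t_i Y_i + r)], whose free phase [r] covers
    the sines as well. Averaging it over Gaussian coefficients [t_i] gives the joint Laplace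
    transform of the squares, and everything about the [Z_i] is deduced from that transform. A Gamma
    variable satisfies the same identity with one component of coefficient 1, so both sides of each
    distance are instances of the record [stein_mixture]. A test function and the right-hand side of
    its Stein equation differ by a constant that is the same for both, and it cancels. Two obstacles
    shape the analysis: [F''] may grow like [1 / y] at 0, which is met by shifting the argument, and
    the derivative of a function of [Z2] may be unbounded, which is met by truncation. The constants
    come from the rescaling: [a W] with [a = nu / 2] has unit scale, so [h'] is divided by [a] and
    [h''] by [a^2]. Hence [4 Delta_1 = nu Delta_1 * 2 / a] and
    [2 e Delta_1 = nu Delta_1 * (e / a^2) * a], the last [a] being the mean of [V]. *)

Lemma is_derive_continuous f x (df : R) : is_derive x 1 f df -> {for x, continuous f}.
Proof. by move=> [d _]; apply/differentiable_continuous/derivable1_diffP. Qed.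

Lemma derive1_eq f x (df : R) : is_derive x 1 f df -> derive1 f x = df.
Proof. by move=> H; rewrite derive1E; apply: derive_val. Qed.

Lemma derive_le_cc f (f' : R -> R) a b : a <= b ->
  (forall x, a <= x <= b -> is_derive x 1 f (f' x)) ->
  (forall x, a < x < b -> 0 <= f' x) -> f a <= f b.
Proof.
move=> ab df f'0; move: ab; rewrite le_eqVlt => /predU1P[->//|ab].
have [||c cab e] := @MVT R f f' a b ab.
- by move=> x; rewrite in_itv/= => /andP[ax xb]; apply: df; rewrite !ltW.
- apply: derivable_within_continuous => x; rewrite in_itv/= => /df dfx.
  exact: ex_derive.
rewrite -subr_ge0 e mulr_ge0 ?subr_ge0 ?(ltW ab)// f'0//.
Qed.

(** Both bounds come from monotonicity, applied to [f y + B * y] and to [B * y - f y]. *)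
Lemma derive_lip_cc f (f' : R -> R) a b (B : R) : a <= b ->
  (forall x, a <= x <= b -> is_derive x 1 f (f' x)) ->
  (forall x, a < x < b -> `|f' x| <= B) -> `|f b - f a| <= B * (b - a).
Proof.
move=> ab df f'B.
have H1 x : a <= x <= b -> is_derive x 1 (fun y : R => f y + B * y) (f' x + B).
  move=> xab; have := df x xab => ?.
  by apply: is_derive_eq; rewrite /GRing.scale/= mulr1 addrC.
have H2 x : a <= x <= b -> is_derive x 1 (fun y : R => B * y - f y) (B - f' x).
  move=> xab; have := df x xab => ?.
  by apply: is_derive_eq; rewrite /GRing.scale/= mulr1.
have := derive_le_cc ab H1; have := derive_le_cc ab H2 => /=.
have h x : a < x < b -> 0 <= B - f' x /\ 0 <= f' x + B.
  by move=> /f'B; rewrite ler_norml; lra.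
move=> /(_ (fun x xab => (h x xab).1)) h1 /(_ (fun x xab => (h x xab).2)) h2.
by rewrite ler_norml; lra.
Qed.

End Calculus.

Section FTC.
Context {R : realType}.
Implicit Types (f g F : R -> R) (a b x y : R).
Notation leb := (@lebesgue_measure R).

Lemma within_continuous_cc f a b :
  (forall x, a <= x <= b -> {for x, continuous f}) -> {within `[a, b], continuous f}.
Proof.
move=> cf; apply/subspace_continuousP => x /=; rewrite in_itv/= => /cf cfx.
exact: cvg_within_filter.
Qed.

Lemma FTC2_cc f F a b : a < b ->
  (forall x, a <= x <= b -> is_derive x 1 F (f x)) ->
  (forall x, a <= x <= b -> {for x, continuous f}) ->
  (\int[leb]_(x in `[a, b]) (f x)%:E = (F b - F a)%:E)%E.
Proof.
move=> ab dF cf; rewrite EFinB; apply: continuous_FTC2 => //.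
- exact: within_continuous_cc.
- split.
  + by move=> x; rewrite in_itv/= => /andP[ax xb]; apply: ex_derive; apply: dF; rewrite !ltW.
  + apply: cvg_at_right_filter; apply: is_derive_continuous; apply: dF.
    by rewrite lexx ltW.
  + apply: cvg_at_left_filter; apply: is_derive_continuous; apply: dF.
    by rewrite lexx ltW.
- move=> x; rewrite in_itv/= => /andP[ax xb]; apply: derive1_eq.
  by apply: dF; rewrite !ltW.
Qed.

Lemma measurable_continuous_open (A : set R) f : open A ->
  (forall x, A x -> {for x, continuous f}) -> measurable_fun A f.
Proof.
move=> oA cf; apply: open_continuous_measurable_fun => // x; rewrite inE; exact: cf.
Qed.

Variables (A : set R) (a b : R^nat).
Hypothesis ab : forall n, a n < b n.
Hypothesis na : nonincreasing_seq a.
Hypothesis nb : nondecreasing_seq b.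
Hypothesis defA : A = \bigcup_n `[a n, b n]%classic.

Let mA : measurable A.
Proof. by rewrite defA; exact: bigcup_measurable. Qed.

Let abA n x : a n <= x <= b n -> A x.
Proof. by move=> xn; rewrite defA; exists n => //=; rewrite in_itv. Qed.

Variables (f F : R -> R) (l0 l1 : R).
Hypothesis dF : forall x, A x -> is_derive x 1 F (f x).
Hypothesis cf : forall x, A x -> {for x, continuous f}.
Hypothesis Fa : F (a n) @[n --> \oo] --> l0.
Hypothesis Fb : F (b n) @[n --> \oo] --> l1.

Let intn n : (\int[leb]_(x in `[a n, b n]) (f x)%:E = (F (b n) - F (a n))%:E)%E.
Proof. by apply: FTC2_cc => // x /abA; [exact: dF|exact: cf]. Qed.

Let ndab : nondecreasing_seq (fun n => `[a n, b n]%classic).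
Proof.
move=> n m nm; apply/subsetPset => x /=; rewrite !in_itv/= => /andP[ax xb].
by rewrite (le_trans (na nm) ax) (le_trans xb (nb nm)).
Qed.

Let mabf n : measurable_fun `[a n, b n] f.
Proof.
apply: subspace_continuous_measurable_fun => //.
by apply: within_continuous_cc => x /abA /cf.
Qed.

Lemma measurable_exhaust : measurable_fun A f.
Proof. by rewrite defA; apply/measurable_fun_bigcup. Qed.

(** Monotone convergence along the segments [[a n, b n]] that exhaust [A]. For nonnegative [f]
    integrability is thus part of the outcome; the signed version below takes it as a hypothesis and
    uses dominated convergence with [|f|]. *)
Lemma ge0_FTC_exhaust : (forall x, A x -> 0 <= f x) ->
  (\int[leb]_(x in A) (f x)%:E = (l1 - l0)%:E)%E.
Proof.
move=> f0.
have h : (\int[leb]_(x in `[a n, b n]) (f x)%:E)%E @[n --> \oo] -->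
    (\int[leb]_(x in A) (f x)%:E)%E.
  rewrite defA; apply: (@ge0_nondecreasing_set_cvg_integral _ (measurableTypeR R) R
    (fun n => `[a n, b n]%classic) (fun x => (f x)%:E) leb ndab) => //.
  - by move=> n; apply/measurable_EFinP; exact: mabf.
  - by move=> n x /=; rewrite in_itv/= lee_fin => /abA; exact: f0.
rewrite (funext intn) in h; apply: (cvg_unique _ h) => //=.
by apply: cvg_EFin; [exact: nearW|exact: cvgB].
Qed.

Lemma FTC_exhaust : leb.-integrable A (EFin \o f) ->
  \int[leb]_(x in A) f x = l1 - l0.
Proof.
move=> intf; rewrite /Rintegral.
have [|||||_ _ h] := @dominated_convergence _ _ R leb A mA
   (fun n x => ((f \_ `[a n, b n]) x)%:E) (EFin \o f) (fun x => `|f x|%:E).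
- move=> n; apply/measurable_EFinP; apply: measurable_funTS.
  by apply/(measurable_restrictT f).
- by apply/measurable_EFinP; apply: measurable_exhaust.
- apply/aeW => x; rewrite {1}defA => -[n _ /= xn].
  apply: cvg_EFin; first exact: nearW.
  apply: cvg_near_cst; exists n => // m /= nm; rewrite patchE mem_set//.
  by have /subsetPset := ndab nm; exact.
- exact: integrable_norm.
- apply/aeW => x n _; rewrite lee_fin patchE.
  by case: ifP => // _; rewrite normr0.
rewrite -[RHS]/(fine (l1 - l0)%:E); congr fine.
apply: (cvg_unique _ h) => //.
have -> : (fun n => \int[leb]_(x in A) ((f \_ `[a n, b n]) x)%:E)%E =
  (fun n => (F (b n) - F (a n))%:E).
  apply/funext => n; rewrite -intn.
  transitivity (\int[leb]_(x in A) (((EFin \o f) \_ `[a n, b n]) x))%E.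
    by apply: eq_integral => x _; rewrite restrict_EFin.
  rewrite -integral_mkcondr setIidr// => x /=; rewrite in_itv/=; exact: abA.
by apply: cvg_EFin; [exact: nearW|exact: cvgB].
Qed.
End FTC.

Section Dominated.
Context d (T : measurableType d) (R : realType) (mu : {measure set T -> \bar R}).

Lemma Rintegral_dominated (D : set T) (f_ : nat -> T -> R) (f g : T -> R) :
  measurable D -> (forall n, measurable_fun D (f_ n)) ->
  (forall x, D x -> f_ n x @[n --> \oo] --> f x) ->
  mu.-integrable D (EFin \o g) ->
  (forall n x, D x -> `|f_ n x| <= g x) ->
  mu.-integrable D (EFin \o f) /\
  \int[mu]_(x in D) f_ n x @[n --> \oo] --> \int[mu]_(x in D) f x.
Proof.
move=> mD mf_ f_f ig f_g.
have mf : measurable_fun D f by apply: measurable_fun_cvg f_f.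
have [|||||i _ h] := @dominated_convergence _ _ R mu D mD
   (fun n x => (f_ n x)%:E) (EFin \o f) (EFin \o g).
- by move=> n; apply/measurable_EFinP; exact: mf_.
- by apply/measurable_EFinP.
- by apply/aeW => x Dx; apply: cvg_EFin; [exact: nearW|exact: f_f].
- exact: ig.
- by apply/aeW => x n Dx; rewrite lee_fin; exact: f_g.
split; first exact: i.
apply: fine_cvg; rewrite fineK; first exact: h.
exact: integrable_fin_num.
Qed.

End Dominated.

Section FTC_half_line.
Context {R : realType}.
Implicit Types (f g F : R -> R) (a b x y : R).
Notation leb := (@lebesgue_measure R).

Let natS_gt0 n : 0 < n.+1%:R :> R. Proof. by rewrite ltr0n. Qed.

Let a1 (n : nat) : R := - n.+1%:R.
Let b1 (n : nat) : R := n.+1%:R.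
(** The shift is by 2 because [a2 0 < b2 0] must be strict: with a shift by 1 the first segment
    would be a point. *)
Let a2 (n : nat) : R := n.+2%:R^-1.
Let b2 (n : nat) : R := n.+2%:R.

Let ab1 n : a1 n < b1 n.
Proof. by rewrite /a1 /b1; have := natS_gt0 n; lra. Qed.

Let na1 : nonincreasing_seq a1.
Proof. by move=> n m nm; rewrite /a1 lerN2 ler_nat ltnS. Qed.

Let nb1 : nondecreasing_seq b1.
Proof. by move=> n m nm; rewrite /b1 ler_nat ltnS. Qed.

Let def1 : [set: R] = \bigcup_n `[a1 n, b1 n]%classic.
Proof.
apply/seteqP; split => // x _; exists (Num.truncn `|x|) => //=.
rewrite in_itv/= -ler_norml /b1 ltW//.
by rewrite truncnS_gt.
Qed.

Let cvgb1 : b1 n @[n --> \oo] --> +oo.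
Proof. by rewrite /b1 (cvg_shiftS (fun n => n%:R : R)); exact: cvgr_idn. Qed.

Let cvga1 : a1 n @[n --> \oo] --> -oo.
Proof.
apply/cvgNry; rewrite (_ : - a1 = b1); first exact: cvgb1.
by apply/funext => n; rewrite /a1 fctE opprK.
Qed.

Let ab2 n : a2 n < b2 n.
Proof.
by rewrite /a2 /b2 (@le_lt_trans _ _ 1)// ?invf_le1 ?ler1n ?ltr1n// ltr0n.
Qed.

Let na2 : nonincreasing_seq a2.
Proof. by move=> n m nm; rewrite /a2 lef_pV2 ?posrE ?ltr0n// ler_nat !ltnS. Qed.

Let nb2 : nondecreasing_seq b2.
Proof. by move=> n m nm; rewrite /b2 ler_nat !ltnS. Qed.

Let def2 : `]0%R, +oo[%classic = \bigcup_n `[a2 n, b2 n]%classic.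
Proof.
apply/seteqP; split => x; last first.
  by move=> [n _ /=]; rewrite !in_itv/= andbT => /andP[+ _]; apply: lt_le_trans; rewrite invr_gt0.
rewrite /= in_itv/= andbT => x0.
exists (maxn (Num.truncn x) (Num.truncn x^-1)) => //=.
rewrite in_itv/=; apply/andP; split.
- rewrite /a2 -[leRHS]invrK lef_pV2 ?posrE ?invr_gt0//.
  rewrite (le_trans (ltW (truncnS_gt _)))// ler_nat.
  by rewrite ltnS (leq_trans (leq_maxr (Num.truncn x) _))// leqnSn.
- rewrite (le_trans (ltW (truncnS_gt _)))// ler_nat.
  by rewrite ltnS (leq_trans (leq_maxl _ (Num.truncn x^-1)))// leqnSn.
Qed.

Let cvgb2 : b2 n @[n --> \oo] --> +oo.
Proof. by rewrite /b2 (cvg_shiftS b1); exact: cvgb1. Qed.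

Let cvga2 : (forall n, 0 < a2 n) /\ a2 n @[n --> \oo] --> 0.
Proof.
split=> [n|]; first by rewrite /a2 invr_gt0.
by rewrite /a2 (cvg_shiftS (@harmonic R)); exact: cvg_harmonic.
Qed.

Lemma FTC_setT f F (l0 l1 : R) :
  (forall x, is_derive x 1 F (f x)) -> continuous f ->
  leb.-integrable setT (EFin \o f) ->
  F x @[x --> -oo] --> l0 -> F x @[x --> +oo] --> l1 ->
  \int[leb]_x f x = l1 - l0.
Proof.
move=> dF cf intf F0 F1; apply: (FTC_exhaust ab1 na1 nb1 def1 (F:=F)) => //.
- by move=> x _; exact: cf.
- exact: (cvg_comp a1 F cvga1 F0).
- exact: (cvg_comp b1 F cvgb1 F1).
Qed.

Lemma ge0_FTC_0y f F (l0 l1 : R) :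
  (forall x, 0 < x -> is_derive x 1 F (f x)) ->
  (forall x, 0 < x -> {for x, continuous f}) -> (forall x, 0 < x -> 0 <= f x) ->
  F x @[x --> 0^'+] --> l0 -> F x @[x --> +oo] --> l1 ->
  (\int[leb]_(x in `]0%R, +oo[) (f x)%:E = (l1 - l0)%:E)%E.
Proof.
move=> dF cf f0 F0 F1; apply: (ge0_FTC_exhaust ab2 na2 nb2 def2 (F:=F)).
- by move=> x /=; rewrite in_itv/= andbT; exact: dF.
- by move=> x /=; rewrite in_itv/= andbT; exact: cf.
- exact: (proj1 (cvg_at_rightP _ _ _) F0 a2 cvga2).
- exact: (cvg_comp b2 F cvgb2 F1).
- by move=> x /=; rewrite in_itv/= andbT; exact: f0.
Qed.

Lemma FTC_0y f F (l0 l1 : R) :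
  (forall x, 0 < x -> is_derive x 1 F (f x)) ->
  (forall x, 0 < x -> {for x, continuous f}) ->
  leb.-integrable `]0%R, +oo[ (EFin \o f) ->
  F x @[x --> 0^'+] --> l0 -> F x @[x --> +oo] --> l1 ->
  \int[leb]_(x in `]0%R, +oo[) f x = l1 - l0.
Proof.
move=> dF cf intf F0 F1; apply: (FTC_exhaust ab2 na2 nb2 def2 (F:=F)) => //.
- by move=> x /=; rewrite in_itv/= andbT; exact: dF.
- by move=> x /=; rewrite in_itv/= andbT; exact: cf.
- exact: (proj1 (cvg_at_rightP _ _ _) F0 a2 cvga2).
- exact: (cvg_comp b2 F cvgb2 F1).
Qed.

Lemma measurable_fun_0y f :
  (forall x, 0 < x -> {for x, continuous f}) -> measurable_fun (`]0%R, +oo[%classic : set R) f.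
Proof.
move=> cf; apply: measurable_continuous_open; first exact: interval_open.
by move=> x /=; rewrite in_itv/= andbT; exact: cf.
Qed.

Lemma is_derive_int_0 f : (forall x, 0 < x -> {for x, continuous f}) ->
  (forall x, 0 < x -> leb.-integrable `]0, x] (EFin \o f)) ->
  forall x, 0 < x -> is_derive x 1 (fun x => \int[leb]_(t in `]0, x[) f t) (f x).
Proof.
move=> cf intf x x0.
have -> : (fun x => \int[leb]_(t in `]0, x[) f t) = (fun x => \int[leb]_(t in `]0, x]) f t).
  apply/funext => y; have [y0|y0] := ltP 0 y.
    apply: Rintegral_itv_bndo_bndc; apply: integrableS (intf y y0) => //.
    by apply: subset_itvl; rewrite bnd_simp.
  by rewrite !set_itv_ge// bnd_simp -leNgt.
have x1 : x < x + 1 by lra.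
have [||h1 h2] := @continuous_FTC1 R f (BRight 0) x (x + 1) x1 _ _ (cf _ x0).
- by apply: intf; lra.
- by rewrite lte_fin.
by apply: DeriveDef; [exact: h1|rewrite -derive1E; exact: h2].
Qed.

Lemma Rintegral_0y_split f x : 0 < x -> leb.-integrable `]0%R, +oo[ (EFin \o f) ->
  \int[leb]_(t in `]0%R, +oo[) f t =
  \int[leb]_(t in `]0, x[) f t + \int[leb]_(t in `]x, +oo[) f t.
Proof.
move=> x0 intf.
have i1 : leb.-integrable `]0, x] (EFin \o f).
  by apply: integrableS intf => //; exact: subset_itvl.
rewrite (@itv_bndbnd_setU _ _ _ (BRight x))//; last by rewrite bnd_simp ltW.
rewrite Rintegral_setU//.
- rewrite -Rintegral_itv_bndo_bndc//; apply: integrableS i1 => //.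
  by apply: subset_itvl; rewrite bnd_simp.
- by rewrite -itv_bndbnd_setU// bnd_simp ltW.
- apply/disj_setPS => y [/=]; rewrite !in_itv/= => /andP[_ yx].
  by rewrite andbT ltNge yx.
Qed.

Lemma Rintegral_xy_split f x y : x <= y -> leb.-integrable `]x, +oo[ (EFin \o f) ->
  \int[leb]_(t in `]x, +oo[) f t =
  \int[leb]_(t in `]x, y]) f t + \int[leb]_(t in `]y, +oo[) f t.
Proof.
move=> xy intf.
rewrite (@itv_bndbnd_setU _ _ _ (BRight y))//.
rewrite Rintegral_setU//.
- by rewrite -itv_bndbnd_setU// bnd_simp.
- apply/disj_setPS => z [/=]; rewrite !in_itv/= => /andP[_ yx].
  by rewrite andbT ltNge yx.
Qed.

Lemma is_derive_int_y f : (forall x, 0 < x -> {for x, continuous f}) ->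
  (forall x, 0 < x -> leb.-integrable `]x, +oo[ (EFin \o f)) ->
  forall x, 0 < x -> is_derive x 1 (fun x => \int[leb]_(t in `]x, +oo[) f t) (- f x).
Proof.
move=> cf intf x x0.
(* A base point strictly between 0 and [x]: near [x] the tail integral is a constant minus the
   integral over []z, y]], to which the fundamental theorem applies. *)
pose z := x / 2; have z0 : 0 < z by rewrite /z; lra.
have zx : z < x by rewrite /z; lra.
have x1 : x < x + 1 by lra.
have [||h1 h2] := @continuous_FTC1 R f (BRight z) x (x + 1) x1 _ _ (cf _ x0).
- apply: integrableS (intf _ z0) => //; exact: subset_itvl.
- by rewrite lte_fin.
have H : is_derive x 1 (fun y => \int[leb]_(t in `]z, +oo[) f t - \int[leb]_(t in `]z, y]) f t) (- f x).
  have H1 : is_derive x 1 (fun y => \int[leb]_(t in `]z, y]) f t) (f x).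
    by apply: DeriveDef; [exact: h1|rewrite -derive1E; exact: h2].
  have := is_deriveB (is_derive_cst (\int[leb]_(t in `]z, +oo[) f t) x 1) H1.
  by rewrite sub0r.
apply: near_eq_is_derive H.
near=> y; have zy : z <= y by apply/ltW; near: y; exact: lt_nbhsr.
by rewrite (Rintegral_xy_split zy (intf _ z0)); ring.
Unshelve. all: by end_near. Qed.

(** Dominated convergence along an arbitrary sequence [u n] tending to 0 from the right: the
    restrictions of [f] to []0, u n[] vanish pointwise in the limit and stay below [|f|]. *)
Lemma cvg_int_0 f : leb.-integrable `]0, 1[ (EFin \o f) ->
  \int[leb]_(t in `]0, x[) f t @[x --> 0^'+] --> 0.
Proof.
move=> intf; apply/cvg_at_rightP => u [u0 cu].
have mf : measurable_fun (`]0, 1[%classic : set R) f by apply/measurable_EFinP; exact: measurable_int intf.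
have [||x x01||n x x01|_] := @Rintegral_dominated _ _ R leb `]0, 1[%classic
  (fun n => f \_ `]0, u n[) (cst 0) (fun x => `|f x|).
- exact: measurable_itv.
- move=> n; apply/measurable_restrict => //.
  by apply: measurable_funS mf => //; exact: subIsetl.
- apply: cvg_near_cst; near=> n; rewrite patchE memNset//= in_itv/=; apply/negP.
  rewrite negb_and -!leNgt; apply/orP; right; apply/ltW; near: n.
  by apply: (cvgr_lt 0 cu); move: x01; rewrite /= in_itv/= => /andP[].
- exact: integrable_norm.
- by rewrite patchE; case: ifP => // _; rewrite normr0.
rewrite Rintegral_cst// mul0r; apply: cvg_trans; apply: near_eq_cvg.
near=> n; rewrite -Rintegral_mkcondr setIidr//; apply: subset_itvl; rewrite bnd_simp ltW//.
by near: n; exact: (cvgr_lt 0 cu).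
Unshelve. all: by end_near. Qed.

Lemma cvg_int_y f (c : R) : leb.-integrable `]c, +oo[ (EFin \o f) ->
  \int[leb]_(t in `]x, +oo[) f t @[x --> +oo] --> 0.
Proof.
move=> intf; apply/cvg_pinftyP => u cu.
have mf : measurable_fun `]c, +oo[ f by apply/measurable_EFinP; exact: measurable_int intf.
have [||x x01||n x x01|_] := @Rintegral_dominated _ _ R leb `]c, +oo[%classic
  (fun n => f \_ `]u n, +oo[) (cst 0) (fun x => `|f x|).
- exact: measurable_itv.
- move=> n; apply/measurable_restrict => //.
  by apply: measurable_funS mf => //; exact: subIsetl.
- apply: cvg_near_cst; near=> n; rewrite patchE memNset//= in_itv/=; apply/negP.
  rewrite andbT -leNgt ltW//; near: n.
  by move/cvgryPgt : cu; apply.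
- exact: integrable_norm.
- by rewrite patchE; case: ifP => // _; rewrite normr0.
rewrite Rintegral_cst// mul0r; apply: cvg_trans; apply: near_eq_cvg.
near=> n; rewrite -Rintegral_mkcondr setIidr//; apply: subset_itvr; rewrite bnd_simp ltW//.
by near: n; move/cvgryPgt : cu; apply.
Unshelve. all: by end_near. Qed.

End FTC_half_line.

Section Integrable_real.
Context d (T : measurableType d) (R : realType) (mu : {measure set T -> \bar R}).
Variables (D : set T) (mD : measurable D).
Implicit Types (f g : T -> R) (k : R).

Lemma integrable_EFinZ k f : mu.-integrable D (fun x => (f x)%:E) ->
  mu.-integrable D (fun x => (k * f x)%:E).
Proof. by move=> /(integrableZl mD k); apply: eq_integrable => // x _; rewrite EFinM. Qed.

Lemma integrable_EFinD f g : mu.-integrable D (fun x => (f x)%:E) ->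
  mu.-integrable D (fun x => (g x)%:E) -> mu.-integrable D (fun x => (f x + g x)%:E).
Proof. by move=> /(integrableD mD) h /h; apply: eq_integrable => // x _; rewrite EFinD. Qed.

Lemma integrable_EFinB f g : mu.-integrable D (fun x => (f x)%:E) ->
  mu.-integrable D (fun x => (g x)%:E) -> mu.-integrable D (fun x => (f x - g x)%:E).
Proof. by move=> /(integrableB mD) h /h; apply: eq_integrable => // x _; rewrite EFinB. Qed.

Lemma integrable_EFin_le f g : measurable_fun D f ->
  (forall x, D x -> `|f x| <= g x) -> mu.-integrable D (fun x => (g x)%:E) ->
  mu.-integrable D (fun x => (f x)%:E).
Proof.
move=> mf fg; apply: le_integrable => //; first exact/measurable_EFinP.
by move=> x Dx; rewrite /= lee_fin (le_trans (fg x Dx))// ler_norm.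
Qed.

Lemma Rintegral_fineK f : mu.-integrable D (fun x => (f x)%:E) ->
  (\int[mu]_(x in D) (f x)%:E = (\int[mu]_(x in D) f x)%:E)%E.
Proof. by move=> h; rewrite /Rintegral fineK//; exact: integrable_fin_num. Qed.

End Integrable_real.

Import HBNNSimple.

(** * Image of a measure with a density *)

Section Weighted_pushforward.
Context d1 d2 (X : measurableType d1) (Y : measurableType d2) (R : realType).
Variables (mu : {measure set X -> \bar R}) (nu : {measure set Y -> \bar R}).
Variables (phi : X -> Y) (mphi : measurable_fun setT phi).
Variables (Z : X -> R) (mZ : measurable_fun setT Z) (Z0 : forall x, 0 <= Z x).
Hypothesis nuE : forall B, measurable B ->
  nu B = (\int[mu]_(x in phi @^-1` B) (Z x)%:E)%E.

Let mphiB B : measurable B -> measurable (phi @^-1` B).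
Proof. by move=> mB; rewrite -[X in measurable X]setTI; exact: mphi. Qed.

(** [nu] is the image by [phi] of the measure with density [Z]. Increasing simple approximations of
    [f] reduce the formula to level sets, where it is [nuE]. It serves twice: with [phi = idfun] for
    laws given by a density, and with a random variable [phi] for the factorization of means under
    independence. *)
Lemma ge0_integral_weighted (f : Y -> R) : measurable_fun setT f ->
  (forall y, 0 <= f y) ->
  (\int[nu]_y (f y)%:E = \int[mu]_x (f (phi x) * Z x)%:E)%E.
Proof.
move=> mf f0; have mEf : measurable_fun setT (EFin \o f) by exact/measurable_EFinP.
pose h := nnsfun_approx measurableT mEf.
have cvgh y : (h n y)%:E @[n --> \oo] --> (f y)%:E.
  by apply: (cvg_nnsfun_approx measurableT mEf) => // z _; rewrite lee_fin.
have ndh y : nondecreasing_seq (fun n => h n y).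
  by move=> a b ab; have /lefP := nd_nnsfun_approx measurableT mEf ab; exact.
have mhphi n : measurable_fun setT (fun x => h n (phi x)).
  by apply: measurableT_comp.
have E1 : (\int[nu]_y (h n y)%:E)%E @[n --> \oo] --> (\int[nu]_y (f y)%:E)%E.
  have -> : (\int[nu]_y (f y)%:E = \int[nu]_y lim ((h n y)%:E @[n --> \oo]))%E.
    by apply: eq_integral => y _; apply/esym/cvg_lim.
  apply: cvg_monotone_convergence => //.
  - by move=> n; apply/measurable_EFinP.
  - by move=> n y _; rewrite lee_fin.
  - by move=> y _ a b ab; rewrite lee_fin ndh.
have E2 : (\int[mu]_x (h n (phi x) * Z x)%:E)%E @[n --> \oo] -->
    (\int[mu]_x (f (phi x) * Z x)%:E)%E.
  have -> : (\int[mu]_x (f (phi x) * Z x)%:E =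
      \int[mu]_x lim ((h n (phi x) * Z x)%:E @[n --> \oo]))%E.
    apply: eq_integral => x _; apply/esym/cvg_lim => //.
    by under eq_fun do rewrite EFinM; rewrite EFinM; apply: cvgeZr.
  apply: cvg_monotone_convergence => //.
  - by move=> n; apply/measurable_EFinP; exact: measurable_funM.
  - by move=> n x _; rewrite lee_fin mulr_ge0.
  - by move=> x _ a b ab; rewrite lee_fin ler_wpM2r ?ndh.
apply: (cvg_unique _ E1) => //.
have mindic n r : measurable_fun setT (fun x => \1_(h n @^-1` [set r]) (phi x) : R).
  by apply: (@measurable_indic _ _ _ _ (phi @^-1` (h n @^-1` [set r]))); exact: mphiB.
suff suf n : (\int[nu]_y (h n y)%:E = \int[mu]_x (h n (phi x) * Z x)%:E)%E.
  by rewrite (funext suf).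
transitivity (\int[nu]_y
   (\sum_(r \in range (h n)) (r * \1_(h n @^-1` [set r]) y)%:E))%E.
  by apply: eq_integral => t tE; rewrite /= fimfunE -fsumEFin.
rewrite ge0_integral_fsum//; last 2 first.
- by move=> r; apply/measurable_EFinP; exact: measurable_funM.
- by move=> m y Ey; exact: nnfun_muleindic_ge0.
transitivity (\int[mu]_x
   (\sum_(r \in range (h n)) ((r * \1_(h n @^-1` [set r]) (phi x)) * Z x)%:E))%E; last first.
  apply: eq_integral => x _; rewrite fsumEFin//.
  by rewrite fimfunE mulr_fsuml//.
rewrite ge0_integral_fsum//; last 2 first.
- move=> r; apply/measurable_EFinP; apply: measurable_funM => //.
  apply: measurable_funM => //.
- by move=> m y Ey; rewrite EFinM mule_ge0 ?lee_fin//; exact: nnfun_muleindic_ge0.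
apply: eq_fsbigr => r rhn.
rewrite (integralZl_indic_nnsfun _ _ )//.
have mr : measurable (h n @^-1` [set r]) by [].
rewrite integral_indic// setIT nuE//.
(* The constant [r] leaves the integral only when it is nonnegative; the level set of a negative
   value of the nonnegative [h n] is empty. *)
have [r0|r0] := leP 0 r; last first.
  rewrite preimage_nnfun0// preimage_set0 integral_set0 mule0.
  by under eq_integral do rewrite indic0 mulr0 mul0r; rewrite integral0.
under [RHS]eq_integral do rewrite -mulrA EFinM.
rewrite ge0_integralZl//; last 2 first.
- apply/measurable_EFinP; apply: measurable_funM => //.
- by move=> x _; rewrite lee_fin mulr_ge0.
congr (_ * _)%E; rewrite integral_mkcond; apply: eq_integral => x _.
rewrite patchE /= indicE; case: ifPn => h1; case: (boolP (_ \in _)) => h2 //=; rewrite ?mul1r ?mul0r//.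
- by move/negP: h2; rewrite !inE in h1 *.
- by move/negP: h1; rewrite !inE in h2 *.
Qed.

Lemma Rintegral_weighted (f : Y -> R) : measurable_fun setT f ->
  mu.-integrable setT (fun x => (f (phi x) * Z x)%:E) ->
  nu.-integrable setT (EFin \o f) /\
  \int[nu]_y f y = \int[mu]_x (f (phi x) * Z x).
Proof.
move=> mf /integrableP[mfZ ifZ]; split.
  apply/integrableP; split; first exact/measurable_EFinP.
  rewrite [ltLHS](_ : _ = \int[nu]_x (`|f x|)%:E)%E//.
  rewrite (ge0_integral_weighted (f := fun y => `|f y|))//; last exact: measurableT_comp.
  rewrite [ltLHS](_ : _ = \int[mu]_x `|(f (phi x) * Z x)%:E|)%E//.
  by apply: eq_integral => x _; rewrite abse_EFin normrM (ger0_norm (Z0 _)).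
rewrite /Rintegral integralE [in RHS]integralE; congr fine; congr (_ - _)%E.
- transitivity (\int[nu]_x (f^\+ x)%:E)%E.
    by apply: eq_integral => y _; rewrite funeposE /funrpos EFin_max.
  rewrite ge0_integral_weighted//; last exact: measurable_funrpos.
  apply: eq_integral => x _; rewrite funeposE /funrpos -EFin_max; congr _%:E.
  by rewrite maxr_pMl// mul0r.
- transitivity (\int[nu]_x (f^\- x)%:E)%E.
    by apply: eq_integral => y _; rewrite funenegE /funrneg EFin_max.
  rewrite ge0_integral_weighted//; last exact: measurable_funrneg.
  apply: eq_integral => x _; rewrite funenegE /funrneg -EFinN -EFin_max; congr _%:E.
  by rewrite maxr_pMl// mul0r mulNr.
Qed.

End Weighted_pushforward.

(** * Diagonalization of the projected covariance *)

Section Spectral.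
Context {R : realType}.

(** The block matrix with rows [(X, A)] and [(B, 1)] has determinant [det (X - A B)], by a
    unitriangular factor on the right. A triangular factor of determinant [X ^ n] on the left turns
    the same determinant into [X ^ n * det (X - B A)]. Cancelling [X ^ n] among polynomials covers
    singular [A] and [B]. *)
Lemma char_poly_mulC n (A B : 'M[R]_n) : char_poly (A *m B) = char_poly (B *m A).
Proof.
rewrite /char_poly /char_poly_mx.
pose p : {poly R} := 'X.
pose A' : 'M[{poly R}]_n := map_mx polyC A.
pose B' : 'M[{poly R}]_n := map_mx polyC B.
have E : block_mx ('X%:M) A' B' 1%:M *m block_mx 1%:M 0 (- B') 1%:M =
         block_mx ('X%:M - A' *m B') A' 0 1%:M :> 'M[{poly R}]_(n + n).
  rewrite mulmx_block !mulmx1 !mulmx0 !mul1mx mulmxN !add0r.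
  by rewrite subrr.
have E2 : block_mx 1%:M 0 (- B') ('X%:M) *m block_mx ('X%:M) A' B' 1%:M =
         block_mx ('X%:M) A' 0 ('X%:M - B' *m A') :> 'M[{poly R}]_(n + n).
  rewrite mulmx_block !mul1mx !mul0mx !addr0 mulmx1 mulNmx.
  by rewrite mul_mx_scalar mul_scalar_mx addNr [_ + 'X%:M]addrC mulNmx.
have := congr1 determinant E; have := congr1 determinant E2.
rewrite !det_mulmx !det_lblock !det_ublock !det1 !mul1r !mulr1 !det_scalar.
rewrite !map_mxM /= -/A' -/B' => + <- => /mulfI; apply.
by rewrite expf_neq0// polyX_eq0.
Qed.

Definition sqnorm n (v : 'rV[R]_n) : R := \sum_i v 0 i ^+ 2.

Lemma sqnormE n (v : 'rV[R]_n) : (v *m v^T) 0 0 = sqnorm v.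
Proof. by rewrite mxE; apply: eq_bigr => i _; rewrite mxE expr2. Qed.

Lemma sqnorm_eq0 n (v : 'rV[R]_n) : sqnorm v = 0 -> v = 0.
Proof.
move=> /eqP; rewrite psumr_eq0 => [/allP h|i _]; last exact: sqr_ge0.
apply/rowP => i; rewrite mxE; apply/eqP; rewrite -sqrf_eq0.
by apply: h; rewrite mem_index_enum.
Qed.

Lemma sqnorm_gt0 n (v : 'rV[R]_n) : v != 0 -> 0 < sqnorm v.
Proof.
move=> v0; rewrite lt_neqAle sumr_ge0 ?andbT; last by move=> i _; exact: sqr_ge0.
by apply: contra v0 => /eqP/esym/sqnorm_eq0 ->.
Qed.

(** [Q] is the reflection that exchanges [e] and [v]. It gives an explicit orthogonal matrix with a
    prescribed image of [e], in place of a completion to an orthonormal basis. *)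
Lemma householder n (v e : 'rV[R]_n) : sqnorm v = 1 -> sqnorm e = 1 ->
  exists Q : 'M[R]_n, [/\ Q^T = Q, Q *m Q = 1%:M & e *m Q = v].
Proof.
move=> v1 e1; have [->|ev] := eqVneq e v.
  by exists 1%:M; rewrite trmx1 !mulmx1.
have [u uE] : {u | u = e - v} by exists (e - v).
pose c := sqnorm u.
have c0 : c != 0 by rewrite gt_eqF// sqnorm_gt0// uE subr_eq0.
have uu : u *m u^T = c%:M.
  by rewrite [LHS]mx11_scalar sqnormE.
pose Q : 'M[R]_n := 1%:M - (2 / c) *: (u^T *m u).
have evT : (e *m v^T) 0 0 = (v *m e^T) 0 0.
  by rewrite !mxE; apply: eq_bigr => i _; rewrite !mxE mulrC.
have cE : c = 2 - 2 * (e *m v^T) 0 0.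
  rewrite /c -sqnormE uE linearB/= mulmxBl !mulmxBr !mxE.
  move: evT v1 e1; rewrite -!sqnormE !mxE => -> -> ->; ring.
exists Q; split.
- by rewrite /Q linearB/= linearZ/= trmx1 trmx_mul trmxK.
- rewrite /Q mulmxBl mul1mx mulmxBr mulmx1 -scalemxAl -scalemxAr.
  rewrite -mulmxA (mulmxA u) uu mul_scalar_mx -scalemxAr !scalerA.
  rewrite -addrA -[RHS]addr0; congr (_ + _).
  rewrite -scalerBl -scaleNr -scalerBl.
  by rewrite (_ : _ - _ = 0) ?scale0r//; field.
- rewrite /Q mulmxBr mulmx1 -scalemxAr mulmxA.
  have -> : e *m u^T = (c / 2)%:M.
    rewrite [LHS]mx11_scalar; congr _%:M.
    rewrite cE uE linearB/= mulmxBr mxE sqnormE e1 [X in _ + X]mxE.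
    by field.
  rewrite mul_scalar_mx scalerA (_ : _ * _ = 1); last by field.
  by rewrite scale1r uE opprB addrC subrK.
Qed.

(** Since the characteristic polynomial is given as a product of linear factors, each induction step
    starts from a real eigenvector for [l ord0]. A reflection moves it to the first basis vector;
    symmetry clears the first column along with the first row, and the remaining block has the other
    factors in the same order. *)
Lemma spectral_real n (A : 'M[R]_n) (l : 'I_n -> R) : A^T = A ->
  char_poly A = \prod_(i < n) ('X - (l i)%:P) ->
  exists Q : 'M[R]_n, Q *m Q^T = 1%:M /\ Q *m A *m Q^T = diag_mx (\row_i l i).
Proof.
elim: n A l => [|n IHn] A l symA chA.
  by exists 1%:M; split; apply/matrixP => -[].
have /eigenvalueP[v vA v0] : eigenvalue A (l ord0).
  by rewrite eigenvalue_root_char chA big_ord_recl rootM root_XsubC eqxx.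
pose w := (Num.sqrt (sqnorm v))^-1 *: v.
have w1 : sqnorm w = 1.
  rewrite /sqnorm /w; under eq_bigr do rewrite mxE exprMn exprVn.
  rewrite -mulr_sumr sqr_sqrtr ?mulVf//.
    by rewrite gt_eqF// sqnorm_gt0.
  by rewrite ltW// sqnorm_gt0.
have wA : w *m A = l ord0 *: w by rewrite /w -scalemxAl vA !scalerA mulrC.
pose e : 'rV[R]_(1 + n) := row_mx 1%:M 0.
have e1 : sqnorm e = 1.
  by rewrite -sqnormE /e tr_row_mx mul_row_col trmx1 mulmx1 mul0mx addr0 mxE.
have [Q0 [Q0T Q0Q Q0e]] := householder w1 e1.
pose B : 'M[R]_(1 + n) := Q0 *m A *m Q0.
have BT : B^T = B by rewrite /B !trmx_mul symA Q0T mulmxA.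
have eB : e *m B = l ord0 *: e.
  rewrite /B !mulmxA Q0e wA -scalemxAl -Q0e -mulmxA Q0Q mulmx1//.
have ulB : ulsubmx B = (l ord0)%:M /\ ursubmx B = 0.
  move: eB; rewrite -[B]submxK /e mul_row_block !mul1mx !mul0mx !addr0.
  rewrite scale_row_mx scaler0 => /eq_row_mx[-> ->].
  by rewrite !(block_mxKul, block_mxKur) scalemx1.
have dlB : dlsubmx B = 0.
  by apply: trmx_inj; rewrite trmx_dlsub BT ulB.2 trmx0.
have BE : B = block_mx (l ord0)%:M 0 0 (drsubmx B).
  by rewrite -[LHS]submxK ulB.1 ulB.2 dlB.
have chB : char_poly (drsubmx B) = \prod_(i < n) ('X - (l (lift ord0 i))%:P).
  have : char_poly B = char_poly A.
    by rewrite /B -mulmxA char_poly_mulC -mulmxA Q0Q mulmx1.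
  rewrite chA big_ord_recl {1}BE /char_poly /char_poly_mx.
  rewrite map_block_mx !map_mx0 (scalar_mx_block 1 n 'X) opp_block_mx add_block_mx.
  rewrite !oppr0 !addr0 det_ublock map_scalar_mx /= -raddfB/= det_scalar expr1.
  by move=> /mulfI; apply; rewrite polyXsubC_eq0.
have symD : (drsubmx B)^T = drsubmx B by rewrite trmx_drsub BT.
have [Q1 [Q1Q Q1D]] := IHn _ _ symD chB.
pose Q2 : 'M[R]_(1 + n) := block_mx 1%:M 0 0 Q1.
have Q2T : Q2^T = block_mx 1%:M 0 0 Q1^T by rewrite /Q2 tr_block_mx !trmx0 trmx1.
have Q2Q : Q2 *m Q2^T = 1%:M.
  rewrite Q2T mulmx_block !mulmx0 !mul0mx !addr0 !add0r mulmx1 Q1Q.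
  by rewrite -scalar_mx_block.
have Q2B : Q2 *m B *m Q2^T = block_mx (l ord0)%:M 0 0 (diag_mx (\row_i l (lift ord0 i))).
  rewrite Q2T BE !mulmx_block -Q1D.
  by rewrite !(mulmx0, mul0mx, addr0, add0r, mulmx1, mul1mx).
exists (Q2 *m Q0); split.
  by rewrite trmx_mul Q0T mulmxA -(mulmxA Q2) Q0Q mulmx1 Q2Q.
rewrite trmx_mul Q0T mulmxA -(mulmxA Q2) -(mulmxA Q2) -/B Q2B.
rewrite (_ : \row_i l i = row_mx (l ord0)%:M (\row_i l (lift ord0 i)) :> 'rV[R]_(1 + n)).
  apply: (etrans _ (esym (diag_mx_row (l ord0)%:M (\row_i l (lift ord0 i))))).
  congr block_mx.
  by rewrite [RHS]mx11_scalar !mxE eqxx.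
apply/rowP => i; rewrite !mxE; case: split_ordP => j ->; rewrite !mxE.
- by rewrite (ord1 j) eqxx mulr1n; congr l; apply/val_inj.
- by congr l; apply/val_inj.
Qed.

(** If [v H H^T = 0] then [v H] has squared norm 0, and full row rank gives [v = 0]. *)
Lemma gram_unitmx q d (H : 'M[R]_(q, d)) : \rank H = q -> H *m H^T \in unitmx.
Proof.
move=> rH; rewrite -row_free_unit -kermx_eq0; apply/eqP/row_matrixP => i.
rewrite row0; set v := row i _.
have vK : v *m (H *m H^T) = 0 by rewrite /v -row_mul mulmx_ker row0.
have vH : v *m H = 0.
  apply: sqnorm_eq0; rewrite -sqnormE trmx_mul -mulmxA (mulmxA H) mulmxA vK.
  by rewrite mul0mx mxE.
have fH : row_free H by rewrite /row_free rH eqxx.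
by apply: (row_free_inj fH); rewrite vH mul0mx.
Qed.

Lemma mp_inverse_unitmx q (A : 'M[R]_q) : A \in unitmx -> A^T = A ->
  mp_inverse A = invmx A.
Proof.
move=> uA sA.
have [B1 B2 B3 B4] : is_mp_inverse A (mp_inverse A).
  apply: (xgetPex (P := [set B | is_mp_inverse A B]) 0); exists (invmx A) => /=.
  by split; rewrite ?mulmxV ?mulVmx ?trmx1 ?mul1mx.
have AB : A *m mp_inverse A = 1%:M.
  by apply: (row_free_inj (A := A)); rewrite ?row_free_unit// B1 mul1mx.
by rewrite -[LHS](mulKmx uA) AB mulmx1.
Qed.

Lemma row_space_projP q d (H : 'M[R]_(q, d)) : \rank H = q ->
  let M := row_space_proj H in
  [/\ M^T = M, M *m M = M & forall mu : 'cV[R]_d, H *m mu = 0 -> M *m mu = 0].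
Proof.
move=> rH M; have uG := gram_unitmx rH.
have sG : (H *m H^T)^T = H *m H^T by rewrite trmx_mul trmxK.
have ME : M = H^T *m invmx (H *m H^T) *m H.
  by rewrite /M /row_space_proj mp_inverse_unitmx.
split.
- by rewrite ME !trmx_mul trmxK trmx_inv sG mulmxA.
- rewrite ME -!mulmxA; congr (_ *m _); rewrite (mulmxA H H^T).
  by rewrite (mulmxA (H *m H^T)) mulmxV// mul1mx.
- by move=> mu Hmu; rewrite ME -mulmxA Hmu mulmx0.
Qed.

(** If [A] had no positive semidefinite square root, [sqrtmx A] would be the default value 0 and the
    characteristic polynomial would be [X ^ d], which does not vanish at the nonzero [lam 0]. The
    existence of the square root is thus read off from the eigenvalues. *)
Lemma sqrtmx_of_nonzero_eigenvalues d q (A S : 'M[R]_d) (lam : 'I_q -> R) :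
  (0 < q)%N -> nonzero_eigenvalues (sqrtmx A *m S *m sqrtmx A) lam ->
  psdmx (sqrtmx A) /\ sqrtmx A *m sqrtmx A = A.
Proof.
move=> q0 [lam0 chA].
have [[B BP]|no] := pselect (exists B, psdmx B /\ B *m B = A).
  exact: (xgetPex (P := [set B | psdmx B /\ B *m B = A]) 0 (ex_intro _ B BP)).
have S0 : sqrtmx A = 0.
  by rewrite /sqrtmx xgetPN// => B BP; apply: no; exists B.
move: chA; rewrite S0 mulmx0 /char_poly /char_poly_mx map_mx0 subr0 det_scalar.
move=> /(congr1 (fun p => p.[lam (Ordinal q0)])).
rewrite (bigD1 (Ordinal q0))//= !hornerM hornerXsubC subrr mul0r mulr0 hornerXn => /eqP.
by rewrite expf_eq0 (negbTE (lam0 _)) andbF.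
Qed.

(** With [S = sqrtmx Sigma], the matrices [M Sigma M = (S M)^T (S M)] and [S M S = (S M) (S M)^T]
    have the same characteristic polynomial. The former is diagonalized because it is the covariance
    of the projected vectors; as a Gram matrix it has nonnegative eigenvalues. *)
Lemma diag_projected_cov d q (Sigma M : 'M[R]_d) (lam : 'I_q -> R) :
  (0 < q)%N -> (q <= d)%N -> M^T = M -> M *m M = M ->
  nonzero_eigenvalues (sqrtmx Sigma *m M *m sqrtmx Sigma) lam ->
  exists (Q : 'M[R]_d) (l : 'I_d -> R),
  [/\ Q *m Q^T = 1%:M, Q *m (M *m Sigma *m M) *m Q^T = diag_mx (\row_i l i),
     (forall i, 0 <= l i),
     (forall i, l i = 0 \/ exists j, l i = lam j) &
     [/\ (forall j, exists i, lam j = l i),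
      \tr (M *m Sigma) = \sum_i l i &
      \tr (M *m Sigma *m (M *m Sigma)) = \sum_i l i ^+ 2]].
Proof.
move=> q0 qd sM MM hlam.
have [[sS pS] SS] := sqrtmx_of_nonzero_eigenvalues q0 hlam.
set S := sqrtmx Sigma in sS pS SS hlam *.
have [lam0 chS] := hlam.
pose C := M *m Sigma *m M.
have CE : C = (S *m M)^T *m (S *m M) by rewrite trmx_mul sM sS /C -SS !mulmxA.
have sC : C^T = C by rewrite CE trmx_mul trmxK.
(* The [q] nonzero eigenvalues are padded with [d - q] zeros, which match the factor
   ['X^(d - q)]. *)
pose l' (i : nat) := if insub i is Some j then lam j else 0 : R.
pose l (i : 'I_d) := l' i.
have lE (j : 'I_q) : l' j = lam j by rewrite /l' valK.
have chC : char_poly C = \prod_(i < d) ('X - (l i)%:P).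
  have -> : char_poly C = char_poly (S *m M *m S).
    by rewrite CE trmx_mul sM sS char_poly_mulC -mulmxA (mulmxA M) MM mulmxA.
  rewrite chS -(big_mkord xpredT (fun i => 'X - (l' i)%:P)) (@big_cat_nat _ _ _ q)//=.
  rewrite mulrC; congr (_ * _); first by rewrite big_mkord; apply: eq_bigr => j _; rewrite lE.
  rewrite big_nat (eq_bigr (fun=> 'X)); last first.
    move=> i /andP[qi _]; rewrite /l' insubF ?subr0//.
    by apply/negbTE; rewrite -leqNgt.
  by rewrite -big_nat prodr_const_nat.
have [Q [QQ QCQ]] := spectral_real sC chC.
have QtQ : Q^T *m Q = 1%:M by exact: mulmx1C.
exists Q, l; split => //.
- move=> i.
  have -> : l i = (Q *m C *m Q^T) i i by rewrite QCQ !mxE eqxx mulr1n.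
  have -> : Q *m C *m Q^T = (S *m M *m Q^T)^T *m (S *m M *m Q^T).
    by rewrite CE !trmx_mul trmxK !mulmxA.
  rewrite mxE sumr_ge0// => k _; rewrite mxE -expr2; exact: sqr_ge0.
- move=> i; rewrite /l /l'; case: insubP => [j _ _|_]; last by left.
  by right; exists j.
split.
- by move=> j; exists (widen_ord qd j); rewrite /l /= lE.
- rewrite -{1}MM -mulmxA mxtrace_mulC -/C -[C]mul1mx -QtQ -mulmxA mxtrace_mulC -mulmxA.
  by rewrite (mulmxA Q) QCQ mxtrace_diag; apply: eq_bigr => i _; rewrite mxE.
- have -> : \tr (M *m Sigma *m (M *m Sigma)) = \tr (C *m C).
    by rewrite /C !mulmxA [RHS]mxtrace_mulC !mulmxA MM -(mulmxA _ M M) MM.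
  have -> : \tr (C *m C) = \tr ((Q *m C *m Q^T) *m (Q *m C *m Q^T)).
    rewrite -!mulmxA [RHS]mxtrace_mulC !mulmxA -(mulmxA _ Q^T) QtQ mulmx1.
    by rewrite -!mulmxA QtQ mulmx1.
  rewrite QCQ mulmx_diag mxtrace_diag; apply: eq_bigr => i _.
  by rewrite !mxE expr2.
Qed.

End Spectral.

(** * Gaussian integrals *)

Section Gaussian.
Context {R : realType}.
Notation leb := (@lebesgue_measure R).
Implicit Types (s t r x c : R).

Lemma normal_fun0E s x : normal_fun 0 s x = expR (- (x ^+ 2 / (2 * s ^+ 2))).
Proof. by rewrite /normal_fun subr0 mulNr mulr_natl. Qed.

Lemma normal_pdf0E s x : s != 0 -> normal_pdf 0 s x = normal_peak s * normal_fun 0 s x.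
Proof. by move=> s0; rewrite normal_pdfE. Qed.

Lemma normal_pdf0_ge0 s x : 0 <= normal_pdf 0 s x.
Proof. exact: normal_pdf_ge0. Qed.

Lemma is_derive_normal_pdf0 s x : s != 0 ->
  is_derive x 1 (normal_pdf 0 s) (- (x / s ^+ 2) * normal_pdf 0 s x).
Proof.
move=> s0; have -> : normal_pdf 0 s = (fun x => normal_peak s * expR (- (x ^+ 2 / (2 * s ^+ 2)))).
  by apply/funext => y; rewrite normal_pdf0E// normal_fun0E.
apply: is_derive_eq; rewrite /GRing.scale/=.
by field.
Qed.

Lemma cvg_normal_pdf0 s : s != 0 ->
  normal_pdf 0 s x @[x --> +oo] --> 0 /\ normal_pdf 0 s x @[x --> -oo] --> 0.
Proof.
move=> s0.
have E1 x : normal_pdf 0 s x = normal_peak s * gauss_fun ((Num.sqrt (2 * s ^+ 2))^-1 * x).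
  rewrite normal_pdf0E// normal_fun0E /gauss_fun exprMn exprVn sqr_sqrtr.
    by rewrite [X in - X]mulrC.
  by rewrite mulr_ge0// sqr_ge0.
have k0 : 0 < (Num.sqrt (2 * s ^+ 2))^-1.
  by rewrite invr_gt0 sqrtr_gt0 mulr_gt0// exprn_even_gt0.
have L1 : normal_pdf 0 s x @[x --> +oo] --> 0.
  under eq_fun do rewrite E1; 
  rewrite (_ : nbhs (0 : R) = nbhs (normal_peak s * 0)); last by rewrite mulr0.
  apply: cvgM; first exact: cvg_cst.
  apply: (cvg_comp (fun x => (Num.sqrt (2 * s ^+ 2))^-1 * x) gauss_fun); last exact: cvg_gauss_fun.
  by apply: gt0_cvgMry => //; exact: cvg_id.
split=> //; apply/cvgNy_compNP.
by under eq_fun do rewrite /= E1 mulrN /gauss_fun sqrrN -/(gauss_fun _) -E1.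
Qed.

(** Half of the exponent absorbs the polynomial, [1 + x^2 <= (1 + 4 s^2) exp (x^2 / (4 s^2))], and
    the other half is, up to a constant, the normal density of standard deviation [sqrt 2 * s]. *)
Lemma integrable_sqr_normal_pdf0 s : s != 0 ->
  leb.-integrable setT (EFin \o (fun x => (1 + x ^+ 2) * normal_pdf 0 s x)).
Proof.
move=> s0; pose u := Num.sqrt 2 * s.
have u0 : u != 0 by rewrite mulf_neq0// gt_eqF// sqrtr_gt0.
have u2 : u ^+ 2 = 2 * s ^+ 2 by rewrite exprMn sqr_sqrtr.
pose C := (1 + 4 * s ^+ 2) * (normal_peak s / normal_peak u).
have pu : 0 < normal_peak u by exact: normal_peak_gt0.
have s2 : 0 < s ^+ 2 by rewrite exprn_even_gt0.
have := integrableZl measurableT C (integrable_normal_pdf 0 u).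
apply: le_integrable => //.
  apply/measurable_EFinP/measurable_funM; last exact: measurable_normal_pdf.
  by apply: measurable_funD => //; exact: measurable_funX.
move=> x _ /=; rewrite lee_fin !ger0_norm; last 2 first.
- rewrite !mulr_ge0 ?normal_pdf_ge0// ?invr_ge0 ?normal_peak_ge0//.
  by rewrite addr_ge0// mulr_ge0// ltW.
- by rewrite mulr_ge0 ?normal_pdf_ge0// addr_ge0// sqr_ge0.
rewrite !normal_pdf0E// !normal_fun0E u2 /C.
rewrite (_ : _ * _ * (_ * _) = (1 + 4 * s ^+ 2) * expR (- (x ^+ 2 / (2 * (2 * s ^+ 2)))) * normal_peak s); last first.
  by field; rewrite gt_eqF.
rewrite mulrCA [leRHS]mulrC ler_wpM2l ?normal_peak_ge0//.
have -> : - (x ^+ 2 / (2 * s ^+ 2)) = - (x ^+ 2 / (4 * s ^+ 2)) + - (x ^+ 2 / (4 * s ^+ 2)) by field.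
have -> : - (x ^+ 2 / (2 * (2 * s ^+ 2))) = - (x ^+ 2 / (4 * s ^+ 2)) by field.
rewrite expRD mulrA ler_wpM2r ?expR_ge0// expRN -ler_pdivlMr ?invr_gt0 ?expR_gt0// invrK.
have h := expR_ge1Dx (x ^+ 2 / (4 * s ^+ 2)).
apply: (le_trans _ (ler_wpM2l _ h)); last by rewrite addr_ge0// mulr_ge0// ltW.
have -> : (1 + 4 * s ^+ 2) * (1 + x ^+ 2 / (4 * s ^+ 2)) =
  1 + x ^+ 2 + (4 * s ^+ 2 + x ^+ 2 / (4 * s ^+ 2)) by field.
rewrite lerDl addr_ge0//; first by rewrite mulr_ge0// ltW.
by rewrite divr_ge0 ?sqr_ge0// mulr_ge0// ltW.
Qed.

Lemma integral_normal_prob0 s (f : R -> R) : s != 0 -> measurable_fun setT f ->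
  leb.-integrable setT (fun x => (f x * normal_pdf 0 s x)%:E) ->
  (normal_prob 0 s).-integrable setT (EFin \o f) /\
  \int[normal_prob 0 s]_x f x = \int[leb]_x (f x * normal_pdf 0 s x).
Proof.
move=> s0 mf; apply: (@Rintegral_weighted _ _ _ _ R leb (normal_prob 0 s) idfun) => //.
- exact: measurable_id.
- exact: measurable_normal_pdf.
- exact: normal_pdf0_ge0.
Qed.

Lemma integrable_bounded_normal_pdf0 s (f : R -> R) (M : R) : s != 0 ->
  measurable_fun setT f -> (forall x, `|f x| <= M * (1 + x ^+ 2)) ->
  leb.-integrable setT (fun x => (f x * normal_pdf 0 s x)%:E).
Proof.
move=> s0 mf fM; have M0 : 0 <= M by have := fM 0; rewrite expr0n addr0 mulr1; exact: le_trans.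
have := integrableZl measurableT M (integrable_sqr_normal_pdf0 s0).
apply: le_integrable => //.
  by apply/measurable_EFinP/measurable_funM => //; exact: measurable_normal_pdf.
move=> x _ /=; rewrite lee_fin !normrM (ger0_norm M0) (ger0_norm (normal_pdf0_ge0 s x)) mulrA.
apply: ler_wpM2r; first exact: normal_pdf0_ge0.
by rewrite (ger0_norm (addr_ge0 _ (sqr_ge0 x))).
Qed.

Lemma integrable_cos_normal s t r : s != 0 ->
  leb.-integrable setT (fun x => (cos (t * x + r) * normal_pdf 0 s x)%:E).
Proof.
move=> s0; apply: (integrable_bounded_normal_pdf0 (M := 1)) => //.
  apply: measurableT_comp; first by apply: continuous_measurable_fun; exact: continuous_cos.
  by apply: measurable_funD => //; exact: measurable_funM.
by move=> x; rewrite (le_trans (cos_max _))// mul1r lerDl sqr_ge0.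
Qed.

Lemma integrable_Xsin_normal s t r : s != 0 ->
  leb.-integrable setT (fun x => (x * sin (t * x + r) * normal_pdf 0 s x)%:E).
Proof.
move=> s0; apply: (integrable_bounded_normal_pdf0 (M := 1)) => //.
  apply: measurable_funM => //.
  apply: measurableT_comp; first by apply: continuous_measurable_fun; exact: continuous_sin.
  by apply: measurable_funD => //; exact: measurable_funM.
move=> x; rewrite normrM mul1r (@le_trans _ _ (`|x| * 1))//.
  by rewrite ler_wpM2l// sin_max.
by have := sqr_ge0 (`|x| - 1); have := normr_ge0 x; rewrite -[x ^+ 2]real_normK ?num_real//; nra.
Qed.

(** As a function of [t] the integral solves [I' = - s^2 t I], by differentiation under the integral
    and an integration by parts. The phase [r] lets one real formula play the part of the
    characteristic function. *)
Lemma integral_cos_normal s t r : s != 0 ->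
  \int[normal_prob 0 s]_x cos (t * x + r) = expR (- (s ^+ 2 * t ^+ 2 / 2)) * cos r.
Proof.
move=> s0.
have -> : \int[normal_prob 0 s]_x cos (t * x + r) =
    \int[leb]_x (cos (t * x + r) * normal_pdf 0 s x).
  apply: (integral_normal_prob0 s0 _ (integrable_cos_normal t r s0)).2.
  apply: measurableT_comp; first by apply: continuous_measurable_fun; exact: continuous_cos.
  by apply: measurable_funD => //; exact: measurable_funM.
pose I (t : R) := \int[leb]_x (cos (t * x + r) * normal_pdf 0 s x).
pose J (t : R) := \int[leb]_x (x * sin (t * x + r) * normal_pdf 0 s x).
have dI (u : R) : is_derive u 1 I (- J u).
  have dc (y x : R) : is_derive y 1 (fun t => cos (t * x + r) * normal_pdf 0 s x)
     (- (x * sin (y * x + r) * normal_pdf 0 s x)).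
    by apply: is_derive_eq; rewrite /GRing.scale/=; ring.
  pose f (t x : R) := cos (t * x + r) * normal_pdf 0 s x.
  pose g (x : R) := (1 + x ^+ 2) * normal_pdf 0 s x.
  have ud : (`]u - 1, u + 1[%classic : set R) u by rewrite /= in_itv/=; lra.
  have i1 (x : R) : (`]u - 1, u + 1[%classic : set R) x -> leb.-integrable setT (EFin \o f x).
    by move=> _; exact: integrable_cos_normal.
  have i2 (x y : R) : (`]u - 1, u + 1[%classic : set R) x -> setT y -> derivable (f ^~ y) x 1.
    by move=> _ _; apply: ex_derive; exact: dc.
  have g0 (y : R) : 0 <= g y by rewrite mulr_ge0 ?normal_pdf0_ge0// addr_ge0// sqr_ge0.
  have ig := integrable_sqr_normal_pdf0 s0.
  have bd (x y : R) : (`]u - 1, u + 1[%classic : set R) x -> setT y -> `|partial1of2 f x y| <= g y.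
    move=> _ _; rewrite /partial1of2 (derive1_eq (dc x y)) normrN normrM.
    rewrite (ger0_norm (normal_pdf0_ge0 s y)) ler_wpM2r ?normal_pdf0_ge0//.
    rewrite normrM (@le_trans _ _ (`|y| * 1))//.
      by rewrite ler_wpM2l// sin_max.
    have := sqr_ge0 (`|y| - 1); have := normr_ge0 y.
    by rewrite -[y ^+ 2]real_normK ?num_real//; nra.
  have d1 := derivable_under_integral measurableT ud i1 i2 g0 ig bd.
  have d2 := differentiation_under_integral measurableT ud i1 i2 g0 ig bd.
  apply: DeriveDef; first exact: d1.
  rewrite -derive1E [LHS]d2 /J.
  rewrite -[RHS]mulN1r -RintegralZl//; last exact: integrable_Xsin_normal.
  by apply: eq_Rintegral => x _; rewrite /partial1of2 (derive1_eq (dc u x)) mulN1r.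
(* The derivative [h] of [F] integrates to 0 over the line, because [F] is squeezed between plus and
   minus the density. *)
have IBP (u : R) : J u = s ^+ 2 * u * I u.
  pose F x := sin (u * x + r) * normal_pdf 0 s x.
  pose h x := u * (cos (u * x + r) * normal_pdf 0 s x) -
    (s ^+ 2)^-1 * (x * sin (u * x + r) * normal_pdf 0 s x).
  have dF x : is_derive x 1 F (h x).
    have := is_derive_normal_pdf0 x s0 => ?.
    by apply: is_derive_eq; rewrite /h /GRing.scale/=; field.
  have ch : continuous h.
    move=> x; have := is_derive_normal_pdf0 x s0 => /is_derive_continuous cp.
    apply: cvgB; (apply: cvgM; first exact: cvg_cst).
      apply: cvgM cp; apply: (continuous_comp (f := fun x => u * x + r)); last exact: continuous_cos.
      by apply: cvgD; [apply: cvgM; [exact: cvg_cst|exact: cvg_id]|exact: cvg_cst].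
    apply: cvgM cp; apply: cvgM; first exact: cvg_id.
    apply: (continuous_comp (f := fun x => u * x + r)); last exact: continuous_sin.
    by apply: cvgD; [apply: cvgM; [exact: cvg_cst|exact: cvg_id]|exact: cvg_cst].
  have i1 : leb.-integrable setT (fun x => (u * (cos (u * x + r) * normal_pdf 0 s x))%:E).
    by apply: integrable_EFinZ => //; exact: integrable_cos_normal.
  have i2 : leb.-integrable setT (fun x => ((s ^+ 2)^-1 * (x * sin (u * x + r) * normal_pdf 0 s x))%:E).
    by apply: integrable_EFinZ => //; exact: integrable_Xsin_normal.
  have ih : leb.-integrable setT (EFin \o h).
    exact: integrable_EFinB.
  have bF x : - normal_pdf 0 s x <= F x <= normal_pdf 0 s x.
    have := sin_max (u * x + r); rewrite ler_norml /F => h1.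
    by have := normal_pdf0_ge0 s x; nra.
  have [c1 c2] := cvg_normal_pdf0 s0.
  have sq (G : set_system R) : Filter G -> normal_pdf 0 s x @[x --> G] --> 0 -> F x @[x --> G] --> 0.
    move=> FG cG; apply: (@squeeze_cvgr _ _ _ _ (fun x => - normal_pdf 0 s x) (normal_pdf 0 s)).
    - by apply: nearW.
    - by have := cvgN cG; rewrite oppr0; apply.
    - exact: cG.
  have := FTC_setT dF ch ih (sq _ _ c2) (sq _ _ c1).
  rewrite subr0 /h RintegralB// !RintegralZl//; last 2 first.
  - exact: integrable_Xsin_normal.
  - exact: integrable_cos_normal.
  move=> /(_ _ _)/eqP; rewrite subr_eq0 => /eqP E.
  have := congr1 (fun z => s ^+ 2 * z) E.
  by rewrite mulVKf ?sqrf_eq0// mulrA => ->.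
(* The integrating factor of the differential equation: [e] is constant, with value [cos r] at 0. *)
pose e (u : R) := expR (s ^+ 2 * u ^+ 2 / 2) * I u.
have de (u : R) : is_derive u 1 e 0.
  have := dI u => ?; apply: is_derive_eq; rewrite /GRing.scale/= IBP; by field.
have := @is_derive_0_is_cst R e t 0 de.
rewrite /e expr0n/= mulr0 mul0r expR0 mul1r.
have -> : I 0 = cos r.
  rewrite /I; under eq_Rintegral do rewrite mul0r add0r.
  rewrite RintegralZl//; last exact: integrable_normal_pdf.
  by rewrite /Rintegral integral_normal_pdf mulr1.
by move=> <-; rewrite mulrA -expRD addNr expR0 mul1r.
Qed.

(** Against the standard density the integrand is [s] times the normal density of variance
    [s^2 = 1 / (1 + 2 c)]. *)
Lemma integral_exp_normal c : 0 <= c ->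
  (\int[normal_prob 0 1]_x (expR (- (c * x ^+ 2)))%:E = ((Num.sqrt (1 + 2 * c))^-1)%:E)%E.
Proof.
move=> c0; pose s := (Num.sqrt (1 + 2 * c))^-1.
have c1 : 0 < 1 + 2 * c by lra.
have s0 : 0 < s by rewrite invr_gt0 sqrtr_gt0.
have s2 : s ^+ 2 = (1 + 2 * c)^-1 by rewrite exprVn sqr_sqrtr// ltW.
have p1 : normal_peak (1 : R) = s * normal_peak s.
  rewrite /normal_peak !expr1n mul1r -[_ *+ 2]mulr_natr -[in RHS]mulr_natr -mulrA.
  rewrite (@sqrtrM _ (s ^+ 2)) ?sqr_ge0// sqrtr_sqr (gtr0_norm s0) mulr_natr.
  by rewrite invfM mulrA divff ?mul1r// gt_eqF.
rewrite (@ge0_integral_weighted _ _ _ _ R leb (normal_prob 0 1) idfun _ (normal_pdf 0 1))//; first last.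
- apply: measurableT_comp => //; apply: measurableT_comp => //.
  by apply: measurable_funM => //; exact: measurable_funX.
- exact: normal_pdf0_ge0.
- exact: measurable_normal_pdf.
- exact: measurable_id.
transitivity (\int[leb]_x (s%:E * (normal_pdf 0 s x)%:E))%E.
  apply: eq_integral => x _; rewrite -EFinM; congr _%:E.
  rewrite !normal_pdf0E ?oner_neq0 ?gt_eqF// p1 !normal_fun0E s2 expr1n.
  rewrite mulrCA -!mulrA; congr (_ * (_ * _)); rewrite -expRD; congr expR.
  by rewrite /=; field; rewrite gt_eqF.
by rewrite integralZl//; [rewrite integral_normal_pdf mule1|exact: integrable_normal_pdf].
Qed.

End Gaussian.

(** * Independence *)

Section Bounded.
Context d (T : measurableType d) (R : realType) (P : probability T R).
Implicit Types (f g Z : T -> R) (M c : R).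

Lemma bounded_integrable f M : measurable_fun setT f -> (forall x, `|f x| <= M) ->
  P.-integrable setT (fun x => (f x)%:E).
Proof.
move=> mf fM; apply: (integrable_EFin_le measurableT (g := cst M)) => //.
by apply: finite_measure_integrable_cst.
Qed.

Lemma Rintegral_cst_prob c : \int[P]_x c = c.
Proof. by rewrite Rintegral_cst//; rewrite [X in fine X]probability_setT mulr1. Qed.

Lemma Rintegral_indic_prob (A : set T) : measurable A -> \int[P]_x \1_A x = fine (P A).
Proof. by move=> mA; rewrite /Rintegral integral_indic// setIT. Qed.

(** The shift by [M] makes [Z + M] the density of a measure, whose image by [xi] is [c + M] times
    the law of [xi], by the hypothesis on indicators. The weighted formula for [f + N >= 0] gives
    the claim once the constant terms are removed. *)
Lemma Rintegral_indep (Z : T -> R) (M c : R) (xi : T -> R) (f : R -> R) (N : R) :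
  measurable_fun setT Z -> (forall x, `|Z x| <= M) ->
  measurable_fun setT xi ->
  (forall B, measurable B -> \int[P]_x (Z x * \1_B (xi x)) = c * fine (P (xi @^-1` B))) ->
  measurable_fun setT f -> (forall x, `|f x| <= N) ->
  \int[P]_x (Z x * f (xi x)) = c * \int[P]_x f (xi x).
Proof.
move=> mZ ZM mxi H mf fN.
have iZ := bounded_integrable mZ ZM.
have mfxi : measurable_fun setT (f \o xi) by exact: measurableT_comp.
have ifxi := @bounded_integrable (f \o xi) N mfxi (fun x => fN _).
have M0 : 0 <= M by apply: le_trans (ZM point).
have N0 : 0 <= N by apply: le_trans (fN 0).
have cE : c = \int[P]_x Z x.
  have := H setT measurableT; rewrite preimage_setT probability_setT mulr1 => <-.
  by apply: eq_Rintegral => x _; rewrite indicT mulr1.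
have ZM0 x : 0 <= Z x + M by have := ZM x; rewrite ler_norml; lra.
have cM0 : 0 <= c + M.
  have -> : c + M = \int[P]_x (Z x + M).
    rewrite RintegralD//; last by apply: (@bounded_integrable _ `|M|).
    by rewrite -cE Rintegral_cst_prob.
  exact: Rintegral_ge0.
have mpre B : measurable B -> measurable (xi @^-1` B).
  by move=> mB; rewrite -[X in measurable X]setTI; exact: mxi.
pose X : {mfun T >-> R} := HB.pack xi (isMeasurableFun.Build _ _ _ _ xi mxi).
pose nu := mscale (NngNum cM0) (distribution P X).
have nuE B : measurable B -> nu B = (\int[P]_(x in xi @^-1` B) (Z x + M)%:E)%E.
  move=> mB; have mxB := mpre B mB.
  have mi : measurable_fun setT (fun x => \1_B (xi x) : R).
    by apply: (@measurable_indic _ _ _ _ (xi @^-1` B)).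
  have b1 x : `|\1_B (xi x) : R| <= 1 by rewrite indicE; case: (_ \in _); rewrite ?normr1 ?normr0.
  have mZ1 : measurable_fun setT (fun x => Z x * \1_B (xi x)) by exact: measurable_funM.
  have iZ1 : P.-integrable setT (fun x => (Z x * \1_B (xi x))%:E).
    by apply: (@bounded_integrable _ (M * 1)) => // x; rewrite normrM ler_pM.
  have i1 : P.-integrable setT (fun x => (\1_B (xi x) : R)%:E).
    exact: (@bounded_integrable _ 1).
  transitivity (((c + M) * fine (P (xi @^-1` B)))%:E).
    by rewrite /nu /mscale/= EFinM fineK// fin_num_measure.
  have -> : ((c + M) * fine (P (xi @^-1` B)) = \int[P]_x (Z x * \1_B (xi x) + M * \1_B (xi x)))%R.
    rewrite RintegralD//; last exact: integrable_EFinZ.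
    rewrite H// RintegralZl// mulrDl; congr (_ + _ * _).
    by rewrite -Rintegral_indic_prob//.
  rewrite -Rintegral_fineK//; last by apply: integrable_EFinD => //; exact: integrable_EFinZ.
  rewrite [RHS]integral_mkcond; apply: eq_integral => x _.
  rewrite -mulrDl patchE indicE; have [xB|xB] := pselect (B (xi x)).
    by rewrite !mem_set// mulr1.
  by rewrite !memNset// mulr0.
have mZM : measurable_fun setT (fun x => Z x + M) by exact: measurable_funD.
have fN0 y : 0 <= f y + N by have := fN y; rewrite ler_norml; lra.
have mfN : measurable_fun setT (fun y => f y + N) by exact: measurable_funD.
have h1 := ge0_integral_weighted mxi mZM ZM0 nuE mfN fN0.
have ifN : P.-integrable setT (fun x => (f (xi x) + N)%:E).
  by apply: integrable_EFinD => //; exact: (@bounded_integrable _ `|N|).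
have ifZ : P.-integrable setT (fun x => (Z x * f (xi x))%:E).
  apply: (@bounded_integrable _ (M * N)); first exact: measurable_funM.
  by move=> x; rewrite normrM ler_pM.
have h2 : (\int[nu]_y (f y + N)%:E = ((c + M) * (\int[P]_x f (xi x) + N))%:E)%E.
  rewrite ge0_integral_mscale//=.
  rewrite (@ge0_integral_distribution _ _ _ _ _ P X (fun y => (f y + N)%:E))//=; last exact/measurable_EFinP.
  - rewrite EFinM (_ : \int[P]_x f (xi x) + N = \int[P]_x (f (xi x) + N)).
      by rewrite -Rintegral_fineK.
    rewrite RintegralD//; last exact: (@bounded_integrable _ `|N|).
    by rewrite Rintegral_cst_prob.
  - exact/measurable_EFinP.
  - by move=> y _; rewrite lee_fin.
have h3 : (\int[P]_x ((f (xi x) + N) * (Z x + M))%:E =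
   (\int[P]_x (Z x * f (xi x)) + (M * (\int[P]_x f (xi x) + N) + N * c))%:E)%E.
  rewrite cE -RintegralZl// -[N in X in _ + (M * X + _)]Rintegral_cst_prob.
  rewrite -RintegralD//; last exact: (@bounded_integrable _ `|N|).
  rewrite -RintegralZl// -RintegralD//; last 2 first.
  - exact: integrable_EFinZ.
  - exact: integrable_EFinZ.
  rewrite -RintegralD//; last by apply: integrable_EFinD => //; exact: integrable_EFinZ.
  rewrite -Rintegral_fineK//; last first.
    by apply: integrable_EFinD => //; apply: integrable_EFinD => //; exact: integrable_EFinZ.
  by apply: eq_integral => x _; congr _%:E; ring.
by move: h1; rewrite h2 h3 => -[]; lra.
Qed.

End Bounded.

Section Independent_reals.
Context d (T : measurableType d) (R : realType) (P : probability T R).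
Context n (xi : 'I_n -> T -> R).
Hypothesis mxi : forall i, measurable_fun setT (xi i).
Hypothesis ind : forall B : 'I_n -> set R, (forall i, measurable (B i)) ->
  P (\bigcap_i (xi i @^-1` B i)) = (\prod_i fine (P (xi i @^-1` B i)))%:E.

Let bdd (f : R -> R) := measurable_fun setT f /\ (forall x, `|f x| <= 1).

Let mfxi (f : R -> R) i : bdd f -> measurable_fun setT (fun x => f (xi i x)).
Proof. by move=> [mf _]; exact: measurableT_comp. Qed.

Let norm_prod1 (Q : pred 'I_n) (F : 'I_n -> R) : (forall i, `|F i| <= 1) ->
  `|\prod_(i < n | Q i) F i| <= 1.
Proof.
move=> F1; rewrite normr_prod; by apply: prodr_ile1 => i _; rewrite normr_ge0 F1.
Qed.

Let mprod (Q : pred 'I_n) (f : 'I_n -> R -> R) : (forall i, bdd (f i)) ->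
  measurable_fun setT (fun x => \prod_(i < n | Q i) f i (xi i x)).
Proof.
move=> bf; under eq_fun do rewrite big_mkcond/=; apply: measurable_prod => i _.
by case: (Q i); [exact: mfxi|exact: measurable_cst].
Qed.

(** Induction on the number [k] of leading factors that are arbitrary, those of index at least [k]
    being indicators. For [k = 0] this is the hypothesis [ind], and each step frees one factor by
    [Rintegral_indep]. *)
Lemma Rintegral_prod_indep (f : 'I_n -> R -> R) : (forall i, bdd (f i)) ->
  \int[P]_x (\prod_i f i (xi i x)) = \prod_i \int[P]_x f i (xi i x).
Proof.
move=> bf.
suff H k : forall f : 'I_n -> R -> R, (forall i, bdd (f i)) ->
    (forall i : 'I_n, (k <= i)%N -> exists2 B, measurable B & f i = \1_B) ->
    \int[P]_x (\prod_i f i (xi i x)) = \prod_i \int[P]_x f i (xi i x).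
  by apply: (H n) => // i; rewrite leqNgt ltn_ord.
elim: k {f bf} => [|k IH] f bf hf.
  have /choice[B HB] i : exists B, measurable B /\ f i = \1_B.
    by have [B mB fB] := hf i (leq0n _); exists B.
  have mB i : measurable (xi i @^-1` B i).
    by rewrite -[X in measurable X]setTI; apply: mxi => //; exact: (HB i).1.
  transitivity (\int[P]_x \1_(\bigcap_i (xi i @^-1` B i)) x : R).
    apply: eq_Rintegral => x _.
    under eq_bigr do rewrite (HB _).2.
    rewrite indicE; case: (pselect ((\bigcap_i (xi i @^-1` B i)) x)) => h.
      by rewrite mem_set// big1// => i _; rewrite indicE mem_set//; exact: h.
    have /existsNP[i /not_implyP[_ hi]] := h.
    by rewrite (memNset h) (bigD1 i)//= indicE memNset// mul0r.
  rewrite Rintegral_indic_prob; last by apply: fin_bigcap_measurable => // i _; exact: mB.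
  rewrite ind; last by move=> i; exact: (HB i).1.
  rewrite /=; apply: eq_bigr => i _; rewrite (HB i).2 -Rintegral_indic_prob//.
have [kn|nk] := ltnP k n; last first.
  apply: IH => // i ki; apply: hf; rewrite ltn_neqAle ki andbT.
  by apply: contraTneq (ltn_ord i) => <-; rewrite -leqNgt.
pose K := Ordinal kn.
under eq_Rintegral do rewrite (bigD1 K)//= mulrC.
rewrite [RHS](bigD1 K)//= mulrC.
apply: (@Rintegral_indep _ _ _ _ _ 1 _ _ _ 1) => //.
- by apply: mprod.
- by move=> x; apply: norm_prod1 => i; exact: (bf i).2.
- move=> B mB; pose g i := if i == K then \1_B else f i.
  have bg i : bdd (g i).
    rewrite /g; case: ifP => // _; split; first exact: measurable_indic.
    by move=> x; rewrite indicE; case: (_ \in _); rewrite ?normr1 ?normr0.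
  have gK : g K = \1_B by rewrite /g eqxx.
  have := IH g bg; rewrite (bigD1 K)//= gK.
  have gE i : i != K -> g i = f i by rewrite /g => /negbTE ->.
  move=> IHg; transitivity (\int[P]_x \prod_i g i (xi i x)).
    apply: eq_Rintegral => x _; rewrite [RHS](bigD1 K)//= gK mulrC.
    by congr (_ * _); apply: eq_bigr => i iK; rewrite gE.
  rewrite IHg; last first.
    move=> i ki; rewrite /g; case: ifPn => iK; first by exists B.
    apply: hf; rewrite ltn_neqAle ki andbT; apply: contra iK => /eqP ki'.
    by apply/eqP/val_inj.
  rewrite mulrC; congr (_ * _); first by apply: eq_bigr => i iK; rewrite gE.
  by rewrite -Rintegral_indic_prob//; rewrite -[X in measurable X]setTI; apply: mxi.
- exact: (bf K).1.
- exact: (bf K).2.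
Qed.

Variable phi : 'I_n -> R.
Hypothesis phiE : forall i r, \int[P]_x cos (xi i x + r) = phi i * cos r.

(** Proved jointly with bounded functions of the remaining variables, because the addition formula,
    used to bring [xi K] into the sum, produces the factors [cos (xi K)] and [sin (xi K)] beside the
    transform of the partial sum. *)
Lemma Rintegral_cos_sum_indep r :
  \int[P]_x cos (\sum_i xi i x + r) = (\prod_i phi i) * cos r.
Proof.
have bcos : bdd cos by split; [apply: continuous_measurable_fun; exact: continuous_cos|exact: cos_max].
have bsin : bdd sin by split; [apply: continuous_measurable_fun; exact: continuous_sin|exact: sin_max].
have Ec i : \int[P]_x cos (xi i x) = phi i.
  by rewrite -[RHS]mulr1 -cos0 -phiE; apply: eq_Rintegral => x _; rewrite addr0.
have Es i : \int[P]_x sin (xi i x) = 0.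
  (* The phase [- pi / 2] turns the cosine into a sine, while the factor [cos r] vanishes: each
     [xi i] has mean sine 0. *)
  have c0 : cos (- (pi / 2)) = 0 :> R by rewrite cosN cos_pihalf.
  rewrite -[RHS](mulr0 (phi i)) -c0 -phiE.
  by apply: eq_Rintegral => x _; rewrite cosBpihalf.
suff H k : (k <= n)%N -> forall (r : R) (f : 'I_n -> R -> R), (forall i, bdd (f i)) ->
    \int[P]_x (cos (\sum_(i < n | (i < k)%N) xi i x + r) * \prod_(i < n | (k <= i)%N) f i (xi i x)) =
    (\prod_(i < n | (i < k)%N) phi i * cos r) * \prod_(i < n | (k <= i)%N) \int[P]_x f i (xi i x).
  have := H n (leqnn n) r (fun=> cos) (fun=> bcos).
  rewrite [X in _ = _ * X]big_pred0; last by move=> i; rewrite leqNgt ltn_ord.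
  have -> : \prod_(i < n | (i < n)%N) phi i = \prod_i phi i.
    by apply: eq_bigl => i; rewrite ltn_ord.
  rewrite mulr1 => <-.
  apply: eq_Rintegral => x _; rewrite [X in _ = _ * X]big_pred0; last by move=> i; rewrite leqNgt ltn_ord.
  by rewrite mulr1; congr (cos (_ + _)); apply: eq_bigl => i; rewrite ltn_ord.
have mS (m : nat) (r' : R) : measurable_fun setT (fun x => cos (\sum_(i < n | (i < m)%N) xi i x + r')).
  apply: (measurableT_comp (f := cos) (g := fun x => \sum_(i < n | (i < m)%N) xi i x + r')).
    exact: bcos.1.
  apply: measurable_funD => //; under eq_fun do rewrite big_mkcond/=.
  by apply: measurable_sum => i; case: (i < m)%N; [exact: mxi|exact: measurable_cst].
elim: k => [_|k IH kn] {}r f bf.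
  rewrite big_pred0// mul1r; under eq_Rintegral do rewrite big_pred0// add0r.
  rewrite RintegralZl//; first by rewrite Rintegral_prod_indep.
  apply: (@bounded_integrable _ _ _ _ _ 1); first by apply: mprod.
  by move=> x; apply: norm_prod1 => i; exact: (bf i).2.
pose K := Ordinal kn.
pose g (h : R -> R) i := if i == K then h else f i.
have bg h : bdd h -> forall i, bdd (g h i) by move=> bh i; rewrite /g; case: ifP.
have gK h : g h K = h by rewrite /g eqxx.
have gN h i : i != K -> g h i = f i by rewrite /g => /negbTE ->.
have eqP1 (i : 'I_n) : (k <= i)%N && (i != K) = (k.+1 <= i)%N.
  by rewrite ltn_neqAle andbC -(inj_eq val_inj) eq_sym.
have eqP2 (i : 'I_n) : (i < k.+1)%N && (i != K) = (i < k)%N.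
  by rewrite -(inj_eq val_inj)/= ltnS [RHS]ltn_neqAle andbC.
have prodg h (F : 'I_n -> (R -> R) -> R) :
    \prod_(i < n | (k <= i)%N) F i (g h i) = F K h * \prod_(i < n | (k.+1 <= i)%N) F i (f i).
  rewrite (bigD1 K)//= gK; congr (_ * _).
  by apply: eq_big => [i|i /andP[_ iK]]; [exact: eqP1|rewrite gN].
have iC h (r' : R) : bdd h -> P.-integrable setT (fun x =>
   (cos (\sum_(i < n | (i < k)%N) xi i x + r') * \prod_(i < n | (k <= i)%N) g h i (xi i x))%:E).
  move=> bh; apply: (@bounded_integrable _ _ _ _ _ (1 * 1)).
    apply: measurable_funM; first exact: mS.
    by apply: mprod; exact: bg.
  move=> x; rewrite normrM ler_pM ?cos_max//; apply: norm_prod1 => i; exact: (bg h bh i).2.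
have IHc := IH (ltnW kn) r _ (bg _ bcos).
(* With the phase lowered by [pi / 2] the induction hypothesis speaks of the sine of the partial
   sum; that term carries the mean sine of [xi K], which is 0. *)
have IHs := IH (ltnW kn) (r - pi / 2) _ (bg _ bsin).
rewrite !(prodg _ (fun i (h : R -> R) => \int[P]_x h (xi i x))) Ec in IHc.
rewrite !(prodg _ (fun i (h : R -> R) => \int[P]_x h (xi i x))) Es in IHs.
rewrite (bigD1 K)//= (eq_bigl _ _ eqP2).
transitivity (phi K * (\prod_(i < n | (i < k)%N) phi i * cos r) *
   \prod_(i < n | (k < i)%N) \int[P]_x f i (xi i x)); last by rewrite !mulrA.
transitivity (\prod_(i < n | (i < k)%N) phi i * cos r *
   (phi K * \prod_(i < n | (k < i)%N) \int[P]_x f i (xi i x)) -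
   \prod_(i < n | (i < k)%N) phi i * cos (r - pi / 2) *
   (0 * \prod_(i < n | (k < i)%N) \int[P]_x f i (xi i x))); last by ring.
rewrite -IHc -IHs -RintegralB//; last 2 first.
- exact: iC.
- exact: iC.
apply: eq_Rintegral => x _.
rewrite (bigD1 K)//= (eq_bigl _ _ eqP2).
rewrite !(prodg _ (fun i (h : R -> R) => h (xi i x))).
rewrite addrA cosBpihalf -addrA [xi K x + _]addrC cosD.
by ring.
Qed.

End Independent_reals.

Section Fubini_bounded.
Context d1 d2 (T1 : measurableType d1) (T2 : measurableType d2) (R : realType).
Variables (P1 : probability T1 R) (P2 : probability T2 R).

Lemma Rintegral_Fubini_bounded (f : T1 * T2 -> R) (M : R) :
  measurable_fun setT f -> (forall z, `|f z| <= M) ->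
  \int[P1]_x (\int[P2]_y f (x, y)) = \int[P2]_y (\int[P1]_x f (x, y)).
Proof.
move=> mf fM.
have m1 x : measurable_fun setT (fun y => f (x, y)) by exact: measurable_fun_pair2.
have m2 y : measurable_fun setT (fun x => f (x, y)) by exact: measurable_fun_pair1.
have i1 x : P2.-integrable setT (fun y => (f (x, y))%:E) by apply: (@bounded_integrable _ _ _ _ _ M).
have i2 y : P1.-integrable setT (fun x => (f (x, y))%:E) by apply: (@bounded_integrable _ _ _ _ _ M).
have intf : (P1 \x P2)%E.-integrable setT (EFin \o f).
  apply: measurable_bounded_integrable => //.
    have E : (P1 \x P2)%E setT = 1%E.
      have := @product_measure1E _ _ _ _ R P1 P2 setT setT measurableT measurableT.
      by rewrite setXTT => ->; rewrite [X in (X * _)%E]probability_setT [X in (_ * X)%E]probability_setT mule1.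
    by rewrite [X in (X < _)%E]E ltry.
  exists M; split; first exact: num_real.
  by move=> N MN z _ /=; rewrite (le_trans (fM z))// ltW.
have := Fubini intf.
rewrite /Rintegral => F; congr fine.
transitivity (\int[P1]_x (\int[P2]_y (EFin \o f) (x, y)))%E.
  by apply: eq_integral => x _; rewrite fineK//; exact: integrable_fin_num (i1 x).
rewrite F; apply: eq_integral => y _.
by rewrite fineK//; exact: integrable_fin_num (i2 y).
Qed.

End Fubini_bounded.

(** * From the cosine transform to the Laplace transform of the squares *)

Section Hubbard_Stratonovich.
Context d0 (T : measurableType d0) (R : realType) (P : probability T R).
Context d (Y : 'I_d -> T -> R) (l : 'I_d -> R).
Hypothesis mY : forall i, measurable_fun setT (Y i).
Hypothesis l0 : forall i, 0 <= l i.
Hypothesis cosY : forall (t : 'I_d -> R) r,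
  \int[P]_x cos (\sum_i t i * Y i x + r) = expR (- (\sum_i l i * t i ^+ 2) / 2) * cos r.

(* Each Gaussian factor [exp (- s y^2)] is linearized as the mean of
   [cos (sqrt (2 s) g y)] over a standard normal [g] independent of [Y]. *)
Lemma Rintegral_exp_quadratic (s : 'I_d -> R) : (forall i, 0 <= s i) ->
  \int[P]_x expR (- \sum_i s i * Y i x ^+ 2) =
  \prod_i (Num.sqrt (1 + 2 * (s i * l i)))^-1.
Proof.
move=> s0.
have mcos : measurable_fun setT (@cos R) by apply: continuous_measurable_fun; exact: continuous_cos.
have msum (Q : pred 'I_d) (t : 'I_d -> R) (r : R) :
    measurable_fun setT (fun x => \sum_(i < d | Q i) t i * Y i x + r).
  apply: measurable_funD => //; under eq_fun do rewrite big_mkcond/=.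
  by apply: measurable_sum => i; case: (Q i); [exact: measurable_funM|exact: measurable_cst].
have mprod (Q : pred 'I_d) :
    measurable_fun setT (fun x => \prod_(i < d | Q i) expR (- (s i * Y i x ^+ 2))).
  under eq_fun do rewrite big_mkcond/=.
  apply: measurable_prod => i _; case: (Q i); last exact: measurable_cst.
  apply: measurableT_comp => //; apply: measurableT_comp => //.
  by apply: measurable_funM => //; exact: measurable_funX.
have prod1 (Q : pred 'I_d) x : `|\prod_(i < d | Q i) expR (- (s i * Y i x ^+ 2))| <= 1.
  rewrite normr_prod; apply: prodr_ile1 => i _; rewrite normr_ge0/= ger0_norm ?expR_ge0//.
  by rewrite -[leRHS]expR0 ler_expR oppr_le0 mulr_ge0// sqr_ge0.
(* The coordinates are converted one at a time: those below [k] already carry their Gaussian factor,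
   the others still sit in the cosine with free coefficients [t]. *)
suff H k : (k <= d)%N -> forall (t : 'I_d -> R) r,
    \int[P]_x (\prod_(i < d | (i < k)%N) expR (- (s i * Y i x ^+ 2)) *
       cos (\sum_(i < d | (k <= i)%N) t i * Y i x + r)) =
    \prod_(i < d | (i < k)%N) (Num.sqrt (1 + 2 * (s i * l i)))^-1 *
      (expR (- (\sum_(i < d | (k <= i)%N) l i * t i ^+ 2) / 2) * cos r).
  have := H d (leqnn d) (fun=> 0) 0.
  rewrite [X in expR (- X / 2)]big_pred0; last by move=> i; rewrite leqNgt ltn_ord.
  rewrite oppr0 mul0r expR0 cos0 !mulr1.
  have -> : \prod_(i < d | (i < d)%N) (Num.sqrt (1 + 2 * (s i * l i)))^-1 =
      \prod_i (Num.sqrt (1 + 2 * (s i * l i)))^-1.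
    by apply: eq_bigl => i; rewrite ltn_ord.
  move=> <-; apply: eq_Rintegral => x _.
  rewrite [X in cos X]addr0 [X in cos X]big_pred0; last by move=> i; rewrite leqNgt ltn_ord.
  rewrite cos0 mulr1 -sumrN expR_sum.
  by apply: eq_bigl => i; rewrite ltn_ord.
elim: k => [_|k IH kd] t r.
  rewrite [X in X * _]big_pred0// mul1r -cosY.
  by apply: eq_Rintegral => x _; rewrite big_pred0// mul1r.
pose K := Ordinal kd.
have eqP1 (i : 'I_d) : (k <= i)%N && (i != K) = (k.+1 <= i)%N.
  by rewrite [RHS]ltn_neqAle andbC -(inj_eq val_inj) eq_sym.
have eqP2 (i : 'I_d) : (i < k.+1)%N && (i != K) = (i < k)%N.
  by rewrite -(inj_eq val_inj)/= ltnS [RHS]ltn_neqAle andbC.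
(* The coefficient of coordinate [K] is made random: the mean over a standard normal [g] of
   [cos (sqrt (2 s) g y + b)] is [exp (- s y^2) cos b]. *)
pose t' (g : R) i := if i == K then Num.sqrt (2 * s K) * g else t i.
have sumg g (F : 'I_d -> R -> R) :
    \sum_(i < d | (k <= i)%N) F i (t' g i) =
    F K (Num.sqrt (2 * s K) * g) + \sum_(i < d | (k.+1 <= i)%N) F i (t i).
  rewrite (bigD1 K)//= /t' eqxx; congr (_ + _).
  by apply: eq_big => [i|i /andP[_ /negbTE ->]//]; exact: eqP1.
pose A x := \prod_(i < d | (i < k)%N) expR (- (s i * Y i x ^+ 2)).
pose B x := \sum_(i < d | (k.+1 <= i)%N) t i * Y i x + r.
have mA : measurable_fun setT A by exact: mprod.
have mB : measurable_fun setT B by exact: msum.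
pose f (z : T * R) := A z.1 * cos (Num.sqrt (2 * s K) * z.2 * Y K z.1 + B z.1).
have mf : measurable_fun setT f.
  apply: measurable_funM; first exact: (measurableT_comp mA measurable_fst).
  apply: (measurableT_comp mcos); apply: measurable_funD; last exact: (measurableT_comp mB measurable_fst).
  apply: measurable_funM; last exact: (measurableT_comp (mY K) measurable_fst).
  by apply: measurable_funM => //; exact: measurable_snd.
have fb z : `|f z| <= 1.
  by rewrite normrM -[leRHS]mulr1 ler_pM// ?prod1// cos_max.
have := Rintegral_Fubini_bounded P (normal_prob 0 1) mf fb.
have one0 : (1 : R) != 0 by exact: oner_neq0.
have -> : \int[P]_x (\int[normal_prob 0 1]_y f (x, y)) =
  \int[P]_x (\prod_(i < d | (i < k.+1)%N) expR (- (s i * Y i x ^+ 2)) *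
       cos (\sum_(i < d | (k.+1 <= i)%N) t i * Y i x + r)).
  apply: eq_Rintegral => x _; rewrite (bigD1 K)//= (eq_bigl _ _ eqP2) -/(A x) -/(B x).
  rewrite /f/=.
  rewrite RintegralZl//; last first.
    apply: (@bounded_integrable _ _ _ _ _ 1) => [|y]; last exact: cos_max.
    apply: (measurableT_comp mcos); apply: measurable_funD => //.
    by apply: measurable_funM => //; exact: measurable_funM.
  under eq_Rintegral do rewrite mulrAC.
  rewrite integral_cos_normal// expr1n mul1r exprMn sqr_sqrtr ?mulr_ge0//.
  by rewrite (_ : 2 * s K * _ / 2 = s K * Y K x ^+ 2); [ring|field].
move=> ->.
rewrite (bigD1 K)//= (eq_bigl _ _ eqP2).
under eq_Rintegral.
  move=> g _; have -> : \int[P]_x f (x, g) =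
     (\prod_(i < d | (i < k)%N) (Num.sqrt (1 + 2 * (s i * l i)))^-1 *
      (expR (- (\sum_(i < d | (k.+1 <= i)%N) l i * t i ^+ 2) / 2) * cos r)) *
      expR (- (s K * l K * g ^+ 2)).
    have := IH (ltnW kd) (t' g) r.
    rewrite (sumg g (fun i y => l i * y ^+ 2)) exprMn sqr_sqrtr ?mulr_ge0// => E.
    transitivity (\int[P]_x (\prod_(i < d | (i < k)%N) expR (- (s i * Y i x ^+ 2)) *
       cos (\sum_(i < d | (k <= i)%N) t' g i * Y i x + r))).
      apply: eq_Rintegral => x _; rewrite /f/= (sumg g (fun i y => y * Y i x)) addrA.
      by [].
    rewrite E -[RHS]mulrA; congr (_ * _); rewrite [RHS]mulrAC -expRD; congr (expR _ * _).
    by field.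
  over.
rewrite RintegralZl//; last first.
  apply: (@bounded_integrable _ _ _ _ _ 1) => [|y].
    apply: measurableT_comp => //; apply: measurableT_comp => //.
    by apply: measurable_funM => //; exact: measurable_funX.
  by rewrite ger0_norm ?expR_ge0// -[leRHS]expR0 ler_expR oppr_le0 mulr_ge0 ?sqr_ge0// mulr_ge0.
rewrite [X in _ * X](_ : _ = (Num.sqrt (1 + 2 * (s K * l K)))^-1); first by ring.
by rewrite /Rintegral integral_exp_normal ?mulr_ge0.
Qed.

End Hubbard_Stratonovich.

(** * From Laplace transforms to smooth functions *)

Section Bernstein.
Context {R : realType}.
Implicit Types (f g : nat -> R) (n k : nat) (u : R).

(* [(bernstein n f).[u]] is the mean of [f] under the binomial law of
   parameters [n] and [u]. *)
Fixpoint bernstein n f : {poly R} :=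
  if n is n'.+1 then 'X * bernstein n' (f \o S) + (1 - 'X) * bernstein n' f
  else (f 0)%:P.

Lemma bernsteinS n f u : (bernstein n.+1 f).[u] =
  u * (bernstein n (f \o S)).[u] + (1 - u) * (bernstein n f).[u].
Proof. by rewrite /= !hornerE. Qed.

Lemma bernstein_le n f g u : 0 <= u <= 1 -> (forall k, (k <= n)%N -> f k <= g k) ->
  (bernstein n f).[u] <= (bernstein n g).[u].
Proof.
move=> /andP[u0 u1]; elim: n f g => [|n IH] f g fg; first by rewrite !hornerC fg.
rewrite !bernsteinS lerD// ler_wpM2l ?subr_ge0// IH// => k kn; apply: fg => //=.
exact: leqW.
Qed.

Lemma bernstein_lin n f g (a b : R) u :
  (bernstein n (fun k => a * f k + b * g k)).[u] =
  a * (bernstein n f).[u] + b * (bernstein n g).[u].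
Proof.
elim: n f g => [|n IH] f g; first by rewrite !hornerC.
rewrite !bernsteinS IH (IH (f \o S) (g \o S)); ring.
Qed.

Lemma bernstein_cst n (a : R) u : (bernstein n (fun=> a)).[u] = a.
Proof.
elim: n => [|n IH]; first by rewrite hornerC.
by rewrite bernsteinS (_ : (fun=> a) \o S = (fun=> a))// IH; ring.
Qed.

(** Squared bias plus the binomial variance [n u (1 - u)]. *)
Lemma bernstein_sqr n (c : R) u :
  (bernstein n (fun k => (k%:R - c) ^+ 2)).[u] = (n%:R * u - c) ^+ 2 + n%:R * u * (1 - u).
Proof.
elim: n c => [|n IH] c; first by rewrite hornerC mul0r !sub0r; ring.
rewrite bernsteinS IH.
have -> : (fun k => (k%:R - c) ^+ 2) \o S = (fun k => (k%:R - (c - 1)) ^+ 2).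
  by apply/funext => k /=; rewrite -natr1; ring.
by rewrite IH -natr1; ring.
Qed.

Lemma bernstein_bound n f M u : 0 <= u <= 1 -> (forall k, `|f k| <= M) ->
  `|(bernstein n f).[u]| <= M.
Proof.
move=> u01 fM; rewrite ler_norml; apply/andP; split.
- rewrite -(bernstein_cst n (- M) u); apply: bernstein_le => // k _.
  by have := fM k; rewrite ler_norml => /andP[].
- rewrite -[leRHS](bernstein_cst n M u); apply: bernstein_le => // k _.
  by have := fM k; rewrite ler_norml => /andP[].
Qed.

(** Chebyshev's argument: [phi v] lies within [e / 2 + (2 M / d^2) (v - u)^2] of [phi u], and the
    quadratic part has Bernstein mean at most [K / n]. Only continuity at the point [u] is asked
    for, because the [phi] used below is built from [ln] and may be discontinuous at 0. *)
Lemma cvg_bernstein (phi : R -> R) (M : R) u : 0 < u <= 1 ->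
  (forall v, `|phi v| <= M) -> {for u, continuous phi} ->
  (bernstein n (fun k => phi (k%:R / n%:R))).[u] @[n --> \oo] --> phi u.
Proof.
move=> /andP[u0 u1] phiM cphi.
have u01 : 0 <= u <= 1 by rewrite ltW.
have M0 : 0 <= M := le_trans (normr_ge0 _) (phiM 0).
apply/cvgrPdist_le => e e0.
have e2 : 0 < e / 2 by lra.
have [d /= d0 dphi] : exists2 d : R, 0 < d & forall v, `|v - u| < d -> `|phi v - phi u| <= e / 2.
  have /cvgrPdist_le/(_ _ e2)[d /= d0 H] := cphi.
  by exists d => // v vd; rewrite distrC; apply: H => /=; rewrite distrC.
pose K := 2 * M / d ^+ 2.
have K0 : 0 <= K by rewrite divr_ge0 ?sqr_ge0// mulr_ge0.
near=> n.
have n0 : 0 < n%:R :> R by rewrite ltr0n; near: n; exact: nbhs_infty_gt.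
have Kn : K / n%:R <= e / 2.
  rewrite ler_pdivrMr// mulrC -ler_pdivrMr//; near: n; exact: nbhs_infty_ger.
have pt k : `|phi (k%:R / n%:R) - phi u| <= e / 2 + K / n%:R ^+ 2 * (k%:R - n%:R * u) ^+ 2.
  have -> : K / n%:R ^+ 2 * (k%:R - n%:R * u) ^+ 2 = K * (k%:R / n%:R - u) ^+ 2.
    by field; rewrite gt_eqF.
  have [h|h] := ltP `|k%:R / n%:R - u| d.
    by rewrite (le_trans (dphi _ h))// lerDl mulr_ge0// sqr_ge0.
  rewrite (@le_trans _ _ (2 * M))//.
    by apply: (le_trans (ler_normB _ _)); rewrite [leRHS]mulr_natl mulr2n lerD.
  rewrite (@le_trans _ _ (K * d ^+ 2))//.
    by rewrite /K divfK// sqrf_eq0 gt_eqF.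
  rewrite (@le_trans _ _ (K * (k%:R / n%:R - u) ^+ 2))//; last by rewrite lerDr ltW.
  by rewrite ler_wpM2l// -[leRHS]real_normK ?num_real// lerXn2r// nnegrE// ltW.
have B2 : (bernstein n (fun k => e / 2 * 1 + K / n%:R ^+ 2 * (k%:R - n%:R * u) ^+ 2)).[u] <= e.
  rewrite (bernstein_lin n (fun=> 1)) bernstein_cst bernstein_sqr subrr expr0n/= add0r mulr1.
  have -> : K / n%:R ^+ 2 * (n%:R * u * (1 - u)) = K / n%:R * (u * (1 - u)).
    by field; rewrite gt_eqF.
  have : K / n%:R * (u * (1 - u)) <= K / n%:R * 1.
    by apply: ler_wpM2l; [rewrite divr_ge0// ltW|nra].
  by lra.
rewrite distrC; rewrite ler_norml; apply/andP; split.
- have : (bernstein n (fun k => 1 * phi u + (- 1) * (e / 2 * 1 + K / n%:R ^+ 2 * (k%:R - n%:R * u) ^+ 2))).[u]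
    <= (bernstein n (fun k => phi (k%:R / n%:R))).[u].
    apply: bernstein_le => // k _; have := pt k; rewrite ler_norml; lra.
  by rewrite (bernstein_lin n (fun=> phi u)) bernstein_cst; lra.
- have : (bernstein n (fun k => phi (k%:R / n%:R))).[u] <=
    (bernstein n (fun k => 1 * phi u + 1 * (e / 2 * 1 + K / n%:R ^+ 2 * (k%:R - n%:R * u) ^+ 2))).[u].
    apply: bernstein_le => // k _; have := pt k; rewrite ler_norml; lra.
  by rewrite (bernstein_lin n (fun=> phi u)) bernstein_cst; lra.
Unshelve. all: by end_near. Qed.

End Bernstein.

Section Monotone_bound.
Context d0 (T : measurableType d0) (R : realType) (P : {measure set T -> \bar R}).

Lemma integrable_monotone_bound (f : nat -> T -> R) (g : T -> R) (B : R) :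
  (forall n, measurable_fun setT (f n)) -> (forall n x, 0 <= f n x) ->
  (forall x, nondecreasing_seq (f ^~ x)) ->
  (forall x, f n x @[n --> \oo] --> g x) ->
  (forall n, (\int[P]_x (f n x)%:E <= B%:E)%E) ->
  P.-integrable setT (fun x => (g x)%:E).
Proof.
move=> mf f0 ndf fg fB.
have mg : measurable_fun setT g by apply: measurable_fun_cvg (fun x _ => fg x).
have g0 x : 0 <= g x.
  by apply: (cvgr_to_ge (fg x)); exact: nearW.
apply/integrableP; split; first exact/measurable_EFinP.
have -> : (\int[P]_x `|(g x)%:E| = \int[P]_x lim ((f n x)%:E @[n --> \oo]))%E.
  apply: eq_integral => x _; rewrite abse_EFin ger0_norm//; apply/esym/cvg_lim => //.
  by apply: cvg_EFin; [exact: nearW|exact: fg].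
have h : (\int[P]_x (f n x)%:E)%E @[n --> \oo] --> (\int[P]_x lim ((f n x)%:E @[n --> \oo]))%E.
  apply: cvg_monotone_convergence => //.
  - by move=> n; exact/measurable_EFinP.
  - by move=> n x _; rewrite lee_fin.
  - by move=> x _ a b ab; rewrite lee_fin; exact: ndf.
apply: (@le_lt_trans _ _ B%:E); last exact: ltry.
by apply: (cvge_to_le h); exact: nearW.
Qed.

End Monotone_bound.

Section Laplace_identity.
Context d0 (T : measurableType d0) (R : realType) (P : probability T R).
Variables (V Z : T -> R) (k m c : R).
Hypothesis mV : measurable_fun setT V.
Hypothesis mZ : measurable_fun setT Z.
Hypothesis V0 : forall x, 0 <= V x.
Hypothesis Z0 : forall x, 0 <= Z x.
Hypothesis ZkV : forall x, Z x <= k * V x.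
Hypothesis iV : P.-integrable setT (fun x => (V x)%:E).
Hypothesis c0 : 0 <= c.
Hypothesis m0 : 0 <= m.
Hypothesis laplace : forall s, 0 < s ->
  (1 + c * s) * \int[P]_x (Z x * expR (- (s * V x))) = m * \int[P]_x expR (- (s * V x)).

Let mexp s : measurable_fun setT (fun x => expR (- (s * V x))).
Proof. by apply: measurableT_comp => //; apply: measurableT_comp => //; exact: measurable_funM. Qed.

Let exp_le1 s x : 0 <= s -> 0 < expR (- (s * V x)) <= 1.
Proof. by move=> s0; rewrite expR_gt0 -[leRHS]expR0 ler_expR oppr_le0 mulr_ge0. Qed.

Lemma laplace_integrable : P.-integrable setT (fun x => (Z x)%:E).
Proof.
apply: (integrable_EFin_le measurableT (g := fun x => k * V x)) => //.
- by move=> x _; rewrite ger0_norm.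
- exact: integrable_EFinZ.
Qed.
Let iZ := laplace_integrable.

Let s_ (n : nat) : R := n.+1%:R^-1.

Let s_gt0 n : 0 < s_ n. Proof. by rewrite invr_gt0. Qed.

Let cvgs : s_ n @[n --> \oo] --> 0.
Proof. exact: cvg_harmonic. Qed.

Let cvg_exp x : expR (- (s_ n * V x)) @[n --> \oo] --> (1 : R).
Proof.
rewrite -expR0; apply: (cvg_comp (fun n => - (s_ n * V x)) expR); last exact: continuous_expR.
have : s_ n * V x @[n --> \oo] --> 0 * V x by apply: cvgM => //; exact: cvg_cst.
by move/cvgN; rewrite mul0r oppr0; apply.
Qed.

(** The limit of [laplace] as [s] tends to 0, with [Z] and 1 as dominating functions. *)
Lemma laplace_mean : \int[P]_x Z x = m.
Proof.
have [|x _||n x _|_ h1] := @Rintegral_dominated _ _ R P setT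
  (fun n x => Z x * expR (- (s_ n * V x))) Z Z measurableT.
- by move=> n; exact: measurable_funM.
- by rewrite -[X in _ --> X]mulr1; apply: cvgM; [exact: cvg_cst|exact: cvg_exp].
- exact: iZ.
- have /andP[e0 e1] := @exp_le1 (s_ n) x (ltW (s_gt0 n)).
  by rewrite normrM !ger0_norm ?(ltW e0)// ler_piMr.
have [|x _||n x _|_ h2] := @Rintegral_dominated _ _ R P setT
  (fun n x => expR (- (s_ n * V x))) (cst 1) (cst 1) measurableT.
- by move=> n; exact: mexp.
- exact: cvg_exp.
- exact: finite_measure_integrable_cst.
- have /andP[e0 e1] := @exp_le1 (s_ n) x (ltW (s_gt0 n)).
  by rewrite ger0_norm ?(ltW e0).
rewrite Rintegral_cst_prob in h2.
have h3 : (1 + c * s_ n) * \int[P]_x (Z x * expR (- (s_ n * V x))) @[n --> \oo] -->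
    (1 + c * 0) * \int[P]_x Z x.
  apply: cvgM h1; apply: cvgD; first exact: cvg_cst.
  by apply: cvgM => //; exact: cvg_cst.
have h4 : (1 + c * s_ n) * \int[P]_x (Z x * expR (- (s_ n * V x))) @[n --> \oo] --> m * 1.
  under eq_fun do rewrite laplace//.
  by apply: cvgM h2; exact: cvg_cst.
by have := cvg_unique _ h3 h4; rewrite mulr0 addr0 mul1r mulr1; apply.
Qed.

(** The value at [V] of the primitive of [v -> exp (- s v)] that vanishes at 0; it tends to [V] as
    [s] tends to 0. *)
Let Psi s x := (1 - expR (- (s * V x))) / s.

Let mPsi s : measurable_fun setT (Psi s).
Proof. by apply: measurable_funM => //; exact: measurable_funB. Qed.

Let Psi_ge0 s x : 0 < s -> 0 <= Psi s x.
Proof. by move=> s0; have := @exp_le1 s x (ltW s0); rewrite /Psi => /andP[_ h]; rewrite divr_ge0 ?subr_ge0// ltW. Qed.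

Let Psi_leV s x : 0 < s -> Psi s x <= V x.
Proof.
move=> s0; rewrite /Psi ler_pdivrMr//.
by have := expR_ge1Dx (- (s * V x)); rewrite mulrC; lra.
Qed.

Let Psi_geV s x : 0 < s -> V x / (1 + s * V x) <= Psi s x.
Proof.
move=> s0; have sV : 0 <= s * V x by rewrite mulr_ge0// ltW.
have s1 : 0 < 1 + s * V x by lra.
rewrite /Psi ler_pdivlMr// expRN.
have h := expR_ge1Dx (s * V x).
have : (expR (s * V x))^-1 <= (1 + s * V x)^-1 by rewrite lef_pV2 ?posrE ?expR_gt0.
suff : V x / (1 + s * V x) * s = 1 - (1 + s * V x)^-1 by lra.
by field; rewrite gt_eqF.
Qed.

Let cvgPsi x : Psi (s_ n) x @[n --> \oo] --> V x.
Proof.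
apply: (@squeeze_cvgr _ _ _ _ (fun n => V x / (1 + s_ n * V x)) (cst (V x))).
- by apply: nearW => n; rewrite Psi_geV//= Psi_leV.
- have h : 1 + s_ n * V x @[n --> \oo] --> 1 + 0 * V x.
    by apply: cvgD; [exact: cvg_cst|apply: cvgM => //; exact: cvg_cst].
  rewrite mul0r addr0 in h.
  rewrite -[X in _ --> X]divr1; apply: cvgM; first exact: cvg_cst.
  by apply: cvgV => //; exact: oner_neq0.
- exact: cvg_cst.
Qed.

Let iPsi s : 0 < s -> P.-integrable setT (fun x => (Psi s x)%:E).
Proof.
move=> s0; apply: (integrable_EFin_le measurableT (g := V)) => //.
by move=> x _; rewrite ger0_norm ?Psi_ge0// Psi_leV.
Qed.

Let iZexp s : 0 <= s -> P.-integrable setT (fun x => (Z x * expR (- (s * V x)))%:E).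
Proof.
move=> s0; apply: (integrable_EFin_le measurableT (g := Z)) => //.
- exact: measurable_funM.
- move=> x _; have /andP[e0 e1] := @exp_le1 s x s0.
  by rewrite normrM !ger0_norm ?(ltW e0)// ler_piMr.
Qed.

Let iexp s : 0 <= s -> P.-integrable setT (fun x => (expR (- (s * V x)))%:E).
Proof.
move=> s0; apply: (@bounded_integrable _ _ _ _ _ 1) => // x.
by have /andP[e0 e1] := @exp_le1 s x s0; rewrite ger0_norm// ltW.
Qed.

Let iZPsi s : 0 < s -> P.-integrable setT (fun x => (Z x * Psi s x)%:E).
Proof.
move=> s0; apply: (integrable_EFin_le measurableT (g := fun x => s^-1 * Z x)).
- exact: measurable_funM.
- move=> x _; rewrite normrM !ger0_norm ?Psi_ge0// mulrC ler_wpM2r//.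
  have /andP[e0 e1] := @exp_le1 s x (ltW s0).
  by rewrite /Psi ler_piMl ?invr_ge0 ?(ltW s0)//; lra.
- exact: integrable_EFinZ.
Qed.

(** The identity [laplace] at [s] is subtracted from its limit [laplace_mean] at 0, and the
    difference is divided by [s]. *)
Let identity_exp s : 0 < s ->
  \int[P]_x (Z x * Psi s x) =
  m * \int[P]_x Psi s x + c * \int[P]_x (Z x * expR (- (s * V x))).
Proof.
move=> s0; have sn : s != 0 by rewrite gt_eqF.
have -> : \int[P]_x (Z x * Psi s x) = s^-1 * (m - \int[P]_x (Z x * expR (- (s * V x)))).
  rewrite -laplace_mean -RintegralB//; last exact/iZexp/ltW.
  rewrite -RintegralZl//; last by apply: integrable_EFinB => //; exact/iZexp/ltW.
  by apply: eq_Rintegral => x _; rewrite /Psi; ring.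
have -> : \int[P]_x Psi s x = s^-1 * (1 - \int[P]_x expR (- (s * V x))).
  rewrite -[in RHS](@Rintegral_cst_prob _ _ _ P 1) -RintegralB//; last 2 first.
  - exact: finite_measure_integrable_cst.
  - exact/iexp/ltW.
  rewrite -RintegralZl//; last first.
    by apply: integrable_EFinB => //; [exact: finite_measure_integrable_cst|exact/iexp/ltW].
  by apply: eq_Rintegral => x _; rewrite /Psi; ring.
have L := laplace s0.
have -> : m * (s^-1 * (1 - \int[P]_x expR (- (s * V x)))) =
  s^-1 * (m - m * \int[P]_x expR (- (s * V x))) by ring.
by rewrite -L; field.
Qed.

(** [identity_exp] bounds the means of [Z * Psi s] by [m E[V] + c m], uniformly in [s]. Monotone
    convergence is applied to the minorant [V / (1 + s V)] of [Psi s], whose monotonicity in [s] is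
    plain. *)
Lemma laplace_integrable_mul : P.-integrable setT (fun x => (Z x * V x)%:E).
Proof.
pose f n x := Z x * (V x / (1 + s_ n * V x)).
have s1 n x : 0 < 1 + s_ n * V x by rewrite ltr_pwDl// mulr_ge0// ltW.
have mf n : measurable_fun setT (f n).
  (* Writing the reciprocal as [expR (- ln _)] makes measurability a matter of composition. *)
  have -> : f n = (fun x => Z x * (V x * expR (- ln (1 + s_ n * V x)))).
    by apply/funext => x; rewrite /f expRN lnK// posrE s1.
  apply: measurable_funM => //; apply: measurable_funM => //.
  apply: measurableT_comp => //; apply: measurableT_comp => //.
  apply: measurableT_comp; first exact: measurable_ln.
  by apply: measurable_funD => //; exact: measurable_funM.
have f0 n x : 0 <= f n x by rewrite /f mulr_ge0// divr_ge0// ltW.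
apply: (@integrable_monotone_bound _ _ _ P f _ (m * \int[P]_x V x + c * m)) => //.
- move=> x a b ab; rewrite /f ler_wpM2l// ler_wpM2l// lef_pV2 ?posrE//.
  by rewrite lerD2l ler_wpM2r// lef_pV2 ?posrE// ler_nat.
- move=> x; rewrite /f; apply: cvgM; first exact: cvg_cst.
  have h : 1 + s_ n * V x @[n --> \oo] --> 1 + 0 * V x.
    by apply: cvgD; [exact: cvg_cst|apply: cvgM => //; exact: cvg_cst].
  rewrite mul0r addr0 in h.
  rewrite -[X in _ --> X]divr1; apply: cvgM; first exact: cvg_cst.
  by apply: cvgV => //; exact: oner_neq0.
- move=> n; have s0 := s_gt0 n.
  apply: (@le_trans _ _ (\int[P]_x (Z x * Psi (s_ n) x)%:E)%E).
    apply: ge0_le_integral => //=.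
    - by move=> x _; rewrite lee_fin.
    - exact/measurable_EFinP.
    - by apply/measurable_EFinP; exact: measurable_funM.
    - by move=> x _; rewrite lee_fin /f ler_wpM2l// Psi_geV.
  rewrite Rintegral_fineK; last exact: iZPsi.
  rewrite lee_fin identity_exp// lerD// ler_wpM2l//.
  + by apply: le_Rintegral => //; [exact: iPsi|by move=> x _; exact: Psi_leV].
  + rewrite -laplace_mean; apply: le_Rintegral => //; first exact/iZexp/ltW.
    move=> x _; have /andP[e0 e1] := @exp_le1 (s_ n) x (ltW s0).
    by rewrite ler_piMr.
- exact: measurableT.
Qed.
Let iZV := laplace_integrable_mul.

Let identity (G psi : R -> R) :=
  [/\ P.-integrable setT (fun x => (Z x * G (V x))%:E),
     P.-integrable setT (fun x => (G (V x))%:E),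
     P.-integrable setT (fun x => (Z x * psi (V x))%:E) &
     \int[P]_x (Z x * G (V x)) =
     m * \int[P]_x G (V x) + c * \int[P]_x (Z x * psi (V x))].

Let identity_lin (a : R) (G1 G2 psi1 psi2 : R -> R) :
  identity G1 psi1 -> identity G2 psi2 ->
  identity (fun x => G1 x + a * G2 x) (fun x => psi1 x + a * psi2 x).
Proof.
move=> [A1 A2 A3 A4] [B1 B2 B3 B4].
have E1 x : Z x * (G1 (V x) + a * G2 (V x)) = Z x * G1 (V x) + a * (Z x * G2 (V x)) by ring.
have E2 x : Z x * (psi1 (V x) + a * psi2 (V x)) = Z x * psi1 (V x) + a * (Z x * psi2 (V x)) by ring.
split.
- by under eq_fun do rewrite E1; apply: integrable_EFinD => //; exact: integrable_EFinZ.
- by apply: integrable_EFinD => //; exact: integrable_EFinZ.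
- by under eq_fun do rewrite E2; apply: integrable_EFinD => //; exact: integrable_EFinZ.
- under eq_Rintegral do rewrite E1.
  under [X in _ = _ + c * X]eq_Rintegral do rewrite E2.
  rewrite !RintegralD//; try exact: integrable_EFinZ.
  by rewrite !RintegralZl// A4 B4; ring.
Qed.

(** The primitive of [x -> exp (- i x)] vanishing at 0; at [i = 0] the quotient degenerates to the
    identity function. *)
Let expG (i : nat) (x : R) : R := if i is 0 then x else (1 - expR (- (i%:R * x))) / i%:R.

Let expG0 i : expG i 0 = 0.
Proof. by case: i => //= i; rewrite mulr0 oppr0 expR0 subrr mul0r. Qed.

Let is_derive_expG i (x : R) : is_derive x 1 (expG i) (expR (- (i%:R * x))).
Proof.
case: i => [|i].
  by rewrite /expG mul0r oppr0 expR0; exact: is_derive_id.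
have i0 : i.+1%:R != 0 :> R by rewrite pnatr_eq0.
rewrite /expG; apply: is_derive_eq; rewrite /GRing.scale/=.
by field.
Qed.

(** For [i > 0] this is [identity_exp]. The case [i = 0], that is [E[Z V] = m E[V] + c E[Z]], is its
    limit along [s_ n], dominated thanks to [laplace_integrable_mul]. *)
Let identity_expG i : identity (expG i) (fun x => expR (- (i%:R * x))).
Proof.
case: i => [|i]; last first.
  have s0 : 0 < i.+1%:R :> R by rewrite ltr0n.
  split; [exact: iZPsi|exact: iPsi|exact/iZexp/ltW|exact: identity_exp].
have E x : Z x * expR (- (0%:R * V x)) = Z x by rewrite mul0r oppr0 expR0 mulr1.
split => //.
  by under eq_fun do rewrite E.
under [X in _ = _ + c * X]eq_Rintegral do rewrite E.
rewrite laplace_mean /=.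
have [|x _||n x _|_ h1] := @Rintegral_dominated _ _ R P setT
  (fun n x => Z x * Psi (s_ n) x) (fun x => Z x * V x) (fun x => Z x * V x) measurableT.
- by move=> n; exact: measurable_funM.
- by apply: cvgM; [exact: cvg_cst|exact: cvgPsi].
- exact: iZV.
- by rewrite normrM !ger0_norm ?Psi_ge0// ler_wpM2l// Psi_leV.
have [|x _||n x _|_ h2] := @Rintegral_dominated _ _ R P setT
  (fun n x => Psi (s_ n) x) V V measurableT.
- by move=> n; exact: mPsi.
- exact: cvgPsi.
- exact: iV.
- by rewrite !ger0_norm ?Psi_ge0// Psi_leV.
have [|x _||n x _|_ h3] := @Rintegral_dominated _ _ R P setT
  (fun n x => Z x * expR (- (s_ n * V x))) Z Z measurableT.
- by move=> n; exact: measurable_funM.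
- by rewrite -[X in _ --> X]mulr1; apply: cvgM; [exact: cvg_cst|exact: cvg_exp].
- exact: iZ.
- have /andP[e0 e1] := @exp_le1 (s_ n) x (ltW (s_gt0 n)).
  by rewrite normrM !ger0_norm ?(ltW e0)// ler_piMr.
rewrite laplace_mean in h3.
apply: (cvg_unique _ h1) => //.
rewrite (funext (fun n => identity_exp (s_gt0 n))).
by apply: cvgD; (apply: cvgM; first exact: cvg_cst).
Qed.

Let polyG (p : {poly R}) (x : R) := \sum_(i < size p) p`_i * expG i x.

Let identity_poly (p : {poly R}) : identity (polyG p) (fun x => p.[expR (- x)]).
Proof.
rewrite /polyG.
have -> : (fun x => p.[expR (- x)]) = (fun x => \sum_(i < size p) p`_i * expR (- (i%:R * x))).
  apply/funext => x; rewrite horner_coef; apply: eq_bigr => i _.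
  by rewrite -expRM_natl mulrN.
elim: (size p) => [|n IH].
  under eq_fun do rewrite big_ord0; under [X in identity _ X]eq_fun do rewrite big_ord0.
  have E0 : P.-integrable setT (fun x => (0 : R)%:E) by exact: finite_measure_integrable_cst.
  split => //.
  - by under eq_fun do rewrite mulr0.
  - by under eq_fun do rewrite mulr0.
  - under eq_Rintegral do rewrite mulr0.
    by rewrite !Rintegral_cst_prob !mulr0 addr0.
under eq_fun do rewrite big_ord_recr; under [X in identity _ X]eq_fun do rewrite big_ord_recr.
exact: identity_lin (identity_expG n).
Qed.

Let is_derive_polyG (p : {poly R}) (x : R) : is_derive x 1 (polyG p) (p.[expR (- x)]).
Proof.
rewrite /polyG horner_coef.
have -> : \sum_(i < size p) p`_i * expR (- x) ^+ i = \sum_(i < size p) p`_i * expR (- (i%:R * x)).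
  by apply: eq_bigr => i _; rewrite -expRM_natl mulrN.
elim: (size p) => [|n IH].
  by under eq_fun do rewrite big_ord0; rewrite big_ord0; exact: is_derive_cst.
under eq_fun do rewrite big_ord_recr/=; rewrite big_ord_recr/=.
have := is_derive_expG n x => ?.
by apply: is_deriveD; apply: is_derive_eq.
Qed.

Let polyG0 (p : {poly R}) : polyG p 0 = 0.
Proof. by rewrite /polyG big1// => i _; rewrite expG0 mulr0. Qed.

(* Bernstein polynomials in [u = expR (- x)] approximate the derivative [psi],
   not [G], so that both [G] and its derivative are approximated at once. *)
Lemma laplace_smooth (G psi : R -> R) (M : R) :
  (forall x : R, 0 <= x -> is_derive x 1 G (psi x)) ->
  (forall x : R, 0 <= x -> {for x, continuous psi}) ->
  (forall x : R, 0 <= x -> `|psi x| <= M) ->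
  \int[P]_x (Z x * G (V x)) = m * \int[P]_x G (V x) + c * \int[P]_x (Z x * psi (V x)).
Proof.
move=> dG cpsi psiM.
(* In the variable [u = exp (- x)] this is [psi x]; the absolute value keeps the argument in the
   half-line for every real [u], so that [phi] is bounded everywhere. *)
pose phi u := psi `|ln u|.
have phiM v : `|phi v| <= M by exact: psiM.
pose p n : {poly R} := bernstein n (fun k => phi (k%:R / n%:R)).
have exp01 (x : R) : 0 <= x -> 0 < expR (- x) <= 1.
  by move=> x0; rewrite expR_gt0 -[leRHS]expR0 ler_expR oppr_le0.
have pM n (x : R) : 0 <= x -> `|(p n).[expR (- x)]| <= M.
  by move=> x0; have /andP[e0 e1] := exp01 x x0; apply: bernstein_bound => //; rewrite ltW.
have pcvg (x : R) : 0 <= x -> (p n).[expR (- x)] @[n --> \oo] --> psi x.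
  move=> x0; have -> : psi x = phi (expR (- x)) by rewrite /phi expRK normrN ger0_norm.
  apply: (cvg_bernstein (exp01 x x0) phiM).
  apply: continuous_comp.
    apply: continuous_comp; last exact: norm_continuous.
    by apply: continuous_ln; exact: expR_gt0.
  by apply: cpsi.
have M0 : 0 <= M by apply: le_trans (psiM 0 _).
(* A uniform bound on the derivatives bounds the primitives by [M * x], which stays integrable
   against [Z] because [E[Z V]] is finite. *)
have GM n (x : R) : 0 <= x -> `|polyG (p n) x| <= M * x.
  move=> x0; rewrite -[polyG _ _]subr0 -(polyG0 (p n)) -[X in M * X]subr0.
  apply: (@derive_lip_cc _ _ (fun x => (p n).[expR (- x)])) => //.
  by move=> y /andP[y0 _]; apply: pM; exact: ltW.
have Gcvg (x : R) : 0 <= x -> polyG (p n) x @[n --> \oo] --> G x - G 0.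
  rewrite le_eqVlt => /predU1P[<-|x0].
    by rewrite subrr; under eq_fun do rewrite polyG0; exact: cvg_cst.
  have cp n y : {for y, continuous (fun x => (p n).[expR (- x)])}.
    apply: (continuous_comp (f := fun x => expR (- x))); last exact: continuous_horner.
    by apply: continuous_comp; [exact: continuousN|exact: continuous_expR].
  have E1 n : polyG (p n) x = \int[lebesgue_measure]_(y in `[0, x]) (p n).[expR (- y)].
    by rewrite /Rintegral (@FTC2_cc _ _ (polyG (p n)) 0 x x0 (fun y _ => is_derive_polyG (p n) y) (fun y _ => cp n y))/= polyG0 subr0.
  have -> : G x - G 0 = \int[lebesgue_measure]_(y in `[0, x]) psi y.
    have d (y : R) : 0 <= y <= x -> is_derive y 1 G (psi y) by move=> /andP[/dG].
    by rewrite /Rintegral (FTC2_cc x0 d)// => y /andP[/cpsi].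
  under eq_fun do rewrite E1.
  have [||y||n y|_ h] := @Rintegral_dominated _ _ R lebesgue_measure `[0, x]%classic
    (fun n y => (p n).[expR (- y)]) psi (cst M).
  - exact: measurable_itv.
  - move=> n; apply: measurable_funTS; apply: continuous_measurable_fun => y; exact: cp.
  - by rewrite /= in_itv/= => /andP[y0 _]; exact: pcvg.
  - apply/integrableP; split; first exact/measurable_EFinP/measurable_cst.
    rewrite /= integral_cst//= lebesgue_measure_itv/= lte_fin x0.
    by rewrite -EFinB -EFinM ltry.
  - by rewrite /= in_itv/= => /andP[y0 _]; exact: pM.
  - exact: h.
have mpoly n : measurable_fun setT (fun x => polyG (p n) (V x)).
  have [_ /integrableP[/measurable_EFinP h _] _ _] := identity_poly (p n).
  exact: h.
have mpolyd n : measurable_fun setT (fun x => (p n).[expR (- V x)]).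
  have mp : measurable_fun setT (fun y : R => (p n).[expR (- y)]); last exact: measurableT_comp mp mV.
  apply: continuous_measurable_fun => y.
  apply: (continuous_comp (f := fun x => expR (- x))); last exact: continuous_horner.
  by apply: continuous_comp; [exact: continuousN|exact: continuous_expR].
have [|x _||n x _|i1 h1] := @Rintegral_dominated _ _ R P setT
  (fun n x => Z x * polyG (p n) (V x)) (fun x => Z x * (G (V x) - G 0)) (fun x => M * (Z x * V x)) measurableT.
- by move=> n; exact: measurable_funM.
- by apply: cvgM; [exact: cvg_cst|exact: Gcvg].
- exact: integrable_EFinZ.
- by rewrite normrM ger0_norm// mulrCA ler_wpM2l// GM.
have [|x _||n x _|i2 h2] := @Rintegral_dominated _ _ R P setT
  (fun n x => polyG (p n) (V x)) (fun x => G (V x) - G 0) (fun x => M * V x) measurableT.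
- by move=> n; exact: mpoly.
- exact: Gcvg.
- exact: integrable_EFinZ.
- by rewrite GM.
have [|x _||n x _|i3 h3] := @Rintegral_dominated _ _ R P setT
  (fun n x => Z x * (p n).[expR (- V x)]) (fun x => Z x * psi (V x)) (fun x => M * Z x) measurableT.
- by move=> n; exact: measurable_funM.
- by apply: cvgM; [exact: cvg_cst|exact: pcvg].
- exact: integrable_EFinZ.
- by rewrite normrM ger0_norm// mulrC ler_wpM2r// pM.
have main : \int[P]_x (Z x * (G (V x) - G 0)) =
    m * \int[P]_x (G (V x) - G 0) + c * \int[P]_x (Z x * psi (V x)).
  apply: (cvg_unique _ h1) => //.
  have E n : \int[P]_x (Z x * polyG (p n) (V x)) =
     m * \int[P]_x polyG (p n) (V x) + c * \int[P]_x (Z x * (p n).[expR (- V x)]).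
    by have [] := identity_poly (p n).
  rewrite (funext E); apply: cvgD; (apply: cvgM; first exact: cvg_cst).
    exact: h2.
  exact: h3.
(* The approximating primitives vanish at 0, so the limit is the identity for [G - G 0]; the
   constant is restored by [laplace_mean]. *)
have iG0 : P.-integrable setT (fun x => (G 0)%:E) by exact: finite_measure_integrable_cst.
have -> : \int[P]_x (Z x * G (V x)) = \int[P]_x (Z x * (G (V x) - G 0)) + G 0 * m.
  rewrite -laplace_mean -RintegralZl// -RintegralD//; last exact: integrable_EFinZ.
  by apply: eq_Rintegral => x _; ring.
have -> : \int[P]_x G (V x) = \int[P]_x (G (V x) - G 0) + G 0.
  rewrite -[X in _ = _ + X](@Rintegral_cst_prob _ _ _ P (G 0)) -RintegralD//.
  by apply: eq_Rintegral => x _; ring.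
by rewrite main; ring.
Qed.

(* The shifts [g (V + s)] with [s] decreasing to [0] avoid the singularity that
   [psi] may have at [0]. *)
Lemma laplace_identity (g psi : R -> R) (B C : R) : P [set x | V x = 0] = 0%E ->
  (forall x : R, 0 < x -> is_derive x 1 g (psi x)) ->
  (forall x : R, 0 < x -> {for x, continuous psi}) ->
  (forall x : R, 0 < x -> `|g x| <= B) ->
  (forall x : R, 0 < x -> `|psi x| <= C * (1 + x^-1)) ->
  [/\ P.-integrable setT (fun x => (Z x * g (V x))%:E),
     P.-integrable setT (fun x => (g (V x))%:E),
     P.-integrable setT (fun x => (Z x * psi (V x))%:E) &
     \int[P]_x (Z x * g (V x)) =
     m * \int[P]_x g (V x) + c * \int[P]_x (Z x * psi (V x))].
Proof.
move=> PV0 dg cpsi gB psiC.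
have cg x : 0 < x -> {for x, continuous g} by move=> x0; exact: is_derive_continuous (dg x x0).
have C0 : 0 <= C.
  by have := le_trans (normr_ge0 _) (psiC 1 ltr01); rewrite invr1; lra.
have Vs n x : 0 < V x + s_ n by rewrite ltr_wpDl.
have mcomp n (f : R -> R) : (forall x, 0 < x -> {for x, continuous f}) ->
    measurable_fun setT (fun x => f (V x + s_ n)).
  move=> cf; apply: (measurable_comp _ _ (measurable_fun_0y cf)).
  - exact: measurable_itv.
  - by move=> y [x _ <-]/=; rewrite in_itv/= Vs.
  - exact: measurable_funD.
have sm n : \int[P]_x (Z x * g (V x + s_ n)) =
    m * \int[P]_x g (V x + s_ n) + c * \int[P]_x (Z x * psi (V x + s_ n)).
  apply: (@laplace_smooth (fun x => g (x + s_ n)) (fun x => psi (x + s_ n)) (C * (1 + (s_ n)^-1))).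
  - move=> x x0; have xs : 0 < x + s_ n by rewrite ltr_wpDl.
    have dx : is_derive x (1 : R) (fun x : R => x + s_ n : R) (1 : R) by apply: is_derive_eq; rewrite addr0.
    by have := @is_derive1_comp R g (fun x : R => x + s_ n) x (psi (x + s_ n)) 1 (dg _ xs) dx; rewrite mulr1.
  - move=> x x0; have xs : 0 < x + s_ n by rewrite ltr_wpDl.
    apply: (continuous_comp (f := fun x : R => x + s_ n)); last exact: cpsi.
    by apply: cvgD; [exact: cvg_id|exact: cvg_cst].
  - move=> x x0; have xs : 0 < x + s_ n by rewrite ltr_wpDl.
    rewrite (le_trans (psiC _ xs))// ler_wpM2l// lerD2l lef_pV2 ?posrE//.
    by rewrite lerDr.
have cvgVs x : V x + s_ n @[n --> \oo] --> V x.
  by rewrite -[X in _ --> X]addr0; apply: cvgD => //; exact: cvg_cst.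
have cvgf x (f : R -> R) : (forall x, 0 < x -> {for x, continuous f}) -> 0 < V x ->
    f (V x + s_ n) @[n --> \oo] --> f (V x).
  move=> cf Vx; exact: (cvg_comp (fun n => V x + s_ n) f (cvgVs x) (cf _ Vx)).
have V00 x : (0 < V x) = (V x != 0) by rewrite lt_def V0 andbT.
(* On the event [V = 0] the factor [Z] vanishes, so the integrands containing it converge there
   whatever [psi] does at 0. *)
have ZV0 x : V x = 0 -> Z x = 0.
  by move=> Vx; apply/eqP; rewrite eq_le Z0 andbT (le_trans (ZkV x))// Vx mulr0.
have cvgZ x (f : R -> R) : (forall x, 0 < x -> {for x, continuous f}) ->
    Z x * f (V x + s_ n) @[n --> \oo] --> Z x * f (V x).
  move=> cf; have [Vx|Vx] := eqVneq (V x) 0.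
    by rewrite ZV0// mul0r; under eq_fun do rewrite mul0r; exact: cvg_cst.
  by apply: cvgM; [exact: cvg_cst|apply: cvgf => //; rewrite V00].
have B0 : 0 <= B by exact: le_trans (normr_ge0 _) (gB 1 ltr01).
have [|x _||n x _|i1 h1] := @Rintegral_dominated _ _ R P setT
  (fun n x => Z x * g (V x + s_ n)) (fun x => Z x * g (V x)) (fun x => B * Z x) measurableT.
- by move=> n; apply: measurable_funM => //; exact: mcomp.
- exact: cvgZ.
- exact: integrable_EFinZ.
- by rewrite normrM ger0_norm// mulrC ler_wpM2r// gB.
(* The bound [Z <= k V] gives [Z / (V + s) <= |k|], which compensates the singularity [1 / x]
   allowed for [psi]. *)
have [|x _||n x _|i2 h2] := @Rintegral_dominated _ _ R P setT
  (fun n x => Z x * psi (V x + s_ n)) (fun x => Z x * psi (V x)) (fun x => C * (Z x + `|k|)) measurableT.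
- by move=> n; apply: measurable_funM => //; exact: mcomp.
- exact: cvgZ.
- apply: (integrable_EFinZ measurableT); apply: (integrable_EFinD measurableT (f := Z) (g := cst `|k|)) => //.
  exact: finite_measure_integrable_cst.
- rewrite normrM ger0_norm// (le_trans (ler_wpM2l (Z0 x) (psiC _ (Vs n x))))//.
  rewrite mulrCA ler_wpM2l// mulrDr mulr1 lerD2l ler_pdivrMr//.
  rewrite (le_trans (ZkV x))// (@le_trans _ _ (`|k| * V x))//.
    by rewrite ler_wpM2r// ler_norm.
  by rewrite ler_wpM2l// lerDl ltW.
pose N := [set x | V x = 0].
have mN : measurable N.
  have -> : N = setT `&` V @^-1` [set 0] by rewrite setTI.
  by apply: mV => //; exact: measurable_set1.
(* Equal to [g (V + s_ n)] off the null event [V = 0] and to [g 0] on it, so that convergence to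
   [g (V x)] holds at every point. *)
pose f_ n x := g (V x + s_ n) * \1_(~` N) x + g 0 * \1_N x.
have mf_ n : measurable_fun setT (f_ n).
  apply: measurable_funD; apply: measurable_funM => //.
  + exact: mcomp.
  + by apply: measurable_indic; exact: measurableC.
have f_B n x : `|f_ n x| <= B + `|g 0|.
  rewrite /f_ (le_trans (ler_normD _ _))// lerD// normrM.
    by rewrite -[leRHS]mulr1 ler_pM// ?gB// indicE; case: (_ \in _); rewrite ?normr1 ?normr0.
  by rewrite ler_piMr// indicE; case: (_ \in _); rewrite ?normr1 ?normr0.
have [|x _||n x _|i3 h3] := @Rintegral_dominated _ _ R P setT
  f_ (fun x => g (V x)) (cst (B + `|g 0|)) measurableT.
- exact: mf_.
- have NE : (x \in N) = (V x == 0) by apply/idP/eqP; rewrite inE.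
  rewrite /f_ !indicE in_setC NE; have [Vx|Vx] := eqVneq (V x) 0.
    by under eq_fun do rewrite /= mulr0 add0r mulr1; rewrite Vx; exact: cvg_cst.
  by under eq_fun do rewrite /= mulr0 mulr1 addr0; apply: cvgf => //; rewrite V00.
- exact: finite_measure_integrable_cst.
- exact: f_B.
have E3 n : \int[P]_x f_ n x = \int[P]_x g (V x + s_ n).
  rewrite /Rintegral; congr fine.
  rewrite (negligible_integral mN)//; last by apply: (@bounded_integrable _ _ _ _ _ (B + `|g 0|)).
  rewrite [RHS](negligible_integral mN)//; last first.
    by apply: (@bounded_integrable _ _ _ _ _ B); [exact: mcomp|move=> x; exact: gB].
  apply: eq_integral => x; rewrite inE => -[_ Nx].
  by rewrite /f_ !indicE in_setC memNset// mulr0 mulr1 addr0.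
split => //.
apply: (cvg_unique _ h1) => //; rewrite (funext sm).
apply: cvgD; (apply: cvgM; first exact: cvg_cst) => //.
by rewrite -(funext E3).
Qed.

End Laplace_identity.

Section Laplace_integrable.
Context d0 (T : measurableType d0) (R : realType) (P : probability T R).

(** Integrability of [Z] at a stage where that of [V] is not yet known. As [s] decreases to 0 the
    functions [Z exp (- s V)] increase to [Z], and [laplace] bounds their means by [m]. *)
Lemma laplace_integrable0 (V Z : T -> R) (k m c : R) :
  measurable_fun setT V -> measurable_fun setT Z ->
  (forall x, 0 <= V x) -> (forall x, 0 <= Z x) -> (forall x, Z x <= k * V x) ->
  0 <= c -> 0 <= m ->
  (forall s, 0 < s ->
    (1 + c * s) * \int[P]_x (Z x * expR (- (s * V x))) = m * \int[P]_x expR (- (s * V x))) ->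
  P.-integrable setT (fun x => (Z x)%:E).
Proof.
move=> mV mZ V0 Z0 ZkV c0 m0 laplace.
pose s_ (n : nat) : R := n.+1%:R^-1.
have s_gt0 n : 0 < s_ n by rewrite invr_gt0.
have mexp s : measurable_fun setT (fun x => expR (- (s * V x))).
  by apply: measurableT_comp => //; apply: measurableT_comp => //; exact: measurable_funM.
have exp_le1 s x : 0 < s -> 0 < expR (- (s * V x)) <= 1.
  by move=> s0; rewrite expR_gt0 -[leRHS]expR0 ler_expR oppr_le0 mulr_ge0// ltW.
apply: (@integrable_monotone_bound _ _ _ P (fun n x => Z x * expR (- (s_ n * V x))) _ m).
- by move=> n; exact: measurable_funM.
- by move=> n x; rewrite mulr_ge0 ?expR_ge0.
- move=> x a b ab; rewrite ler_wpM2l// ler_expR lerN2 ler_wpM2r//.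
  by rewrite lef_pV2 ?posrE// ler_nat.
- move=> x; rewrite -[X in _ --> X]mulr1; apply: cvgM; first exact: cvg_cst.
  rewrite -expR0; apply: (cvg_comp (fun n => - (s_ n * V x)) expR); last exact: continuous_expR.
  have : s_ n * V x @[n --> \oo] --> 0 * V x by apply: cvgM; [exact: cvg_harmonic|exact: cvg_cst].
  by move/cvgN; rewrite mul0r oppr0; apply.
- move=> n; have sn := s_gt0 n.
  have ib : P.-integrable setT (fun x => (Z x * expR (- (s_ n * V x)))%:E).
    (* For each fixed [s], [Z exp (- s V) <= |k| V exp (- s V) <= |k| / s]. *)
    apply: (@bounded_integrable _ _ _ _ _ (`|k| / s_ n)); first exact: measurable_funM.
    move=> x; rewrite ger0_norm; last by rewrite mulr_ge0 ?expR_ge0.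
    rewrite expRN ler_pdivrMr ?expR_gt0// mulrAC ler_pdivlMr//.
    have h1 : Z x <= `|k| * V x by rewrite (le_trans (ZkV x))// ler_wpM2r// ler_norm.
    apply: (@le_trans _ _ (`|k| * (s_ n * V x))).
      by rewrite mulrCA mulrC ler_wpM2l// ltW.
    by rewrite ler_wpM2l//; have := expR_ge1Dx (s_ n * V x); lra.
  rewrite Rintegral_fineK// lee_fin.
  have I0 : 0 <= \int[P]_x (Z x * expR (- (s_ n * V x))).
    by apply: Rintegral_ge0 => x _; rewrite mulr_ge0 ?expR_ge0.
  apply: (@le_trans _ _ ((1 + c * s_ n) * \int[P]_x (Z x * expR (- (s_ n * V x))))).
    by rewrite ler_peMl// lerDl mulr_ge0// ltW.
  rewrite laplace// ler_piMr// -[leRHS](@Rintegral_cst_prob _ _ _ P).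
  apply: le_Rintegral => //.
  + apply: (@bounded_integrable _ _ _ _ _ 1) => // x.
    by have /andP[e0 e1] := @exp_le1 (s_ n) x sn; rewrite ger0_norm// ltW.
  + exact: finite_measure_integrable_cst.
  + by move=> x _; have /andP[] := @exp_le1 (s_ n) x sn.
Qed.

End Laplace_integrable.

(** * The Laplace identity for a sum of squares *)

Section Quadratic_law.
Context d0 (T : measurableType d0) (R : realType) (P : probability T R).
Context d (Y : 'I_d -> T -> R) (l : 'I_d -> R) (kappa : R).
Hypothesis mY : forall i, measurable_fun setT (Y i).
Hypothesis l0 : forall i, 0 <= l i.
Hypothesis kappa0 : 0 < kappa.
Hypothesis expY : forall s : 'I_d -> R, (forall i, 0 <= s i) ->
  \int[P]_x expR (- \sum_i s i * Y i x ^+ 2) = \prod_i (Num.sqrt (1 + 2 * (s i * l i)))^-1.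

Let k0 := ltW kappa0.

Let V x := kappa * \sum_i Y i x ^+ 2.

Lemma quadratic_ge0 x : 0 <= V x.
Proof. by apply: mulr_ge0; [exact: ltW|apply: sumr_ge0 => i _; exact: sqr_ge0]. Qed.

Lemma sqr_le_quadratic i x : Y i x ^+ 2 <= kappa^-1 * V x.
Proof.
rewrite mulrA mulVf ?gt_eqF// mul1r (bigD1 i)//= lerDl sumr_ge0// => j _.
exact: sqr_ge0.
Qed.

Lemma measurable_quadratic : measurable_fun setT V.
Proof. by apply: measurable_funM => //; apply: measurable_sum => i; exact: measurable_funX. Qed.
Let mV := measurable_quadratic.

Let expV (s t : R) i x : expR (- \sum_j (s * kappa + t * (j == i)%:R) * Y j x ^+ 2) =
  expR (- (s * V x)) * expR (- (t * Y i x ^+ 2)).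
Proof.
rewrite -expRD -opprD; congr (expR (- _)).
rewrite /V (eq_bigr (fun j => s * kappa * Y j x ^+ 2 + t * ((j == i)%:R * Y j x ^+ 2))).
  rewrite big_split/= -!mulr_sumr mulrA; congr (_ + _ * _).
  by rewrite (bigD1 i)//= eqxx mul1r big1 ?addr0// => j /negbTE ->; rewrite mul0r.
by move=> j _; ring.
Qed.

Let mexp s : measurable_fun setT (fun x => expR (- (s * V x))).
Proof. by apply: measurableT_comp => //; apply: measurableT_comp => //; exact: measurable_funM. Qed.

Let exp_le1 s x : 0 <= s -> 0 < expR (- (s * V x)) <= 1.
Proof. by move=> s0; rewrite expR_gt0 -[leRHS]expR0 ler_expR oppr_le0 mulr_ge0 ?quadratic_ge0. Qed.

Let s_ (n : nat) : R := n.+1%:R^-1.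
Let s_gt0 n : 0 < s_ n. Proof. by rewrite invr_gt0. Qed.
Let cvgs : s_ n @[n --> \oo] --> 0. Proof. exact: cvg_harmonic. Qed.

Let sqr_le_exp i s x : 0 < s -> s * kappa * Y i x ^+ 2 <= expR (s * V x).
Proof.
move=> s0; apply: le_trans (expR_ge1Dx _).
have := sqr_le_quadratic i x; rewrite ler_pdivlMl// => /(ler_wpM2l (ltW s0)).
by rewrite mulrA; lra.
Qed.

(* The Laplace transform is differentiated in the coefficient of [Y i ^+ 2]. *)
Lemma quadratic_laplace i s : 0 < s ->
  (1 + 2 * (kappa * l i) * s) * \int[P]_x (Y i x ^+ 2 * expR (- (s * V x))) =
  l i * \int[P]_x expR (- (s * V x)).
Proof.
move=> s0; have sk0 : 0 < s * kappa by rewrite mulr_gt0.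
pose a t := 1 + 2 * ((s * kappa + t) * l i).
have a1 t : 0 <= t -> 1 <= a t.
  by move=> t0; rewrite /a lerDl mulr_ge0// mulr_ge0// addr_ge0// ltW.
pose A := \prod_(j < d | j != i) (Num.sqrt (1 + 2 * (s * kappa * l j)))^-1.
have phi t : 0 <= t ->
    \int[P]_x (expR (- (s * V x)) * expR (- (t * Y i x ^+ 2))) = (Num.sqrt (a t))^-1 * A.
  move=> t0; under eq_Rintegral do rewrite -expV.
  rewrite expY; last by move=> j; apply: addr_ge0; [exact: ltW|rewrite mulr_ge0].
  rewrite (bigD1 i)//= eqxx mulr1; congr (_ * _).
  by apply: eq_bigr => j /negbTE ->; rewrite mulr0 addr0.
have phi0 : \int[P]_x expR (- (s * V x)) = (Num.sqrt (a 0))^-1 * A.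
  rewrite -phi//; apply: eq_Rintegral => x _.
  by rewrite mul0r oppr0 expR0 mulr1.
have sa t : 0 <= t -> 0 < Num.sqrt (a t).
  by move=> t0; rewrite sqrtr_gt0 (lt_le_trans ltr01)// a1.
(* Up to sign, the difference quotient at [t = 0] with step [s_ n] of
   [t -> exp (- s V) exp (- t Y_i^2)]; its mean is explicit for every [n]. *)
pose D n x := expR (- (s * V x)) * ((1 - expR (- (s_ n * Y i x ^+ 2))) / s_ n).
have ie t : 0 <= t -> P.-integrable setT (fun x => (expR (- (s * V x)) * expR (- (t * Y i x ^+ 2)))%:E).
  move=> t0; apply: (@bounded_integrable _ _ _ _ _ 1).
    apply: measurable_funM => //; apply: measurableT_comp => //; apply: measurableT_comp => //.
    by apply: measurable_funM => //; exact: measurable_funX.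
  move=> x; have /andP[e0 e1] := @exp_le1 s x (ltW s0).
  rewrite normrM !ger0_norm ?expR_ge0// mulr_ile1 ?expR_ge0//.
  by rewrite -[leRHS]expR0 ler_expR oppr_le0 mulr_ge0// sqr_ge0.
have ED n : \int[P]_x D n x = 2 * l i * A / (Num.sqrt (a 0) * Num.sqrt (a (s_ n)) *
    (Num.sqrt (a (s_ n)) + Num.sqrt (a 0))).
  have sn := s_gt0 n; have sn' := ltW sn.
  have -> : \int[P]_x D n x = (s_ n)^-1 * ((Num.sqrt (a 0))^-1 * A - (Num.sqrt (a (s_ n)))^-1 * A).
    rewrite -!phi// -RintegralB//; [|exact: ie|exact: ie].
    rewrite -RintegralZl//; last by apply: integrable_EFinB => //; exact: ie.
    apply: eq_Rintegral => x _; rewrite /D mul0r oppr0 expR0; ring.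
  (* A difference of squares clears the small denominator [s_ n] from the difference quotient of
     [a^(-1/2)]. *)
  have e : Num.sqrt (a (s_ n)) ^+ 2 - Num.sqrt (a 0) ^+ 2 = 2 * s_ n * l i.
    rewrite !sqr_sqrtr ?(le_trans ler01)//; [|exact: a1|exact: a1].
    by rewrite /a; ring.
  have p0 := sa 0 (lexx 0); have p1 := sa _ sn'.
  set u := Num.sqrt (a 0) in e p0 *; set v := Num.sqrt (a (s_ n)) in e p1 *.
  have -> : 2 * l i = (v ^+ 2 - u ^+ 2) / s_ n by rewrite e; field; rewrite gt_eqF.
  by field; rewrite !gt_eqF// addr_gt0.
have [|x _||n x _|_ h] := @Rintegral_dominated _ _ R P setT D
   (fun x => Y i x ^+ 2 * expR (- (s * V x))) (cst ((s * kappa)^-1)) measurableT.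
- move=> n; apply: measurable_funM => //; apply: measurable_funM => //.
  apply: measurable_funB => //; apply: measurableT_comp => //; apply: measurableT_comp => //.
  by apply: measurable_funM => //; exact: measurable_funX.
- rewrite mulrC; apply: cvgM; first exact: cvg_cst.
  pose y := Y i x ^+ 2; have y0 : 0 <= y by exact: sqr_ge0.
  apply: (@squeeze_cvgr _ _ _ _ (fun n => y / (1 + s_ n * y)) (cst y)).
  + apply: nearW => n; have sn := s_gt0 n.
    have s1 : 0 < 1 + s_ n * y by rewrite ltr_pwDl// mulr_ge0// ltW.
    apply/andP; split; last first.
      by rewrite ler_pdivrMr//; have := expR_ge1Dx (- (s_ n * y)); rewrite /= mulrC; lra.
    rewrite ler_pdivlMr// expRN; have h := expR_ge1Dx (s_ n * y).
    have : (expR (s_ n * y))^-1 <= (1 + s_ n * y)^-1 by rewrite lef_pV2 ?posrE ?expR_gt0.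
    suff : y / (1 + s_ n * y) * s_ n = 1 - (1 + s_ n * y)^-1 by lra.
    by field; rewrite gt_eqF.
  + have h : 1 + s_ n * y @[n --> \oo] --> 1 + 0 * y.
      by apply: cvgD; [exact: cvg_cst|apply: cvgM => //; exact: cvg_cst].
    rewrite mul0r addr0 in h.
    rewrite -[X in _ --> X]divr1; apply: cvgM; first exact: cvg_cst.
    by apply: cvgV => //; exact: oner_neq0.
  + exact: cvg_cst.
- exact: finite_measure_integrable_cst.
- have /andP[e0 e1] := @exp_le1 s x (ltW s0).
  have sn := s_gt0 n.
  have y0 : 0 <= Y i x ^+ 2 by exact: sqr_ge0.
  have b1 : 0 <= (1 - expR (- (s_ n * Y i x ^+ 2))) / s_ n <= Y i x ^+ 2.
    apply/andP; split.
      by rewrite divr_ge0 ?(ltW sn)// subr_ge0 -[leRHS]expR0 ler_expR oppr_le0 mulr_ge0// ltW.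
    by rewrite ler_pdivrMr//; have := expR_ge1Dx (- (s_ n * Y i x ^+ 2)); rewrite mulrC; lra.
  move/andP: b1 => [b0 b1].
  rewrite /D ger0_norm; last by rewrite mulr_ge0// ltW.
  rewrite (le_trans (ler_wpM2l (ltW e0) b1))//.
  rewrite expRN mulrC ler_pdivrMr ?expR_gt0// ler_pdivlMl//.
  exact: sqr_le_exp.
have h2 : \int[P]_x D n x @[n --> \oo] --> 2 * l i * A / (Num.sqrt (a 0) * Num.sqrt (a 0) *
    (Num.sqrt (a 0) + Num.sqrt (a 0))).
  rewrite (funext ED).
  have ca : Num.sqrt (a (s_ n)) @[n --> \oo] --> Num.sqrt (a 0).
    apply: (cvg_comp (fun n => a (s_ n)) Num.sqrt); last exact: sqrt_continuous.
    rewrite /a; apply: cvgD; first exact: cvg_cst.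
    apply: cvgM; first exact: cvg_cst.
    apply: cvgM; last exact: cvg_cst.
    by apply: cvgD => //; exact: cvg_cst.
  apply: cvgM; first exact: cvg_cst.
  have p0 := sa 0 (lexx 0).
  apply: cvgV; first by rewrite gt_eqF// !mulr_gt0// addr_gt0.
  apply: cvgM; first by apply: cvgM => //; exact: cvg_cst.
  by apply: cvgD => //; exact: cvg_cst.
have p0 := sa 0 (lexx 0).
rewrite (cvg_unique _ h h2)// phi0.
have -> : 1 + 2 * (kappa * l i) * s = Num.sqrt (a 0) ^+ 2.
  by rewrite sqr_sqrtr ?(le_trans ler01)// ?a1// /a; ring.
by field; rewrite gt_eqF//= gt_eqF// addr_gt0.
Qed.

(** [P (V = 0) <= E[exp (- s V)] <= (1 + 2 s kappa l_i)^(-1/2)], which tends to 0 as [s] grows. *)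
Lemma quadratic_neq0 i : 0 < l i -> P [set x | V x = 0] = 0%E.
Proof.
move=> li; pose N := [set x | V x = 0].
have mN : measurable N.
  have -> : N = setT `&` V @^-1` [set 0] by rewrite setTI.
  by apply: mV => //; exact: measurable_set1.
have Pfin : P N = (fine (P N))%:E by rewrite fineK// fin_num_measure.
suff H : fine (P N) <= 0.
  by rewrite Pfin; congr EFin; apply/eqP; rewrite eq_le H fine_ge0.
apply/ler_addgt0Pr => e e0; rewrite add0r.
(* Chosen so that [2 s kappa l_i = e^(-2)], which makes the last bound at most [e]. *)
pose s := (e ^- 2) / (2 * (kappa * l i)).
have kl : 0 < 2 * (kappa * l i) by rewrite !mulr_gt0.
have s0 : 0 < s by rewrite divr_gt0// invr_gt0 exprn_gt0.
have s0' := ltW s0.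
have q0 j : 0 <= 2 * (s * kappa * l j) by rewrite mulr_ge0// mulr_ge0// mulr_ge0// ltW.
have i1 : P.-integrable setT (fun x => (expR (- (s * V x)))%:E).
  apply: (@bounded_integrable _ _ _ _ _ 1) => // x.
  by have /andP[e0' e1] := @exp_le1 s x (ltW s0); rewrite ger0_norm// ltW.
apply: (@le_trans _ _ (\int[P]_x expR (- (s * V x)))).
  rewrite -Rintegral_indic_prob//; apply: le_Rintegral => //.
    apply: (@bounded_integrable _ _ _ _ _ 1); first exact: measurable_indic.
    by move=> x; rewrite indicE; case: (_ \in _); rewrite ?normr1 ?normr0.
  move=> x _; rewrite indicE; case: (pselect (N x)) => Nx.
    by rewrite mem_set// Nx mulr0 oppr0 expR0.
  by rewrite memNset// expR_ge0.
have -> : \int[P]_x expR (- (s * V x)) = \prod_j (Num.sqrt (1 + 2 * (s * kappa * l j)))^-1.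
  rewrite -(expY (s := fun=> s * kappa)); last by move=> _; rewrite ltW// mulr_gt0.
  by apply: eq_Rintegral => x _; rewrite /V -mulr_sumr mulrA.
rewrite (bigD1 i)//=.
have q1 j : 0 <= (Num.sqrt (1 + 2 * (s * kappa * l j)))^-1 <= 1.
  rewrite invr_ge0 sqrtr_ge0/= invf_le1; last first.
    by rewrite sqrtr_gt0 ltr_pwDl.
  by rewrite -[leLHS]sqrtr1 ler_wsqrtr// lerDl.
apply: (@le_trans _ _ (Num.sqrt (1 + 2 * (s * kappa * l i)))^-1).
  rewrite ler_piMr//.
  by apply: prodr_ile1 => j _; exact: q1.
have -> : 2 * (s * kappa * l i) = e ^- 2.
  by rewrite /s; field; rewrite !gt_eqF.
have e2 : 0 < e ^- 2 by rewrite invr_gt0 exprn_gt0.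
rewrite invf_ple ?posrE//; last by rewrite sqrtr_gt0 addr_gt0.
have -> : e^-1 = Num.sqrt (e ^- 2) by rewrite -exprVn sqrtr_sqr ger0_norm// invr_ge0 ltW.
rewrite ler_wsqrtr//.
by rewrite lerDr.
Qed.

End Quadratic_law.

(** * The Gamma distribution *)

Section Monotone_limits.
Context {R : realType}.
Implicit Types f : R -> R.

(** Relations between Gamma integrals are proved below by comparing derivatives, together with a
    zero limit at one end of the half-line; this lemma and the next three package the method. *)
Lemma ge0_at_right0 f (f' : R -> R) b :
  (forall x : R, 0 < x <= b -> is_derive x 1 f (f' x)) ->
  (forall x : R, 0 < x < b -> 0 <= f' x) ->
  f x @[x --> 0^'+] --> 0 -> forall x, 0 < x <= b -> 0 <= f x.
Proof.
move=> df f'0 f0 x /andP[x0 xb]; apply: (cvgr_to_le f0).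
near=> y; have y0 : 0 < y by near: y; exact: nbhs_right_gt.
have yx : y <= x by near: y; exact: nbhs_right_le.
apply: (@derive_le_cc _ _ f') => // z /andP[yz zx].
- by apply: df; rewrite (lt_le_trans y0 yz) (le_trans zx xb).
- by apply: f'0; rewrite (lt_trans y0 yz) (lt_le_trans zx xb).
Unshelve. all: by end_near. Qed.

Lemma ge0_at_pinfty f (f' : R -> R) :
  (forall x : R, 0 < x -> is_derive x 1 f (f' x)) ->
  (forall x : R, 0 < x -> f' x <= 0) ->
  f x @[x --> +oo] --> 0 -> forall x : R, 0 < x -> 0 <= f x.
Proof.
move=> df f'0 f0 x x0; apply: (cvgr_to_le f0).
near=> y; have xy : x <= y.
  by near: y; exact: (nbhs_pinfty_ge (num_real x)).
rewrite -lerN2; apply: (@derive_le_cc _ (fun y => - f y) (fun y => - f' y)) => // z /andP[xz zy].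
- have := df z (lt_le_trans x0 xz) => ?; exact: is_deriveN.
- by rewrite oppr_ge0 f'0// (lt_trans x0).
Unshelve. all: by end_near. Qed.

Lemma eq0_at_right0 f b :
  (forall x : R, 0 < x <= b -> is_derive x 1 f 0) ->
  f x @[x --> 0^'+] --> 0 -> forall x, 0 < x <= b -> f x = 0.
Proof.
move=> df f0 x xb; apply/eqP; rewrite eq_le -[X in X && _]oppr_ge0; apply/andP; split.
- apply: (@ge0_at_right0 (fun x => - f x) (fun=> 0) b) => //.
    move=> y yb; have := df y yb => ?; rewrite -[X in is_derive _ _ _ X](@oppr0 R).
    exact: is_deriveN.
  by have := cvgN f0; rewrite oppr0; apply.
- exact: (@ge0_at_right0 f (fun=> 0) b).
Qed.

Lemma eq0_at_pinfty f :
  (forall x : R, 0 < x -> is_derive x 1 f 0) ->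
  f x @[x --> +oo] --> 0 -> forall x, 0 < x -> f x = 0.
Proof.
move=> df f0 x x0; apply/eqP; rewrite eq_le -[X in X && _]oppr_ge0; apply/andP; split.
- apply: (@ge0_at_pinfty (fun x => - f x) (fun=> 0)) => //.
    move=> y yb; have := df y yb => ?; rewrite -[X in is_derive _ _ _ X](@oppr0 R).
    exact: is_deriveN.
  by have := cvgN f0; rewrite oppr0; apply.
- exact: (@ge0_at_pinfty f (fun=> 0)).
Qed.

End Monotone_limits.

Section Exponential_tails.
Context {R : realType}.
Local Notation leb := (@lebesgue_measure R).

Lemma is_derive_exp2 (x : R) :
  is_derive x 1 (fun x : R => - 2 * expR (- (x / 2))) (expR (- (x / 2))).
Proof. by apply: is_derive_eq; rewrite /GRing.scale/=; field. Qed.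

Lemma continuous_exp2 (x : R) : {for x, continuous (fun x : R => expR (- (x / 2)))}.
Proof.
have h : is_derive x 1 (fun x : R => expR (- (x / 2))) (- 2^-1 * expR (- (x / 2))).
  by apply: is_derive_eq; rewrite /GRing.scale/=; field.
exact: is_derive_continuous h.
Qed.

Lemma cvg_exp2 : expR (- (x / 2)) @[x --> +oo] --> (0 : R).
Proof.
apply: (cvg_comp (fun x : R => x / 2) (fun y => expR (- y))); last exact: cvgr_expR.
by apply: gt0_cvgMly; [rewrite invr_gt0|exact: cvg_id].
Qed.

Lemma integrable_exp2 (z : R) : 0 <= z -> leb.-integrable `]z, +oo[ (fun x => (expR (- (x / 2)))%:E).
Proof.
move=> z0; suff h : leb.-integrable `]0%R, +oo[ (fun x => (expR (- (x / 2)))%:E).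
  by apply: integrableS h => //; apply: subset_itvr; rewrite bnd_simp.
have E : (\int[leb]_(x in `]0%R, +oo[) (expR (- (x / 2)))%:E = (0 - (- 2 : R))%:E)%E.
  apply: (@ge0_FTC_0y _ (fun x => expR (- (x / 2))) (fun x => - 2 * expR (- (x / 2))) (- 2) 0).
  - by move=> x _; exact: is_derive_exp2.
  - by move=> x _; exact: continuous_exp2.
  - by move=> x _; exact: expR_ge0.
  - apply: cvg_at_right_filter; rewrite -[X in _ --> X]mulr1.
    apply: cvgM; first exact: cvg_cst.
    by have := @continuous_exp2 0; rewrite /prop_for /continuous_at mul0r oppr0 expR0.
  - by rewrite -(mulr0 (- 2)); apply: cvgM; [exact: cvg_cst|exact: cvg_exp2].
apply/integrableP; split.
  by apply/measurable_EFinP; apply: measurable_fun_0y => x _; exact: continuous_exp2.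
under eq_integral do rewrite abse_EFin ger0_norm ?expR_ge0//.
by rewrite E ltry.
Qed.

Lemma Rintegral_exp2 (z : R) : 0 < z -> \int[leb]_(x in `]z, +oo[) expR (- (x / 2)) = 2 * expR (- (z / 2)).
Proof.
move=> z0; apply/eqP; rewrite -subr_eq0; apply/eqP.
apply: (@eq0_at_pinfty _ (fun z => \int[leb]_(x in `]z, +oo[) expR (- (x / 2)) - 2 * expR (- (z / 2)))) => //.
  move=> x x0.
  have h1 := @is_derive_int_y R (fun x => expR (- (x / 2))) (fun x _ => @continuous_exp2 x) (fun x h => integrable_exp2 (ltW h)) x x0.
  have := is_derive_exp2 x => h2.
  have -> : (fun z => \int[leb]_(x in `]z, +oo[) expR (- (x / 2)) - 2 * expR (- (z / 2))) =
    (fun z => \int[leb]_(x in `]z, +oo[) expR (- (x / 2)) + (- 2) * expR (- (z / 2))).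
    by apply/funext => y; rewrite mulNr.
  by apply: is_derive_eq; rewrite addrC subrr.
rewrite -[X in _ --> X](subrr 0); apply: cvgB.
  exact: (cvg_int_y (integrable_exp2 (lexx 0))).
by rewrite -(mulr0 2); apply: cvgM; [exact: cvg_cst|exact: cvg_exp2].
Qed.

Lemma exp_tail_integrable (f : R -> R) (C z : R) : 0 < z ->
  (forall x, 0 < x -> {for x, continuous f}) ->
  (forall x, z < x -> `|f x| <= C * expR (- (x / 2))) ->
  leb.-integrable `]z, +oo[ (fun x => (f x)%:E).
Proof.
move=> z0 cf fC.
have mI : measurable (`]z, +oo[%classic : set (measurableTypeR R)) by exact: measurable_itv.
apply: (integrable_EFin_le mI (g := fun x => C * expR (- (x / 2)))).
- apply: (measurable_funS (measurable_itv `]0%R, +oo[)); last exact: measurable_fun_0y.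
  by apply: subset_itvr; rewrite bnd_simp ltW.
- by move=> x /=; rewrite in_itv/= andbT; exact: fC.
- by apply: (integrable_EFinZ mI); exact/integrable_exp2/ltW.
Qed.

Lemma exp_tail_le (f : R -> R) (C z x : R) : 0 < z ->
  (forall x, 0 < x -> {for x, continuous f}) ->
  (forall x, z < x -> `|f x| <= C * expR (- (x / 2))) -> z <= x ->
  `|\int[leb]_(t in `]x, +oo[) f t| <= 2 * C * expR (- (x / 2)).
Proof.
move=> z0 cf fC zx; have x0 := lt_le_trans z0 zx.
have fC' t : x < t -> `|f t| <= C * expR (- (t / 2)).
  by move=> xt; apply: fC; exact: le_lt_trans xt.
have i1 := exp_tail_integrable x0 cf fC'.
have mI : measurable (`]x, +oo[%classic : set (measurableTypeR R)) by exact: measurable_itv.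
rewrite (le_trans (le_normr_Rintegral mI i1))//.
rewrite -mulrA mulrCA -Rintegral_exp2// -RintegralZl//; last exact/integrable_exp2/ltW.
apply: le_Rintegral => //.
- exact: integrable_norm i1.
- by apply: (integrable_EFinZ mI); exact/integrable_exp2/ltW.
- by move=> t /=; rewrite in_itv/= andbT; exact: fC'.
Qed.

End Exponential_tails.

Section Gamma_density.
Context {R : realType}.
Local Notation leb := (@lebesgue_measure R).

Lemma cvg_powR_y (a : R) : 0 < a -> x `^ a @[x --> +oo] --> +oo.
Proof.
move=> a0; apply/cvgryPge => M; near=> x.
have M0 : 0 <= `|M| `^ a^-1 by exact: powR_ge0.
have Mx : `|M| `^ a^-1 <= x by near: x; exact: nbhs_pinfty_ge.
rewrite (le_trans (ler_norm M))// -[leLHS]powRr1// -(mulVf (lt0r_neq0 a0)) powRrM.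
apply: ge0_ler_powR => //; rewrite ?nnegrE ?(ltW a0)//; exact: le_trans Mx.
Unshelve. all: by end_near. Qed.

(** This is [ln t <= t] at [t = x / (2 a)]. Only half of the exponential is spent on the power, so
    that [x^a exp (- x)] keeps the tail [exp (- x / 2)]. *)
Lemma powR_le_exp (a x : R) : 0 < a -> 0 < x ->
  x `^ a <= (2 * a) `^ a * expR (x / 2).
Proof.
move=> a0 x0; have a20 : 0 < 2 * a by rewrite mulr_gt0.
rewrite /powR !gt_eqF// -expRD ler_expR.
have : ln (x / (2 * a)) <= x / (2 * a).
  rewrite -[leRHS]addr0 -lerBlDr subr0.
  by have := @le_ln1Dx R (x / (2 * a) - 1); rewrite [1 + _]addrC subrK ltrDr divr_gt0// => /(_ isT); lra.
rewrite ln_div ?posrE// => /(ler_wpM2l (ltW a0)).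
have -> : a * (x / (2 * a)) = x / 2 by field; rewrite gt_eqF.
by rewrite mulrBr; lra.
Qed.

Section Shape.
Variable a : R.
Hypothesis a0 : 0 < a.

Let f (x : R) := x `^ (a - 1) * expR (- x).

Lemma powRB1 (x : R) : 0 < x -> x `^ (a - 1) = x `^ a / x.
Proof.
move=> x0; rewrite powRD; last by rewrite (gt_eqF x0) implybT.
by rewrite powR_inv1// ltW.
Qed.

(** The dominating function [g] has the elementary primitive [- 1 / (a (1 + x^a))] and is adequate
    at both ends: it behaves like [x^(a - 1)] near 0, where the integrand may be singular, and is
    integrable at infinity. *)
Lemma gamma_integrand_integrable : leb.-integrable `]0%R, +oo[ (fun x => (f x)%:E).
Proof.
pose C := (1 + (2 * a) `^ a) ^+ 2.
pose g (x : R) := x `^ (a - 1) / (1 + x `^ a) ^+ 2.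
have p0 (x : R) : 0 < 1 + x `^ a by rewrite ltr_pwDl// powR_ge0.
have dg (x : R) : 0 < x -> is_derive x 1 (fun x : R => - a^-1 * (1 + x `^ a)^-1) (g x).
  move=> x0; have h := is_derive1_powR a x0.
  have h1 : is_derive x 1 (fun x : R => 1 + x `^ a) (a * x `^ (a - 1)).
    by have := is_deriveD (is_derive_cst (1 : R) x (1 : R)) h; rewrite add0r.
  have nz : 1 + x `^ a != 0 by rewrite gt_eqF.
  have h2 := @is_deriveV _ (fun x : R => 1 + x `^ a) _ _ _ nz h1.
  apply: is_derive_eq; rewrite /g/GRing.scale/= -exprVn; field.
  by rewrite (gt_eqF a0) nz.
have cpow (b x : R) : 0 < x -> {for x, continuous (fun x : R => x `^ b)}.
  by move=> x0; exact: is_derive_continuous (is_derive1_powR b x0).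
have cg (x : R) : 0 < x -> {for x, continuous g}.
  move=> x0; apply: cvgM; first exact: cpow.
  apply: cvgV; first by rewrite expf_neq0// gt_eqF.
  rewrite expr2; under eq_fun do rewrite expr2.
  have h : 1 + y `^ a @[y --> x] --> 1 + x `^ a by apply: cvgD; [exact: cvg_cst|exact: cpow].
  exact: cvgM.
have g0 (x : R) : 0 <= g x by rewrite divr_ge0 ?powR_ge0 ?sqr_ge0.
have Eg : (\int[leb]_(x in `]0%R, +oo[) (g x)%:E = (0 - - a^-1 : R)%:E)%E.
  apply: (ge0_FTC_0y dg) => //.
  - have e1 : - a^-1 = - a^-1 * (1 + 0)^-1 by rewrite addr0 invr1 mulr1.
    rewrite [X in _ --> X]e1.
    apply: cvgM; first exact: cvg_cst.
    apply: cvgV; first by rewrite addr0 oner_neq0.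
    by apply: cvgD; [exact: cvg_cst|exact: powR_cvg0].
  - rewrite -(mulr0 (- a^-1)); apply: cvgM; first exact: cvg_cst.
    apply/gtr0_cvgV0; first by apply: nearW => x; exact: p0.
    apply/cvgryPge => M; near=> x.
    rewrite (@le_trans _ _ (x `^ a))//; last by rewrite lerDr.
    by near: x; move: M; apply/cvgryPge; exact: cvg_powR_y.
have ig : leb.-integrable `]0%R, +oo[ (fun x => (g x)%:E).
  apply/integrableP; split; first by apply/measurable_EFinP; exact: measurable_fun_0y.
  under eq_integral do rewrite abse_EFin ger0_norm ?g0//.
  by rewrite Eg ltry.
have mI : measurable (`]0%R, +oo[%classic : set (measurableTypeR R)) by exact: measurable_itv.
apply: (integrable_EFin_le mI (g := fun x => C * g x)).
- apply: measurable_fun_0y => x x0; apply: cvgM; first exact: cpow.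
  by apply: continuous_comp; [exact: continuousN|exact: continuous_expR].
- move=> x /=; rewrite in_itv/= andbT => x0.
  rewrite ger0_norm; last by rewrite mulr_ge0 ?powR_ge0 ?expR_ge0.
  rewrite /f /g mulrCA ler_wpM2l ?powR_ge0// expRN ler_pdivlMr ?exprn_gt0//.
  rewrite ler_pdivrMl ?expR_gt0//.
  have -> : x = x / 2 + x / 2 by field.
  rewrite expRD; have -> : x / 2 + x / 2 = x by field.
  (* Both 1 and [x^a] are at most multiples of [exp (x / 2)], so [(1 + x^a)^2 <= C exp x]. *)
  have e1 : 1 <= expR (x / 2) by rewrite -[leLHS]expR0 ler_expR divr_ge0// ltW.
  have := powR_le_exp a0 x0; set u := expR (x / 2) in e1 *; set k := (2 * a) `^ a => h.
  have k0 : 0 <= k by exact: powR_ge0.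
  have : 1 + x `^ a <= (1 + k) * u by nra.
  move=> hh; have := ler_pM (ltW (p0 x)) (ltW (p0 x)) hh hh.
  by rewrite /C -/k !expr2 => /le_trans; apply; rewrite le_eqVlt; apply/orP; left; apply/eqP; ring.
- exact: integrable_EFinZ.
Unshelve. all: by end_near. Qed.

Lemma Gamma_fun_gt0 : 0 < Gamma_fun a.
Proof.
have i1 := gamma_integrand_integrable.
have sub : `]1%R, 2%R[ `<=` (`]0%R, +oo[%classic : set R).
  by move=> x /=; rewrite !in_itv/= => /andP[x1 _]; rewrite andbT (lt_trans ltr01).
(* On []1, 2[] one has [0 <= ln x <= 2], so [m] is a lower bound of the integrand whatever the sign
   of [a - 1]. *)
pose m : R := expR (- (2 * `|a - 1| + 2)).
apply: (@lt_le_trans _ _ (\int[leb]_(x in `]1%R, 2%R[) m)).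
  rewrite Rintegral_cst//= lebesgue_measure_itv/= lte_fin.
  by rewrite ifT ?ltr1n// -EFinB/= mulr_gt0 ?expR_gt0//; lra.
apply: (@le_trans _ _ (\int[leb]_(x in `]1%R, 2%R[) f x)).
  apply: le_Rintegral => //.
  - apply/integrableP; split; first by apply/measurable_EFinP; exact: measurable_cst.
    rewrite integral_cst//= lebesgue_measure_itv/= lte_fin ltr1n//= -EFinB -EFinM.
    exact: ltry.
  - exact: integrableS i1.
  - move=> x /=; rewrite in_itv/= => /andP[x1 x2]; have x0 := lt_trans ltr01 x1.
    rewrite /f /powR gt_eqF// -expRD ler_expR opprD lerD//; last by rewrite lerN2 ltW.
    have l0 : 0 <= ln x by exact/ln_ge0/ltW.
    have l2 : ln x <= 2.
      have := @le_ln1Dx R (x - 1); rewrite [1 + _]addrC subrK ltrDr => /(_ x0); lra.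
    have := ler_norm (- (a - 1)); rewrite normrN.
    by have := normr_ge0 (a - 1); set n := `|_|; nra.
rewrite /Rintegral fine_le//.
- by apply: integrable_fin_num => //; exact: integrableS i1.
- by apply: integrable_fin_num.
- apply: ge0_subset_integral => //.
  + exact: measurable_int i1.
  + by move=> x _; rewrite lee_fin mulr_ge0 ?powR_ge0 ?expR_ge0.
Qed.

Variable b : R.
Hypothesis b0 : 0 < b.
Let p := gamma_pdf a b.

Let k := (Gamma_fun a * b `^ a)^-1.
Let k0 : 0 < k. Proof. by rewrite invr_gt0 mulr_gt0 ?Gamma_fun_gt0 ?powR_gt0. Qed.

Let pE (x : R) : 0 < x -> p x = k * x `^ (a - 1) * expR (- x / b).
Proof. by move=> x0; rewrite /p /gamma_pdf x0. Qed.

Lemma gamma_pdf_gt0 (x : R) : 0 < x -> 0 < p x.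
Proof. by move=> x0; rewrite pE// !mulr_gt0 ?powR_gt0 ?expR_gt0. Qed.

Lemma gamma_pdf_ge0 (x : R) : 0 <= p x.
Proof.
have [x0|x0] := ltP 0 x; first exact/ltW/gamma_pdf_gt0.
by rewrite /p/gamma_pdf ltNge x0.
Qed.

Lemma is_derive_gamma_pdf (x : R) : 0 < x ->
  is_derive x 1 p (p x * ((a - 1) / x - b^-1)).
Proof.
move=> x0.
have h := is_derive1_powR (a - 1) x0.
have h1 : is_derive x 1 (fun x : R => k * x `^ (a - 1) * expR (- x / b)) (p x * ((a - 1) / x - b^-1)).
  apply: is_derive_eq; rewrite /GRing.scale/= pE//.
  have -> : x `^ (a - 1 - 1) = x `^ (a - 1) / x.
    rewrite [LHS]powRD; last by rewrite (gt_eqF x0) implybT.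
    by rewrite powR_inv1// ltW.
  by field; rewrite !gt_eqF.
apply: near_eq_is_derive h1.
  near=> y; rewrite pE//; near: y.
  exact: lt_nbhsr.
Unshelve. all: by end_near. Qed.

Lemma continuous_gamma_pdf (x : R) : 0 < x -> {for x, continuous p}.
Proof. by move=> x0; exact: is_derive_continuous (is_derive_gamma_pdf x0). Qed.

Lemma gamma_pdf_npos (x : R) : x <= 0 -> p x = 0.
Proof. by move=> x0; rewrite /p /gamma_pdf ltNge x0. Qed.

Lemma measurable_gamma_pdf : measurable_fun setT p.
Proof.
have -> : p = (fun x : R => ((fun x => k * x `^ (a - 1) * expR (- x / b)) \_ (`]0%R, +oo[)) x).
  apply/funext => x; rewrite patchE; case: ifPn => [|h].
    by rewrite inE/= in_itv/= andbT => x0; rewrite pE.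
  rewrite gamma_pdf_npos// leNgt; apply/negP => x0; move/negP: h; apply.
  by rewrite inE/= in_itv/= x0.
apply/(measurable_restrictT (fun x : R => k * x `^ (a - 1) * expR (- x / b))); first exact: measurable_itv.
apply: measurable_fun_0y => x x0.
have h : k * y `^ (a - 1) * expR (- y / b) @[y --> x] --> k * x `^ (a - 1) * expR (- x / b).
  apply: cvgM.
    by apply: cvgM; [exact: cvg_cst|exact: is_derive_continuous (is_derive1_powR _ x0)].
  apply: continuous_comp; last exact: continuous_expR.
  by apply: cvgM; [apply: cvgN; exact: cvg_id|exact: cvg_cst].
exact: h.
Qed.

Lemma mul_gamma_pdf (x : R) : 0 < x -> x * p x = k * x `^ a * expR (- x / b).
Proof. by move=> x0; rewrite pE// powRB1//; field; rewrite gt_eqF. Qed.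

Lemma cvg_mul_gamma_pdf_0 : x * p x @[x --> 0^'+] --> 0.
Proof.
have h : k * x `^ a * expR (- x / b) @[x --> 0^'+] --> k * 0 * expR (- 0 / b); last first.
  rewrite mulr0 mul0r in h; apply: cvg_trans h.
  by apply: near_eq_cvg; near=> x; rewrite mul_gamma_pdf.
apply: cvgM; first by apply: cvgM; [exact: cvg_cst|exact: powR_cvg0].
apply: cvg_at_right_filter.
apply: (@continuous_comp _ _ _ (fun x : R => - x / b) expR); last exact: continuous_expR.
by apply: cvgM; [apply: cvgN; exact: cvg_id|exact: cvg_cst].
Unshelve. all: by end_near. Qed.

End Shape.

Section Unit_scale.
Variable a : R.
Hypothesis a0 : 0 < a.
Local Notation p := (gamma_pdf a 1).
Local Notation P := (gamma_lower a).
Local Notation Q := (gamma_upper a).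

Lemma gamma_pdf1E (x : R) : 0 < x -> p x = (Gamma_fun a)^-1 * (x `^ (a - 1) * expR (- x)).
Proof. by move=> x0; rewrite /gamma_pdf x0 powR1 mulr1 divr1 mulrA. Qed.

Lemma integrable_gamma_pdf : leb.-integrable `]0%R, +oo[ (fun x => (p x)%:E).
Proof.
have mI : measurable (`]0%R, +oo[%classic : set (measurableTypeR R)) by exact: measurable_itv.
have := integrable_EFinZ mI (Gamma_fun a)^-1 (gamma_integrand_integrable a0).
apply: eq_integrable => // x; rewrite inE/= in_itv/= andbT => x0.
by rewrite gamma_pdf1E.
Qed.

Lemma gamma_pdf_mass : \int[leb]_(x in `]0%R, +oo[) p x = 1.
Proof.
transitivity (\int[leb]_(x in `]0%R, +oo[) ((Gamma_fun a)^-1 * (x `^ (a - 1) * expR (- x)))).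
  by apply: eq_Rintegral => x; rewrite inE/= in_itv/= andbT => x0; rewrite gamma_pdf1E.
rewrite RintegralZl//; last exact: gamma_integrand_integrable.
by rewrite mulVf// gt_eqF// Gamma_fun_gt0.
Qed.

(** Makes [y p(y)] an integrating factor of the Stein equation:
    [(y p F)' = p (y F' + (a - y) F)]. *)
Lemma is_derive_mul_gamma_pdf (x : R) : 0 < x -> is_derive x 1 (fun x : R => x * p x) ((a - x) * p x).
Proof.
move=> x0; have h := is_derive_gamma_pdf a ltr01 x0.
have h1 := is_derive_id x (1 : R).
have := is_deriveM h1 h; rewrite /GRing.scale/=.
have -> : x * (p x * ((a - 1) / x - 1^-1)) + p x * 1 = (a - x) * p x.
  by rewrite invr1; field; exact: lt0r_neq0.
exact.
Qed.

Let C := (Gamma_fun a)^-1 * (2 * a) `^ a.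

Lemma mul_gamma_pdf_le : exists C : R, 0 <= C /\ forall x : R, 0 < x -> x * p x <= C * expR (- (x / 2)).
Proof.
exists C; split; first by rewrite mulr_ge0 ?powR_ge0// invr_ge0 ltW// Gamma_fun_gt0.
move=> x x0; rewrite gamma_pdf1E// powRB1//.
have -> : x * ((Gamma_fun a)^-1 * (x `^ a / x * expR (- x))) = (Gamma_fun a)^-1 * (x `^ a * expR (- x)).
  by field; rewrite !gt_eqF// Gamma_fun_gt0.
rewrite /C -mulrA ler_wpM2l// ?invr_ge0 ?(ltW (Gamma_fun_gt0 a0))//.
have -> : - (x / 2) = x / 2 - x by field.
by rewrite expRD mulrA ler_wpM2r ?expR_ge0// powR_le_exp.
Qed.

Lemma cvg_mul_gamma_pdf_y : x * p x @[x --> +oo] --> 0.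
Proof.
have [C' [C0 h]] := mul_gamma_pdf_le.
apply: (@squeeze_cvgr _ _ _ _ (cst 0) (fun x => C' * expR (- (x / 2)))).
- near=> x; have x0 : 0 < x by near: x; exact: nbhs_pinfty_gt.
  by rewrite h// andbT mulr_ge0 ?gamma_pdf_ge0 ?ltW.
- exact: cvg_cst.
- by rewrite -(mulr0 C'); apply: cvgM; [exact: cvg_cst|exact: cvg_exp2].
Unshelve. all: by end_near. Qed.

Lemma integrable_gamma_pdf_0 x : leb.-integrable `]0, x] (fun x => (p x)%:E).
Proof.
by apply: integrableS integrable_gamma_pdf => //; apply: subset_itvl; rewrite bnd_simp.
Qed.

Lemma integrable_gamma_pdf_y x : 0 <= x -> leb.-integrable `]x, +oo[ (fun x => (p x)%:E).
Proof.
by move=> x0; apply: integrableS integrable_gamma_pdf => //; apply: subset_itvr; rewrite bnd_simp.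
Qed.

Let cp (x : R) : 0 < x -> {for x, continuous p}.
Proof. exact: continuous_gamma_pdf. Qed.

Lemma is_derive_gamma_lower (x : R) : 0 < x -> is_derive x 1 P (p x).
Proof.
exact: (@is_derive_int_0 _ p cp (fun x _ => integrable_gamma_pdf_0 x) x).
Qed.

Lemma is_derive_gamma_upper (x : R) : 0 < x -> is_derive x 1 Q (- p x).
Proof.
exact: (@is_derive_int_y _ p cp (fun x h => integrable_gamma_pdf_y (ltW h)) x).
Qed.

Lemma gamma_lowerD (x : R) : 0 < x -> P x + Q x = 1.
Proof. by move=> x0; rewrite -gamma_pdf_mass (Rintegral_0y_split x0)//; exact: integrable_gamma_pdf. Qed.

Lemma cvg_gamma_lower_0 : P x @[x --> 0^'+] --> 0.
Proof.
apply: cvg_int_0; apply: integrableS (integrable_gamma_pdf_0 1) => //.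
by apply: subset_itvl; rewrite bnd_simp.
Qed.

Lemma cvg_gamma_upper_y : Q x @[x --> +oo] --> 0.
Proof. exact: cvg_int_y (integrable_gamma_pdf_y (lexx 0)). Qed.

Lemma gamma_lower_ge0 (x : R) : 0 < x -> 0 <= P x.
Proof.
by move=> x0; apply: Rintegral_ge0 => y _; exact: gamma_pdf_ge0.
Qed.

Lemma gamma_upper_ge0 (x : R) : 0 <= Q x.
Proof. by apply: Rintegral_ge0 => y _; exact: gamma_pdf_ge0. Qed.

End Unit_scale.
End Gamma_density.

(** * Mills ratios *)

Section Derivative_helpers.
Context {R : realType}.

Lemma derive1n2_eq (f f1 : R -> R) (f2 : R) (z : R) : 0 < z ->
  (forall x : R, 0 < x -> is_derive x 1 f (f1 x)) -> is_derive z 1 f1 f2 ->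
  derive1n 2 f z = f2.
Proof.
move=> z0 df df1; rewrite /= .
apply: derive1_eq; apply: near_eq_is_derive df1.
near=> y; apply/esym/derive1_eq/df; near: y; exact: lt_nbhsr.
Unshelve. all: by end_near. Qed.

Lemma bounded_integrable_0 (f : R -> R) (B x : R) :
  (forall y : R, 0 < y -> {for y, continuous f}) -> (forall y, 0 < y -> y <= x -> `|f y| <= B) ->
  (@lebesgue_measure R).-integrable `]0, x] (fun y => (f y)%:E).
Proof.
move=> cf fB.
have mI : measurable (`]0, x]%classic : set (measurableTypeR R)) by exact: measurable_itv.
apply: (integrable_EFin_le mI (g := cst B)).
- apply: (measurable_funS (measurable_itv `]0%R, +oo[)); last exact: measurable_fun_0y.
  by apply: subset_itvl; rewrite bnd_simp.
- by move=> y /=; rewrite in_itv/= => /andP[]; exact: fB.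
- apply/integrableP; split; first by apply/measurable_EFinP; exact: measurable_cst.
  rewrite /= integral_cst//= lebesgue_measure_itv/=; case: ifP => _.
    by rewrite -EFinB -EFinM ltry.
  by rewrite mule0 ltry.
Qed.

End Derivative_helpers.

Section Mills.
Context {R : realType}.
Local Notation leb := (@lebesgue_measure R).
Variable a : R.
Hypothesis a0 : 0 < a.
Local Notation p := (gamma_pdf a 1).
Local Notation P := (gamma_lower a).
Local Notation Q := (gamma_upper a).
Local Notation P1 := (gamma_lower1 a).
Local Notation Q1 := (gamma_upper1 a).

Lemma gamma_lower_continuous (x : R) : 0 < x -> {for x, continuous P}.
Proof. by move=> x0; exact: is_derive_continuous (is_derive_gamma_lower a0 x0). Qed.

Lemma gamma_upper_continuous (x : R) : 0 < x -> {for x, continuous Q}.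
Proof. by move=> x0; exact: is_derive_continuous (is_derive_gamma_upper a0 x0). Qed.

Lemma gamma_lower_le1 (x : R) : 0 < x -> 0 <= P x <= 1.
Proof.
move=> x0; have := gamma_lowerD a0 x0; have := gamma_upper_ge0 a0 x.
by have := gamma_lower_ge0 a0 x0; lra.
Qed.

Lemma gamma_upper_le1 (x : R) : 0 < x -> 0 <= Q x <= 1.
Proof.
move=> x0; have := gamma_lowerD a0 x0; have := gamma_upper_ge0 a0 x.
by have := gamma_lower_ge0 a0 x0; lra.
Qed.

(** Past [z] the density is at most [(C / z) exp (- y / 2)], a bound that is then integrated. *)
Lemma gamma_upper_tail z : 0 < z ->
  exists2 C : R, 0 <= C & forall x, z < x -> Q x <= C * expR (- (x / 2)).
Proof.
move=> z0; have [C [C0 h]] := mul_gamma_pdf_le a0.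
exists (2 * (C / z)); first by rewrite mulr_ge0// divr_ge0// ltW.
move=> x zx; rewrite -[leLHS]ger0_norm ?gamma_upper_ge0//.
apply: (exp_tail_le z0); last exact: ltW.
- by move=> y y0; exact: continuous_gamma_pdf.
- move=> y zy; have y0 := lt_trans z0 zy.
  rewrite ger0_norm ?gamma_pdf_ge0// mulrAC ler_pdivlMr//.
  apply: le_trans (h y y0); rewrite mulrC ler_wpM2r ?gamma_pdf_ge0//.
  exact: ltW.
Qed.

Section Weight.
Variables (K : R -> R) (B : R).
Hypothesis cK : forall x : R, 0 < x -> {for x, continuous K}.
Hypothesis KB : forall x : R, 0 < x -> `|K x| <= B.

Let B0 : 0 <= B. Proof. exact: le_trans (normr_ge0 _) (KB ltr01). Qed.

Lemma lower_weight_integrable x : leb.-integrable `]0, x] (fun y => (K y * P y)%:E).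
Proof.
apply: (@bounded_integrable_0 _ _ B).
- by move=> y y0; apply: cvgM; [exact: cK|exact: gamma_lower_continuous].
- move=> y y0 _; have /andP[P0 PP] := gamma_lower_le1 y0.
  by rewrite normrM -[leRHS]mulr1 ler_pM// ?KB// ger0_norm.
Qed.

Lemma upper_weight_integrable x : 0 < x -> leb.-integrable `]x, +oo[ (fun y => (K y * Q y)%:E).
Proof.
move=> x0; have [C C0 h] := gamma_upper_tail x0.
apply: (@exp_tail_integrable _ _ (B * C)) => //.
- by move=> y y0; apply: cvgM; [exact: cK|exact: gamma_upper_continuous].
- move=> y xy; have y0 := lt_trans x0 xy.
  rewrite normrM -mulrA ler_pM// ?KB// ger0_norm ?gamma_upper_ge0//; exact: h.
Qed.

Lemma is_derive_lower_weight (x : R) : 0 < x ->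
  is_derive x 1 (fun y => \int[leb]_(t in `]0, y[) (K t * P t)) (K x * P x).
Proof.
apply: (@is_derive_int_0 _ (fun t => K t * P t)) => [y y0|y _].
- by apply: cvgM; [exact: cK|exact: gamma_lower_continuous].
- exact: lower_weight_integrable.
Qed.

Lemma is_derive_upper_weight (x : R) : 0 < x ->
  is_derive x 1 (fun y => \int[leb]_(t in `]y, +oo[) (K t * Q t)) (- (K x * Q x)).
Proof.
apply: (@is_derive_int_y _ (fun t => K t * Q t)) => [y y0|y].
- by apply: cvgM; [exact: cK|exact: gamma_upper_continuous].
- exact: upper_weight_integrable.
Qed.

Lemma cvg_lower_weight : \int[leb]_(t in `]0, y[) (K t * P t) @[y --> 0^'+] --> 0.
Proof.
apply: cvg_int_0; apply: integrableS (lower_weight_integrable 1) => //.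
by apply: subset_itvl; rewrite bnd_simp.
Qed.

Lemma cvg_upper_weight : \int[leb]_(t in `]y, +oo[) (K t * Q t) @[y --> +oo] --> 0.
Proof. exact: cvg_int_y (upper_weight_integrable ltr01). Qed.

End Weight.

Let onec (x : R) : 0 < x -> {for x, continuous (fun=> 1 : R)}.
Proof. by move=> _; exact: cvg_cst. Qed.
Let oneB (x : R) : 0 < x -> `|(fun=> 1 : R) x| <= 1.
Proof. by rewrite normr1. Qed.

Let P1E y : P1 y = \int[leb]_(t in `]0, y[) (1 * P t).
Proof. by apply: eq_Rintegral => x _; rewrite mul1r. Qed.
Let Q1E y : Q1 y = \int[leb]_(t in `]y, +oo[) (1 * Q t).
Proof. by apply: eq_Rintegral => x _; rewrite mul1r. Qed.

Lemma is_derive_gamma_lower1 (x : R) : 0 < x -> is_derive x 1 P1 (P x).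
Proof. by move=> /(is_derive_lower_weight onec oneB); rewrite mul1r -(funext P1E). Qed.

Lemma is_derive_gamma_upper1 (x : R) : 0 < x -> is_derive x 1 Q1 (- Q x).
Proof. by move=> /(is_derive_upper_weight onec oneB); rewrite mul1r -(funext Q1E). Qed.

Lemma cvg_gamma_lower1 : P1 y @[y --> 0^'+] --> 0.
Proof. by rewrite (funext P1E); exact: cvg_lower_weight onec oneB. Qed.

Lemma cvg_gamma_upper1 : Q1 y @[y --> +oo] --> 0.
Proof. by rewrite (funext Q1E); exact: cvg_upper_weight onec oneB. Qed.

Lemma gamma_lower1_ge0 x : 0 <= P1 x.
Proof.
apply: Rintegral_ge0 => y /=; rewrite in_itv/= => /andP[y0 _].
exact: gamma_lower_ge0.
Qed.

Lemma gamma_upper1_ge0 x : 0 <= Q1 x.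
Proof. by apply: Rintegral_ge0 => y _; exact: gamma_upper_ge0. Qed.

Lemma lower_weight_le (K : R -> R) (B x : R) : 0 < x ->
  (forall x : R, 0 < x -> {for x, continuous K}) -> (forall x : R, 0 < x -> `|K x| <= B) ->
  `|\int[leb]_(t in `]0, x[) (K t * P t)| <= B * P1 x.
Proof.
move=> x0 cK KB.
have mI : measurable (`]0, x[%classic : set (measurableTypeR R)) by exact: measurable_itv.
have sub : `]0, x[ `<=` (`]0, x]%classic : set R) by apply: subset_itvl; rewrite bnd_simp.
have i1 : leb.-integrable `]0, x[ (fun y => (K y * P y)%:E).
  by apply: integrableS (lower_weight_integrable cK KB x).
have i2 : leb.-integrable `]0, x[ (fun y => (1 * P y)%:E).
  by apply: integrableS (lower_weight_integrable onec oneB x).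
rewrite (le_trans (le_normr_Rintegral mI i1))// P1E -RintegralZl//.
apply: le_Rintegral => //.
- exact: integrable_norm i1.
- exact: integrable_EFinZ.
- move=> t /=; rewrite in_itv/= => /andP[t0 _].
  by rewrite normrM mul1r [X in _ * X <= _]ger0_norm ?gamma_lower_ge0// ler_wpM2r ?gamma_lower_ge0// KB.
Qed.

Lemma upper_weight_le (K : R -> R) (B x : R) : 0 < x ->
  (forall x : R, 0 < x -> {for x, continuous K}) -> (forall x : R, 0 < x -> `|K x| <= B) ->
  `|\int[leb]_(t in `]x, +oo[) (K t * Q t)| <= B * Q1 x.
Proof.
move=> x0 cK KB.
have mI : measurable (`]x, +oo[%classic : set (measurableTypeR R)) by exact: measurable_itv.
have i1 := upper_weight_integrable cK KB x0.
have i2 := upper_weight_integrable onec oneB x0.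
rewrite (le_trans (le_normr_Rintegral mI i1))// Q1E -RintegralZl//.
apply: le_Rintegral => //.
- exact: integrable_norm i1.
- exact: integrable_EFinZ.
- move=> t /=; rewrite in_itv/= andbT => xt; have t0 := lt_trans x0 xt.
  by rewrite normrM mul1r [X in _ * X <= _]ger0_norm ?gamma_upper_ge0// ler_wpM2r ?gamma_upper_ge0// KB.
Qed.

Lemma cvg_mul_exp2 : x * expR (- (x / 2)) @[x --> +oo] --> (0 : R).
Proof.
have c4 : expR (- (x / 4)) @[x --> +oo] --> (0 : R).
  apply: (cvg_comp (fun x : R => x / 4) (fun y => expR (- y))); last exact: cvgr_expR.
  by apply: gt0_cvgMly; [rewrite invr_gt0|exact: cvg_id].
apply: (@squeeze_cvgr _ _ _ _ (cst 0) (fun x => 4 * expR (- (x / 4)))).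
- near=> x; have x0 : 0 < x by near: x; exact: nbhs_pinfty_gt.
  have x0' := ltW x0; rewrite mulr_ge0 ?expR_ge0//=.
  have -> : - (x / 2) = - (x / 4) + - (x / 4) by field.
  rewrite expRD mulrA ler_wpM2r ?expR_ge0// expRN ler_pdivrMr ?expR_gt0//.
  by have := expR_ge1Dx (x / 4); lra.
- exact: cvg_cst.
- by rewrite -(mulr0 4); apply: cvgM; [exact: cvg_cst|exact: c4].
Unshelve. all: by end_near. Qed.

Lemma cvg_mul_gamma_upper : x * Q x @[x --> +oo] --> 0.
Proof.
have [C C0 h] := gamma_upper_tail (@ltr01 R).
apply: (@squeeze_cvgr _ _ _ _ (cst 0) (fun x => C * (x * expR (- (x / 2))))).
- near=> x; have x1 : 1 < x by near: x; exact: nbhs_pinfty_gt.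
  have x0 : 0 < x := lt_trans ltr01 x1.
  have x0' := ltW x0; rewrite mulr_ge0 ?gamma_upper_ge0//= mulrCA ler_wpM2l//; exact: h.
- exact: cvg_cst.
- by rewrite -(mulr0 C); apply: cvgM; [exact: cvg_cst|exact: cvg_mul_exp2].
Unshelve. all: by end_near. Qed.

Let cvg_idr : (x : R) @[x --> 0^'+] --> (0 : R).
Proof. by apply: cvg_at_right_filter; exact: cvg_id. Qed.

(** Both sides tend to 0 at 0 and have derivative [P]. This closed form and its counterpart for
    [gamma_upper1] express the iterated integrals through [P], [Q] and [y p(y)], so that later
    identities reduce to field arithmetic. *)
Lemma gamma_lower1E (y : R) : 0 < y -> P1 y = (y - a) * P y + y * p y.
Proof.
move=> y0; apply/eqP; rewrite -subr_eq0; apply/eqP.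
apply: (@eq0_at_right0 _ (fun y => P1 y - ((y - a) * P y + y * p y)) y); last by rewrite y0/=.
- move=> x /andP[x0 _].
  have h1 := is_derive_gamma_lower1 x0; have h2 := is_derive_gamma_lower a0 x0.
  have h3 := is_derive_mul_gamma_pdf a x0.
  by apply: is_derive_eq; rewrite /GRing.scale/=; ring.
- rewrite -[X in _ --> X](subrr 0); apply: cvgB; first exact: cvg_gamma_lower1.
  have h : (x - a) * P x + x * p x @[x --> 0^'+] --> (0 - a) * 0 + 0.
    apply: cvgD; last exact: cvg_mul_gamma_pdf_0.
    by apply: cvgM; [apply: cvgB => //; exact: cvg_cst|exact: cvg_gamma_lower_0].
  by rewrite mulr0 addr0 in h.
Qed.

Lemma gamma_upper1E (y : R) : 0 < y -> Q1 y = (a - y) * Q y + y * p y.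
Proof.
move=> y0; apply/eqP; rewrite -subr_eq0; apply/eqP.
apply: (@eq0_at_pinfty _ (fun y => Q1 y - ((a - y) * Q y + y * p y))) => //.
- move=> x x0.
  have h1 := is_derive_gamma_upper1 x0; have h2 := is_derive_gamma_upper a0 x0.
  have h3 := is_derive_mul_gamma_pdf a x0.
  by apply: is_derive_eq; rewrite /GRing.scale/=; ring.
- rewrite -[X in _ --> X](subrr 0); apply: cvgB; first exact: cvg_gamma_upper1.
  have h : (a * Q x - x * Q x) + x * p x @[x --> +oo] --> (a * 0 - 0) + 0.
    apply: cvgD; last exact: cvg_mul_gamma_pdf_y.
    apply: cvgB; last exact: cvg_mul_gamma_upper.
    by apply: cvgM; [exact: cvg_cst|exact: cvg_gamma_upper_y].
  rewrite mulr0 subr0 addr0 in h.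
  by under eq_fun do rewrite mulrBl.
Qed.

Let w (y : R) := y * p y.
Let w0 (y : R) : 0 < y -> 0 < w y.
Proof. by move=> y0; rewrite mulr_gt0// gamma_pdf_gt0. Qed.
Let dw (y : R) : 0 < y -> is_derive y 1 w ((a - y) * p y).
Proof. exact: is_derive_mul_gamma_pdf. Qed.

(** Derivatives of the Mills ratios. The first ones are kept in terms of [Q1] and [P1], which shows
    their signs; the second ones are kept in terms of the ratios themselves. *)
Definition mills_upper' (y : R) := - (Q1 y / (y * w y)).
Definition mills_lower' (y : R) := P1 y / (y * w y).
Definition mills_upper'' (y : R) := ((a + 1 - y) + ((y - a) ^+ 2 + a) * mills_upper a y) / y ^+ 2.
Definition mills_lower'' (y : R) := (((y - a) ^+ 2 + a) * mills_lower a y - (a + 1 - y)) / y ^+ 2.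

Lemma is_derive_mills_upper (y : R) : 0 < y -> is_derive y 1 (mills_upper a) (mills_upper' y).
Proof.
move=> y0; have h1 := is_derive_gamma_upper a0 y0.
have wn : w y != 0 by rewrite gt_eqF// w0.
have h2 := is_deriveV wn (dw y0).
have -> : mills_upper a = (fun y => Q y * (w y)^-1) by [].
apply: is_derive_eq.
rewrite /GRing.scale/= /mills_upper' gamma_upper1E// -/(w y) -exprVn.
have pn : p y != 0 by rewrite gt_eqF// gamma_pdf_gt0.
rewrite /w; field.
by rewrite pn/= gt_eqF.
Qed.

Lemma is_derive_mills_lower (y : R) : 0 < y -> is_derive y 1 (mills_lower a) (mills_lower' y).
Proof.
move=> y0; have h1 := is_derive_gamma_lower a0 y0.
have wn : w y != 0 by rewrite gt_eqF// w0.
have h2 := is_deriveV wn (dw y0).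
have -> : mills_lower a = (fun y => P y * (w y)^-1) by [].
apply: is_derive_eq.
rewrite /GRing.scale/= /mills_lower' gamma_lower1E// -/(w y) -exprVn.
have pn : p y != 0 by rewrite gt_eqF// gamma_pdf_gt0.
rewrite /w; field.
by rewrite pn/= gt_eqF.
Qed.

Lemma is_derive_mills_upper' (y : R) : 0 < y -> is_derive y 1 mills_upper' (mills_upper'' y).
Proof.
move=> y0; have h1 := is_derive_gamma_upper1 y0.
have h2 := dw y0.
have wn : y * w y != 0 by rewrite mulf_neq0 ?gt_eqF// w0.
have h3 : is_derive y 1 (fun y => y * w y) (y * ((a - y) * p y) + w y).
  by apply: is_derive_eq; rewrite /GRing.scale/=; ring.
have h4 := @is_deriveV _ (fun y => y * w y) _ _ _ wn h3.
rewrite /mills_upper'; apply: is_derive_eq.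
rewrite /GRing.scale/= /mills_upper'' /mills_upper gamma_upper1E// -/(w y) -exprVn.
have pn : p y != 0 by rewrite gt_eqF// gamma_pdf_gt0.
rewrite /w; field.
by rewrite pn/= gt_eqF.
Qed.

Lemma is_derive_mills_lower' (y : R) : 0 < y -> is_derive y 1 mills_lower' (mills_lower'' y).
Proof.
move=> y0; have h1 := is_derive_gamma_lower1 y0.
have h2 := dw y0.
have wn : y * w y != 0 by rewrite mulf_neq0 ?gt_eqF// w0.
have h3 : is_derive y 1 (fun y => y * w y) (y * ((a - y) * p y) + w y).
  by apply: is_derive_eq; rewrite /GRing.scale/=; ring.
have h4 := @is_deriveV _ (fun y => y * w y) _ _ _ wn h3.
rewrite /mills_lower'; apply: is_derive_eq.
rewrite /GRing.scale/= /mills_lower'' /mills_lower gamma_lower1E// -/(w y) -exprVn.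
have pn : p y != 0 by rewrite gt_eqF// gamma_pdf_gt0.
rewrite /w; field.
by rewrite pn/= gt_eqF.
Qed.

Lemma stein_C2E (z : R) : 0 < z -> stein_C2 a z =
  mills_upper'' z * \int[leb]_(x in `]0, z[) P1 x +
  mills_lower'' z * \int[leb]_(x in `]z, +oo[) Q1 x.
Proof.
move=> z0; rewrite /stein_C2; congr (_ * _ + _ * _).
- exact: (derive1n2_eq z0 is_derive_mills_upper (is_derive_mills_upper' z0)).
- exact: (derive1n2_eq z0 is_derive_mills_lower (is_derive_mills_lower' z0)).
Qed.

(* [y^2 mills_upper'' y = q y * D y / (y p y)] for the function [D] of the next
   proof, whose derivative [- 2 y^2 p y / q y ^ 2] has constant sign. *)
Let q (y : R) := (y - a) ^+ 2 + a.
Let q0 y : 0 < q y. Proof. by rewrite ltr_wpDl// sqr_ge0. Qed.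
Let dq (y : R) : is_derive y 1 q (2 * (y - a)).
Proof. by apply: is_derive_eq; rewrite /GRing.scale/=; ring. Qed.

Lemma mills_upper''_ge0 (y : R) : 0 < y -> 0 <= mills_upper'' y.
Proof.
move=> y0; pose D (y : R) := Q y - w y * (y - a - 1) * (q y)^-1.
have Dge0 : 0 <= D y.
  apply: (@ge0_at_pinfty _ D (fun y => - (2 * y ^+ 2 * p y / q y ^+ 2))) => //.
  - move=> x x0; have h1 := is_derive_gamma_upper a0 x0.
    have h2 := dw x0; have qn : q x != 0 by rewrite gt_eqF.
    have h3 := is_deriveV qn (dq x).
    rewrite /D; apply: is_derive_eq; rewrite /GRing.scale/= -exprVn /w.
    have qE : q x = (x - a) ^+ 2 + a by [].
    by rewrite qE in qn *; field.
  - move=> x x0; rewrite oppr_le0 divr_ge0 ?sqr_ge0//.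
    by rewrite mulr_ge0 ?gamma_pdf_ge0// mulr_ge0 ?sqr_ge0.
  - rewrite -[X in _ --> X](subrr 0) /D; apply: cvgB; first exact: cvg_gamma_upper_y.
    (* From [|x - a - 1| <= 2 ((x - a)^2 + 1) <= c q]; with it the second term of [D] tends to 0 at
       infinity along with [y p(y)]. *)
    pose c := 2 * (1 + a^-1).
    apply: (@squeeze_cvgr _ _ _ _ (fun x => - c * w x) (fun x => c * w x)).
    + near=> x; have x0 : 0 < x by near: x; exact: nbhs_pinfty_gt.
      have c0 : `|(x - a - 1) / q x| <= c.
        rewrite normrM normfV (gtr0_norm (q0 x)) ler_pdivrMr//.
        have h : `|x - a - 1| <= 2 * ((x - a) ^+ 2 + 1).
          have h1 := sqr_ge0 (x - a); have h2 := sqr_ge0 (x - a - 1); have h3 := sqr_ge0 (x - a + 1).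
          by rewrite ler_norml; apply/andP; split; lra.
        apply: (le_trans h); rewrite /c /q -mulrA ler_wpM2l//.
        have -> : (1 + a^-1) * ((x - a) ^+ 2 + a) = (x - a) ^+ 2 + a + a^-1 * (x - a) ^+ 2 + 1.
          by field; rewrite gt_eqF.
        have : 0 <= a^-1 * (x - a) ^+ 2 by rewrite mulr_ge0 ?sqr_ge0// invr_ge0 ltW.
        by move=> u0; rewrite lerD2r -addrA lerDl addr_ge0// ltW.
      rewrite mulNr -ler_norml -mulrA normrM (gtr0_norm (w0 x0)) mulrC.
      by rewrite ler_wpM2r// ltW// w0.
    + by rewrite -(mulr0 (- c)); apply: cvgM; [exact: cvg_cst|exact: cvg_mul_gamma_pdf_y].
    + by rewrite -(mulr0 c); apply: cvgM; [exact: cvg_cst|exact: cvg_mul_gamma_pdf_y].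
have -> : mills_upper'' y = q y * D y / (y ^+ 2 * w y).
  rewrite /mills_upper'' /mills_upper /D -/(w y) -/(q y).
  have := q0 y => qp; have wn := w0 y0.
  by field; rewrite !gt_eqF.
apply: divr_ge0; first by apply: mulr_ge0 => //; exact: ltW (q0 y).
by apply: mulr_ge0; [exact: sqr_ge0|exact/ltW/w0].
Unshelve. all: by end_near. Qed.

(** The comparison of the upper case started from the other end: this [D] tends to 0 at 0 and has
    derivative [2 y^2 p / q^2 >= 0]. *)
Lemma mills_lower''_ge0 (y : R) : 0 < y -> 0 <= mills_lower'' y.
Proof.
move=> y0; pose D (y : R) := P y + w y * ((y - a - 1) * (q y)^-1).
have Dge0 : 0 <= D y.
  apply: (@ge0_at_right0 _ D (fun y => 2 * y ^+ 2 * p y / q y ^+ 2) y); last by rewrite y0/=.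
  - move=> x /andP[x0 _]; have h1 := is_derive_gamma_lower a0 x0.
    have h2 := dw x0; have qn : q x != 0 by rewrite gt_eqF.
    have h3 := is_deriveV qn (dq x).
    rewrite /D; apply: is_derive_eq; rewrite /GRing.scale/= -exprVn /w.
    have qE : q x = (x - a) ^+ 2 + a by [].
    by rewrite qE in qn *; field.
  - move=> x /andP[x0 _]; rewrite divr_ge0 ?sqr_ge0//.
    by rewrite mulr_ge0 ?gamma_pdf_ge0// mulr_ge0 ?sqr_ge0.
  - have h : D x @[x --> 0^'+] --> 0 + 0 * ((0 - a - 1) * (q 0)^-1).
      rewrite /D; apply: cvgD; first exact: cvg_gamma_lower_0.
      apply: cvgM; first exact: cvg_mul_gamma_pdf_0.
      apply: cvgM; first by apply: cvgB; [apply: cvgB|]; [|exact: cvg_cst|exact: cvg_cst].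
      apply: cvgV; first by rewrite gt_eqF.
      by apply: cvg_at_right_filter; exact: is_derive_continuous (dq 0).
    by rewrite mul0r addr0 in h.
have -> : mills_lower'' y = q y * D y / (y ^+ 2 * w y).
  rewrite /mills_lower'' /mills_lower /D -/(w y) -/(q y).
  have := q0 y => qp; have wn := w0 y0.
  by field; rewrite !gt_eqF.
apply: divr_ge0; first by apply: mulr_ge0 => //; exact: ltW (q0 y).
by apply: mulr_ge0; [exact: sqr_ge0|exact/ltW/w0].
Qed.

(** It expresses that [F'' = 0] for [K = 1], whose Stein solution is the constant -1. It controls
    the nonnegative coefficients of [A] and [A'] in [F'']: bounds [B P1] and [B Q1] on these
    integrals contribute at most [B / y]. *)
Lemma mills''_sum (y : R) : 0 < y -> y * (mills_upper'' y * P1 y + mills_lower'' y * Q1 y) = 1.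
Proof.
move=> y0; have pn : p y != 0 by rewrite gt_eqF// gamma_pdf_gt0.
rewrite gamma_upper1E// gamma_lower1E// /mills_upper'' /mills_lower'' /mills_upper /mills_lower.
have -> : Q y = 1 - P y by rewrite -(gamma_lowerD a0 y0) addrC addKr.
field; by rewrite pn/= gt_eqF.
Qed.

End Mills.

(** * The Stein equation of the Gamma distribution *)

Section Combination.
Context {R : realType}.

Lemma norm_cross_le (b p q u v : R) : 0 <= p -> 0 <= q ->
  `|u| <= b * p -> `|v| <= b * q -> `|q * u - p * v| <= 2 * b * (p * q).
Proof.
move=> p0 q0 up vq; rewrite (le_trans (ler_normB _ _))// !normrM (ger0_norm p0) (ger0_norm q0).
have := ler_wpM2l q0 up; have := ler_wpM2l p0 vq; lra.
Qed.

Lemma norm_combination_le (m n u v U V : R) : 0 <= m -> 0 <= n ->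
  `|u| <= U -> `|v| <= V -> `|m * u + n * v| <= m * U + n * V.
Proof.
move=> m0 n0 uU vV; rewrite (le_trans (ler_normD _ _))// !normrM (ger0_norm m0) (ger0_norm n0).
by rewrite lerD// ler_wpM2l.
Qed.

Lemma is_derive_mulDmul (f g u v : R -> R) (f' g' u' v' x : R) :
  is_derive x 1 f f' -> is_derive x 1 u u' -> is_derive x 1 g g' -> is_derive x 1 v v' ->
  is_derive x 1 (fun y => - (f y * u y + g y * v y)) (- (f' * u x + f x * u' + (g' * v x + g x * v'))).
Proof. by move=> ? ? ? ?; apply: is_derive_eq; rewrite /GRing.scale/=; ring. Qed.

Lemma is_derive_mulB (f u v : R -> R) (f' u' v' x : R) :
  is_derive x 1 f f' -> is_derive x 1 u u' -> is_derive x 1 v v' ->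
  is_derive x 1 (fun y => f y * u y - v y) (f' * u x + f x * u' - v').
Proof. by move=> ? ? ?; apply: is_derive_eq; rewrite /GRing.scale/=; ring. Qed.

Lemma continuous_combination (k f g u v : R -> R) (x : R) : x != 0 ->
  {for x, continuous k} -> {for x, continuous f} -> {for x, continuous g} ->
  {for x, continuous u} -> {for x, continuous v} ->
  {for x, continuous (fun y : R => k y / y - (f y * u y + g y * v y))}.
Proof.
move=> x0 ck cf cg cu cv; apply: cvgB.
  by apply: cvgM => //; apply: cvgV => //; exact: cvg_id.
by apply: cvgD; apply: cvgM.
Qed.

Variable a : R.
Hypothesis a0 : 0 < a.

Let cq (y : R) : (fun x : R => (x - a) ^+ 2 + a) @ y --> (y - a) ^+ 2 + a.
Proof.
apply: cvgD; last exact: cvg_cst.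
by rewrite expr2; apply: cvgM; apply: cvgB; [exact: cvg_id|exact: cvg_cst|exact: cvg_id|exact: cvg_cst].
Qed.

Let cl (y : R) : (fun x : R => a + 1 - x) @ y --> a + 1 - y.
Proof. by apply: cvgB; [exact: cvg_cst|exact: cvg_id]. Qed.

Let c2 (y : R) : (fun x : R => x ^+ 2) @ y --> y ^+ 2.
Proof. by rewrite expr2; apply: cvgM; exact: cvg_id. Qed.

Lemma mills_upper''_continuous (y : R) : 0 < y -> {for y, continuous (mills_upper'' a)}.
Proof.
move=> y0; have y2 : y ^+ 2 != 0 by rewrite expf_neq0// gt_eqF.
apply: cvgM; last exact: (cvgV y2 (@c2 y)).
apply: cvgD; first exact: cl.
apply: cvgM; first exact: cq.
exact: is_derive_continuous (is_derive_mills_upper a0 y0).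
Qed.

Lemma mills_lower''_continuous (y : R) : 0 < y -> {for y, continuous (mills_lower'' a)}.
Proof.
move=> y0; have y2 : y ^+ 2 != 0 by rewrite expf_neq0// gt_eqF.
apply: cvgM; last exact: (cvgV y2 (@c2 y)).
apply: cvgB; last exact: cl.
apply: cvgM; first exact: cq.
exact: is_derive_continuous (is_derive_mills_lower a0 y0).
Qed.

End Combination.

Section Stein_solution.
Context {R : realType}.
Local Notation leb := (@lebesgue_measure R).
Variable a : R.
Hypothesis a0 : 0 < a.
Local Notation p := (gamma_pdf a 1).
Local Notation P := (gamma_lower a).
Local Notation Q := (gamma_upper a).
Local Notation P1 := (gamma_lower1 a).
Local Notation Q1 := (gamma_upper1 a).
Variables (K : R -> R) (B : R).
Hypothesis cK : forall x : R, 0 < x -> {for x, continuous K}.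
Hypothesis KB : forall x : R, 0 < x -> `|K x| <= B.

Let B0 : 0 <= B. Proof. exact: le_trans (normr_ge0 _) (KB ltr01). Qed.

Let A (y : R) := \int[leb]_(t in `]0, y[) (K t * P t).
Let A' (y : R) := \int[leb]_(t in `]y, +oo[) (K t * Q t).

Let dA (x : R) : 0 < x -> is_derive x 1 A (K x * P x).
Proof. exact: is_derive_lower_weight cK KB x. Qed.
Let dA' (x : R) : 0 < x -> is_derive x 1 A' (- (K x * Q x)).
Proof. exact: is_derive_upper_weight cK KB x. Qed.

Let A_le (x : R) : 0 < x -> `|A x| <= B * P1 x.
Proof. by move=> x0; exact: lower_weight_le. Qed.
Let A'_le (x : R) : 0 < x -> `|A' x| <= B * Q1 x.
Proof. by move=> x0; exact: upper_weight_le. Qed.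

(* [stein_rhs] is the primitive of [K] whose mean under the Gamma law is 0, and
   [stein_sol] is the bounded solution of [y F' + (a - y) F = stein_rhs]. *)
Definition stein_sol (y : R) := - (mills_upper a y * A y + mills_lower a y * A' y).
Definition stein_sol' (y : R) := - (mills_upper' a y * A y + mills_lower' a y * A' y).
Definition stein_sol'' (y : R) := K y / y - (mills_upper'' a y * A y + mills_lower'' a y * A' y).
Definition stein_rhs (y : R) := A y - A' y.

Let pn (y : R) : 0 < y -> p y != 0.
Proof. by move=> y0; rewrite gt_eqF// gamma_pdf_gt0. Qed.

Let QE (y : R) : 0 < y -> Q y = 1 - P y.
Proof. by move=> y0; rewrite -(gamma_lowerD a0 y0) addrC addKr. Qed.

(** The terms containing [K] cancel, because [mills_upper * P = mills_lower * Q]. *)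
Lemma is_derive_stein_sol (y : R) : 0 < y -> is_derive y 1 stein_sol (stein_sol' y).
Proof.
move=> y0; have h1 := is_derive_mills_upper a0 y0; have h2 := is_derive_mills_lower a0 y0.
have h3 := dA y0; have h4 := dA' y0.
have := is_derive_mulDmul h1 h3 h2 h4; congr (is_derive _ _ _ _); rewrite /stein_sol'.
rewrite /mills_upper /mills_lower; have p0 := pn y0.
by field; rewrite p0/= gt_eqF.
Qed.

(** Here the terms containing [K] add up to [K y / y], because [P1 Q + Q1 P = y p(y)]. *)
Lemma is_derive_stein_sol' (y : R) : 0 < y -> is_derive y 1 stein_sol' (stein_sol'' y).
Proof.
move=> y0; have h1 := is_derive_mills_upper' a0 y0; have h2 := is_derive_mills_lower' a0 y0.
have h3 := dA y0; have h4 := dA' y0.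
have := is_derive_mulDmul h1 h3 h2 h4; congr (is_derive _ _ _ _); rewrite /stein_sol''.
rewrite /mills_upper' /mills_lower' gamma_lower1E// gamma_upper1E// QE//; have p0 := pn y0.
by field; rewrite p0/= gt_eqF.
Qed.

Lemma is_derive_stein_rhs (y : R) : 0 < y -> is_derive y 1 stein_rhs (K y).
Proof.
move=> y0; have h3 := dA y0; have h4 := dA' y0.
have := is_deriveB h3 h4; congr (is_derive _ _ _ _); rewrite QE//; ring.
Qed.

Lemma stein_solE (y : R) : 0 < y ->
  y * stein_sol' y + (a - y) * stein_sol y = stein_rhs y.
Proof.
move=> y0; rewrite /stein_sol' /stein_sol /stein_rhs /mills_upper' /mills_lower'.
rewrite /mills_upper /mills_lower gamma_lower1E// gamma_upper1E//; have p0 := pn y0.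
by field; rewrite p0/= gt_eqF.
Qed.

Lemma stein_sol''_continuous (y : R) : 0 < y -> {for y, continuous stein_sol''}.
Proof.
move=> y0; apply: continuous_combination; first by rewrite gt_eqF.
- exact: cK.
- exact: mills_upper''_continuous.
- exact: mills_lower''_continuous.
- exact: is_derive_continuous (dA y0).
- exact: is_derive_continuous (dA' y0).
Qed.

(** The integrals [A] and [A'] are at most [B P1] and [B Q1] in absolute value, and
    [mills_upper * P1 + mills_lower * Q1 = 1]. *)
Lemma stein_sol_le (y : R) : 0 < y -> `|stein_sol y| <= B.
Proof.
move=> y0; have w0 : 0 < y * p y by rewrite mulr_gt0// gamma_pdf_gt0.
have u0 : 0 <= mills_upper a y by rewrite divr_ge0 ?gamma_upper_ge0// ltW.
have l0 : 0 <= mills_lower a y by rewrite divr_ge0 ?gamma_lower_ge0// ltW.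
have -> : B = mills_upper a y * (B * P1 y) + mills_lower a y * (B * Q1 y).
  rewrite /mills_upper /mills_lower gamma_lower1E// gamma_upper1E// QE//.
  by have p0 := pn y0; field; rewrite p0/= gt_eqF.
rewrite normrN; exact: (norm_combination_le u0 l0 (A_le y0) (A'_le y0)).
Qed.

(** One [B] is the bound on [K], the other comes from [mills''_sum]. *)
Lemma stein_sol''_le (y : R) : 0 < y -> y * `|stein_sol'' y| <= 2 * B.
Proof.
move=> y0; have u0 := mills_upper''_ge0 a0 y0; have l0 := mills_lower''_ge0 a0 y0.
rewrite -[X in X * _](gtr0_norm y0) -normrM.
have -> : y * stein_sol'' y = K y - y * (mills_upper'' a y * A y + mills_lower'' a y * A' y).
  by rewrite /stein_sol''; field; rewrite gt_eqF.
rewrite mulr_natl mulr2n (le_trans (ler_normB _ _))// lerD ?KB//.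
have -> : B = y * (mills_upper'' a y * (B * P1 y) + mills_lower'' a y * (B * Q1 y)).
  by rewrite -[LHS]mul1r -(mills''_sum a0 y0); ring.
rewrite normrM (gtr0_norm y0) ler_wpM2l ?(ltW y0)//.
exact: (norm_combination_le u0 l0 (A_le y0) (A'_le y0)).
Qed.

(* Near [0], [P1 y <= (2 / a) y^2 p y]; away from [0] the bound comes from the
   Stein equation. *)
Lemma stein_sol'_bounded : exists C : R, forall y, 0 < y -> `|stein_sol' y| <= C.
Proof.
have [C [C0 wC]] := mul_gamma_pdf_le a0.
have w_le (y : R) : 0 < y -> y * p y <= C.
  move=> y0; rewrite (le_trans (wC y y0))// ler_piMr// -[leRHS]expR0 ler_expR.
  by rewrite oppr_le0 divr_ge0// ltW.
have Q1_le (y : R) : 0 < y -> Q1 y <= a + C.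
  move=> y0; rewrite gamma_upper1E// lerD// ?w_le//.
  have /andP[q0 q1] := gamma_upper_le1 a0 y0.
  by have := a0; nra.
have P1_le (y : R) : 0 < y -> P1 y <= y + C.
  move=> y0; rewrite gamma_lower1E// lerD// ?w_le//.
  have /andP[q0 q1] := gamma_lower_le1 a0 y0.
  by have := a0; nra.
have b0 : 0 < a / 2 by rewrite divr_gt0.
have P_small (y : R) : 0 < y <= a / 2 -> P y <= 2 / a * (y * p y).
  move=> yb; rewrite -subr_ge0; apply: (@ge0_at_right0 _ (fun y => 2 / a * (y * p y) - P y)
      (fun y => 2 / a * ((a - y) * p y) - p y) (a / 2)); last exact: yb.
  - move=> x /andP[x0 _]; have h1 := is_derive_mul_gamma_pdf a x0.
    have h2 := is_derive_gamma_lower a0 x0.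
    by apply: is_derive_eq.
  - move=> x /andP[x0 xa]; rewrite mulrA -[X in _ - X]mul1r -mulrBl mulr_ge0 ?gamma_pdf_ge0//.
    have -> : 2 / a * (a - x) - 1 = (a - 2 * x) / a by field; rewrite gt_eqF.
    by rewrite divr_ge0 ?(ltW a0)//; lra.
  - rewrite -[X in _ --> X](subrr 0); apply: cvgB; last exact: cvg_gamma_lower_0.
    by rewrite -[X in _ --> X](mulr0 (2 / a)); apply: cvgM; [exact: cvg_cst|exact: cvg_mul_gamma_pdf_0].
have P1_small (y : R) : 0 < y <= a / 2 -> P1 y <= 2 / a * (y * (y * p y)).
  move=> yb; rewrite -subr_ge0; apply: (@ge0_at_right0 _ (fun y => 2 / a * (y * (y * p y)) - P1 y)
      (fun y => 2 / a * (y * ((a - y) * p y) + y * p y) - P y) (a / 2)); last exact: yb.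
  - move=> x /andP[x0 _]; have h1 := is_derive_mul_gamma_pdf a x0.
    have h2 := is_derive_gamma_lower1 a0 x0.
    by apply: is_derive_eq; rewrite /GRing.scale/=; ring.
  - move=> x /andP[x0 xa]; have := P_small x; rewrite x0 (ltW xa) => /(_ isT) h.
    have : 0 <= 2 / a * (x * ((a - x) * p x)).
      rewrite mulr_ge0// ?divr_ge0 ?(ltW a0)// mulr_ge0 ?(ltW x0)// mulr_ge0 ?gamma_pdf_ge0//.
      by lra.
    by rewrite mulrDr; lra.
  - rewrite -[X in _ --> X](subrr 0); apply: cvgB; last exact: cvg_gamma_lower1.
    have h : 2 / a * (x * (x * p x)) @[x --> 0^'+] --> 2 / a * (0 * 0).
      apply: cvgM; first exact: cvg_cst.
      apply: cvgM; last exact: cvg_mul_gamma_pdf_0.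
      by apply: cvg_at_right_filter; exact: cvg_id.
    by rewrite !mulr0 in h.
(* The first constant serves for [y <= a / 2], through the bound [P1_small]. The second serves
   beyond, where solving the Stein equation for [stein_sol'] divides a quantity of linear growth by
   [y]. *)
exists (Num.max (4 * B / a * (a + C)) (B * (2 + (2 * a + 2 * C) / (a / 2)))).
move=> y y0; rewrite le_max; apply/orP.
have w0 : 0 < y * p y by rewrite mulr_gt0// gamma_pdf_gt0.
have [ya|ya] := leP y (a / 2).
  left; have P1s := P1_small y; rewrite y0 ya in P1s; have {}P1s := P1s isT.
  have -> : stein_sol' y = (Q1 y * A y - P1 y * A' y) / (y * (y * p y)).
    by rewrite /stein_sol' /mills_upper' /mills_lower'; have p0 := pn y0; field; rewrite p0/= gt_eqF.
  have yw : 0 < y * (y * p y) by rewrite mulr_gt0.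
  rewrite normrM normfV (gtr0_norm yw) ler_pdivrMr//.
  have P10 := gamma_lower1_ge0 a0 y; have Q10 := gamma_upper1_ge0 a0 y.
  apply: (@le_trans _ _ (2 * B * (P1 y * Q1 y))).
    exact: (norm_cross_le P10 Q10 (A_le y0) (A'_le y0)).
  have -> : 4 * B / a * (a + C) * (y * (y * p y)) = 2 * B * ((2 / a * (y * (y * p y))) * (a + C)).
    by field; rewrite gt_eqF.
  apply: ler_wpM2l; first by rewrite mulr_ge0.
  exact: (ler_pM P10 Q10 P1s (Q1_le _ y0)).
right.
have h1 : `|A y| <= B * (y + C) := le_trans (A_le y0) (ler_wpM2l B0 (P1_le _ y0)).
have h2 : `|A' y| <= B * (a + C) := le_trans (A'_le y0) (ler_wpM2l B0 (Q1_le _ y0)).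
have h3 : `|stein_rhs y| <= B * (y + C) + B * (a + C) := le_trans (ler_normB (A y) (A' y)) (lerD h1 h2).
move: (stein_solE y0) h3 (stein_sol_le y0).
move: (stein_sol' y) (stein_rhs y) (stein_sol y) => u v f e vB fB.
have -> : u = (v - (a - y) * f) / y by rewrite -e; field; rewrite gt_eqF.
rewrite normrM normfV (gtr0_norm y0) ler_pdivrMr//.
apply: (@le_trans _ _ (B * (y + C) + B * (a + C) + (a + y) * B)).
  rewrite (le_trans (ler_normB _ _))// lerD// normrM ler_pM//.
  by rewrite (le_trans (ler_normB _ _))// !gtr0_norm.
have -> : B * (y + C) + B * (a + C) + (a + y) * B = B * (2 * y + (2 * a + 2 * C)) by ring.
have c0 : 0 <= 2 * a + 2 * C := addr_ge0 (mulr_ge0 (ler0n _ 2) (ltW a0)) (mulr_ge0 (ler0n _ 2) C0).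
rewrite -mulrA ler_wpM2l// [leRHS]mulrDl lerD2l mulrAC ler_pdivlMr// ler_wpM2l//.
exact: ltW.
Qed.

(** An integration by parts: up to sign, [K P1 - A] and [K Q1 - A'] are the integrals of [K']
    against [P1] and [Q1], hence at most [L] times the integrals in [stein_C2]. By [mills''_sum] the
    term [K y / y] is what completes [A] and [A'] to these differences. The bound [B] on [K] is
    absent from the result, which makes truncation possible later. *)
Lemma stein_sol''_le_C2 (K' : R -> R) (L : R) :
  (forall x : R, 0 < x -> is_derive x 1 K (K' x)) -> (forall x : R, 0 < x -> `|K' x| <= L) ->
  forall y : R, 0 < y -> `|stein_sol'' y| <= L * stein_C2 a y.
Proof.
move=> dK K'L y y0.
have L0 : 0 <= L by exact: le_trans (normr_ge0 _) (K'L _ ltr01).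
have cP1 x : 0 < x -> {for x, continuous P1}.
  by move=> x0; exact: is_derive_continuous (is_derive_gamma_lower1 a0 x0).
have cQ1 x : 0 < x -> {for x, continuous Q1}.
  by move=> x0; exact: is_derive_continuous (is_derive_gamma_upper1 a0 x0).
have P1_le (x : R) : 0 < x -> 0 <= P1 x <= x.
  move=> x0; rewrite gamma_lower1_ge0//= -subr_ge0.
  apply: (@ge0_at_right0 _ (fun x => x - P1 x) (fun x => 1 - P x) x); last by rewrite x0/=.
  - by move=> z /andP[z0 _]; have h := is_derive_gamma_lower1 a0 z0; apply: is_derive_eq.
  - by move=> z /andP[z0 _]; have /andP[_] := gamma_lower_le1 a0 z0; rewrite subr_ge0.
  - rewrite -[X in _ --> X](subrr 0); apply: cvgB; last exact: cvg_gamma_lower1.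
    by apply: cvg_at_right_filter; exact: cvg_id.
pose S (x : R) := \int[leb]_(t in `]0, x[) P1 t.
pose T (x : R) := \int[leb]_(t in `]x, +oo[) Q1 t.
have iP1 x : leb.-integrable `]0, x] (fun t => (P1 t)%:E).
  apply: (@bounded_integrable_0 _ P1 x x cP1) => z z0 zx.
  by have /andP[h1 h2] := P1_le z z0; rewrite ger0_norm// (le_trans h2).
have Q1tail z : 0 < z -> exists2 C : R, 0 <= C & forall x, z < x -> Q1 x <= C * expR (- (x / 2)).
  move=> z0; have [C C0 h] := gamma_upper_tail a0 z0.
  exists (2 * C); first by rewrite mulr_ge0.
  move=> x zx; rewrite -[leLHS]ger0_norm ?gamma_upper1_ge0//.
  apply: (exp_tail_le z0); last exact: ltW.
  - by move=> t; exact: gamma_upper_continuous.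
  - by move=> t zt; rewrite ger0_norm ?gamma_upper_ge0// h.
have iQ1 x : 0 < x -> leb.-integrable `]x, +oo[ (fun t => (Q1 t)%:E).
  move=> x0; have [C C0 h] := Q1tail x x0.
  apply: (@exp_tail_integrable _ _ C) => //.
  by move=> t xt; rewrite ger0_norm ?gamma_upper1_ge0// h.
have dS (x : R) : 0 < x -> is_derive x 1 S (P1 x).
  by apply: (@is_derive_int_0 _ P1 cP1) => z _; exact: iP1.
have dT (x : R) : 0 < x -> is_derive x 1 T (- Q1 x).
  exact: (@is_derive_int_y _ Q1 cQ1 iQ1).
have S0 : S x @[x --> 0^'+] --> 0.
  by apply: cvg_int_0; apply: integrableS (iP1 1) => //; apply: subset_itvl; rewrite bnd_simp.
have T0 : T x @[x --> +oo] --> 0 by exact: cvg_int_y (iQ1 1 ltr01).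
pose G (x : R) := K x * P1 x - A x.
pose G' (x : R) := K x * Q1 x - A' x.
have dG (x : R) : 0 < x -> is_derive x 1 G (K' x * P1 x).
  move=> x0; have := is_derive_mulB (dK x x0) (is_derive_gamma_lower1 a0 x0) (dA x0).
  by congr (is_derive _ _ _ _); ring.
have dG' (x : R) : 0 < x -> is_derive x 1 G' (K' x * Q1 x).
  move=> x0; have := is_derive_mulB (dK x x0) (is_derive_gamma_upper1 a0 x0) (dA' x0).
  by congr (is_derive _ _ _ _); ring.
have G0 : G x @[x --> 0^'+] --> 0.
  rewrite -[X in _ --> X](subrr 0); apply: cvgB; last exact: cvg_lower_weight cK KB.
  apply: (@squeeze_cvgr _ _ _ _ (fun x => - (B * P1 x)) (fun x => B * P1 x)).
  - near=> x; have x0 : 0 < x by near: x; exact: nbhs_right_gt.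
    by rewrite -ler_norml normrM ler_pM// ?KB// ger0_norm ?gamma_lower1_ge0.
  - have h : - (B * P1 x) @[x --> 0^'+] --> - (B * 0).
      by apply: cvgN; apply: cvgM; [exact: cvg_cst|exact: cvg_gamma_lower1].
    by rewrite mulr0 oppr0 in h.
  - have h : B * P1 x @[x --> 0^'+] --> B * 0.
      by apply: cvgM; [exact: cvg_cst|exact: cvg_gamma_lower1].
    by rewrite mulr0 in h.
have G'0 : G' x @[x --> +oo] --> 0.
  rewrite -[X in _ --> X](subrr 0); apply: cvgB; last exact: cvg_upper_weight cK KB.
  apply: (@squeeze_cvgr _ _ _ _ (fun x => - (B * Q1 x)) (fun x => B * Q1 x)).
  - near=> x; have x0 : 0 < x by near: x; exact: nbhs_pinfty_gt.
    by rewrite -ler_norml normrM ler_pM// ?KB// ger0_norm ?gamma_upper1_ge0.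
  - have h : - (B * Q1 x) @[x --> +oo] --> - (B * 0).
      by apply: cvgN; apply: cvgM; [exact: cvg_cst|exact: cvg_gamma_upper1].
    by rewrite mulr0 oppr0 in h.
  - have h : B * Q1 x @[x --> +oo] --> B * 0.
      by apply: cvgM; [exact: cvg_cst|exact: cvg_gamma_upper1].
    by rewrite mulr0 in h.
have absK x s : 0 < x -> `|s| = 1 -> 0 <= L + s * K' x.
  move=> x0 s1; have := K'L x x0; rewrite -[`|K' x|]mul1r -s1 -normrM ler_norml.
  by move=> /andP[]; lra.
(* The values [s = 1] and [s = -1] give the two halves of the bound on [|G|]. *)
have Gs (s : R) : `|s| = 1 -> 0 <= L * S y + s * G y.
  move=> s1; apply: (@ge0_at_right0 _ (fun x => L * S x + s * G x) (fun x => (L + s * K' x) * P1 x) y);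
    last by rewrite y0/=.
  - move=> x /andP[x0 _]; have h1 := dS x x0; have h2 := dG x x0.
    have := is_deriveD (is_deriveZ L h1) (is_deriveZ s h2); congr (is_derive _ _ _ _).
    by rewrite /GRing.scale/=; ring.
  - by move=> x /andP[x0 _]; rewrite mulr_ge0 ?gamma_lower1_ge0// absK.
  - have h : L * S x + s * G x @[x --> 0^'+] --> L * 0 + s * 0.
      by apply: cvgD; (apply: cvgM; first exact: cvg_cst).
    by rewrite !mulr0 addr0 in h.
have G's (s : R) : `|s| = 1 -> 0 <= L * T y + s * G' y.
  move=> s1; apply: (@ge0_at_pinfty _ (fun x => L * T x + s * G' x) (fun x => - ((L - s * K' x) * Q1 x))); last exact: y0.
  - move=> x x0; have h1 := dT x x0; have h2 := dG' x x0.
    have := is_deriveD (is_deriveZ L h1) (is_deriveZ s h2); congr (is_derive _ _ _ _).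
    by rewrite /GRing.scale/=; ring.
  - move=> x x0; rewrite oppr_le0; apply: mulr_ge0; [rewrite -mulNr; apply: absK; [exact: x0|by rewrite normrN]|exact: gamma_upper1_ge0].
  - have h : L * T x + s * G' x @[x --> +oo] --> L * 0 + s * 0.
      by apply: cvgD; (apply: cvgM; first exact: cvg_cst).
    by rewrite !mulr0 addr0 in h.
have GS : `|G y| <= L * S y.
  have h1 := Gs 1 (normr1 _); have h2 : 0 <= L * S y + (-1) * G y by apply: Gs; rewrite normrN1.
  by rewrite ler_norml; apply/andP; split; lra.
have G'T : `|G' y| <= L * T y.
  have h1 := G's 1 (normr1 _); have h2 : 0 <= L * T y + (-1) * G' y by apply: G's; rewrite normrN1.
  by rewrite ler_norml; apply/andP; split; lra.
have -> : stein_sol'' y = mills_upper'' a y * G y + mills_lower'' a y * G' y.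
  rewrite /stein_sol'' /G /G'.
  have := mills''_sum a0 y0 => e; have -> : K y / y = K y * (mills_upper'' a y * P1 y + mills_lower'' a y * Q1 y).
    by rewrite -[in LHS](mulr1 (K y)) -e; field; rewrite gt_eqF.
  by ring.
have u0 := mills_upper''_ge0 a0 y0; have l0 := mills_lower''_ge0 a0 y0.
rewrite stein_C2E// -/(S y) -/(T y).
have -> : L * (mills_upper'' a y * S y + mills_lower'' a y * T y) =
  mills_upper'' a y * (L * S y) + mills_lower'' a y * (L * T y) by ring.
exact: (norm_combination_le u0 l0 GS G'T).
Unshelve. all: by end_near. Qed.

End Stein_solution.

(** * Stirling's inequality *)

Section Stirling.
Context {R : realType}.
Local Notation leb := (@lebesgue_measure R).

Lemma Gamma_funS (a : R) : 0 < a -> Gamma_fun (a + 1) = a * Gamma_fun a.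
Proof.
move=> a0; have a1 : 0 < a + 1 by rewrite addr_gt0.
have i1 := gamma_integrand_integrable a0; have i2 := gamma_integrand_integrable a1.
rewrite addrK in i2.
have mI : measurable (`]0%R, +oo[%classic : set (measurableTypeR R)) by exact: measurable_itv.
have d (x : R) : 0 < x -> is_derive x 1 (fun x : R => x `^ a * expR (- x))
    (a * (x `^ (a - 1) * expR (- x)) - x `^ a * expR (- x)).
  move=> x0; have h := is_derive1_powR a x0.
  by apply: is_derive_eq; rewrite /GRing.scale/=; ring.
have cp (b x : R) : 0 < x -> {for x, continuous (fun x : R => x `^ b * expR (- x))}.
  move=> x0; apply: cvgM; first exact: is_derive_continuous (is_derive1_powR b x0).
  by apply: continuous_comp; [exact: continuousN|exact: continuous_expR].
have e : \int[leb]_(x in `]0%R, +oo[) (a * (x `^ (a - 1) * expR (- x)) - x `^ a * expR (- x)) = 0 - 0.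
  apply: (FTC_0y d).
  - move=> x x0; apply: cvgB; last exact: cp.
    by apply: cvgM; [exact: cvg_cst|exact: cp].
  - by apply: integrable_EFinB => //; exact: integrable_EFinZ.
  - have h : x `^ a * expR (- x) @[x --> 0^'+] --> 0 * expR (- 0 : R).
      apply: cvgM; first exact: powR_cvg0.
      apply: cvg_at_right_filter.
      by apply: continuous_comp; [exact: continuousN|exact: continuous_expR].
    by rewrite mul0r in h.
  - pose C := (2 * a) `^ a.
    apply: (@squeeze_cvgr _ _ _ _ (cst 0) (fun x => C * expR (- (x / 2)))).
    + near=> x; have x0 : 0 < x by near: x; exact: (nbhs_pinfty_gt (num_real _)).
      rewrite mulr_ge0 ?powR_ge0 ?expR_ge0//=.
      have -> : - (x / 2) = x / 2 - x by field.
      by rewrite expRD mulrA ler_wpM2r ?expR_ge0// powR_le_exp.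
    + exact: cvg_cst.
    + have h : C * expR (- (x / 2)) @[x --> +oo] --> C * 0.
        by apply: cvgM; [exact: cvg_cst|exact: cvg_exp2].
      by rewrite mulr0 in h.
move: e; rewrite subrr RintegralB//; last exact: integrable_EFinZ.
rewrite RintegralZl// => /eqP; rewrite subr_eq0 => /eqP.
by rewrite /Gamma_fun addrK => ->.
Unshelve. all: by end_near. Qed.

Lemma ln1D_ge (v : R) : 0 <= v -> v - v ^+ 2 / 2 <= ln (1 + v).
Proof.
rewrite le_eqVlt => /predU1P[<-|v0]; first by rewrite expr0n/= mul0r subr0 addr0 ln1.
have dF (x : R) : 0 <= x -> is_derive x 1 (fun v : R => ln (1 + v) - (v - v ^+ 2 / 2)) (x ^+ 2 / (1 + x)).
  move=> x0; have x1 : 0 < 1 + x by rewrite ltr_pwDl.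
  have h1 := is_derive1_ln x1.
  have h2 : is_derive x 1 (fun v : R => 1 + v) 1.
    by have := is_deriveD (is_derive_cst (1 : R) x (1 : R)) (is_derive_id x (1 : R)); rewrite add0r.
  have h3 := is_derive1_comp h1 h2.
  have h4 : is_derive x 1 (fun v : R => v - v ^+ 2 / 2) (1 - x).
    by apply: is_derive_eq; rewrite /GRing.scale/=; field.
  have := is_deriveB h3 h4; congr (is_derive _ _ _ _).
  by field; rewrite gt_eqF.
rewrite -subr_ge0; apply: (@ge0_at_right0 _ (fun v => ln (1 + v) - (v - v ^+ 2 / 2))
    (fun v => v ^+ 2 / (1 + v)) v); last by rewrite v0/=.
- by move=> x /andP[x0 _]; exact/dF/ltW.
- by move=> x /andP[x0 _]; rewrite divr_ge0 ?sqr_ge0// addr_ge0// ltW.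
- have h := cvg_at_right_filter (is_derive_continuous (dF 0 (lexx 0))).
  by rewrite addr0 ln1 expr0n/= mul0r !subrr in h.
Qed.

(** The difference vanishes at 0 and has derivative [t^2 (2 - 3 t) / (1 - t)], nonnegative on
    [[0, 1/2]]. Together with [ln1D_ge] it bounds [ln (1 + v)] from below to second order with a
    cubic error for [|v| <= 1/2]. *)
Lemma ln1B_ge (t : R) : 0 <= t <= 2^-1 -> - t - t ^+ 2 / 2 - t ^+ 3 <= ln (1 - t).
Proof.
rewrite le_eqVlt => /andP[/predU1P[<-|t0] t1].
  by rewrite !expr0n/= mul0r !subr0 oppr0 ln1.
have dF (x : R) : 0 <= x <= 2^-1 ->
    is_derive x 1 (fun t : R => ln (1 - t) - (- t - t ^+ 2 / 2 - t ^+ 3)) (x ^+ 2 * (2 - 3 * x) / (1 - x)).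
  move=> /andP[x0 xl]; have x1 : 0 < 1 - x by lra.
  have h1 := is_derive1_ln x1.
  have h2 : is_derive x 1 (fun v : R => 1 - v) (-1).
    by have := is_deriveB (is_derive_cst (1 : R) x (1 : R)) (is_derive_id x (1 : R)); rewrite sub0r.
  have h3 := @is_derive1_comp R (@ln R) (fun v : R => 1 - v) x _ _ h1 h2.
  have h4 : is_derive x 1 (fun v : R => - v - v ^+ 2 / 2 - v ^+ 3) (- 1 - x - 3 * x ^+ 2).
    by apply: is_derive_eq; rewrite /GRing.scale/=; field.
  have := is_deriveB h3 h4; congr (is_derive _ _ _ _).
  by field; rewrite gt_eqF.
rewrite -subr_ge0; apply: (@ge0_at_right0 _ (fun t => ln (1 - t) - (- t - t ^+ 2 / 2 - t ^+ 3))
    (fun t => t ^+ 2 * (2 - 3 * t) / (1 - t)) (2^-1)); last by rewrite t0/=.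
- by move=> x /andP[x0 xl]; apply: dF; rewrite (ltW x0).
- move=> x /andP[x0 xl]; rewrite divr_ge0//; last by lra.
  by rewrite mulr_ge0 ?sqr_ge0//; lra.
- have z : 0 <= (0 : R) <= 2^-1 by rewrite lexx/= invr_ge0.
  have e0 : ln (1 - 0) - (- 0 - 0 ^+ 2 / 2 - 0 ^+ 3) = 0 :> R.
    by rewrite subr0 ln1; lra.
  have h := cvg_at_right_filter (is_derive_continuous (dF 0 z)).
  by rewrite -[X in _ --> X]e0; exact: h.
Qed.

(* [psi x = ln (rho x / rho (x + 1))] for the function [rho] below. It is
   nonnegative because it is convex and tends to [0] at infinity. *)
Let psi (x : R) := (x + 2^-1) * (ln (x + 1) - ln x) - 1 - (12 * x + 1)^-1 + (12 * x + 13)^-1.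
Let psi' (x : R) := (ln (x + 1) - ln x) - 2^-1 * (x^-1 + (x + 1)^-1) +
  12 * (12 * x + 1) ^- 2 - 12 * (12 * x + 13) ^- 2.
Let psi'' (x : R) := 2^-1 * (x ^- 2 + (x + 1) ^- 2) - (x * (x + 1))^-1
  - 288 * (12 * x + 1) ^- 3 + 288 * (12 * x + 13) ^- 3.

Let dlin (c e x : R) : 0 < c * x + e -> is_derive x 1 (fun x : R => (c * x + e)^-1) (- c * (c * x + e) ^- 2).
Proof.
move=> h; have h1 : is_derive x 1 (fun x : R => c * x + e) c.
  by apply: is_derive_eq; rewrite /GRing.scale/= addr0 mulr1.
have := @is_deriveV _ (fun x : R => c * x + e) _ _ _ (lt0r_neq0 h) h1.
by congr (is_derive _ _ _ _); rewrite /GRing.scale/= mulrC mulNr mulrN.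
Qed.

Let dlin2 (c e x : R) : 0 < c * x + e -> is_derive x 1 (fun x : R => (c * x + e) ^- 2) (- 2 * c * (c * x + e) ^- 3).
Proof.
move=> h; have h1 := dlin h.
have -> : (fun x : R => (c * x + e) ^- 2) = (fun x : R => ((c * x + e)^-1) ^+ 2).
  by apply/funext => y; rewrite exprVn.
apply: is_derive_eq; rewrite /GRing.scale/=; field; exact: lt0r_neq0.
Qed.

Let dln (x : R) : 0 < x -> is_derive x 1 (fun x : R => ln (x + 1) - ln x) ((x + 1)^-1 - x^-1).
Proof.
move=> x0; have x1 : 0 < x + 1 by rewrite addr_gt0.
have h1 := is_derive1_ln x1; have h0 := is_derive1_ln x0.
have h2 : is_derive x 1 (fun v : R => v + 1) 1.
  by have := is_deriveD (is_derive_id x (1 : R)) (is_derive_cst (1 : R) x (1 : R)); rewrite addr0.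
have := is_deriveB (@is_derive1_comp R (@ln R) (fun v : R => v + 1) x _ _ h1 h2) h0.
by congr (is_derive _ _ _ _); rewrite mulr1.
Qed.

Let dpsi (x : R) : 0 < x -> is_derive x 1 psi (psi' x).
Proof.
move=> x0; have h := dln x0.
have e1 : 0 < 12 * x + 1 by rewrite addr_gt0// mulr_gt0.
have e2 : 0 < 12 * x + 13 by rewrite addr_gt0// mulr_gt0.
have h1 := dlin e1; have h2 := dlin e2.
have h3 : is_derive x 1 (fun x : R => x + 2^-1) 1.
  by have := is_deriveD (is_derive_id x (1 : R)) (is_derive_cst (2^-1 : R) x (1 : R)); rewrite addr0.
have := is_deriveD (is_deriveB (is_deriveB (is_deriveM h3 h) (is_derive_cst (1 : R) x (1 : R))) h1) h2.
congr (is_derive _ _ _ _); rewrite /GRing.scale/= /psi'.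
by field; rewrite ?gt_eqF// addr_gt0.
Qed.

Let dpsi' (x : R) : 0 < x -> is_derive x 1 psi' (psi'' x).
Proof.
move=> x0; have h := dln x0.
have e1 : 0 < 12 * x + 1 by rewrite addr_gt0// mulr_gt0.
have e2 : 0 < 12 * x + 13 by rewrite addr_gt0// mulr_gt0.
have h1 := dlin2 e1; have h2 := dlin2 e2.
have x1 : 0 < 1 * x + 1 by rewrite mul1r addr_gt0.
have x0' : 0 < 1 * x + 0 by rewrite mul1r addr0.
have h3 := dlin x1; have h4 := dlin x0'.
have E : psi' = (fun x => (ln (x + 1) - ln x) - 2^-1 * ((1 * x + 0)^-1 + (1 * x + 1)^-1) +
  12 * (12 * x + 1) ^- 2 - 12 * (12 * x + 13) ^- 2).
  by apply/funext => y; rewrite /psi' mul1r addr0.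
rewrite E.
have := is_deriveB (is_deriveD (is_deriveB h (is_deriveZ 2^-1 (is_deriveD h4 h3))) (is_deriveZ 12 h1)) (is_deriveZ 12 h2).
congr (is_derive _ _ _ _); rewrite /GRing.scale/= /psi'' !mul1r addr0.
by field; rewrite ?gt_eqF// addr_gt0.
Qed.

(** The sign of [psi''] after the substitution [t = 12 x]. Over a common denominator the numerator
    is a polynomial in [t] whose only negative coefficient is absorbed by its neighbours. *)
Let cubes (t : R) : 0 < t ->
  2 * ((t + 1) ^- 3 - (t + 13) ^- 3) <= 2^-1 * (t^-1 - (t + 12)^-1) ^+ 2.
Proof.
move=> t0; have t1 : 0 < t + 1 by rewrite addr_gt0.
have t12 : 0 < t + 12 by rewrite addr_gt0.
have t13 : 0 < t + 13 by rewrite addr_gt0.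
rewrite -subr_ge0.
have -> : 2^-1 * (t^-1 - (t + 12)^-1) ^+ 2 - 2 * ((t + 1) ^- 3 - (t + 13) ^- 3) =
  2^-1 * 12 ^+ 2 * (4 * t ^+ 5 + 86 * t ^+ 4 + t * (356 * t ^+ 2 - 633 * t + 7098) + 2197) /
  ((t * (t + 12)) ^+ 2 * ((t + 1) * (t + 13)) ^+ 3).
  by field; rewrite !gt_eqF.
have t0' := ltW t0.
have q : 0 <= 356 * t ^+ 2 - 633 * t + 7098.
  by have := sqr_ge0 (t - 1); have := sqr_ge0 t; lra.
have N := addr_ge0 (addr_ge0 (addr_ge0 (mulr_ge0 (ler0n R 4) (exprn_ge0 5 t0'))
  (mulr_ge0 (ler0n R 86) (exprn_ge0 4 t0'))) (mulr_ge0 t0' q)) (ler0n R 2197).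
have D : 0 <= (t * (t + 12)) ^+ 2 * ((t + 1) * (t + 13)) ^+ 3.
  by apply: mulr_ge0; [exact: sqr_ge0|apply: exprn_ge0; apply: mulr_ge0; exact: ltW].
have E : 0 <= 2^-1 * 12 ^+ 2 :> R by apply: mulr_ge0; [rewrite invr_ge0; exact: ler0n|exact: sqr_ge0].
exact: (divr_ge0 (mulr_ge0 E N) D).
Qed.

Let psi''_ge0 (x : R) : 0 < x -> 0 <= psi'' x.
Proof.
move=> x0; have t0 : 0 < 12 * x by rewrite mulr_gt0.
have := cubes t0.
have -> : 2^-1 * ((12 * x)^-1 - (12 * x + 12)^-1) ^+ 2 =
    12 ^- 2 * (2^-1 * (x ^- 2 + (x + 1) ^- 2) - (x * (x + 1))^-1).
  by have x1 : 0 < x + 1 by [rewrite addr_gt0]; field; rewrite !gt_eqF// addr_gt0.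
rewrite ler_pdivlMl ?exprn_gt0// /psi''.
have -> : 12 ^+ 2 * (2 * ((12 * x + 1) ^- 3 - (12 * x + 13) ^- 3)) =
  288 * (12 * x + 1) ^- 3 - 288 * (12 * x + 13) ^- 3.
  have -> : 288 = 12 ^+ 2 * 2 :> R by ring.
  by ring.
by lra.
Qed.

Let cvg_invD (c e : R) : 0 < c -> (c * x + e)^-1 @[x --> +oo] --> 0.
Proof.
move=> c0; apply/gtr0_cvgV0.
  near=> x; have : - e / c < x by near: x; exact: (nbhs_pinfty_gt (num_real _)).
  by rewrite ltr_pdivrMr// mulrC; lra.
apply/cvgryPge => M; near=> x; have : (M - e) / c <= x by near: x; exact: (nbhs_pinfty_ge (num_real _)).
by rewrite ler_pdivrMr// mulrC; lra.
Unshelve. all: by end_near. Qed.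

Let cvg_invx : x^-1 @[x --> +oo] --> (0 : R).
Proof.
by have := @cvg_invD 1 0 ltr01; under eq_fun do rewrite mul1r addr0.
Qed.
Let cvg_invx1 : (x + 1)^-1 @[x --> +oo] --> (0 : R).
Proof.
by have := @cvg_invD 1 1 ltr01; under eq_fun do rewrite mul1r.
Qed.

Let ln_step (x : R) : 0 < x -> (x + 1)^-1 <= ln (x + 1) - ln x <= x^-1.
Proof.
move=> x0; have x1 : 0 < x + 1 by rewrite addr_gt0.
apply/andP; split.
- have := @le_ln1Dx R (- (x + 1)^-1).
  have -> : 1 + - (x + 1)^-1 = x / (x + 1) by field; rewrite gt_eqF.
  rewrite ln_div// ltrN2 => h; suff /h : (x + 1)^-1 < 1 by lra.
  by rewrite invf_lt1//; lra.
- have := @le_ln1Dx R (x^-1).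
  have -> : 1 + x^-1 = (x + 1) / x by field; rewrite gt_eqF.
  rewrite ln_div// => h; apply: h.
  by rewrite (lt_trans (ltrN10 _))// invr_gt0.
Qed.

Let cvg_ln_step : ln (x + 1) - ln x @[x --> +oo] --> (0 : R).
Proof.
apply: (@squeeze_cvgr _ _ _ _ (fun x => (x + 1)^-1) (fun x => x^-1)) => //.
by near=> x; apply: ln_step; near: x; exact: (nbhs_pinfty_gt (num_real _)).
Unshelve. all: by end_near. Qed.

Let psi'_le0 (x : R) : 0 < x -> psi' x <= 0.
Proof.
move=> x0; rewrite -oppr_ge0; apply: (@ge0_at_pinfty _ (fun x => - psi' x) (fun x => - psi'' x)) => //.
- by move=> y y0; exact: is_deriveN (dpsi' y0).
- by move=> y y0; rewrite oppr_le0 psi''_ge0.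
- have h : - psi' x @[x --> +oo] --> (- (0 - 2^-1 * (0 + 0) + 12 * (0 * 0) - 12 * (0 * 0)) : R).
    apply: cvgN; rewrite /psi'.
    apply: cvgB; last first.
      apply: cvgM; first exact: cvg_cst.
      by under eq_fun do rewrite -exprVn expr2; apply: cvgM; exact: cvg_invD.
    apply: cvgD; last first.
      apply: cvgM; first exact: cvg_cst.
      by under eq_fun do rewrite -exprVn expr2; apply: cvgM; exact: cvg_invD.
    apply: cvgB => //; apply: cvgM; first exact: cvg_cst.
    exact: cvgD.
  have e0 : - (0 - 2^-1 * (0 + 0) + 12 * (0 * 0) - 12 * (0 * 0)) = 0 :> R by ring.
  by rewrite e0 in h.
Qed.

Let psi_ge0 (x : R) : 0 < x -> 0 <= psi x.
Proof.
move=> x0; apply: (@ge0_at_pinfty _ psi psi') => //.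
have h0 : (x + 2^-1) * (ln (x + 1) - ln x) @[x --> +oo] --> (1 : R).
  apply: (@squeeze_cvgr _ _ _ _ (fun x => 1 - 2^-1 * (x + 1)^-1) (fun x => 1 + 2^-1 * x^-1)).
  - near=> y; have y0 : 0 < y by near: y; exact: (nbhs_pinfty_gt (num_real _)).
    have /andP[h1 h2] := ln_step y0.
    have y2 : 0 <= y + 2^-1 by rewrite addr_ge0 ?invr_ge0// ltW.
    have -> : 1 - 2^-1 * (y + 1)^-1 = (y + 2^-1) * (y + 1)^-1.
      by field; rewrite gt_eqF// addr_gt0.
    have -> : 1 + 2^-1 * y^-1 = (y + 2^-1) * y^-1 by field; rewrite gt_eqF.
    by rewrite !ler_wpM2l.
  - have h : 1 - 2^-1 * (x + 1)^-1 @[x --> +oo] --> (1 - 2^-1 * 0 : R).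
      by apply: cvgB; [exact: cvg_cst|apply: cvgM => //; exact: cvg_cst].
    by rewrite mulr0 subr0 in h.
  - have h : 1 + 2^-1 * x^-1 @[x --> +oo] --> (1 + 2^-1 * 0 : R).
      by apply: cvgD; [exact: cvg_cst|apply: cvgM => //; exact: cvg_cst].
    by rewrite mulr0 addr0 in h.
have h : psi x @[x --> +oo] --> (1 - 1 - 0 + 0 : R).
  rewrite /psi; apply: cvgD; last exact: cvg_invD.
  apply: cvgB; last exact: cvg_invD.
  by apply: cvgB => //; exact: cvg_cst.
have e0 : 1 - 1 - 0 + 0 = 0 :> R by ring.
by rewrite e0 in h.
Unshelve. all: by end_near. Qed.

(** [expR (L x)] is Robbins' lower approximation of [Gamma_fun (x + 1)] without its factor
    [sqrt (2 pi)], since [12 x + 1 = 12 alpha - 11] for [alpha = x + 1]. The goal becomes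
    [rho >= sqrt (2 pi)]: [rho] does not increase along [x + n], and far out it is bounded below by
    Laplace's method. *)
Let L (x : R) := (x + 2^-1) * ln x - x + (12 * x + 1)^-1.
Let rho (x : R) := Gamma_fun (x + 1) * expR (- L x).

Let rho_ge (x : R) : 0 < x -> rho (x + 1) <= rho x.
Proof.
move=> x0; have x1 : 0 < x + 1 by rewrite addr_gt0.
rewrite /rho Gamma_funS// [_ * Gamma_fun _]mulrC -mulrA.
apply: ler_wpM2l; first exact/ltW/Gamma_fun_gt0.
rewrite -[X in X * _](@lnK R)// -expRD ler_expR.
have := psi_ge0 x0; rewrite /psi /L.
have -> : 12 * (x + 1) + 1 = 12 * x + 13 by ring.
have -> : x + 1 + 2^-1 = x + 2^-1 + 1 by ring.
lra.
Qed.

Let rho_geD (x : R) n : 0 < x -> rho (x + n%:R) <= rho x.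
Proof.
move=> x0; elim: n => [|n IH]; first by rewrite addr0.
apply: le_trans IH; rewrite -natr1 addrA; apply: rho_ge.
by rewrite ltr_wpDr.
Qed.

Let J (M : R) := \int[leb]_(t in `]0, M[) expR (- t ^+ 2).

Let gaussc (x : R) : {for x, continuous (fun t : R => expR (- t ^+ 2))}.
Proof. exact: continuous_gauss_fun. Qed.

Let igauss : leb.-integrable `]0%R, +oo[ (fun t => (expR (- t ^+ 2))%:E).
Proof. by apply: integrableS integrableT_gauss. Qed.

Let cvgJ : J n%:R @[n --> \oo] --> Num.sqrt pi / 2.
Proof.
have tot : \int[leb]_(x in `]0%R, +oo[) expR (- x ^+ 2) = Num.sqrt pi / 2.
  rewrite /Rintegral integral_itv_obnd_cbnd; last first.
    by apply: measurable_funTS; apply/measurable_EFinP; exact: measurable_gauss_fun.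
  by rewrite integral0y_gauss.
have h : \int[leb]_(t in `]n%:R, +oo[) expR (- t ^+ 2) @[n --> \oo] --> 0.
  exact: (cvg_comp (fun n => n%:R) _ (@cvgr_idn R) (cvg_int_y igauss)).
have : Num.sqrt pi / 2 - \int[leb]_(t in `]n%:R, +oo[) expR (- t ^+ 2) @[n --> \oo] --> Num.sqrt pi / 2 - 0.
  by apply: cvgB h; exact: cvg_cst.
rewrite subr0; apply: cvg_trans; apply: near_eq_cvg; near=> n.
have n0 : 0 < n%:R :> R by rewrite ltr0n; near: n; exact: nbhs_infty_gt.
by rewrite -tot (Rintegral_0y_split n0 igauss) addrK.
Unshelve. all: by end_near. Qed.

Let is_derive_J (x : R) : 0 < x -> is_derive x 1 J (expR (- x ^+ 2)).
Proof.
apply: (@is_derive_int_0 _ (fun t => expR (- t ^+ 2))) => [y _|y _]; first exact: gaussc.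
by apply: integrableS igauss => //; apply: subset_itvl; rewrite bnd_simp.
Qed.

Let cvg_J0 : J x @[x --> 0^'+] --> 0.
Proof.
apply: cvg_int_0; apply: integrableS igauss => //.
by apply: subset_itvl; rewrite bnd_simp.
Qed.

(* The integral defining [Gamma_fun (y + 1)] is restricted to the points
   [y * (1 + s * r)] with [`|s| <= M], where the integrand is nearly Gaussian. *)
Section Laplace_method.
Variables (y M : R).
Hypotheses (y0 : 0 < y) (M0 : 0 < M).
(** In this scale the quadratic exponent [- y (s r)^2 / 2] is [- s^2]. *)
Let r := Num.sqrt (2 / y).
Hypothesis Mr : M * r <= 2^-1.

Let r0 : 0 < r. Proof. by rewrite sqrtr_gt0 divr_gt0. Qed.
Let r2 : r ^+ 2 = 2 / y. Proof. by rewrite sqr_sqrtr// divr_ge0// ltW. Qed.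

Let f (u : R) := u `^ (y + 1 - 1) * expR (- u).
Let I (u : R) := \int[leb]_(t in `]0, u[) f t.

Let y10 : 0 < y + 1. Proof. by rewrite addr_gt0. Qed.
Let iF : leb.-integrable `]0%R, +oo[ (fun t => (f t)%:E).
Proof. exact: gamma_integrand_integrable y10. Qed.
Let cf (u : R) : 0 < u -> {for u, continuous f}.
Proof.
move=> u0; apply: cvgM; first exact: is_derive_continuous (is_derive1_powR _ u0).
by apply: continuous_comp; [exact: continuousN|exact: continuous_expR].
Qed.
Let dI (u : R) : 0 < u -> is_derive u 1 I (f u).
Proof.
apply: (@is_derive_int_0 _ f cf) => z _.
by apply: integrableS iF => //; apply: subset_itvl; rewrite bnd_simp.
Qed.
Let I_ge0 u : 0 <= I u.
Proof. by apply: Rintegral_ge0 => t _; rewrite mulr_ge0 ?powR_ge0 ?expR_ge0. Qed.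
Let I_le u : 0 < u -> I u <= Gamma_fun (y + 1).
Proof.
move=> u0; rewrite /Gamma_fun (Rintegral_0y_split u0 iF) lerDl.
by apply: Rintegral_ge0 => t _; rewrite mulr_ge0 ?powR_ge0 ?expR_ge0.
Qed.

(** Collects the Jacobian [y r], the peak value [y^y exp (- y)] of the integrand and the cubic error
    of the logarithm, uniform over [|s| <= M]. *)
Let c := y * r * expR (y * ln y - y - y * (M * r) ^+ 3).

Let f_ge (s : R) : `|s| <= M -> c * expR (- s ^+ 2) <= y * r * f (y + s * (y * r)).
Proof.
move=> sM; have sr : `|s * r| <= M * r by rewrite normrM (gtr0_norm r0) ler_wpM2r// ltW.
have sr1 := le_trans sr Mr.
have /andP[s1 s2] : - 2^-1 <= s * r <= 2^-1 by rewrite -ler_norml.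
have v0 : 0 < 1 + s * r by lra.
have uE : y + s * (y * r) = y * (1 + s * r) by ring.
have u0 : 0 < y + s * (y * r) by rewrite uE mulr_gt0.
rewrite /c /f -!mulrA ler_wpM2l ?(ltW y0)// ler_wpM2l ?(ltW r0)// addrK.
rewrite /powR gt_eqF// -!expRD ler_expR uE lnM ?posrE//.
have e : s ^+ 2 = y * ((s * r) ^+ 2 / 2).
  by rewrite exprMn r2; field; rewrite gt_eqF.
rewrite e.
suff : s * r - (s * r) ^+ 2 / 2 - (M * r) ^+ 3 <= ln (1 + s * r).
  by move/(ler_wpM2l (ltW y0)); lra.
have M3 : 0 <= (M * r) ^+ 3 by rewrite exprn_ge0// mulr_ge0// ltW.
have [h|h] := leP 0 (s * r).
  by have := ln1D_ge h; lra.
have h' : 0 <= - (s * r) <= 2^-1 by apply/andP; split; lra.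
have := ln1B_ge h'; rewrite opprK sqrrN.
have : (- (s * r)) ^+ 3 <= (M * r) ^+ 3.
  rewrite lerXn2r ?nnegrE//; [by lra|by rewrite mulr_ge0// ltW|].
  by move: sr; rewrite ltr0_norm.
by lra.
Qed.

Let uD (s : R) : 0 <= s <= M -> 0 < y + s * (y * r).
Proof. by move=> /andP[s0 _]; rewrite ltr_wpDr// mulr_ge0// ltW// mulr_gt0. Qed.

Let uB (s : R) : 0 <= s <= M -> 0 < y - s * (y * r).
Proof.
move=> /andP[s0 sM]; have : s * r <= M * r by rewrite ler_wpM2r// ltW.
have -> : y - s * (y * r) = y * (1 - s * r) by ring.
by move=> h; rewrite mulr_gt0//; have := Mr; lra.
Qed.

(** The change of variable [u = y + s y r] is carried out by differentiating in [s]: both sides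
    agree in the limit [s = 0], and [f_ge] compares their derivatives. *)
Let upper_half : I y + c * J M <= I (y + M * (y * r)).
Proof.
have daff (s : R) : is_derive s 1 (fun s : R => y + s * (y * r)) (y * r).
  by apply: is_derive_eq; rewrite /GRing.scale/=; ring.
rewrite -subr_ge0; apply: (@ge0_at_right0 _ (fun s => I (y + s * (y * r)) - (I y + c * J s))
   (fun s => y * r * f (y + s * (y * r)) - c * expR (- s ^+ 2)) M); last by rewrite M0/=.
- move=> s /andP[s0 sM]; have u0 : 0 < y + s * (y * r) by apply: uD; rewrite ltW.
  have h1 := @is_derive1_comp R I (fun s : R => y + s * (y * r)) s _ _ (dI u0) (daff s).
  have := is_deriveB h1 (is_deriveD (is_derive_cst (I y) s (1 : R)) (is_deriveZ c (is_derive_J s0))).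
  by congr (is_derive _ _ _ _); rewrite /GRing.scale/=; ring.
- move=> s /andP[s0 sM]; rewrite subr_ge0; apply: f_ge.
  by rewrite ger0_norm ltW.
- have h : I (y + s * (y * r)) - (I y + c * J s) @[s --> 0^'+] --> I (y + 0 * (y * r)) - (I y + c * 0).
    apply: cvgB.
      apply: cvg_at_right_filter.
      apply: (@continuous_comp _ _ _ (fun s : R => y + s * (y * r)) I).
        exact: is_derive_continuous (daff 0).
      by rewrite mul0r addr0; exact: is_derive_continuous (dI y0).
    by apply: cvgD; [exact: cvg_cst|apply: cvgM; [exact: cvg_cst|exact: cvg_J0]].
  by rewrite mul0r addr0 mulr0 addr0 subrr in h.
Qed.

Let lower_half : I (y - M * (y * r)) + c * J M <= I y.
Proof.
have daff (s : R) : is_derive s 1 (fun s : R => y - s * (y * r)) (- (y * r)).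
  by apply: is_derive_eq; rewrite /GRing.scale/=; ring.
rewrite -subr_ge0; apply: (@ge0_at_right0 _ (fun s => I y - (I (y - s * (y * r)) + c * J s))
   (fun s => y * r * f (y - s * (y * r)) - c * expR (- s ^+ 2)) M); last by rewrite M0/=.
- move=> s /andP[s0 sM]; have u0 : 0 < y - s * (y * r) by apply: uB; rewrite ltW.
  have h1 := @is_derive1_comp R I (fun s : R => y - s * (y * r)) s _ _ (dI u0) (daff s).
  have := is_deriveB (is_derive_cst (I y) s (1 : R)) (is_deriveD h1 (is_deriveZ c (is_derive_J s0))).
  by congr (is_derive _ _ _ _); rewrite /GRing.scale/=; ring.
- move=> s /andP[s0 sM]; rewrite subr_ge0; have h := @f_ge (- s).
  by rewrite normrN (gtr0_norm s0) sqrrN mulNr in h; exact: (h (ltW sM)).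
- have h : I y - (I (y - s * (y * r)) + c * J s) @[s --> 0^'+] --> I y - (I (y - 0 * (y * r)) + c * 0).
    apply: cvgB; first exact: cvg_cst.
    apply: cvgD.
      apply: cvg_at_right_filter.
      apply: (@continuous_comp _ _ _ (fun s : R => y - s * (y * r)) I).
        exact: is_derive_continuous (daff 0).
      by rewrite mul0r subr0; exact: is_derive_continuous (dI y0).
    by apply: cvgM; [exact: cvg_cst|exact: cvg_J0].
  by rewrite mul0r subr0 mulr0 addr0 subrr in h.
Qed.

(** The two halves add up to [2 c J M]. For fixed [M] the exponent tends to 0 as [y] grows, and
    [2 sqrt 2 J M] tends to [sqrt (2 pi)] as [M] grows. *)
Lemma laplace_bound : 2 * Num.sqrt 2 * J M * expR (- (2 * M ^+ 3 * r) - (12 * y + 1)^-1) <= rho y.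
Proof.
have h : 2 * c * J M <= Gamma_fun (y + 1).
  have M' : 0 <= M <= M by rewrite lexx ltW.
  have := I_le (uD M'); have := I_ge0 (y - M * (y * r)).
  have := upper_half; have := lower_half; lra.
have := ler_wpM2r (expR_ge0 (- L y)) h; apply: le_trans.
have sq2 : Num.sqrt 2 = y * r * expR (- (2^-1 * ln y)).
  rewrite -[RHS]ger0_norm; last by rewrite mulr_ge0 ?expR_ge0// mulr_ge0// ltW.
  rewrite -sqrtr_sqr; congr Num.sqrt.
  rewrite !exprMn r2 -expRM_natl.
  have -> : 2 * - (2^-1 * ln y) = - ln y by field.
  by rewrite expRN lnK// ; field; rewrite gt_eqF.
rewrite le_eqVlt; apply/orP; left; apply/eqP.
have -> : 2 * c * J M * expR (- L y) = 2 * (y * r) * J M * (expR (y * ln y - y - y * (M * r) ^+ 3) * expR (- L y)).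
  by rewrite /c; ring.
rewrite sq2 -expRD.
have -> : 2 * (y * r * expR (- (2^-1 * ln y))) * J M * expR (- (2 * M ^+ 3 * r) - (12 * y + 1)^-1) =
   2 * (y * r) * J M * (expR (- (2^-1 * ln y)) * expR (- (2 * M ^+ 3 * r) - (12 * y + 1)^-1)) by ring.
rewrite -expRD; congr (_ * expR _).
have -> : y * (M * r) ^+ 3 = 2 * M ^+ 3 * r.
  have -> : y * (M * r) ^+ 3 = y * r ^+ 2 * M ^+ 3 * r by ring.
  by rewrite r2; field; rewrite gt_eqF.
by rewrite /L; ring.
Qed.

End Laplace_method.

(** The window [M] stays fixed while [n] tends to infinity along [x + n], and is enlarged only
    afterwards; [rho_geD] brings the bound back to [x]. *)
Lemma stirling_rho (x : R) : 0 < x -> Num.sqrt (2 * (pi : R)) <= rho x.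
Proof.
move=> x0.
have HM (M : R) : 0 < M -> 2 * Num.sqrt 2 * J M <= rho x.
  move=> M0.
  have cvx : (x + n%:R)^-1 @[n --> \oo] --> (0 : R).
    have h : (1 * (n%:R : R) + x)^-1 @[n --> \oo] --> 0.
      exact: (cvg_comp (fun n => n%:R) _ (@cvgr_idn R) (cvg_invD x ltr01)).
    by under eq_fun do rewrite addrC -[_%:R]mul1r.
  have cvr : Num.sqrt (2 / (x + n%:R)) @[n --> \oo] --> (0 : R).
    have h : Num.sqrt (2 * (x + n%:R)^-1) @[n --> \oo] --> Num.sqrt (2 * 0 : R).
      apply: (cvg_comp _ Num.sqrt); last exact: sqrt_continuous.
      by apply: cvgM => //; exact: cvg_cst.
    by rewrite mulr0 sqrtr0 in h.
  have cvi : (12 * (x + n%:R) + 1)^-1 @[n --> \oo] --> (0 : R).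
    have h : (12 * (n%:R : R) + (12 * x + 1))^-1 @[n --> \oo] --> 0.
      have t12 : 0 < 12 :> R by [].
      exact: (cvg_comp (fun n => n%:R) _ (@cvgr_idn R) (cvg_invD (12 * x + 1) t12)).
    by under eq_fun do rewrite mulrDr [_ * x + _]addrC -addrA.
  have h : 2 * Num.sqrt 2 * J M * expR (- (2 * M ^+ 3 * Num.sqrt (2 / (x + n%:R))) - (12 * (x + n%:R) + 1)^-1)
     @[n --> \oo] --> 2 * Num.sqrt 2 * J M * expR (- (2 * M ^+ 3 * 0) - 0).
    apply: cvgM; first exact: cvg_cst.
    apply: (cvg_comp _ expR); last exact: continuous_expR.
    apply: cvgB => //; apply: cvgN; apply: cvgM => //; exact: cvg_cst.
  have e0 : - (2 * M ^+ 3 * 0) - 0 = 0 :> R by ring.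
  rewrite e0 expR0 mulr1 in h.
  apply: (cvgr_to_le h); near=> n.
  apply: (le_trans _ (rho_geD n x0)); apply: laplace_bound => //.
    by rewrite ltr_wpDr.
  rewrite mulrC -ler_pdivlMr//; near: n.
  by apply: (cvgr_le 0 cvr); rewrite divr_gt0// invr_gt0.
have h : 2 * Num.sqrt 2 * J n%:R @[n --> \oo] --> 2 * Num.sqrt 2 * (Num.sqrt pi / 2).
  by apply: cvgM => //; exact: cvg_cst.
have -> : Num.sqrt (2 * (pi : R)) = 2 * Num.sqrt 2 * (Num.sqrt pi / 2).
  by rewrite (sqrtrM pi (ler0n R 2)); field.
apply: (cvgr_to_le h); near=> n; apply: HM; rewrite ltr0n.
by near: n; exact: nbhs_infty_gt.
Unshelve. all: by end_near. Qed.

Lemma Gamma_fun_ge (x : R) : 0 < x ->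
  Num.sqrt (2 * pi * x) * expR (x * ln x - x) * stirling_r (x + 1) <= Gamma_fun (x + 1).
Proof.
move=> x0; have := ler_wpM2r (expR_ge0 (L x)) (stirling_rho x0).
have -> : rho x * expR (L x) = Gamma_fun (x + 1).
  by rewrite /rho -mulrA -expRD (addNr (L x)) expR0 mulr1.
apply: le_trans.
rewrite /stirling_r.
have -> : 12 * (x + 1) - 11 = 12 * x + 1 by ring.
have e : Num.sqrt x = expR (2^-1 * ln x).
  rewrite -[RHS]ger0_norm ?expR_ge0// -sqrtr_sqr; congr Num.sqrt.
  rewrite -expRM_natl; have -> : 2 * (2^-1 * ln x) = ln x by field.
  by rewrite lnK.
rewrite (sqrtrM x (mulr_ge0 (ler0n R 2) (pi_ge0 R))) e -!mulrA -!expRD.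
rewrite le_eqVlt; apply/orP; left; apply/eqP; congr (_ * expR _).
by rewrite /L; ring.
Qed.

End Stirling.

(** * Random variables with a Gamma law *)

Section Gamma_law.
Context {R : realType} {d : measure_display} {T : measurableType d}.
Variable Q : probability T R.
Variable U : {RV Q >-> R}.
Local Notation leb := (@lebesgue_measure R).
Variables a b : R.
Hypothesis a0 : 0 < a.
Hypothesis b0 : 0 < b.
Hypothesis lawU : forall B : set R, measurable B -> distribution Q U B = gamma_law a b B.
Local Notation p := (gamma_pdf a b).

Let mp : measurable_fun setT p := measurable_gamma_pdf a b.
Let p0 x : 0 <= p x := gamma_pdf_ge0 a0 b0 x.

Lemma gamma_integral_ge0 (f : R -> R) : measurable_fun setT f -> (forall x, 0 <= f x) ->
  (\int[Q]_x (f (U x))%:E = \int[leb]_x (f x * p x)%:E)%E.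
Proof.
move=> mf f0.
rewrite -(@ge0_integral_weighted _ _ _ _ _ leb (distribution Q U) idfun _ p mp p0 lawU f mf f0) //.
  by rewrite ge0_integral_distribution//=; exact/measurable_EFinP.
exact: measurable_id.
Qed.

Lemma gamma_Rintegral_ge0 (f : R -> R) : measurable_fun setT f -> (forall x, 0 <= f x) ->
  \int[Q]_x f (U x) = \int[leb]_(x in `]0%R, +oo[) (f x * p x).
Proof.
move=> mf f0; rewrite /Rintegral gamma_integral_ge0//; congr fine.
rewrite [RHS]integral_mkcond; apply: eq_integral => x _; rewrite patchE.
case: ifPn => // h; rewrite gamma_pdf_npos ?mulr0// leNgt; apply/negP => x0.
by move/negP: h; apply; rewrite inE/= in_itv/= x0.
Qed.

Lemma gamma_pdf_integrable : leb.-integrable setT (fun x => (p x)%:E).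
Proof.
apply/integrableP; split; first exact/measurable_EFinP.
under eq_integral do rewrite abse_EFin ger0_norm ?p0//.
have := lawU (@measurableT _ _); rewrite /gamma_law probability_setT => <-.
exact: ltry.
Qed.

Lemma gamma_law_npos : Q [set x | U x <= 0] = 0%E.
Proof.
have -> : [set x | U x <= 0] = U @^-1` `]-oo, 0].
  by apply/seteqP; split => x /=; rewrite in_itv.
have := @lawU `]-oo, 0] (measurable_itv _); rewrite /distribution/= /pushforward => ->.
rewrite /gamma_law integral0_eq// => x /=; rewrite in_itv/= => x0.
by rewrite gamma_pdf_npos.
Qed.

(** Truncation at 0 makes nonnegativity hold everywhere instead of almost surely, as a mixture
    demands; division by [b] reduces to unit scale. *)
Let V x := Num.max (U x) 0 / b.

Lemma gamma_scaled_ge0 x : 0 <= V x.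
Proof. by rewrite divr_ge0 ?(ltW b0)// le_max lexx orbT. Qed.

Lemma measurable_gamma_scaled : measurable_fun setT V.
Proof. by apply: measurable_funM => //; exact: measurable_maxr. Qed.
Let mV := measurable_gamma_scaled.

Lemma gamma_scaled_neq0 : Q [set x | V x = 0] = 0%E.
Proof.
rewrite -gamma_law_npos; congr (Q _); apply/seteqP; split => x /=.
  move/eqP; rewrite mulf_eq0 invr_eq0 (gt_eqF b0) orbF.
  by move=> /eqP <-; rewrite le_max lexx.
by move=> h; rewrite /V max_r// mul0r.
Qed.

(** The function [x p(x) exp (- s x / b)] tends to 0 at both ends of the half-line, and its
    derivative is [a h - (1 + s) g], the difference of the two integrands. *)
Lemma gamma_scaled_laplace s : 0 < s ->
  (1 + 1 * s) * \int[Q]_x (V x * expR (- (s * V x))) = a * \int[Q]_x expR (- (s * V x)).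
Proof.
move=> s0; have sb : 0 < s / b by rewrite divr_gt0.
pose m (x : R) := Num.max x 0 / b.
have mm : measurable_fun setT m by apply: measurable_funM => //; exact: measurable_maxr.
have m0 x : 0 <= m x by rewrite divr_ge0 ?(ltW b0)// le_max lexx orbT.
have me : measurable_fun setT (fun x => expR (- (s * m x))).
  by apply: measurableT_comp => //; apply: measurableT_comp => //; exact: measurable_funM.
have mE x : 0 < x -> m x = x / b by move=> x0; rewrite /m max_l// ltW.
rewrite (@gamma_Rintegral_ge0 (fun x => m x * expR (- (s * m x)))); last 2 first.
- exact: measurable_funM.
- by move=> x; rewrite mulr_ge0 ?expR_ge0.
rewrite (@gamma_Rintegral_ge0 (fun x => expR (- (s * m x)))); [|exact: me|by move=> x; exact: expR_ge0].
pose g (x : R) := x / b * expR (- (s / b * x)) * p x.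
pose h (x : R) := expR (- (s / b * x)) * p x.
have -> : \int[leb]_(x in `]0%R, +oo[) (m x * expR (- (s * m x)) * p x) = \int[leb]_(x in `]0%R, +oo[) g x.
  apply: eq_Rintegral => x; rewrite inE/= in_itv/= andbT => x0.
  by rewrite /g mE//; congr (_ * expR (- _) * _); ring.
have -> : \int[leb]_(x in `]0%R, +oo[) (expR (- (s * m x)) * p x) = \int[leb]_(x in `]0%R, +oo[) h x.
  apply: eq_Rintegral => x; rewrite inE/= in_itv/= andbT => x0.
  by rewrite /h mE//; congr (expR (- _) * _); ring.
have ip : leb.-integrable `]0%R, +oo[ (fun x => (p x)%:E) by apply: integrableS gamma_pdf_integrable.
have mI : measurable (`]0%R, +oo[%classic : set (measurableTypeR R)) by exact: measurable_itv.
have cexp (x : R) : {for x, continuous (fun x : R => expR (- (s / b * x)))}.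
  have hh : is_derive x 1 (fun x : R => expR (- (s / b * x))) (- (s / b) * expR (- (s / b * x))).
    by apply: is_derive_eq; rewrite /GRing.scale/=; ring.
  exact: is_derive_continuous hh.
have cp (x : R) : 0 < x -> {for x, continuous p} by exact: continuous_gamma_pdf.
have ch (x : R) : 0 < x -> {for x, continuous h} by move=> x0; apply: cvgM; [exact: cexp|exact: cp].
have cg (x : R) : 0 < x -> {for x, continuous g}.
  move=> x0; apply: cvgM; last exact: cp.
  by apply: cvgM; [apply: cvgM; [exact: cvg_id|exact: cvg_cst]|exact: cexp].
have ih : leb.-integrable `]0%R, +oo[ (fun x => (h x)%:E).
  apply: (integrable_EFin_le mI (g := p)) => //; first exact: measurable_fun_0y.
  move=> x /=; rewrite in_itv/= andbT => x0.
  rewrite ger0_norm; last by rewrite mulr_ge0 ?expR_ge0.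
  rewrite ler_piMl// -[leRHS]expR0 ler_expR oppr_le0 mulr_ge0 ?ltW//.
have ig : leb.-integrable `]0%R, +oo[ (fun x => (g x)%:E).
  apply: (integrable_EFin_le mI (g := fun x => s^-1 * p x)); first exact: measurable_fun_0y.
    move=> x /=; rewrite in_itv/= andbT => x0.
    rewrite ger0_norm; last by rewrite !mulr_ge0 ?expR_ge0 ?invr_ge0 ?(ltW b0) ?(ltW x0).
    rewrite /g ler_wpM2r// expRN ler_pdivrMr ?expR_gt0// ler_pdivlMl//.
    by have := expR_ge1Dx (s / b * x); lra.
  exact: integrable_EFinZ.
have key : \int[leb]_(x in `]0%R, +oo[) (a * h x - (1 + s) * g x) = 0 - 0.
  apply: (@FTC_0y _ _ (fun x : R => x * p x * expR (- (s / b * x)))).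
  - move=> x x0; have h1 := is_derive_gamma_pdf a b0 x0.
    apply: is_derive_eq; rewrite /GRing.scale/= /h /g; field.
    by rewrite !gt_eqF.
  - move=> x x0; apply: cvgB.
      by apply: cvgM; [exact: cvg_cst|exact: ch].
    by apply: cvgM; [exact: cvg_cst|exact: cg].
  - by apply: integrable_EFinB => //; exact: integrable_EFinZ.
  - have h0 : x * p x * expR (- (s / b * x)) @[x --> 0^'+] --> 0 * expR (- (s / b * 0)).
      apply: cvgM; first exact: cvg_mul_gamma_pdf_0.
      by apply: cvg_at_right_filter; exact: cexp.
    by rewrite mul0r in h0.
  (* From [powR_le_exp] at [2 x / b]: the power costs [exp (x / b)], which cancels the decay of [p]
     and leaves the factor in [s]. *)
  - pose C := (Gamma_fun a * b `^ a)^-1 * ((b / 2) `^ a * (2 * a) `^ a).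
    apply: (@squeeze_cvgr _ _ _ _ (cst 0) (fun x => C * expR (- (s / b * x)))).
    + near=> x; have x0 : 0 < x by near: x; exact: (nbhs_pinfty_gt (num_real _)).
      rewrite !mulr_ge0 ?expR_ge0 ?(ltW x0)//= ler_wpM2r ?expR_ge0//.
      rewrite mul_gamma_pdf// /C -mulrA ler_wpM2l//.
        by rewrite invr_ge0 mulr_ge0 ?powR_ge0 ?ltW ?Gamma_fun_gt0.
      have xb : 0 < 2 * x / b by rewrite divr_gt0// mulr_gt0.
      have -> : x `^ a = (b / 2) `^ a * (2 * x / b) `^ a.
        rewrite -powRM ?ltW//; last by rewrite divr_gt0.
        by congr (_ `^ _); field; rewrite gt_eqF.
      rewrite -[leLHS]mulrA; apply: ler_wpM2l; first exact: powR_ge0.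
      rewrite mulNr expRN ler_pdivrMr ?expR_gt0//.
      by have := powR_le_exp a0 xb; have -> : 2 * x / b / 2 = x / b by field; rewrite gt_eqF.
    + exact: cvg_cst.
    + have h0 : C * expR (- (s / b * x)) @[x --> +oo] --> C * 0.
        apply: cvgM; first exact: cvg_cst.
        apply: (cvg_comp (fun x : R => s / b * x) (fun y => expR (- y))); last exact: cvgr_expR.
        by apply: gt0_cvgMry => //; exact: cvg_id.
      by rewrite mulr0 in h0.
move: key; rewrite subrr RintegralB//; [|exact: integrable_EFinZ|exact: integrable_EFinZ].
rewrite !RintegralZl// => /eqP; rewrite subr_eq0 => /eqP ->.
by rewrite mul1r.
Unshelve. all: by end_near. Qed.

Lemma gamma_integral_le (C : R) (f : R -> R) : (forall t, p t <= C) ->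
  measurable_fun setT f -> (forall x, 0 <= f x) ->
  (\int[Q]_x (f (U x))%:E <= C%:E * \int[leb]_x (f x)%:E)%E.
Proof.
move=> pC mf f0; have C0 : 0 <= C := le_trans (p0 0) (pC 0).
rewrite gamma_integral_ge0// -ge0_integralZl//; last 2 first.
- exact/measurable_EFinP.
- by move=> x _; rewrite lee_fin.
apply: ge0_le_integral => //=.
- by move=> x _; rewrite lee_fin mulr_ge0.
- by apply/measurable_EFinP; exact: measurable_funM.
- by apply/measurable_EFinP; exact: measurable_funM.
- by move=> x _; rewrite lee_fin mulrC ler_wpM2r.
Qed.

End Gamma_law.

(** The density is largest at [x = (a - 1) / a], and its value there is bounded through
    [Gamma_fun_ge] at [a - 1]. *)
Lemma gamma_pdf_le (R : realType) (a x : R) : 1 < a ->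
  gamma_pdf a a^-1 x <= a / (Num.sqrt (2 * pi * (a - 1)) * stirling_r a).
Proof.
move=> a1; have a0 : 0 < a := lt_trans ltr01 a1.
have a10 : 0 < a - 1 by rewrite subr_gt0.
have r0 : 0 < Num.sqrt (2 * pi * (a - 1)) * stirling_r a.
  by rewrite mulr_gt0 ?expR_gt0// sqrtr_gt0 !mulr_gt0 ?pi_gt0.
set D := _ * stirling_r a in r0 *.
have [x0|x0] := leP x 0; first by rewrite gamma_pdf_npos// divr_ge0 ?ltW.
rewrite /gamma_pdf x0 invrK ler_pdivlMr//.
have G0 := Gamma_fun_gt0 a0.
have pa : 0 < a^-1 `^ a by rewrite powR_gt0// invr_gt0.
rewrite invfM -!mulrA ler_pdivrMl//.
have H := Gamma_fun_ge a10; rewrite subrK in H.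
have -> : (a^-1 `^ a)^-1 = a * expR ((a - 1) * ln a).
  rewrite -[X in X * _](@lnK R)// -expRD /powR gt_eqF ?invr_gt0// lnV// -expRN.
  by congr expR; ring.
have -> : x `^ (a - 1) * (expR (- x * a) * D) =
   expR ((a - 1) * ln x - x * a) * D.
  by rewrite /powR gt_eqF// mulrA -expRD mulNr.
apply: (@le_trans _ _ (a * (Num.sqrt (2 * pi * (a - 1)) * expR ((a - 1) * ln (a - 1) - (a - 1)) * stirling_r a))); last first.
  by rewrite mulrC ler_wpM2r// ltW.
rewrite -[leLHS]mulrA; apply: ler_wpM2l; first exact: ltW.
rewrite [leLHS]mulrA -expRD.
have -> : Num.sqrt (2 * pi * (a - 1)) * expR ((a - 1) * ln (a - 1) - (a - 1)) * stirling_r a =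
  expR ((a - 1) * ln (a - 1) - (a - 1)) * D by rewrite /D; ring.
rewrite ler_wpM2r ?(ltW r0)// ler_expR.
(* Equal to 1 at the mode; [ln u <= u - 1] compares the exponent with its value there. *)
pose u := x * a / (a - 1); have u0 : 0 < u by rewrite divr_gt0// mulr_gt0.
have := @le_ln1Dx R (u - 1); rewrite [1 + _]addrC subrK ltrDr => /(_ u0).
have -> : ln u = ln x + ln a - ln (a - 1) by rewrite /u ln_div ?posrE ?mulr_gt0// lnM.
move/(ler_wpM2l (ltW a10)).
have -> : (a - 1) * (u - 1) = x * a - (a - 1) by rewrite /u; field; rewrite gt_eqF.
lra.
Qed.

(** * Stein discrepancy of a mixture *)

Lemma Rintegral_sum_ord d (T : measurableType d) (R : realType) (P : {measure set T -> \bar R})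
    n (f : 'I_n -> T -> R) : (forall i, P.-integrable setT (fun x => (f i x)%:E)) ->
  P.-integrable setT (fun x => (\sum_i f i x)%:E) /\
  \int[P]_x (\sum_i f i x) = \sum_i \int[P]_x f i x.
Proof.
move=> fi; have h : (\int[P]_x (\sum_i f i x)%:E = \sum_i (\int[P]_x (f i x)%:E))%E.
  by under eq_integral do rewrite -sumEFin; exact: integral_sum.
split.
  by under eq_fun do rewrite -sumEFin; exact: integrable_sum.
by rewrite [LHS]/Rintegral h (eq_bigr _ (fun i _ => Rintegral_fineK measurableT (fi i))) sumEFin.
Qed.

Section Mixture.
Context d0 (T : measurableType d0) (R : realType) (P : probability T R).
Context n (Z : 'I_n -> T -> R) (l c : 'I_n -> R) (kappa a : R).
Hypothesis mZ : forall i, measurable_fun setT (Z i).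
Hypothesis Z0 : forall i x, 0 <= Z i x.
Hypothesis kappa0 : 0 < kappa.
Hypothesis a0 : 0 < a.
Hypothesis l0 : forall i, 0 <= l i.
Hypothesis c0 : forall i, 0 <= c i.
Let V x := kappa * \sum_i Z i x.
Hypothesis laplace : forall i s, 0 < s ->
  (1 + c i * s) * \int[P]_x (Z i x * expR (- (s * V x))) = l i * \int[P]_x expR (- (s * V x)).
Hypothesis V_neq0 : P [set x | V x = 0] = 0%E.
Hypothesis sum_l : kappa * \sum_i l i = a.
Hypothesis sum_cl : \sum_i (1 - c i) * l i = 0.

Let V0 x : 0 <= V x. Proof. by apply: mulr_ge0; [exact: ltW|exact: sumr_ge0]. Qed.
Let mV : measurable_fun setT V.
Proof. by apply: measurable_funM => //; exact: measurable_sum. Qed.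
Let ZV i x : Z i x <= kappa^-1 * V x.
Proof.
rewrite mulrA mulVf ?gt_eqF// mul1r (bigD1 i)//= lerDl.
exact: sumr_ge0.
Qed.
Let iZ i : P.-integrable setT (fun x => (Z i x)%:E).
Proof. exact: (laplace_integrable0 mV (mZ i) V0 (Z0 i) (ZV i) (c0 i) (l0 i) (laplace i)). Qed.

Let iVsum (f : T -> R) : (forall i, P.-integrable setT (fun x => (Z i x * f x)%:E)) ->
  P.-integrable setT (fun x => (V x * f x)%:E) /\
  \int[P]_x (V x * f x) = kappa * \sum_i \int[P]_x (Z i x * f x).
Proof.
move=> /Rintegral_sum_ord[i1 e1].
have E x : V x * f x = kappa * \sum_i Z i x * f x by rewrite /V -mulrA mulr_suml.
split; first by under eq_fun do rewrite E; exact: integrable_EFinZ.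
by under eq_Rintegral do rewrite E; rewrite RintegralZl// e1.
Qed.

Lemma mixture_integrable : P.-integrable setT (fun x => (V x)%:E).
Proof.
have [|h _] := @iVsum (cst 1); last by under eq_fun do rewrite -[V _]mulr1.
by move=> i; under eq_fun do rewrite mulr1.
Qed.
Let iV := mixture_integrable.

Lemma mixture_mean : \int[P]_x V x = a.
Proof.
have [|_ h] := @iVsum (cst 1); first by move=> i; under eq_fun do rewrite mulr1.
under eq_Rintegral do rewrite -[V _]mulr1.
rewrite h -sum_l; congr (_ * _); apply: eq_bigr => i _.
under eq_Rintegral do rewrite mulr1.
exact: (laplace_mean mV (mZ i) V0 (Z0 i) (ZV i) iV (laplace i)).
Qed.

Lemma mixture_sqr_integrable : P.-integrable setT (fun x => (V x * V x)%:E).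
Proof.
have [|//] := @iVsum V => i.
exact: (laplace_integrable_mul mV (mZ i) V0 (Z0 i) (ZV i) iV (c0 i) (l0 i) (laplace i)).
Qed.

Section Discrepancy.
Variables (F F1 F2 : R -> R) (B C D : R).
Hypothesis dF : forall x : R, 0 < x -> is_derive x 1 F (F1 x).
Hypothesis dF1 : forall x : R, 0 < x -> is_derive x 1 F1 (F2 x).
Hypothesis cF2 : forall x : R, 0 < x -> {for x, continuous F2}.
Hypothesis FB : forall x : R, 0 < x -> `|F x| <= B.
Hypothesis F1C : forall x : R, 0 < x -> `|F1 x| <= C.
Hypothesis F2D : forall x : R, 0 < x -> x * `|F2 x| <= D.

Let first_order i : [/\ P.-integrable setT (fun x => (Z i x * F (V x))%:E),
     P.-integrable setT (fun x => (F (V x))%:E),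
     P.-integrable setT (fun x => (Z i x * F1 (V x))%:E) &
     \int[P]_x (Z i x * F (V x)) =
     l i * \int[P]_x F (V x) + c i * \int[P]_x (Z i x * F1 (V x))].
Proof.
have C0 : 0 <= C := le_trans (normr_ge0 _) (F1C ltr01).
have F1C' (x : R) : 0 < x -> `|F1 x| <= C * (1 + x^-1).
  by move=> x0; rewrite (le_trans (F1C x0))// ler_peMr// lerDl invr_ge0 ltW.
have cF1 (x : R) (x0 : 0 < x) := is_derive_continuous (dF1 x0).
exact: (laplace_identity mV (mZ i) V0 (Z0 i) (ZV i) iV (c0 i) (l0 i) (laplace i) V_neq0 dF cF1 FB F1C').
Qed.

Let second_order i : [/\ P.-integrable setT (fun x => (Z i x * F1 (V x))%:E),
     P.-integrable setT (fun x => (F1 (V x))%:E),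
     P.-integrable setT (fun x => (Z i x * F2 (V x))%:E) &
     \int[P]_x (Z i x * F1 (V x)) =
     l i * \int[P]_x F1 (V x) + c i * \int[P]_x (Z i x * F2 (V x))].
Proof.
have D0 : 0 <= D by apply: le_trans (F2D ltr01); rewrite mulr_ge0.
have F2D' (x : R) : 0 < x -> `|F2 x| <= D * (1 + x^-1).
  move=> x0; have := F2D x0; rewrite mulrC -ler_pdivlMr// => h.
  by rewrite (le_trans h)// ler_wpM2l// lerDr.
exact: (laplace_identity mV (mZ i) V0 (Z0 i) (ZV i) iV (c0 i) (l0 i) (laplace i) V_neq0 dF1 cF2 F1C F2D').
Qed.

Let iF : P.-integrable setT (fun x => (F (V x))%:E).
Proof.
(* The claim is read off any index; for [n = 0] the sum of the [l i] would be 0, against [a > 0]. *)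
case: (posnP n) => [n0|n0]; last by have [_ h _ _] := first_order (Ordinal n0).
move: a0; rewrite -sum_l big1 ?mulr0 ?ltxx// => i _.
by have := ltn_ord i; rewrite {2}n0.
Qed.

Let G x := V x * F1 (V x) + (a - V x) * F (V x).

Lemma mixture_stein : P.-integrable setT (fun x => (G x)%:E) /\
  \int[P]_x G x = kappa * \sum_i c i * (1 - c i) * \int[P]_x (Z i x * F2 (V x)).
Proof.
have [|i1 e1] := @iVsum (fun x => F1 (V x)); first by move=> i; have [] := second_order i.
have [|i2 e2] := @iVsum (fun x => F (V x)); first by move=> i; have [] := first_order i.
have E x : G x = V x * F1 (V x) + (a * F (V x) - V x * F (V x)) by rewrite /G; ring.
have i3 : P.-integrable setT (fun x => (a * F (V x))%:E) by exact: integrable_EFinZ.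
have i4 : P.-integrable setT (fun x => (a * F (V x) - V x * F (V x))%:E) by exact: integrable_EFinB.
split; first by under eq_fun do rewrite E; exact: integrable_EFinD.
under eq_Rintegral do rewrite E.
rewrite RintegralD// RintegralB// RintegralZl// e1 e2 -sum_l.
rewrite -!mulrA -!mulrBr -mulrDr; congr (_ * _).
rewrite mulr_suml -sumrB -big_split/=.
have -> : \sum_i (\int[P]_x (Z i x * F1 (V x)) + (l i * \int[P]_x F (V x) - \int[P]_x (Z i x * F (V x)))) =
  \sum_i ((1 - c i) * l i * \int[P]_x F1 (V x) + c i * (1 - c i) * \int[P]_x (Z i x * F2 (V x))).
  apply: eq_bigr => i _; have [_ _ _ e3] := first_order i; have [_ _ _ e4] := second_order i.
  by rewrite e3 e4; ring.
by rewrite big_split/= -mulr_suml sum_cl mul0r add0r.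
Qed.

(** Absolute values are taken component by component; as [kappa * sum_i Z_i = V], the components
    recombine into [V |F2 (V)|], the quantity that the Stein factors bound. *)
Lemma mixture_stein_le (m : R) : (forall i, `|c i * (1 - c i)| <= m) ->
  P.-integrable setT (fun x => (V x * `|F2 (V x)|)%:E) /\
  `|\int[P]_x G x| <= m * \int[P]_x (V x * `|F2 (V x)|).
Proof.
move=> cm; have i1 i : P.-integrable setT (fun x => (Z i x * `|F2 (V x)|)%:E).
  have [_ _ h _] := second_order i.
  have := integrable_norm h; apply: eq_integrable => // x _ /=.
  by rewrite normrM (ger0_norm (Z0 i x)).
have [i2 e2] := iVsum i1; split => //.
have [_ ->] := mixture_stein; rewrite e2 normrM (gtr0_norm kappa0) mulrCA ler_wpM2l ?(ltW kappa0)//.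
rewrite (le_trans (ler_norm_sum _ _ _))// mulr_sumr ler_sum// => i _.
rewrite normrM ler_pM//.
have [_ _ h _] := second_order i.
rewrite (le_trans (le_normr_Rintegral measurableT h))// le_eqVlt; apply/orP; left; apply/eqP.
by apply: eq_Rintegral => x _; rewrite /= normrM (ger0_norm (Z0 i x)).
Qed.

(** [H] and [Phi] have the same derivative, hence differ by the constant [H 1 - Phi 1] on the
    half-line; the event [V = 0], where the restricted [H] is 0, is null. *)
Lemma mixture_expectation (H K Phi : R -> R) :
  (forall x : R, 0 < x -> is_derive x 1 H (K x)) ->
  (forall x : R, 0 < x -> is_derive x 1 Phi (K x)) ->
  (forall x : R, 0 < x -> x * F1 x + (a - x) * F x = Phi x) ->
  P.-integrable setT (fun x => ((H \_ `]0%R, +oo[) (V x))%:E) /\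
  \int[P]_x (H \_ `]0%R, +oo[) (V x) = \int[P]_x G x + (H 1 - Phi 1).
Proof.
move=> dH dPhi FE; have [iG _] := mixture_stein.
have HE x : 0 < x -> H x = Phi x + (H 1 - Phi 1).
  move=> x0.
  pose E0 := fun y => H y - Phi y.
  have dD (y : R) : 0 < y -> is_derive y 1 E0 0.
    move=> y0; have := is_deriveB (dH y y0) (dPhi y y0).
    by rewrite subrr.
  have e (u v : R) : 0 < u -> u <= v -> E0 u = E0 v.
    move=> u0 uv; apply/esym/eqP; rewrite -subr_eq0 -normr_le0 -(mul0r (v - u)).
    apply: (@derive_lip_cc _ E0 (fun=> 0)) => // y; last by rewrite normr0.
    by move=> /andP[uy _]; apply: dD; exact: lt_le_trans uy.
  have -> : H 1 - Phi 1 = E0 x.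
    by have [h|/ltW h] := leP 1 x; [exact: e|apply/esym; exact: e].
  by rewrite /E0; ring.
have [c1 c1E] : exists c1, c1 = H 1 - Phi 1 by eexists.
rewrite -c1E in HE *.
pose N := [set x | V x = 0].
have mN : measurable N.
  have -> : N = setT `&` V @^-1` [set 0] by rewrite setTI.
  by apply: mV => //; exact: measurable_set1.
have E x : (H \_ `]0%R, +oo[) (V x) = (G x + c1) * \1_(~` N) x.
  rewrite indicE in_setC patchE; case: (pselect (N x)) => Nx.
    by rewrite (mem_set Nx)/= mulr0 memNset//= in_itv/= Nx ltxx.
  have Vx : 0 < V x by rewrite lt_def V0 andbT; apply/eqP.
  rewrite (memNset Nx)/= mulr1 mem_set/=; last by rewrite in_itv/= Vx.
  by rewrite HE// /G FE.
have iGc : P.-integrable setT (fun x => (G x + c1)%:E).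
  by apply: (integrable_EFinD measurableT (g := cst c1)) => //; exact: finite_measure_integrable_cst.
have iH : P.-integrable setT (fun x => ((G x + c1) * \1_(~` N) x)%:E).
  apply: (integrable_EFin_le measurableT (g := fun x => `|G x + c1|)).
  - apply: measurable_funM; last by apply: measurable_indic; exact: measurableC.
    by have /integrableP[/measurable_EFinP] := iGc.
  - move=> x _; rewrite normrM ler_piMr// indicE.
    by case: (_ \in _); rewrite ?normr1 ?normr0.
  - exact: integrable_norm iGc.
split; first by under eq_fun do rewrite E.
under eq_Rintegral do rewrite E.
rewrite -[X in _ + X](@Rintegral_cst_prob _ _ _ P) -RintegralD//; last exact: finite_measure_integrable_cst.
rewrite /Rintegral; congr fine.
rewrite (negligible_integral mN)// [RHS](negligible_integral mN)//.
apply: eq_integral => x; rewrite inE => -[_ Nx].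
by rewrite indicE in_setC memNset// mulr1.
Qed.

End Discrepancy.

End Mixture.

(* [mixture_laplace] is the identity [E[Z_i F(V)] = l_i E[F(V)] + c_i E[Z_i F'(V)]]
   for [F(v) = exp (- s v)]; it holds when the [Z_i] are independent Gamma
   variables of mean [l_i], the scale of [kappa Z_i] being [c_i]. *)
Record stein_mixture d0 (T : measurableType d0) (R : realType) (P : probability T R)
    n (Z : 'I_n -> T -> R) (l c : 'I_n -> R) (kappa a : R) : Prop := SteinMixture {
  mixture_measurable : forall i, measurable_fun setT (Z i);
  mixture_coord_ge0 : forall i x, 0 <= Z i x;
  mixture_scale_gt0 : 0 < kappa;
  mixture_shape_gt0 : 0 < a;
  mixture_mean_ge0 : forall i, 0 <= l i;
  mixture_coef_ge0 : forall i, 0 <= c i;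
  mixture_laplace : forall i s, 0 < s ->
    (1 + c i * s) * \int[P]_x (Z i x * expR (- (s * (kappa * \sum_j Z j x)))) =
    l i * \int[P]_x expR (- (s * (kappa * \sum_j Z j x)));
  mixture_neq0 : P [set x | kappa * \sum_j Z j x = 0] = 0%E;
  mixture_sum_mean : kappa * \sum_i l i = a;
  mixture_sum_coef : \sum_i (1 - c i) * l i = 0 }.

Lemma is_derive0_eq (R : realType) (f : R -> R) : (forall x : R, 0 < x -> is_derive x 1 f 0) ->
  forall x, 0 < x -> f x = f 1.
Proof.
move=> df x x0; have e (u v : R) : 0 < u -> u <= v -> f u = f v.
  move=> u0 uv; apply/esym/eqP; rewrite -subr_eq0 -normr_le0 -(mul0r (v - u)).
  apply: (@derive_lip_cc _ f (fun=> 0)) => // y; last by rewrite normr0.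
  by move=> /andP[uy _]; apply: df; exact: lt_le_trans uy.
by have [h|/ltW h] := leP 1 x; [exact/esym/e|exact: e].
Qed.

Section Single.
Context d0 (T : measurableType d0) (R : realType) (P : probability T R).
Context n (Z : 'I_n -> T -> R) (l c : 'I_n -> R) (kappa a : R).
Hypothesis M : stein_mixture P Z l c kappa a.
Let V x := kappa * \sum_i Z i x.
Variables (K H : R -> R) (B : R).
Hypothesis cK : forall x : R, 0 < x -> {for x, continuous K}.
Hypothesis KB : forall x : R, 0 < x -> `|K x| <= B.
Hypothesis dH : forall x : R, 0 < x -> is_derive x 1 H (K x).

(** The constant [H 1 - stein_rhs a K 1] depends on the mixture only through the shape [a], so it
    can be eliminated between two mixtures. *)
Lemma mixture_discrepancy (m : R) : (forall i, `|c i * (1 - c i)| <= m) ->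
  [/\ P.-integrable setT (fun x => ((H \_ `]0%R, +oo[) (V x))%:E),
     P.-integrable setT (fun x => (V x * `|stein_sol'' a K (V x)|)%:E) &
     `|\int[P]_x (H \_ `]0%R, +oo[) (V x) - (H 1 - stein_rhs a K 1)| <=
     m * \int[P]_x (V x * `|stein_sol'' a K (V x)|)].
Proof.
move=> cm; case: M => mZ Z0 k0 a0 l0 c0 lap neq0 suml sumc.
have [C hC] := stein_sol'_bounded a0 cK KB.
have dF (x : R) (x0 : 0 < x) := is_derive_stein_sol a0 cK KB x0.
have dF1 (x : R) (x0 : 0 < x) := is_derive_stein_sol' a0 cK KB x0.
have cF2 (x : R) (x0 : 0 < x) := @stein_sol''_continuous _ _ a0 _ _ cK KB x x0.
have FB (x : R) (x0 : 0 < x) := stein_sol_le a0 cK KB x0.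
have F2D (x : R) (x0 : 0 < x) := stein_sol''_le a0 cK KB x0.
have dPhi (x : R) (x0 : 0 < x) := is_derive_stein_rhs a0 cK KB x0.
have FE (x : R) (x0 : 0 < x) := stein_solE a0 K x0.
have [i1 e1] := mixture_expectation mZ Z0 k0 a0 l0 c0 lap neq0 suml sumc dF dF1 cF2 FB hC F2D dH dPhi FE.
have [i2 e2] := mixture_stein_le mZ Z0 k0 a0 l0 c0 lap neq0 suml sumc dF dF1 cF2 FB hC F2D cm.
split; [exact: i1|exact: i2|].
by rewrite /V e1 addrK; exact: e2.
Qed.

End Single.

(** * Comparison of two mixtures of equal shape *)

Section Comparison.
Context d1 d2 (T1 : measurableType d1) (T2 : measurableType d2) (R : realType).
Variables (P : probability T1 R) (Q : probability T2 R).
Context n1 (Z1 : 'I_n1 -> T1 -> R) (l1 c1 : 'I_n1 -> R) (kappa1 : R).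
Context n2 (Z2 : 'I_n2 -> T2 -> R) (l2 : 'I_n2 -> R) (kappa2 : R).
Variable a : R.
Hypothesis M1 : stein_mixture P Z1 l1 c1 kappa1 a.
Hypothesis M2 : stein_mixture Q Z2 l2 (fun=> 1) kappa2 a.
Let V1 x := kappa1 * \sum_i Z1 i x.
Let V2 x := kappa2 * \sum_i Z2 i x.
Variable m : R.
Hypothesis m0 : 0 <= m.
Hypothesis cm : forall i, `|c1 i * (1 - c1 i)| <= m.

Let a0 : 0 < a. Proof. by case: M1. Qed.

(** For the second mixture every coefficient is 1 and the discrepancy bound is 0: its mean is
    exactly the constant of [mixture_discrepancy] and can replace it for the first mixture. *)
Lemma comparison_bounded (K H : R -> R) (B : R) :
  (forall x : R, 0 < x -> {for x, continuous K}) -> (forall x : R, 0 < x -> `|K x| <= B) ->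
  (forall x : R, 0 < x -> is_derive x 1 H (K x)) ->
  [/\ P.-integrable setT (fun x => ((H \_ `]0%R, +oo[) (V1 x))%:E),
     Q.-integrable setT (fun x => ((H \_ `]0%R, +oo[) (V2 x))%:E),
     P.-integrable setT (fun x => (V1 x * `|stein_sol'' a K (V1 x)|)%:E) &
     `|\int[P]_x (H \_ `]0%R, +oo[) (V1 x) - \int[Q]_x (H \_ `]0%R, +oo[) (V2 x)| <=
     m * \int[P]_x (V1 x * `|stein_sol'' a K (V1 x)|)].
Proof.
move=> cK KB dH.
have [i1 i2 e1] := mixture_discrepancy M1 cK KB dH cm.
have c0 (i : 'I_n2) : `|(fun=> 1 : R) i * (1 - (fun=> 1 : R) i)| <= 0 by rewrite subrr mulr0 normr0.
have [i3 _ e2] := mixture_discrepancy M2 cK KB dH c0.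
split => //; move: e2; rewrite mul0r normr_le0 subr_eq0 => /eqP e2.
by rewrite /V2 e2; exact: e1.
Qed.

Lemma comparison_lip1 (K H : R -> R) (B : R) :
  (forall x : R, 0 < x -> {for x, continuous K}) -> (forall x : R, 0 < x -> `|K x| <= B) ->
  (forall x : R, 0 < x -> is_derive x 1 H (K x)) ->
  [/\ P.-integrable setT (fun x => ((H \_ `]0%R, +oo[) (V1 x))%:E),
     Q.-integrable setT (fun x => ((H \_ `]0%R, +oo[) (V2 x))%:E) &
     `|\int[P]_x (H \_ `]0%R, +oo[) (V1 x) - \int[Q]_x (H \_ `]0%R, +oo[) (V2 x)| <= m * (2 * B)].
Proof.
move=> cK KB dH; have [i1 i2 i3 e] := comparison_bounded cK KB dH.
split => //; apply: (le_trans e); rewrite ler_wpM2l//.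
rewrite -[leRHS](@Rintegral_cst_prob _ _ _ P); apply: le_Rintegral => //.
  exact: finite_measure_integrable_cst.
have B0 : 0 <= B := le_trans (normr_ge0 _) (KB 1 ltr01).
have V0 x : 0 <= V1 x.
  by case: M1 => _ Z0 k0 *; apply: mulr_ge0; [exact: ltW|exact: sumr_ge0].
move=> x _; have [Vx|Vx] := ltP 0 (V1 x).
  exact: (stein_sol''_le a0 cK KB Vx).
have -> : V1 x = 0 by apply/eqP; rewrite eq_le Vx V0.
by rewrite mul0r mulr_ge0.
Qed.

Section Lip2.
Variables (K K' H : R -> R) (L r : R).
Hypothesis dK : forall x : R, 0 < x -> is_derive x 1 K (K' x).
Hypothesis K'L : forall x : R, 0 < x -> `|K' x| <= L.
Hypothesis dH : forall x : R, 0 < x -> is_derive x 1 H (K x).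
Hypothesis C2r : m = 0 \/ forall z, 0 < z -> stein_C2 a z <= r.

Let L0 : 0 <= L. Proof. exact: le_trans (normr_ge0 _) (K'L ltr01). Qed.
Let V10 x : 0 <= V1 x.
Proof. by case: M1 => _ Z0 k0 *; apply: mulr_ge0; [exact: ltW|exact: sumr_ge0]. Qed.
Let cK (x : R) (x0 : 0 < x) := is_derive_continuous (dK x0).

Let s_ (k : nat) : R := k.+1%:R^-1.
Let s_gt0 k : 0 < s_ k. Proof. by rewrite invr_gt0. Qed.
(* A bounded truncation of [K] whose derivative is still bounded by [L]. *)
Let K_ (k : nat) (x : R) := K x * (1 + (s_ k * K x) ^+ 2)^-1.
Let K_' (k : nat) (x : R) := K' x * ((1 - (s_ k * K x) ^+ 2) * (1 + (s_ k * K x) ^+ 2) ^- 2).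

Let den k x : 1 <= 1 + (s_ k * K x) ^+ 2. Proof. by rewrite lerDl sqr_ge0. Qed.
Let den0 k x : 0 < 1 + (s_ k * K x) ^+ 2. Proof. exact: lt_le_trans ltr01 (den k x). Qed.

Let dK_ k (x : R) : 0 < x -> is_derive x 1 (K_ k) (K_' k x).
Proof.
move=> x0; have h := dK x0; have nz := lt0r_neq0 (den0 k x).
have h1 : is_derive x 1 (fun y => 1 + (s_ k * K y) ^+ 2) (2 * (s_ k * K x) * (s_ k * K' x)).
  by apply: is_derive_eq; rewrite /GRing.scale/=; ring.
have h2 := @is_deriveV _ (fun y => 1 + (s_ k * K y) ^+ 2) _ _ _ nz h1.
have := is_deriveM h h2; congr (is_derive _ _ _ _); rewrite /GRing.scale/= /K_'.
by field.
Qed.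

Let K_L k (x : R) : 0 < x -> `|K_' k x| <= L.
Proof.
move=> x0; rewrite normrM -[leRHS]mulr1 ler_pM// ?K'L//.
have q0 : 0 < (1 + (s_ k * K x) ^+ 2) ^+ 2 by rewrite exprn_gt0.
rewrite normrM normfV (gtr0_norm q0) ler_pdivrMr// mul1r ler_norml.
by have := sqr_ge0 (s_ k * K x); move: (_ ^+ 2) => t t0; apply/andP; split; nra.
Qed.

Let K_le k x : `|K_ k x| <= `|K x|.
Proof.
rewrite normrM ler_piMr// normfV gtr0_norm// invf_le1//.
Qed.

Let K_B k x : `|K_ k x| <= (s_ k)^-1.
Proof.
rewrite normrM normfV (gtr0_norm (den0 k x)) ler_pdivrMr// ler_pdivlMl//.
rewrite -[X in X * _](gtr0_norm (s_gt0 k)) -normrM -[in leRHS](real_normK (num_real _)).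
by move: `|_| (normr_ge0 (s_ k * K x)) => t t0; nra.
Qed.

Let K_cvg x : K_ k x @[k --> \oo] --> K x.
Proof.
have h : K_ k x @[k --> \oo] --> K x * (1 + (0 * K x) * (0 * K x))^-1.
  apply: cvgM; first exact: cvg_cst.
  apply: cvgV; first by rewrite mul0r mulr0 addr0 oner_neq0.
  apply: cvgD; first exact: cvg_cst.
  by apply: cvgM; (apply: cvgM; [exact: cvg_harmonic|exact: cvg_cst]).
by rewrite !mul0r addr0 invr1 mulr1 in h.
Qed.

(** As [|x - 1| <= 1 + x], this bound for an [L]-Lipschitz [K] is valid on both sides of 1. *)
Let bnd x := `|K 1| + L * (1 + x).
Let Kbnd (x : R) : 0 < x -> `|K x| <= bnd x.
Proof.
move=> x0; have lip (u v : R) : 0 < u -> u <= v -> `|K v - K u| <= L * (v - u).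
  move=> u0 uv; apply: (@derive_lip_cc _ K K') => // y /andP[uy _]; [apply: dK|apply: K'L].
    exact: lt_le_trans uy.
  exact: lt_trans uy.
have h : `|K x - K 1| <= L * (1 + x).
  have [h|/ltW h] := leP 1 x.
    by rewrite (le_trans (lip _ _ ltr01 h))// ler_wpM2l//; lra.
  by rewrite distrC (le_trans (lip _ _ x0 h))// ler_wpM2l//; lra.
rewrite /bnd -[X in `|X| <= _](subrK (K 1)) addrC (le_trans (ler_normD _ _))// lerD2l//.
Qed.

Local Notation leb := (@lebesgue_measure R).

Let iK x : leb.-integrable `]0, x] (fun y => (K y)%:E).
Proof.
apply: (@bounded_integrable_0 _ _ (bnd x)) => // y y0 yx.
by rewrite (le_trans (Kbnd y0))// lerD2l ler_wpM2l// lerD2l.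
Qed.

Let iK_ k x : leb.-integrable `]0, x] (fun y => (K_ k y)%:E).
Proof.
apply: (@bounded_integrable_0 _ _ (s_ k)^-1) => // y y0.
exact: is_derive_continuous (dK_ k y0).
Qed.

Let h0 := H 1 - \int[leb]_(t in `]0, 1[) K t.
Let H_ k x := h0 + \int[leb]_(t in `]0, x[) K_ k t.

Let HE (x : R) : 0 < x -> H x = h0 + \int[leb]_(t in `]0, x[) K t.
Proof.
move=> x0; suff : H x - \int[leb]_(t in `]0, x[) K t = h0 by rewrite /h0 => <-; rewrite subrK.
apply: (@is_derive0_eq _ (fun x => H x - \int[leb]_(t in `]0, x[) K t)) => // y y0.
have := is_deriveB (dH y0) (@is_derive_int_0 _ K cK (fun x _ => iK x) y y0).
by rewrite subrr.
Qed.

Let dH_ k (x : R) : 0 < x -> is_derive x 1 (H_ k) (K_ k x).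
Proof.
move=> x0; have cK_ (y : R) (y0 : 0 < y) := is_derive_continuous (dK_ k y0).
have := is_deriveD (is_derive_cst h0 x (1 : R)) (@is_derive_int_0 _ (K_ k) cK_ (fun x _ => iK_ k x) x x0).
by rewrite add0r.
Qed.

Let H_cvg (x : R) : 0 < x -> H_ k x @[k --> \oo] --> H x.
Proof.
move=> x0; rewrite HE//; apply: cvgD; first exact: cvg_cst.
have [||y _||k y|_ //] := @Rintegral_dominated _ _ R leb `]0, x[%classic K_ K (fun=> bnd x).
- exact: measurable_itv.
- move=> k; apply: (measurable_funS (measurable_itv `]0%R, +oo[)).
    by apply: subset_itvl; rewrite bnd_simp.
  by apply: measurable_fun_0y => y y0; exact: is_derive_continuous (dK_ k y0).
- exact: K_cvg.
- apply/integrableP; split; first by apply/measurable_EFinP; exact: measurable_cst.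
  rewrite /= integral_cst//= lebesgue_measure_itv/= lte_fin x0 -EFinB -EFinM.
  exact: ltry.
- rewrite /= in_itv/= => /andP[y0 yx].
  by rewrite (le_trans (K_le _ _))// (le_trans (Kbnd y0))// lerD2l ler_wpM2l// lerD2l ltW.
Qed.

Let H_le k (x : R) : 0 < x -> `|H_ k x| <= `|h0| + bnd x * x.
Proof.
move=> x0; rewrite (le_trans (ler_normD _ _))// lerD2l//.
have mI : measurable (`]0, x[%classic : set (measurableTypeR R)) by exact: measurable_itv.
have i1 : leb.-integrable `]0, x[ (fun y => (K_ k y)%:E).
  by apply: integrableS (iK_ k x) => //; apply: subset_itvl; rewrite bnd_simp.
rewrite (le_trans (le_normr_Rintegral mI i1))//.
have -> : bnd x * x = \int[leb]_(t in `]0, x[) bnd x.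
  by rewrite Rintegral_cst//= lebesgue_measure_itv/= lte_fin x0 -EFinB/= subr0.
apply: le_Rintegral => //.
- exact: integrable_norm i1.
- apply/integrableP; split; first by apply/measurable_EFinP; exact: measurable_cst.
  rewrite /= integral_cst//= lebesgue_measure_itv/= lte_fin x0 -EFinB -EFinM.
  exact: ltry.
- move=> t /=; rewrite in_itv/= => /andP[t0 tx].
  by rewrite (le_trans (K_le _ _))// (le_trans (Kbnd t0))// lerD2l ler_wpM2l// lerD2l ltW.
Qed.

Let poly_bound (x : R) : 0 <= x -> bnd x * x = (`|K 1| + L) * x + L * (x * x).
Proof. by move=> _; rewrite /bnd; ring. Qed.

(** The [H_ k] grow at most quadratically, uniformly in [k]; the finite second moment from
    [mixture_sqr_integrable] provides the dominating function. *)
Let limit d0 (T : measurableType d0) (S : probability T R) n (Z : 'I_n -> T -> R) l c kappa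
    (N : stein_mixture S Z l c kappa a) (V := fun x => kappa * \sum_i Z i x) :
  (forall k, S.-integrable setT (fun x => ((H_ k \_ `]0%R, +oo[) (V x))%:E)) ->
  S.-integrable setT (fun x => ((H \_ `]0%R, +oo[) (V x))%:E) /\
  \int[S]_x (H_ k \_ `]0%R, +oo[) (V x) @[k --> \oo] --> \int[S]_x (H \_ `]0%R, +oo[) (V x).
Proof.
move=> iH_; case: (N) => mZ Z0 k0 _ l0 c0 lap neq0 suml sumc.
have V0 x : 0 <= V x by apply: mulr_ge0; [exact: ltW|exact: sumr_ge0].
have iV := mixture_integrable mZ Z0 k0 l0 c0 lap.
have iV2 := mixture_sqr_integrable mZ Z0 k0 l0 c0 lap.
have [|x _||k x _|i1 h1] := @Rintegral_dominated _ _ R S setT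
   (fun k x => (H_ k \_ `]0%R, +oo[) (V x)) (fun x => (H \_ `]0%R, +oo[) (V x))
   (fun x => `|h0| + ((`|K 1| + L) * V x + L * (V x * V x))) measurableT.
- by move=> k; have /integrableP[/measurable_EFinP] := iH_ k.
- have [Vx|Vx] := ltP 0 (V x).
    rewrite patchE mem_set/= ?in_itv/= ?Vx//.
    under eq_fun do rewrite patchE mem_set/= ?in_itv/= ?Vx//.
    exact: H_cvg.
  have Vn : ~ (`]0%R, +oo[%classic : set R) (V x) by rewrite /= in_itv/= andbT; apply/negP; rewrite -leNgt.
  rewrite patchE memNset//; under eq_fun do rewrite patchE memNset//.
  exact: cvg_cst.
- apply: (integrable_EFinD measurableT (f := cst `|h0|)); first exact: finite_measure_integrable_cst.
  by apply: (integrable_EFinD measurableT); exact: integrable_EFinZ.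
- have bV : 0 <= bnd (V x) * V x.
    by rewrite mulr_ge0// addr_ge0// mulr_ge0// addr_ge0.
  rewrite -poly_bound// patchE; case: ifPn => [|_]; last by rewrite normr0 addr_ge0.
  by rewrite inE/= in_itv/= andbT; exact: H_le.
- by split.
Qed.

(** Since [K] may be unbounded, [comparison_bounded] is applied to the truncations [K_ k] and their
    primitives [H_ k]. The resulting bound does not depend on [k] and passes to the limit. The first
    alternative of [C2r] covers [m = 0], where the bound is 0 whatever the size of [stein_C2]. *)
Lemma comparison_lip2 :
  [/\ P.-integrable setT (fun x => ((H \_ `]0%R, +oo[) (V1 x))%:E),
     Q.-integrable setT (fun x => ((H \_ `]0%R, +oo[) (V2 x))%:E) &
     `|\int[P]_x (H \_ `]0%R, +oo[) (V1 x) - \int[Q]_x (H \_ `]0%R, +oo[) (V2 x)| <= m * (L * r * a)].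
Proof.
have step k : [/\ P.-integrable setT (fun x => ((H_ k \_ `]0%R, +oo[) (V1 x))%:E),
     Q.-integrable setT (fun x => ((H_ k \_ `]0%R, +oo[) (V2 x))%:E) &
     `|\int[P]_x (H_ k \_ `]0%R, +oo[) (V1 x) - \int[Q]_x (H_ k \_ `]0%R, +oo[) (V2 x)| <= m * (L * r * a)].
  have cK_ (x : R) (x0 : 0 < x) := is_derive_continuous (dK_ k x0).
  have KB (x : R) (x0 : 0 < x) := K_B k x.
  have [i1 i2 i3 e] := comparison_bounded cK_ KB (@dH_ k).
  split => //; apply: (le_trans e).
  case: C2r => [->|C2]; first by rewrite !mul0r.
  rewrite ler_wpM2l//; case: (M1) => mZ Z0 k0 _ l0 c0 lap neq0 suml sumc.
  have iV := mixture_integrable mZ Z0 k0 l0 c0 lap.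
  (* As [|F''| <= L r] pointwise, [V |F''(V)|] has mean at most [L r E[V] = L r a]. *)
  rewrite -[X in _ * X](mixture_mean mZ Z0 k0 l0 c0 lap suml) -RintegralZl//.
  apply: le_Rintegral => //; first exact: integrable_EFinZ.
  move=> x _; rewrite mulrC; have [Vx|Vx] := ltP 0 (V1 x).
    rewrite ler_wpM2r//.
    rewrite (le_trans (stein_sol''_le_C2 a0 cK_ KB (@dK_ k) (@K_L k) Vx))//.
    by rewrite ler_wpM2l// C2.
  have -> : V1 x = 0 by apply/eqP; rewrite eq_le Vx V10.
  have -> : kappa1 * \sum_i Z1 i x = 0 by apply/eqP; rewrite eq_le Vx; exact: V10.
  by rewrite !mulr0.
have [|i1 h1] := limit M1; first by move=> k; have [] := step k.
have [|i2 h2] := limit M2; first by move=> k; have [] := step k.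
split => //.
have h : `|\int[P]_x (H_ k \_ `]0%R, +oo[) (V1 x) - \int[Q]_x (H_ k \_ `]0%R, +oo[) (V2 x)| @[k --> \oo] -->
    `|\int[P]_x (H \_ `]0%R, +oo[) (V1 x) - \int[Q]_x (H \_ `]0%R, +oo[) (V2 x)|.
  by apply: cvg_norm; exact: cvgB h1 h2.
by apply: (cvgr_to_le h); apply: nearW => k; have [] := step k.
Qed.

End Lip2.

End Comparison.

(** * Gaussian vectors *)

Section Normal_vectors.
Context {R : realType} {dT : measure_display} {T : measurableType dT}.
Variable P : probability T R.

Lemma Rintegral_law d' (Y : measurableType d') (eta : T -> Y) (nu : {measure set Y -> \bar R})
    (f : Y -> R) (M : R) :
  measurable_fun setT eta -> (forall B, measurable B -> P (eta @^-1` B) = nu B) ->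
  measurable_fun setT f -> (forall x, `|f x| <= M) ->
  \int[P]_x f (eta x) = \int[nu]_y f y.
Proof.
move=> meta law mf fM.
pose E : {RV P >-> Y} := HB.pack eta (isMeasurableFun.Build _ _ _ _ eta meta).
rewrite /Rintegral; congr fine.
have i1 : P.-integrable setT ((EFin \o f) \o E).
  by apply: (@bounded_integrable _ _ _ _ _ M) => [|x]; [exact: measurableT_comp|exact: fM].
have := integral_distribution (X := E) (f := EFin \o f) _ i1.
move=> <-; last exact/measurable_EFinP.
by apply: eq_measure_integral => B mB _; exact: law.
Qed.

Variables (d : nat) (X : T -> 'cV[R]_d) (mu : 'cV[R]_d) (Sigma : 'M[R]_d).
Hypothesis nX : normal_vec P X mu Sigma.
Let proj (b : 'cV[R]_d) (w : T) : R := (b^T *m X w) 0 0.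

Lemma measurable_proj b : measurable_fun setT (proj b).
Proof.
have [_ mX _] := nX.
have -> : proj b = (fun w => \sum_j b j 0 * X w j 0).
  by apply/funext => w; rewrite /proj mxE; apply: eq_bigr => j _; rewrite mxE.
by apply: measurable_sum => j; exact: measurable_funM.
Qed.

(** The law of the projection may be a point mass, which follows the same formula with variance
    0. *)
Lemma Rintegral_cos_proj b s r : (b^T *m mu) 0 0 = 0 ->
  \int[P]_w cos (s * proj b w + r) = expR (- (quad_form Sigma b * s ^+ 2 / 2)) * cos r.
Proof.
move=> bmu; have [[_ psd] mX law] := nX.
have mcos : measurable_fun setT (fun x : R => cos (s * x + r)).
  apply: measurableT_comp; first by apply: continuous_measurable_fun; exact: continuous_cos.
  by apply: measurable_funD => //; exact: measurable_funM.
have cos1 x : `|cos (s * x + r)| <= 1 by exact: cos_max.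
have [v0|v0] := eqVneq (quad_form Sigma b) 0.
  rewrite v0 !mul0r oppr0 expR0 mul1r.
  have -> : \int[P]_w cos (s * proj b w + r) = \int[\d_(0 : R)]_y cos (s * y + r).
    apply: (@Rintegral_law _ _ _ _ (fun y => cos (s * y + r)) 1) => //; first exact: measurable_proj.
    move=> B mB; rewrite (law b B mB) bmu /normal_law v0 eqxx//.
  rewrite /Rintegral integral_dirac//; last exact/measurable_EFinP.
  by rewrite diracT mul1e mulr0 add0r.
have sv0 : Num.sqrt (quad_form Sigma b) != 0.
  by rewrite gt_eqF// sqrtr_gt0 lt_def v0 psd.
have -> : \int[P]_w cos (s * proj b w + r) =
    \int[normal_prob 0 (Num.sqrt (quad_form Sigma b))]_y cos (s * y + r).
  have lawn B : measurable B -> P (proj b @^-1` B) = normal_prob 0 (Num.sqrt (quad_form Sigma b)) B.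
    by move=> mB; rewrite (law b B mB) bmu /normal_law (negbTE v0).
  have := @Rintegral_law _ (measurableTypeR R) _ (normal_prob 0 (Num.sqrt (quad_form Sigma b))) (fun y => cos (s * y + r)) 1
    (measurable_proj b) lawn mcos cos1.
by [].
by rewrite integral_cos_normal// sqr_sqrtr.
Qed.

(** A linear form is measurable for the sigma-algebra generated by the coordinates, so that
    independence of the vectors passes to their projections. *)
Lemma vec_events_proj b (B : set R) : measurable B -> vec_events X (proj b @^-1` B).
Proof.
move=> mB.
pose G := [set A | exists (j : 'I_d) (B : set R), measurable B /\ A = (fun w => X w j 0) @^-1` B].
have mc j : measurable_fun (setT : set (g_sigma_algebraType G)) (fun w : g_sigma_algebraType G => X w j 0).
  move=> _ C mC; rewrite setTI; apply: sub_sigma_algebra; exists j, C; by split.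
have mp : measurable_fun (setT : set (g_sigma_algebraType G)) (fun w : g_sigma_algebraType G => proj b w).
  have -> : (fun w : g_sigma_algebraType G => proj b w) = (fun w => \sum_j b j 0 * X w j 0).
    by apply/funext => w; rewrite /proj mxE; apply: eq_bigr => j _; rewrite mxE.
  by apply: measurable_sum => j; exact: measurable_funM.
by have := mp measurableT B mB; rewrite setTI.
Qed.

End Normal_vectors.

Section Sample_mean.
Context {R : realType} {dT : measure_display} {T : measurableType dT}.
Variable P : probability T R.
Variables (n d : nat) (X : 'I_n -> T -> 'cV[R]_d) (mu : 'cV[R]_d) (Sigma : 'M[R]_d).
Hypothesis n0 : (0 < n)%N.
Hypothesis indX : independent_vecs P X.
Hypothesis nX : forall i, normal_vec P (X i) mu Sigma.

Lemma Rintegral_cos_sample_mean b r : (b^T *m mu) 0 0 = 0 ->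
  \int[P]_w cos ((b^T *m (Num.sqrt n%:R *: sample_mean X w)) 0 0 + r) =
  expR (- (quad_form Sigma b / 2)) * cos r.
Proof.
(* Each of the [n] independent summands contributes the variance [s^2 b' Sigma b], and
   [n s^2 = 1]. *)
move=> bmu; pose s : R := (Num.sqrt n%:R)^-1.
have nR : 0 < n%:R :> R by rewrite ltr0n.
have s2 : n%:R * s ^+ 2 = 1 by rewrite /s exprVn sqr_sqrtr ?ltW// mulfV ?gt_eqF.
pose xi i w := s * (b^T *m X i w) 0 0.
have E w : (b^T *m (Num.sqrt n%:R *: sample_mean X w)) 0 0 = \sum_i xi i w.
  rewrite /sample_mean scalerA -scalemxAr mxE mulmx_sumr summxE mulr_sumr.
  apply: eq_bigr => i _; congr (_ * _); rewrite /s.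
  rewrite -[X in _ / X](@sqr_sqrtr _ n%:R) ?ltW// expr2 invfM mulrA mulfV ?mul1r//.
  by rewrite gt_eqF// sqrtr_gt0.
under eq_Rintegral do rewrite E.
have mxi i : measurable_fun setT (xi i).
  by apply: measurable_funM => //; exact: (measurable_proj (nX i) b).
have ind (B : 'I_n -> set R) : (forall i, measurable (B i)) ->
    P (\bigcap_i (xi i @^-1` B i)) = (\prod_i fine (P (xi i @^-1` B i)))%:E.
  move=> mB.
  have mC i : measurable ((fun x : R => s * x) @^-1` B i).
    have ms : measurable_fun setT (fun x : R => s * x) by exact: measurable_funM.
    by have := ms measurableT _ (mB i); rewrite setTI.
  have := indX (J := finset.setT) (A := fun i => xi i @^-1` B i).
  rewrite (_ : [set` finset.setT] = setT); last first.
    by apply/seteqP; split => // i _ /=; rewrite finset.in_setT.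
  move=> ->; last by move=> i _; exact: (@vec_events_proj _ _ _ _ (X i) b _ (mC i)).
  by congr EFin; apply: eq_bigl => i; rewrite finset.in_setT.
rewrite (Rintegral_cos_sum_indep mxi ind (phi := fun=> expR (- (quad_form Sigma b * s ^+ 2 / 2)))); last first.
  by move=> i q; exact: (Rintegral_cos_proj (nX i)).
rewrite prodr_const card_ord -expRM_natl; congr (expR _ * _).
have -> : n%:R * - (quad_form Sigma b * s ^+ 2 / 2) = - (quad_form Sigma b * (n%:R * s ^+ 2) / 2) by ring.
by rewrite s2 mulr1.
Qed.

End Sample_mean.

(** * The Kolmogorov distance *)

Section Ramp.
Context {R : realType}.
Local Notation leb := (@lebesgue_measure R).

(* The test functions of [Z1] must be differentiable, so the corners of the
   piecewise linear ramp are rounded. *)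
Definition smooth_abs (e u : R) := Num.sqrt (u ^+ 2 + e ^+ 2).

Section Smooth_abs.
Variable e : R.
Hypothesis e0 : 0 < e.

Let rad (u : R) : 0 < u ^+ 2 + e ^+ 2.
Proof. by rewrite ltr_wpDl ?sqr_ge0// exprn_gt0. Qed.

Lemma smooth_abs_gt0 u : 0 < smooth_abs e u. Proof. by rewrite sqrtr_gt0. Qed.

Lemma is_derive_smooth_abs (u : R) : is_derive u 1 (smooth_abs e) (u / smooth_abs e u).
Proof.
have h : is_derive u 1 (fun u : R => u ^+ 2 + e ^+ 2) (2 * u).
  by apply: is_derive_eq; rewrite /GRing.scale/=; ring.
have := @is_derive1_comp R Num.sqrt (fun u : R => u ^+ 2 + e ^+ 2) u _ _ (is_derive1_sqrt (rad u)) h; congr (is_derive _ _ _ _).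
rewrite /smooth_abs; field; rewrite gt_eqF// sqrtr_gt0//.
Qed.

Lemma norm_le_smooth_abs u : `|u| <= smooth_abs e u.
Proof. by rewrite -sqrtr_sqr ler_wsqrtr// lerDl sqr_ge0. Qed.

Lemma smooth_abs_le u : smooth_abs e u <= `|u| + e.
Proof.
have p0 : 0 <= `|u| + e by rewrite addr_ge0// ltW.
rewrite -[leRHS](ger0_norm p0) -sqrtr_sqr ler_wsqrtr//.
rewrite -(real_normK (num_real u)); have := normr_ge0 u; move: `|u| => t t0.
by have := e0; nra.
Qed.

Lemma smooth_abs_derive_le u : `|u / smooth_abs e u| <= 1.
Proof.
rewrite normrM normfV (gtr0_norm (smooth_abs_gt0 u)) ler_pdivrMr ?smooth_abs_gt0//.
by rewrite mul1r norm_le_smooth_abs.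
Qed.

Lemma smooth_abs_derive_continuous (u : R) :
  {for u, continuous (fun u : R => u / smooth_abs e u)}.
Proof.
apply: cvgM; first exact: cvg_id.
apply: cvgV; first by rewrite gt_eqF// smooth_abs_gt0.
exact: is_derive_continuous (is_derive_smooth_abs u).
Qed.

End Smooth_abs.

Lemma integral_affine_itv (k c u v : R) : u < v ->
  (\int[leb]_x (((fun x => k * x + c) \_ `[u, v]) x)%:E =
   (k * v ^+ 2 / 2 + c * v - (k * u ^+ 2 / 2 + c * u))%:E)%E.
Proof.
move=> uv.
have d (x : R) : u <= x <= v -> is_derive x 1 (fun x : R => k * x ^+ 2 / 2 + c * x) (k * x + c).
  by move=> _; apply: is_derive_eq; rewrite /GRing.scale/=; field.
have cc (x : R) : u <= x <= v -> {for x, continuous (fun x : R => k * x + c)}.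
  move=> _; apply: cvgD; last exact: cvg_cst.
  by apply: cvgM; [exact: cvg_cst|exact: cvg_id].
rewrite -(FTC2_cc uv d cc) [RHS]integral_mkcond; apply: eq_integral => x _.
by rewrite !patchE; case: ifP.
Qed.

End Ramp.

Section Kolmogorov.
Context d1 d2 (T1 : measurableType d1) (T2 : measurableType d2) (R : realType).
Variables (P : probability T1 R) (Q : probability T2 R).
Variables (X : T1 -> R) (Y : T2 -> R) (D C : R).
Local Notation leb := (@lebesgue_measure R).
Local Notation Rp := (`]0%R, +oo[%classic : set R).
Hypothesis mX : measurable_fun setT X.
Hypothesis mY : measurable_fun setT Y.
Hypothesis X0 : P [set x | X x <= 0] = 0%E.
Hypothesis Y0 : Q [set x | Y x <= 0] = 0%E.
Hypothesis lip : forall (h h' : R -> R) (B : R),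
  (forall x : R, 0 < x -> is_derive x 1 h (h' x)) ->
  (forall x : R, 0 < x -> {for x, continuous h'}) ->
  (forall x : R, 0 < x -> `|h' x| <= B) ->
  [/\ P.-integrable setT (fun x => ((h \_ Rp) (X x))%:E),
     Q.-integrable setT (fun x => ((h \_ Rp) (Y x))%:E) &
     `|\int[P]_x (h \_ Rp) (X x) - \int[Q]_x (h \_ Rp) (Y x)| <= D * B].
Hypothesis density : forall f : R -> R, measurable_fun setT f -> (forall x, 0 <= f x) ->
  (\int[Q]_x (f (Y x))%:E <= C%:E * \int[leb]_x (f x)%:E)%E.

Let prob_itv d (T : measurableType d) (S : probability T R) (V : T -> R) (mV : measurable_fun setT V)
    (V0 : S [set x | V x <= 0] = 0%E) z :
  fine (S (V @^-1` `]-oo, z])) = \int[S]_x \1_(`]0, z]%classic : set R) (V x).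
Proof.
have mpre (i : interval R) : measurable (V @^-1` [set` i]).
  by rewrite -[X in measurable X]setTI; apply: mV => //; exact: measurable_itv.
have mN : measurable [set x | V x <= 0].
  have -> : [set x | V x <= 0] = V @^-1` `]-oo, 0] by apply/seteqP; split => x /=; rewrite in_itv.
  exact: mpre.
rewrite -Rintegral_indic_prob; last exact: mpre.
rewrite /Rintegral; congr fine.
have ib (A : set T) : measurable A -> S.-integrable setT (fun x => (\1_A x : R)%:E).
  move=> mA; apply: (@bounded_integrable _ _ _ _ _ 1); first exact: measurable_indic.
  by move=> x; rewrite indicE; case: (_ \in _); rewrite ?normr1 ?normr0.
rewrite (negligible_integral mN)//; last exact/ib/mpre.
rewrite [RHS](negligible_integral mN)//; last first.
  apply: (@bounded_integrable _ _ _ _ _ 1).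
    by apply: measurableT_comp => //; exact: measurable_indic.
  by move=> x; rewrite indicE; case: (_ \in _); rewrite ?normr1 ?normr0.
apply: eq_integral => x; rewrite inE => -[_ /= /negP]; rewrite -ltNge => Vx.
rewrite !indicE; congr (_%:R%:E); congr nat_of_bool.
by apply/idP/idP; rewrite !inE/= !in_itv/= Vx.
Qed.

Variables (z e : R).
Hypothesis e0 : 0 < e.

(** A ramp from 1 at [y] down to 0 at [y + e], written with absolute values so that replacing them
    by [smooth_abs k] yields the continuously differentiable [h], with slope still at most
    [1 / e]. *)
Let ramp (y x : R) := (`|x - (y + e)| - `|x - y| + e) / (2 * e).
Let h (k y x : R) := (smooth_abs k (x - (y + e)) - smooth_abs k (x - y) + e) / (2 * e).
Let h' (k y x : R) := ((x - (y + e)) / smooth_abs k (x - (y + e)) - (x - y) / smooth_abs k (x - y)) / (2 * e).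

Let ramp1 y x : x <= y -> ramp y x = 1.
Proof.
move=> xy; have e1 := e0.
rewrite /ramp ler0_norm ?ler0_norm; [|lra|lra].
by field; rewrite gt_eqF.
Qed.

Let ramp0 y x : y + e <= x -> ramp y x = 0.
Proof.
move=> xy; have e1 := e0.
rewrite /ramp ger0_norm ?ger0_norm; [|lra|lra].
by field; rewrite gt_eqF.
Qed.

Let rampE y x : y <= x <= y + e -> ramp y x = 1 - (x - y) / e.
Proof.
move=> /andP[yx xy]; rewrite /ramp ler0_norm ?ger0_norm; [|lra|lra].
by field; rewrite gt_eqF.
Qed.

Let h_ramp k y x : 0 < k -> `|h k y x - ramp y x| <= k / e.
Proof.
move=> k0; have e1 := e0.
have -> : h k y x - ramp y x = ((smooth_abs k (x - (y + e)) - `|x - (y + e)|) -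
   (smooth_abs k (x - y) - `|x - y|)) / (2 * e) by rewrite /h /ramp; ring.
have e2 : 0 < 2 * e by rewrite mulr_gt0.
rewrite normrM normfV (gtr0_norm e2) ler_pdivrMr//.
have -> : k / e * (2 * e) = 2 * k by field; rewrite gt_eqF.
have := norm_le_smooth_abs k (x - (y + e)); have := smooth_abs_le k0 (x - (y + e)).
have := norm_le_smooth_abs k (x - y); have := smooth_abs_le k0 (x - y).
move: (`|x - y|) (`|x - (y + e)|) (smooth_abs k (x - (y + e))) (smooth_abs k (x - y)) => u1 u2 u3 u4 *.
by rewrite ler_norml; apply/andP; split; lra.
Qed.

Let h_lip k y : 0 < k ->
  [/\ P.-integrable setT (fun x => ((h k y \_ Rp) (X x))%:E),
     Q.-integrable setT (fun x => ((h k y \_ Rp) (Y x))%:E) &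
     `|\int[P]_x (h k y \_ Rp) (X x) - \int[Q]_x (h k y \_ Rp) (Y x)| <= D * e^-1].
Proof.
move=> k0; have e2 : 0 < 2 * e by rewrite mulr_gt0.
have dsub (c x : R) : is_derive x 1 (fun x : R => x - c) 1.
  by have := is_deriveB (is_derive_id x (1 : R)) (is_derive_cst c x (1 : R)); rewrite subr0.
have ds (c x : R) : is_derive x 1 (fun x => smooth_abs k (x - c)) ((x - c) / smooth_abs k (x - c)).
  have := @is_derive1_comp R (smooth_abs k) (fun x : R => x - c) x _ _ (is_derive_smooth_abs k0 (x - c)) (dsub c x).
  by rewrite mulr1.
have cs (c x : R) : (fun x : R => (x - c) / smooth_abs k (x - c)) @ x --> (x - c) / smooth_abs k (x - c).
  apply: (@continuous_comp _ _ _ (fun x : R => x - c) (fun u : R => u / smooth_abs k u)).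
    by apply: cvgB; [exact: cvg_id|exact: cvg_cst].
  exact: smooth_abs_derive_continuous.
apply: (@lip (h k y) (h' k y)).
- move=> x _; have := is_deriveZ (2 * e)^-1 (is_deriveD (is_deriveB (ds (y + e) x) (ds y x)) (is_derive_cst e x (1 : R))).
  congr (is_derive _ _ _ _); last by rewrite addr0 /GRing.scale/= mulrC.
  by apply/funext => u; rewrite /h /= /GRing.scale/= mulrC.
- by move=> x _; apply: cvgM; [apply: cvgB; exact: cs|exact: cvg_cst].
- move=> x _; rewrite /h' normrM normfV (gtr0_norm e2) ler_pdivrMr//.
  have -> : e^-1 * (2 * e) = 1 + 1 by field; rewrite gt_eqF.
  by rewrite (le_trans (ler_normB _ _))// lerD// smooth_abs_derive_le.
Qed.

Let itv01 x : \1_(`]0, z]%classic : set R) x = ((0 < x) && (x <= z))%:R :> R.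
Proof. by rewrite indicE; congr (nat_of_bool _)%:R; apply/idP/idP; rewrite inE/= in_itv. Qed.

Let patchp f x : (f \_ Rp) x = if 0 < x then f x else 0 :> R.
Proof. by rewrite patchE; congr (if _ then _ else _); apply/idP/idP; rewrite inE/= in_itv/= andbT. Qed.

(** Triangles of height 1 and base [e], hence of area [e / 2]. The first dominates the excess over
    the indicator of the ramp starting at [z], the second the deficit of the ramp ending at [z]. *)
Let upper (x : R) : R := ((fun x : R => (- e^-1) * x + (1 + z / e)) \_ `[z, z + e]) x.
Let lower (x : R) : R := ((fun x : R => e^-1 * x + (1 - z / e)) \_ `[z - e, z]) x.

Let patch_cc (f : R -> R) (u v x : R) : (f \_ `[u, v]) x = if (u <= x) && (x <= v) then f x else 0 :> R.
Proof. by rewrite patchE; congr (if _ then _ else _); apply/idP/idP; rewrite inE/= in_itv/=. Qed.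

Let upper_ge0 x : 0 <= upper x.
Proof.
rewrite /upper patch_cc; case: ifP => // /andP[zx xz].
have -> : - e^-1 * x + (1 + z / e) = (z + e - x) / e by field; rewrite gt_eqF.
by rewrite divr_ge0 ?(ltW e0)//; lra.
Qed.

Let lower_ge0 x : 0 <= lower x.
Proof.
rewrite /lower patch_cc; case: ifP => // /andP[zx xz].
have -> : e^-1 * x + (1 - z / e) = (x - (z - e)) / e by field; rewrite gt_eqF.
by rewrite divr_ge0 ?(ltW e0)//; lra.
Qed.

Let maff (k c u v : R) : measurable_fun setT ((fun x : R => k * x + c) \_ `[u, v]).
Proof.
apply/(measurable_restrictT (fun x : R => k * x + c)); first exact: measurable_itv.
apply: measurable_funTS; apply: measurable_funD => //; exact: measurable_funM.
Qed.

Let C0 : 0 <= C.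
Proof.
have := @density (fun x => upper x) (maff _ _ _ _) upper_ge0.
have ze : z < z + e by rewrite ltrDl.
rewrite /upper integral_affine_itv// -EFinM => hC.
have h0 : (0 <= \int[Q]_x (upper (Y x))%:E)%E by apply: integral_ge0 => x _; rewrite lee_fin.
have := le_trans h0 hC; rewrite lee_fin.
have -> : - e^-1 * (z + e) ^+ 2 / 2 + (1 + z / e) * (z + e) - (- e^-1 * z ^+ 2 / 2 + (1 + z / e) * z) = e / 2.
  by field; rewrite gt_eqF.
by rewrite pmulr_lge0// divr_gt0.
Qed.

Let small_mass (f : R -> R) : measurable_fun setT f -> (forall x, 0 <= f x) ->
  (\int[leb]_x (f x)%:E = (e / 2)%:E)%E ->
  Q.-integrable setT (fun x => (f (Y x))%:E) /\ \int[Q]_x f (Y x) <= C * (e / 2).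
Proof.
move=> mf f0 fe; have := density mf f0; rewrite fe -EFinM => hC.
have i1 : Q.-integrable setT (fun x => (f (Y x))%:E).
  apply/integrableP; split; first by apply/measurable_EFinP; exact: measurableT_comp.
  under eq_integral do rewrite abse_EFin ger0_norm//.
  by rewrite (le_lt_trans hC)// ltry.
by split => //; rewrite -lee_fin -Rintegral_fineK.
Qed.

Let upper_mass : Q.-integrable setT (fun x => (upper (Y x))%:E) /\ \int[Q]_x upper (Y x) <= C * (e / 2).
Proof.
apply: small_mass => //; first exact: maff.
have ze : z < z + e by rewrite ltrDl.
by rewrite /upper integral_affine_itv//; congr EFin; field; rewrite gt_eqF.
Qed.

Let lower_mass : Q.-integrable setT (fun x => (lower (Y x))%:E) /\ \int[Q]_x lower (Y x) <= C * (e / 2).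
Proof.
apply: small_mass => //; first exact: maff.
have ze : z - e < z by rewrite gtrBl.
by rewrite /lower integral_affine_itv//; congr EFin; field; rewrite gt_eqF.
Qed.

Let iindic d (T : measurableType d) (S : probability T R) (V : T -> R) : measurable_fun setT V ->
  S.-integrable setT (fun x => (\1_(`]0, z]%classic : set R) (V x) : R)%:E).
Proof.
move=> mV; apply: (@bounded_integrable _ _ _ _ _ 1).
  apply: measurableT_comp => //; exact: measurable_indic.
by move=> x; rewrite itv01; case: (_ && _); rewrite ?normr1 ?normr0.
Qed.

Let bounds k y x : 0 < k -> ramp y x - k / e <= h k y x /\ h k y x <= ramp y x + k / e.
Proof. by move=> /(@h_ramp k y x); rewrite ler_distl => /andP[]. Qed.

Let ramp_ge0 y x : y <= x -> 0 <= ramp y x.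
Proof.
move=> yx; have [h1|h1] := leP (y + e) x; first by rewrite ramp0.
rewrite rampE; last by rewrite yx ltW.
by rewrite subr_ge0 ler_pdivrMr// mul1r lerBlDl ltW.
Qed.

Let ramp_le1 y x : x <= y + e -> ramp y x <= 1.
Proof.
move=> xy; have [h1|h1] := leP x y; first by rewrite ramp1.
rewrite rampE; last by rewrite xy ltW.
by rewrite lerBlDr lerDl divr_ge0 ?(ltW e0)// subr_ge0 ltW.
Qed.

Let indic_le_ramp k x : 0 < k ->
  \1_(`]0, z]%classic : set R) x <= (h k z \_ Rp) x + k / e.
Proof.
move=> k0; have ke : 0 <= k / e by rewrite divr_ge0 ?ltW.
have [b1 b2] := bounds z x k0.
rewrite itv01 patchp; case: (ltP 0 x) => [x0|_]/=; last by rewrite add0r.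
rewrite -lerBlDr (le_trans _ b1)// lerD2r.
by case: (leP x z) => xz /=; [rewrite ramp1|rewrite ramp_ge0// ltW].
Qed.

Let ramp_le_upper k x : 0 < k ->
  (h k z \_ Rp) x <= \1_(`]0, z]%classic : set R) x + upper x + k / e.
Proof.
move=> k0; have ke : 0 <= k / e by rewrite divr_ge0 ?ltW.
have [b1 b2] := bounds z x k0; have u0 := upper_ge0 x.
rewrite itv01 patchp; case: (ltP 0 x) => [x0|_]/=; last by rewrite !addr_ge0.
rewrite (le_trans b2)// lerD2r.
case: (leP x z) => xz /=; first by rewrite ramp1// lerDl.
rewrite add0r; have [h1|h1] := leP (z + e) x; first by rewrite ramp0.
rewrite rampE; last by rewrite (ltW xz) (ltW h1).
rewrite /upper patch_cc (ltW xz) (ltW h1)/=.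
have -> : 1 - (x - z) / e = - e^-1 * x + (1 + z / e) by field; rewrite gt_eqF.
by [].
Qed.

Let ramp_le_indic k x : 0 < k ->
  (h k (z - e) \_ Rp) x <= \1_(`]0, z]%classic : set R) x + k / e.
Proof.
move=> k0; have ke : 0 <= k / e by rewrite divr_ge0 ?ltW.
have [b1 b2] := bounds (z - e) x k0.
rewrite itv01 patchp; case: (ltP 0 x) => [x0|_]/=; last by rewrite add0r.
rewrite (le_trans b2)// lerD2r.
by case: (leP x z) => xz /=; [rewrite ramp_le1// subrK|rewrite ramp0// subrK ltW].
Qed.

Let lower_le_ramp k x : 0 < k ->
  \1_(`]0, z]%classic : set R) x <= (h k (z - e) \_ Rp) x + lower x + k / e.
Proof.
move=> k0; have ke : 0 <= k / e by rewrite divr_ge0 ?ltW.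
have [b1 b2] := bounds (z - e) x k0; have w0 := lower_ge0 x.
rewrite itv01 patchp; case: (ltP 0 x) => [x0|_]/=; last by rewrite !addr_ge0.
rewrite -lerBlDr -lerBlDr (le_trans _ b1)// addrAC lerD2r lerBlDr.
case: (leP x z) => xz /=; last by rewrite addr_ge0// ramp_ge0// lerBlDr (le_trans (ltW xz))// lerDl ltW.
have [h1|h1] := leP x (z - e); first by rewrite ramp1// lerDl.
rewrite rampE; last by rewrite subrK xz ltW.
rewrite /lower patch_cc xz (ltW h1)/=.
have -> : 1 - (x - (z - e)) / e + (e^-1 * x + (1 - z / e)) = 1 by field; rewrite gt_eqF.
by [].
Qed.

Let add d (T : measurableType d) (S : probability T R) (f g : T -> R) :
  S.-integrable setT (fun x => (f x)%:E) -> S.-integrable setT (fun x => (g x)%:E) ->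
  \int[S]_x (f x + g x) = \int[S]_x f x + \int[S]_x g x.
Proof. by move=> fi gi; apply: RintegralD. Qed.

Let le_int d (T : measurableType d) (S : probability T R) (f g : T -> R) :
  S.-integrable setT (fun x => (f x)%:E) -> S.-integrable setT (fun x => (g x)%:E) ->
  (forall x, f x <= g x) -> \int[S]_x f x <= \int[S]_x g x.
Proof. by move=> fi gi fg; apply: le_Rintegral. Qed.

(** Two ramps sandwich the indicator of []0, z]]: [D / e] is the cost of a test function of slope
    [1 / e], and [C * e / 2] the mass of a triangle under the density bound. *)
Lemma kolmogorov_le :
  `|fine (P (X @^-1` `]-oo, z])) - fine (Q (Y @^-1` `]-oo, z]))| <= D / e + C * e / 2.
Proof.
rewrite !prob_itv//; set p := \int[P]_x _; set q := \int[Q]_x _.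
have ics d (T : measurableType d) (S : probability T R) c : S.-integrable setT (fun x => (c : R)%:E).
  exact: finite_measure_integrable_cst.
(* The smoothing parameter [k] costs a further [2 k / e] and is sent to 0 at the end. *)
have step k : 0 < k -> `|p - q| <= D / e + C * e / 2 + 2 * (k / e).
  move=> k0.
  have [iX1 iY1 l1] := h_lip z k0; have [iX2 iY2 l2] := h_lip (z - e) k0.
  have [iu mu] := upper_mass; have [il ml] := lower_mass.
  have ke : 0 <= k / e by rewrite divr_ge0 ?ltW.
  have iP := @ics _ _ P (k / e); have iQ := @ics _ _ Q (k / e).
  have A1 : p <= \int[P]_x (h k z \_ Rp) (X x) + k / e.
    rewrite /p -(Rintegral_cst_prob P (k / e)) -(add iX1 iP).
    apply: (le_int (@iindic _ _ P _ mX) (integrable_EFinD measurableT iX1 iP)) => x.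
    exact: indic_le_ramp.
  have A2 : \int[Q]_x (h k z \_ Rp) (Y x) <= q + \int[Q]_x upper (Y x) + k / e.
    have iqu := integrable_EFinD measurableT (@iindic _ _ Q _ mY) iu.
    rewrite /q -(Rintegral_cst_prob Q (k / e)) -(add (@iindic _ _ Q _ mY) iu) -(add iqu iQ).
    apply: (le_int iY1 (integrable_EFinD measurableT iqu iQ)) => x.
    exact: ramp_le_upper.
  have A3 : \int[P]_x (h k (z - e) \_ Rp) (X x) <= p + k / e.
    rewrite /p -(Rintegral_cst_prob P (k / e)) -(add (@iindic _ _ P _ mX) iP).
    apply: (le_int iX2 (integrable_EFinD measurableT (@iindic _ _ P _ mX) iP)) => x.
    exact: ramp_le_indic.
  have A4 : q <= \int[Q]_x (h k (z - e) \_ Rp) (Y x) + \int[Q]_x lower (Y x) + k / e.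
    have ihl := integrable_EFinD measurableT iY2 il.
    rewrite /q -(Rintegral_cst_prob Q (k / e)) -(add iY2 il) -(add ihl iQ).
    apply: (le_int (@iindic _ _ Q _ mY) (integrable_EFinD measurableT ihl iQ)) => x.
    exact: lower_le_ramp.
  move: l1 l2 A1 A2 A3 A4 mu ml; rewrite !ler_norml.
  move: p q (\int[P]_x _) (\int[P]_x _) (\int[Q]_x _) (\int[Q]_x _) (\int[Q]_x _) (\int[Q]_x _).
  have -> : C * e / 2 = C * (e / 2) by rewrite mulrA.
  move: (D / e) (k / e) (C * (e / 2)) => u1 u2 u3.
  move=> v1 v2 v3 v4 v5 v6 v7 v8 /andP[a1 a2] /andP[a3 a4] b1 b2 b3 b4 b5 b6.
  by apply/andP; split; lra.
apply/ler_addgt0Pr => k k0; have k1 : 0 < k * e / 2 by rewrite divr_gt0// mulr_gt0.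
apply: (le_trans (step _ k1)); rewrite lerD2l le_eqVlt; apply/orP; left; apply/eqP.
by field; rewrite gt_eqF.
Qed.

End Kolmogorov.

(** * The Wald statistic *)

Section Wald_mixture.
Context {R : realType} {dT : measure_display} {T : measurableType dT}.
Variable P : probability T R.
Variables (n d : nat) (X : 'I_n -> T -> 'cV[R]_d) (mu : 'cV[R]_d) (Sigma M O : 'M[R]_d).
Variable l : 'I_d -> R.
Hypothesis n0 : (0 < n)%N.
Hypothesis indX : independent_vecs P X.
Hypothesis nX : forall i, normal_vec P (X i) mu Sigma.
Hypothesis sM : M^T = M.
Hypothesis MM : M *m M = M.
Hypothesis Mmu : M *m mu = 0.
Hypothesis OO : O *m O^T = 1%:M.
Hypothesis OD : O *m (M *m Sigma *m M) *m O^T = diag_mx (\row_i l i).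
Hypothesis l0 : forall i, 0 <= l i.
Hypothesis trE : \tr (M *m Sigma) = \sum_i l i.
Hypothesis tr2E : \tr (M *m Sigma *m (M *m Sigma)) = \sum_i l i ^+ 2.
Hypothesis tr0 : exists i, 0 < l i.

Local Notation tr := (\tr (M *m Sigma)).
Local Notation tr2 := (\tr (M *m Sigma *m (M *m Sigma))).
Local Notation nu := (wald_nu M Sigma).

Let y w := Num.sqrt n%:R *: sample_mean X w.
(** Coordinates, in the diagonalizing basis, of the projected and rescaled mean; they are centered
    because [M mu = 0], with covariance [diag l]. *)
Let Y i w := (O *m M *m y w) i 0.

Lemma wald_trace_gt0 : [/\ 0 < tr, 0 < tr2 & 0 < nu].
Proof.
have [i li] := tr0.
have p1 : 0 < tr.
  by rewrite trE (bigD1 i)//= ltr_pwDl// sumr_ge0.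
have p2 : 0 < tr2.
  rewrite tr2E (bigD1 i)//= ltr_pwDl ?exprn_gt0// sumr_ge0// => j _; exact: sqr_ge0.
by split => //; rewrite /wald_nu divr_gt0// exprn_gt0.
Qed.

(** [O] is orthogonal and [M] a symmetric projection, so [O M y] has squared norm [y^T M y]. *)
Let sum_sqr w : \sum_i Y i w ^+ 2 = n%:R * quad_form M (sample_mean X w).
Proof.
have -> : \sum_i Y i w ^+ 2 = ((O *m M *m y w)^T *m (O *m M *m y w)) 0 0.
  by rewrite mxE; apply: eq_bigr => i _; rewrite mxE expr2.
rewrite !trmx_mul sM !mulmxA -[_ *m M *m O^T *m O]mulmxA (mulmx1C OO) mulmx1.
rewrite -[_ *m M *m M]mulmxA MM.
have -> : (y w)^T = Num.sqrt n%:R *: (sample_mean X w)^T by rewrite /y linearZ.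
by rewrite /y -scalemxAr -!scalemxAl scalerA -expr2 sqr_sqrtr// mxE.
Qed.

Let lin (t : 'I_d -> R) w : \sum_i t i * Y i w = (((O *m M)^T *m (\col_i t i))^T *m y w) 0 0.
Proof.
rewrite trmx_mul trmxK -mulmxA [RHS]mxE; apply: eq_bigr => i _.
by congr (_ * _); rewrite !mxE.
Qed.

Let cosY (t : 'I_d -> R) r :
  \int[P]_x cos (\sum_i t i * Y i x + r) = expR (- (\sum_i l i * t i ^+ 2) / 2) * cos r.
Proof.
under eq_Rintegral do rewrite lin.
set b := (O *m M)^T *m _.
have bmu : (b^T *m mu) 0 0 = 0.
  by rewrite trmx_mul trmxK -!mulmxA Mmu !mulmx0 mxE.
have e : quad_form Sigma b = \sum_i l i * t i ^+ 2.
  rewrite /quad_form.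
  have -> : b^T *m Sigma *m b =
      (\col_i t i)^T *m (O *m (M *m Sigma *m M) *m O^T) *m \col_i t i.
    by rewrite /b !trmx_mul !trmxK sM !mulmxA.
  by rewrite OD mul_mx_diag mxE; apply: eq_bigr => i _; rewrite !mxE mulrAC mulrC expr2.
rewrite mulNr -e; exact: (Rintegral_cos_sample_mean n0 indX nX r bmu).
Qed.

Let mY i : measurable_fun setT (Y i).
Proof.
rewrite (_ : Y i = fun w => \sum_j (O *m M) i j *
    (Num.sqrt n%:R * n%:R^-1 * \sum_k X k w j 0)); last first.
  apply/funext => w; rewrite /Y mxE; apply: eq_bigr => j _; congr (_ * _).
  by rewrite /y /sample_mean scalerA mxE summxE.
apply: measurable_sum => j; apply: measurable_funM => //.
apply: measurable_funM => //; apply: measurable_sum => k.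
by case: (nX k).
Qed.

(** Apart from measurability, the stochastic properties of the [Y i] enter through their joint
    cosine transform [cosY], by way of [Rintegral_exp_quadratic]. *)
Lemma wald_mixture : exists Z : 'I_d -> T -> R,
  stein_mixture P Z l (fun i => 2 * (nu / 2 / tr * l i)) (nu / 2 / tr) (nu / 2) /\
  forall w, nu / 2 / tr * \sum_i Z i w = nu / 2 * wald_stat M Sigma X w.
Proof.
have [t0 t20 nu0] := wald_trace_gt0.
have k0 : 0 < nu / 2 / tr by apply: divr_gt0 => //; exact: divr_gt0.
have expY := Rintegral_exp_quadratic mY l0 cosY.
exists (fun i w => Y i w ^+ 2); split; last first.
  move=> w; rewrite sum_sqr /wald_stat.
  move: (quad_form _ _) => u; field; rewrite gt_eqF//.
have [i li] := tr0.
split.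
- by move=> j; exact: measurable_funX.
- by move=> j x; exact: sqr_ge0.
- exact: k0.
- by rewrite divr_gt0.
- exact: l0.
- by move=> j; rewrite !mulr_ge0 ?l0// ltW// ?invr_gt0// .
- by move=> j s s0; exact: (quadratic_laplace mY l0 k0 expY).
- exact: (quadratic_neq0 mY l0 k0 expY li).
- by rewrite -trE divfK// gt_eqF.
(* [sum_i c_i l_i = (nu / tr) tr2], which equals [tr = sum_i l_i] by the definition of [nu]: this
   condition is what fixes the degrees of freedom. *)
- under eq_bigr do rewrite mulrBl mul1r.
  rewrite sumrB -trE.
  have -> : \sum_(j < d) 2 * (nu / 2 / tr * l j) * l j = nu / tr * tr2.
    rewrite tr2E mulr_sumr; apply: eq_bigr => j _.
    by field; rewrite gt_eqF.
  rewrite /wald_nu; apply/eqP; rewrite subr_eq0; apply/eqP.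
  by field; rewrite !gt_eqF.
Qed.

End Wald_mixture.

Section Gamma_mixture.
Context {R : realType} {d : measure_display} {T : measurableType d}.
Variables (Q : probability T R) (U : {RV Q >-> R}) (a : R).
Hypothesis a0 : 0 < a.
Hypothesis lawU : forall B : set R, measurable B -> distribution Q U B = gamma_law a a^-1 B.

(** The truncation of [a U] at 0 has unit scale and forms a mixture with a single component of
    coefficient 1. *)
Lemma gamma_mixture : stein_mixture Q (fun (_ : 'I_1) x => Num.max (U x) 0 / a^-1)
  (fun=> a) (fun=> 1) 1 a.
Proof.
have b0 : 0 < a^-1 by rewrite invr_gt0.
split => //.
- by move=> _; exact: measurable_gamma_scaled.
- by move=> _ x; exact: (@gamma_scaled_ge0 _ _ _ Q U a^-1 b0 x).
- by move=> _; exact: ltW.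
- move=> _ s s0.
  under eq_Rintegral do rewrite mul1r big_ord1.
  under [in RHS]eq_Rintegral do rewrite mul1r big_ord1.
  exact: (gamma_scaled_laplace a0 b0 lawU s0).
- under eq_set do rewrite mul1r big_ord1.
  exact: (gamma_scaled_neq0 b0 lawU).
- by rewrite big_ord1 mul1r.
- by rewrite big_ord1 subrr mul0r.
Qed.

End Gamma_mixture.

Section Scaled_comparison.
Context d1 d2 (T1 : measurableType d1) (T2 : measurableType d2) (R : realType).
Variables (P : probability T1 R) (Q : probability T2 R).
Context n (Z : 'I_n -> T1 -> R) (l c : 'I_n -> R) (kappa a : R).
Variables (W : T1 -> R) (U : {RV Q >-> R}) (m : R).
Local Notation Rp := (`]0%R, +oo[%classic : set R).
Hypothesis MZ : stein_mixture P Z l c kappa a.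
Hypothesis WE : forall w, kappa * \sum_i Z i w = a * W w.
Hypothesis lawU : forall B : set R, measurable B -> distribution Q U B = gamma_law a a^-1 B.
Hypothesis m0 : 0 <= m.
Hypothesis cm : forall i, `|c i * (1 - c i)| <= m.

Let a0 : 0 < a. Proof. by case: MZ. Qed.
Let MU := gamma_mixture a0 lawU.

Let patchp (f : R -> R) (x : R) : (f \_ Rp) x = if 0 < x then f x else 0 :> R.
Proof. by rewrite patchE; congr (if _ then _ else _); apply/idP/idP; rewrite inE/= in_itv/= andbT. Qed.

Let patch_W (h : R -> R) w : ((fun x : R => h (x / a)) \_ Rp) (kappa * \sum_i Z i w) = (h \_ Rp) (W w).
Proof. by rewrite WE !patchp (pmulr_rgt0 _ a0) mulrAC mulfV ?mul1r ?gt_eqF. Qed.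

Let patch_U (h : R -> R) w :
  ((fun x : R => h (x / a)) \_ Rp) (1 * \sum_(i < 1) (Num.max (U w) 0 / a^-1)) = (h \_ Rp) (U w).
Proof.
rewrite mul1r big_ord1 invrK !patchp pmulr_lgt0// lt_max ltxx orbF mulfK ?gt_eqF//.
by case: ltP => // U0; rewrite max_l// ltW.
Qed.

Let transfer (f1 g1 : T1 -> R) (f2 g2 : T2 -> R) (C : R) : f1 =1 g1 -> f2 =1 g2 ->
  [/\ P.-integrable setT (fun w => (f1 w)%:E), Q.-integrable setT (fun w => (f2 w)%:E) &
     `|\int[P]_w f1 w - \int[Q]_w f2 w| <= C] ->
  [/\ P.-integrable setT (fun w => (g1 w)%:E), Q.-integrable setT (fun w => (g2 w)%:E) &
     `|\int[P]_w g1 w - \int[Q]_w g2 w| <= C].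
Proof. by move=> /funext -> /funext ->. Qed.

Let d_scale (h h' : R -> R) : (forall x : R, 0 < x -> is_derive x 1 h (h' x)) ->
  forall x : R, 0 < x -> is_derive x 1 (fun x : R => h (x / a)) (h' (x / a) / a).
Proof.
move=> dh x x0; have xa : 0 < x / a by rewrite divr_gt0.
have ds : is_derive x 1 (fun x : R => x / a) a^-1.
  have := is_deriveZ a^-1 (is_derive_id x (1 : R)); congr (is_derive _ _ _ _).
    by apply/funext => u; rewrite /= /GRing.scale/= mulrC.
  by rewrite /GRing.scale/= mulr1.
exact: (@is_derive1_comp R h (fun x : R => x / a) x _ _ (dh _ xa) ds).
Qed.

(** The Stein equation has unit scale, so [a W] and [a U] are compared, with the test function
    [x -> h (x / a)]; each derivative costs a factor [1 / a]. *)
Lemma scaled_comparison_lip1 (h h' : R -> R) (B : R) :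
  (forall x : R, 0 < x -> is_derive x 1 h (h' x)) ->
  (forall x : R, 0 < x -> {for x, continuous h'}) ->
  (forall x : R, 0 < x -> `|h' x| <= B) ->
  [/\ P.-integrable setT (fun w => ((h \_ Rp) (W w))%:E),
     Q.-integrable setT (fun w => ((h \_ Rp) (U w))%:E) &
     `|\int[P]_w (h \_ Rp) (W w) - \int[Q]_w (h \_ Rp) (U w)| <= m * (2 * (B / a))].
Proof.
move=> dh ch hB.
have cK (x : R) : 0 < x -> {for x, continuous (fun x : R => h' (x / a) / a)}.
  move=> x0; have xa : 0 < x / a by rewrite divr_gt0.
  apply: cvgM; last exact: cvg_cst.
  apply: (@continuous_comp _ _ _ (fun x : R => x / a) h'); last exact: ch.
  by apply: cvgM; [exact: cvg_id|exact: cvg_cst].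
have KB (x : R) : 0 < x -> `|h' (x / a) / a| <= B / a.
  move=> x0; rewrite normrM normfV (gtr0_norm a0) ler_wpM2r ?invr_ge0 ?(ltW a0)//.
  by rewrite hB// divr_gt0.
have := comparison_lip1 MZ MU m0 cm cK KB (d_scale dh).
exact: (transfer (patch_W h) (patch_U h)).
Qed.

Lemma scaled_comparison_lip2 (h h' h'' : R -> R) (L r : R) :
  (forall x : R, 0 < x -> is_derive x 1 h (h' x)) ->
  (forall x : R, 0 < x -> is_derive x 1 h' (h'' x)) ->
  (forall x : R, 0 < x -> `|h'' x| <= L) ->
  m = 0 \/ (forall z, 0 < z -> stein_C2 a z <= r) ->
  [/\ P.-integrable setT (fun w => ((h \_ Rp) (W w))%:E),
     Q.-integrable setT (fun w => ((h \_ Rp) (U w))%:E) &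
     `|\int[P]_w (h \_ Rp) (W w) - \int[Q]_w (h \_ Rp) (U w)| <= m * (L / a ^+ 2 * r * a)].
Proof.
move=> dh dh' hL C2.
have dK (x : R) : 0 < x -> is_derive x 1 (fun x : R => h' (x / a) / a) (h'' (x / a) / a / a).
  move=> x0; have := is_deriveZ a^-1 (d_scale dh' x0); congr (is_derive _ _ _ _).
    by apply/funext => u; rewrite /= /GRing.scale/= mulrC.
  by rewrite /GRing.scale/= mulrC.
have KB (x : R) : 0 < x -> `|h'' (x / a) / a / a| <= L / a ^+ 2.
  move=> x0; rewrite -mulrA -invfM -expr2 normrM normfV (gtr0_norm (exprn_gt0 2 a0)).
  by rewrite ler_wpM2r ?invr_ge0 ?exprn_ge0 ?(ltW a0)// hL// divr_gt0.
have := comparison_lip2 MZ MU m0 cm dK KB (d_scale dh) C2.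
exact: (transfer (patch_W h) (patch_U h)).
Qed.

Lemma scaled_npos : P [set w | W w <= 0] = 0%E.
Proof.
case: MZ => mZ Z0 k0 _ _ _ _ <- _ _; congr (P _); apply/seteqP; split => w /=; rewrite WE.
  move=> Ww; have : 0 <= a * W w by rewrite -WE mulr_ge0 ?(ltW k0)// sumr_ge0.
  by rewrite pmulr_rge0// => W0; rewrite (_ : W w = 0) ?mulr0//; apply/eqP; rewrite eq_le Ww.
by move/eqP; rewrite mulf_eq0 (gt_eqF a0)/= => /eqP ->.
Qed.

Lemma measurable_scaled : measurable_fun setT W.
Proof.
case: MZ => mZ _ _ _ _ _ _ _ _ _.
rewrite (_ : W = fun w => a^-1 * (kappa * \sum_i Z i w)).
  apply: measurable_funM => //; apply: measurable_funM => //.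
  by apply: measurable_sum.
by apply/funext => w; rewrite WE mulKf// gt_eqF.
Qed.

End Scaled_comparison.

Lemma expect_posE d (T : measurableType d) (R : realType) (P : probability T R)
    (X : T -> R) (h : R -> R) :
  P.-integrable setT (fun w => ((h \_ (`]0%R, +oo[%classic : set R)) (X w))%:E) ->
  expect_pos P X h = (\int[P]_w (h \_ (`]0%R, +oo[%classic : set R)) (X w))%:E.
Proof. by move=> ih; rewrite /expect_pos unlock -(Rintegral_fineK measurableT ih). Qed.

Lemma dist_class_le d1 d2 (T1 : measurableType d1) (T2 : measurableType d2) (R : realType)
    (P : probability T1 R) (Q : probability T2 R) (X : T1 -> R) (Y : T2 -> R)
    (Z : set (R -> R)) (C : R) :
  (forall h, Z h ->
    [/\ P.-integrable setT (fun w => ((h \_ (`]0%R, +oo[%classic : set R)) (X w))%:E),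
       Q.-integrable setT (fun w => ((h \_ (`]0%R, +oo[%classic : set R)) (Y w))%:E) &
       `|\int[P]_w (h \_ (`]0%R, +oo[%classic : set R)) (X w) -
         \int[Q]_w (h \_ (`]0%R, +oo[%classic : set R)) (Y w)| <= C]) ->
  (dist_class Z P X Q Y <= C%:E)%E.
Proof.
move=> ZC; apply: ge_ereal_sup => _ [h /ZC[iX iY hC] <-].
by rewrite (expect_posE iX) (expect_posE iY) -EFinB abse_EFin lee_fin.
Qed.

(** At [e = D / sqrt (C D / 2)] the two terms are equal; for [D = 0] the bound follows by letting
    [e] tend to 0. *)
Lemma le_of_smoothing (R : realType) (x D C : R) : 0 <= D -> 0 < C ->
  (forall e, 0 < e -> x <= D / e + C * e / 2) -> x <= 2 * Num.sqrt (C * D / 2).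
Proof.
move=> D0 C0 hx; move: D0; rewrite le_eqVlt => /predU1P[D0|D0].
  rewrite -D0 mulr0 mul0r sqrtr0 mulr0; apply/ler_addgt0Pr => e e0.
  have e1 : 0 < 2 * e / C by rewrite divr_gt0// mulr_gt0.
  have := hx _ e1; rewrite -D0 mul0r.
  by have -> : C * (2 * e / C) / 2 = e by field; rewrite gt_eqF.
have s0 : 0 < C * D / 2 by rewrite divr_gt0// mulr_gt0.
have r0 : 0 < Num.sqrt (C * D / 2) by rewrite sqrtr_gt0.
have := sqr_sqrtr (ltW s0); move: (Num.sqrt _) r0 => s r0 sE.
have De : 0 < D / s by rewrite divr_gt0.
have := hx _ De; congr (_ <= _).
have -> : C * (D / s) / 2 = s by rewrite mulrA mulrAC -sE expr2 mulfK// gt_eqF.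
by rewrite mulr_natl mulr2n; congr (_ + _); field; rewrite !gt_eqF.
Qed.

Lemma is_derive_derive1 (R : realType) (f : R -> R) (x : R) :
  derivable f x 1 -> is_derive x 1 f (derive1 f x).
Proof. by move=> df; rewrite derive1E; exact: DeriveDef. Qed.

Section Wald_Delta.
Context {R : realType}.
Variables (d q : nat) (M Sigma : 'M[R]_d) (lam : 'I_q -> R) (r : nat).

Lemma wald_Delta_ge j :
  `|lam j * \tr (M *m Sigma) / \tr (M *m Sigma *m (M *m Sigma)) - 1| *
    (lam j / \tr (M *m Sigma)) ^+ r <= wald_Delta M Sigma lam r.
Proof. exact: le_bigmax. Qed.

Lemma wald_Delta_ge0 : 0 <= wald_Delta M Sigma lam r.
Proof. exact: bigmax_ge_id. Qed.

End Wald_Delta.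

Theorem corollary3p9 (R : realType) (n d q : nat)
  (hn : (1 <= n)%N) (hd : (1 <= d)%N) (hq : (1 <= q)%N) (hqd : (q <= d)%N)
  (H : 'M[R]_(q, d)) (hH : \rank H = q)
  (dT : measure_display) (T : measurableType dT) (P : probability T R)
  (X : 'I_n -> T -> 'cV[R]_d) (mu : 'cV[R]_d) (Sigma : 'M[R]_d)
  (hindep : independent_vecs P X)
  (hnormal : forall i : 'I_n, normal_vec P (X i) mu Sigma)
  (lam : 'I_q -> R)
  (hlam : nonzero_eigenvalues
            (sqrtmx Sigma *m row_space_proj H *m sqrtmx Sigma) lam)
  (H0 : H *m mu = 0)
  (dU : measure_display) (TU : measurableType dU) (Q : probability TU R)
  (U : {RV Q >-> R}) :
  let TH := row_space_proj H in
  let W := wald_stat TH Sigma X in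
  let nu := wald_nu TH Sigma in
  let Delta := wald_Delta TH Sigma lam in
  (forall B : set R, measurable B ->
     distribution Q U B = gamma_law (nu / 2) (2 / nu) B) ->
  [/\ (dist_class Z1 P W Q U <= (4 * Delta 1%N)%:E)%E,
      (dist_class Z2 P W Q U <=
         (8 * Delta 2%N)%:E + 2%:E * stein_e (nu / 2) * (Delta 1%N)%:E)%E &
      2 < nu ->
      (dist_kol P W Q U <=
         (2 * Num.sqrt (nu * Delta 1%N /
            (Num.sqrt (2 * pi * (nu / 2 - 1)) * stirling_r (nu / 2))))%:E)%E].
Proof.
move=> TH W nu Delta; rewrite -[2 / nu]invf_div => lawU.
have [trM MM Mmu] := row_space_projP hH.
have [G [l [OO OD l0 ll [laml trE tr2E]]]] := diag_projected_cov hq hqd trM MM hlam.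
have lpos : exists i, 0 < l i.
  have [i li] := laml (Ordinal hq).
  by exists i; rewrite lt_def l0 -li andbT; case: hlam => + _; exact.
have [t0 t20 nu0] := wald_trace_gt0 l0 trE tr2E lpos.
have [Z [MZ WE]] := wald_mixture hn hindep hnormal trM MM (Mmu _ H0) OO OD l0 trE tr2E lpos.
rewrite -/TH -/nu -/W in t0 t20 nu0 MZ WE.
have D0 r : 0 <= Delta r := wald_Delta_ge0 _ _ _ _.
have m0 : 0 <= nu * Delta 1%N by rewrite mulr_ge0// ltW.
set kappa := nu / 2 / \tr (TH *m Sigma) in MZ WE.
(* The coefficient of the mixture is the ratio whose distance to 1 enters [Delta]. *)
have cE i : 2 * (kappa * l i) = l i * \tr (TH *m Sigma) / \tr (TH *m Sigma *m (TH *m Sigma)).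
  by rewrite /kappa /nu /wald_nu; field; rewrite !gt_eqF.
(* As [c_i = nu l_i / tr], the product [|c_i (1 - c_i)|] is [nu] times a term of the maximum
   [Delta 1]; the padded zero eigenvalues contribute 0. *)
have cm i : `|2 * (kappa * l i) * (1 - 2 * (kappa * l i))| <= nu * Delta 1%N.
  have [->|[j lj]] := ll i; first by rewrite !(mulr0, mul0r) normr0.
  have c0 : 0 <= 2 * (kappa * l i) by rewrite cE !mulr_ge0 ?l0// ?invr_ge0 ltW.
  rewrite normrM (ger0_norm c0) distrC cE lj.
  have := wald_Delta_ge TH Sigma lam 1 j; rewrite expr1 -(ler_pM2l nu0).
  apply: le_trans; rewrite le_eqVlt; apply/orP; left; apply/eqP.
  by move: (`|_|) => u; rewrite /nu /wald_nu; field; rewrite !gt_eqF.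
have lip1 := scaled_comparison_lip1 MZ WE lawU m0 cm.
have lip2 := scaled_comparison_lip2 MZ WE lawU m0 cm.
have bound1 B : nu * Delta 1%N * (2 * (B / (nu / 2))) = 4 * Delta 1%N * B.
  by field; rewrite gt_eqF.
split.
- apply: dist_class_le => h hZ.
  have -> : 4 * Delta 1%N = nu * Delta 1%N * (2 * (1 / (nu / 2))) by rewrite bound1 mulr1.
  have dh (x : R) (x0 : 0 < x) : is_derive x 1 h (derive1 h x).
    by have [dh _ _] := hZ x x0; exact: is_derive_derive1.
  have ch (x : R) (x0 : 0 < x) : {for x, continuous (derive1 h)} by have [] := hZ x x0.
  have hB (x : R) (x0 : 0 < x) : `|derive1 h x| <= 1 by have [] := hZ x x0.
  exact: lip1 dh ch hB.
(* Here [m (L / a^2) r a] with [L = 1] equals [2 r Delta 1]; the nonnegative term [8 Delta 2] is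
   added afterwards. *)
- have lip2' r : nu * Delta 1%N = 0 \/ (forall z, 0 < z -> stein_C2 (nu / 2) z <= r) ->
      (dist_class Z2 P W Q U <= (2 * r * Delta 1%N)%:E)%E.
    move=> C2; apply: dist_class_le => h hZ.
    have -> : 2 * r * Delta 1%N = nu * Delta 1%N * (1 / (nu / 2) ^+ 2 * r * (nu / 2)).
      by field; rewrite gt_eqF.
    have dh (x : R) (x0 : 0 < x) : is_derive x 1 h (derive1 h x).
      by have [dh _ _ _] := hZ x x0; exact: is_derive_derive1.
    have dh' (x : R) (x0 : 0 < x) : is_derive x 1 (derive1 h) (derive1n 2 h x).
      by have [_ dh' _ _] := hZ x x0; exact: is_derive_derive1.
    have hB (x : R) (x0 : 0 < x) : `|derive1n 2 h x| <= 1 by have [] := hZ x x0.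
    exact: lip2 dh dh' hB C2.
  have D20 : (0%:E <= (8 * Delta 2%N)%:E)%E by rewrite lee_fin mulr_ge0.
  (* In the extended reals the product of [stein_e] with 0 is 0 even if [stein_e] is infinite; this
     case therefore goes through the alternative [m = 0]. *)
  have [D1|D1] := eqVneq (Delta 1%N) 0.
    have := lip2' 0; rewrite D1 !(mulr0, mule0) adde0 => h.
    by apply: (le_trans (h _)); [left|].
  have [[r er]|er|er] : [\/ exists r, stein_e (nu / 2) = r%:E, stein_e (nu / 2) = +oo%E | stein_e (nu / 2) = -oo%E].
    by case: (stein_e _) => [r| |]; [constructor 1; exists r|constructor 2|constructor 3].
  + rewrite er; have -> : ((8 * Delta 2%N)%:E + 2%:E * r%:E * (Delta 1%N)%:E =
        (8 * Delta 2%N + 2 * r * Delta 1%N)%:E)%E by [].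
    apply: (le_trans (lip2' r _)).
      right => z z0; rewrite -lee_fin -er; apply: ereal_sup_ubound.
      by exists z => //; rewrite /= in_itv/= z0.
    by rewrite lee_fin lerDr.
  + have Dp : 0 < Delta 1%N by rewrite lt_def D1 D0.
    rewrite er gt0_muley ?lte_fin// gt0_mulye ?lte_fin//.
    by rewrite addey ?leey.
  (* The supremum is over a nonempty set of real values, hence above [-oo]. *)
  + have : ((stein_C2 (nu / 2) 1)%:E <= stein_e (nu / 2))%E.
      by apply: ereal_sup_ubound; exists 1 => //; rewrite /= in_itv/= ltr01.
    by move=> /(lt_le_trans (ltNyr _)); rewrite er ltxx.
- move=> nu2; have a1 : 1 < nu / 2 by rewrite ltr_pdivlMr// mul1r.
  have a0 : 0 < nu / 2 := lt_trans ltr01 a1.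
  have b0 : 0 < (nu / 2)^-1 by rewrite invr_gt0.
  set den := Num.sqrt _ * stirling_r _.
  have den0 : 0 < den.
    by rewrite mulr_gt0 ?expR_gt0// sqrtr_gt0 !mulr_gt0 ?pi_gt0// subr_gt0.
  apply: ge_ereal_sup => _ [z _ <-].
  rewrite -[P _]fineK ?fin_num_measure//; last first.
    by rewrite -[X in measurable X]setTI; apply: (measurable_scaled MZ WE) => //.
  rewrite -[Q _]fineK ?fin_num_measure//; last first.
    by rewrite -[X in measurable X]setTI; apply: (measurable_funPT U) => //.
  rewrite -EFinB abse_EFin lee_fin.
  (* Read as [C D / 2], with the density bound [C = (nu / 2) / den] and the cost [D = 4 Delta 1] of
     a unit slope. *)
  have -> : nu * Delta 1%N / den = nu / 2 / den * (4 * Delta 1%N) / 2.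
    by field; rewrite gt_eqF.
  apply: le_of_smoothing; [by rewrite mulr_ge0|by rewrite divr_gt0|] => e e0.
  apply: kolmogorov_le => //.
  + exact: (measurable_scaled MZ WE).
  + exact: (scaled_npos MZ WE).
  + exact: (gamma_law_npos lawU).
  + by move=> h h' B dh ch hB; rewrite -bound1; exact: lip1 dh ch hB.
  + by move=> f mf f0; apply: (gamma_integral_le a0 b0 lawU) => // t; exact: gamma_pdf_le.
Qed.
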